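(* Let $\beta>0$ and let $n\ge1$ be an integer. For $\lambda\in\mathbb R$ let $\alpha_\lambda(u)$ be the strong solution of $$d\alpha_\lambda = \lambda\tfrac{\beta}{4}e^{\frac{\beta}{4}u}\, du + \Re[(e^{-i\alpha_\lambda(u)}-1)(dZ-i n\, du)],\qquad \lim_{u\to-\infty}\alpha_\lambda(u)=0,$$ and set $\mathbf q(\lambda)=[q_1(\lambda),\dots,q_n(\lambda)]^T$ with $q_k(\lambda)=E[e^{ik\alpha_\lambda(0)}]$. Define $\mathbf s_k\in\mathbb C^n$ by $\mathbf{s}_0=-\frac{n+1}{2}\mathbf{A}_n^{-1}\mathbf{e}_n$ and $\mathbf{s}_k=i \left(k \mathbf{I}-\tfrac{4}{\beta} \mathbf{A}_n\right)^{-1} \mathbf{B}_n \mathbf{s}_{k-1}$ for $k\ge1$. Then the density of the $\mathrm{HP}_{\beta,n}$ process is given by $$\rho^{(1)}_{\beta,n}(\lambda) =\frac{1}{2\pi}\left(1+2\,\mathbf{v}_n^T\,\Re \mathbf{q}(\lambda)\right)=\frac{1}{\pi} \sum_{j=1}^\infty \mathbf{v}_n^T \mathbf{s}_{2j}\, \lambda^{2j},\qquad \lambda\in\mathbb R.$$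
   Context: $Z$ is a two-sided complex Brownian motion with independent standard real and imaginary parts, the same for all $\lambda\in\mathbb R$. $\mathbf A_n$ is the tridiagonal and $\mathbf B_n$ the diagonal $n\times n$ matrix with nonzero entries $[\mathbf{A}_n]_{k,k}=-k^2$, $[\mathbf{A}_n]_{k,k-1}=\frac12 k(k+n)$, $[\mathbf{A}_n]_{k,k+1}=\frac12 k(k-n)$, $[\mathbf{B}_n]_{k,k}=k$. The vectors $\mathbf e_n,\mathbf v_n\in\mathbb R^n$ are $\mathbf e_n=[1,0,\dots,0]^T$ and $[\mathbf v_n]_k=(-1)^k\binom{2n}{n+k}\big/\binom{2n}{n}$, $1\le k\le n$. Let $\Theta\in[0,2\pi)$ be a random variable independent of $Z$ with probability density $\frac{1}{2\pi}\frac{\Gamma(1+n)^2}{\Gamma(1+2n)}(1-e^{-i\theta})^{n}(1-e^{i\theta})^{n}$. The $\mathrm{HP}_{\beta,n}$ process is the point process $\{\lambda\in\mathbb R:\alpha_\lambda(0)=\Theta \bmod 2\pi\}$. Its density $\rho^{(1)}_{\beta,n}$ is the Radon–Nikodym derivative of the expected number of points $A\mapsto E[\mathrm{HP}_{\beta,n}(A)]$ with respect to Lebesgue measure; it is determined up to null sets and the formula gives a version. *)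

(* Defs.v *)
From HB Require Import structures.
From mathcomp Require Import all_boot all_order all_algebra.
From mathcomp Require Export complex.
From mathcomp Require Import all_classical all_reals all_analysis measurable_realfun.
Import Order.TTheory GRing.Theory Num.Theory.
Import numFieldNormedType.Exports.

Set Implicit Arguments.
Unset Strict Implicit.
Unset Printing Implicit Defensive.

Local Open Scope classical_set_scope.
Local Open Scope ring_scope.
Local Open Scope complex_scope.

Section ComplexValued.
Context {R : realType}.

Definition expi (x : R) : R[i] := cos x +i* sin x.

Definition cabs2 (z : R[i]) : R := complex.Re z ^+ 2 + complex.Im z ^+ 2.

Definition Gamma (x : R) : R :=
  \int[lebesgue_measure]_(t in `]0, +oo[) (t `^ (x - 1) * expR (- t)).

End ComplexValued.

Section Probability.
Context {R : realType} {d : measure_display} {T : measurableType d}.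
Variable P : probability T R.

Definition cexpectation (X : T -> R[i]) : R[i] :=
  (\int[P]_w complex.Re (X w)) +i* (\int[P]_w complex.Im (X w)).

(* Events determined by the real random variables X i, i in D. *)
Definition preimages {I : Type} (D : set I) (X : I -> T -> R) : set_system T :=
  [set A | exists i B, [/\ D i, measurable B & A = X i @^-1` B]].

Definition independent (F G : set_system T) : Prop :=
  forall A B, F A -> G B -> P (A `&` B) = (P A * P B)%E.

Definition increment (W : R -> T -> R) (p : R * R) (w : T) : R :=
  W p.2 w - W p.1 w.

Definition before (u : R) : set (R * R) := [set p | p.1 <= p.2 /\ p.2 <= u].

(* The past of a two-sided Brownian motion at time u is generated by its
   increments before u, not by its values: for u < 0 the normalization W 0 = 0
   makes W u a function of the increments after u. *)
Record two_sided_BM (W : R -> T -> R) : Prop := {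
  BM_measurable : forall u, measurable_fun setT (W u) ;
  BM_continuous : {ae P, forall w, continuous (W^~ w)} ;
  BM_zero : {ae P, forall w, W 0 w = 0} ;
  BM_normal : forall r u B, r < u -> measurable B ->
    P (increment W (r, u) @^-1` B) = normal_prob 0 (Num.sqrt (u - r)) B ;
  BM_independent : forall r u, r < u ->
    independent <<s preimages [set (r, u)] (increment W) >>
                <<s preimages (before r) (increment W) >> }.

Definition re_part (Z : R -> T -> R[i]) (u : R) (w : T) : R :=
  complex.Re (Z u w).
Definition im_part (Z : R -> T -> R[i]) (u : R) (w : T) : R :=
  complex.Im (Z u w).

(* Normalization: E |Z u - Z r| ^ 2 = 2 (u - r). *)
Record two_sided_complex_BM (Z : R -> T -> R[i]) : Prop := {
  cBM_re : two_sided_BM (re_part Z) ;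
  cBM_im : two_sided_BM (im_part Z) ;
  cBM_independent : independent <<s preimages setT (re_part Z) >>
                                <<s preimages setT (im_part Z) >> }.

Definition sigma_of_process (Z : R -> T -> R[i]) : set_system T :=
  <<s preimages setT (re_part Z) `|` preimages setT (im_part Z) >>.

(* Filtration of Z, augmented by the null events. *)
Definition filtration (Z : R -> T -> R[i]) (u : R) : set_system T :=
  <<s preimages (before u) (increment (re_part Z))
      `|` preimages (before u) (increment (im_part Z))
      `|` [set N | measurable N /\ P N = 0%E] >>.

Definition rv_measurable (G : set_system T) (X : T -> R) : Prop :=
  forall B, measurable B -> G (X @^-1` B).

Definition crv_measurable (G : set_system T) (X : T -> R[i]) : Prop :=
  rv_measurable G (@complex.Re R \o X) /\ rv_measurable G (@complex.Im R \o X).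

(* Data of the process that equals step_val j on
   [step_time j, step_time j.+1[ for j < step_num. *)
Record step_process := StepProcess {
  step_num : nat ;
  step_time : nat -> R ;
  step_val : nat -> T -> R[i] }.

Record is_elementary (Z : R -> T -> R[i]) (r u : R) (phi : step_process) :
    Prop := {
  elem_start : step_time phi 0%N = r ;
  elem_end : step_time phi (step_num phi) = u ;
  elem_incr : forall j, (j < step_num phi)%N ->
    step_time phi j < step_time phi j.+1 ;
  elem_adapted : forall j, (j < step_num phi)%N ->
    crv_measurable (filtration Z (step_time phi j)) (step_val phi j) ;
  elem_L2 : forall j, (j < step_num phi)%N ->
    (\int[P]_w (cabs2 (step_val phi j w))%:E < +oo)%E }.

Definition step_eval (phi : step_process) (x : R) (w : T) : R[i] :=
  \sum_(j < step_num phi)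
    (if step_time phi j <= x < step_time phi j.+1 then step_val phi j w else 0).

Definition step_integral (Z : R -> T -> R[i]) (phi : step_process) (w : T) :
    R[i] :=
  \sum_(j < step_num phi)
    step_val phi j w * (Z (step_time phi j.+1) w - Z (step_time phi j) w).

(* J is the Ito integral of H dZ over [r, u]: the L2(P) limit of the integrals
   of elementary processes converging to H in L2(du x P). *)
Definition is_ito_integral (Z : R -> T -> R[i]) (H : R -> T -> R[i]) (r u : R)
    (J : T -> R[i]) : Prop :=
  crv_measurable measurable J /\
  exists phi : nat -> step_process,
  [/\ forall m, is_elementary Z r u (phi m),
      (\int[P]_w \int[lebesgue_measure]_(x in `[r, u])
          (cabs2 (H x w - step_eval (phi m) x w))%:E)%E @[m --> \oo] --> 0%E &
      (\int[P]_w (cabs2 (J w - step_integral Z (phi m) w))%:E)%E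
          @[m --> \oo] --> 0%E].

Record strong_solution (Z : R -> T -> R[i]) (beta : R) (n : nat) (lambda : R)
    (a : R -> T -> R) : Prop := {
  sol_adapted : forall u, rv_measurable (filtration Z u) (a u) ;
  sol_continuous : {ae P, forall w, continuous (a^~ w)} ;
  sol_init : {ae P, forall w, a u w @[u --> -oo] --> 0} ;
  sol_eq : forall r u, r <= u -> exists J : T -> R[i],
    is_ito_integral Z (fun x w => expi (- a x w) - 1) r u J /\
    {ae P, forall w, a u w - a r w =
      \int[lebesgue_measure]_(x in `[r, u])
        (lambda * (beta / 4) * expR (beta / 4 * x))
      + complex.Re (J w)
      + \int[lebesgue_measure]_(x in `[r, u])
        complex.Re ((expi (- a x w) - 1) * - ('i * n%:R))} }.

Definition theta_density (n : nat) (x : R) : R[i] :=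
  ((2 * pi)^-1 * (Gamma (1 + n%:R) ^+ 2 / Gamma (1 + 2 * n%:R)))%:C
  * (1 - expi (- x)) ^+ n * (1 - expi x) ^+ n.

(* theta_density is real-valued. *)
Record theta_variable (n : nat) (Theta : T -> R) : Prop := {
  theta_measurable : measurable_fun setT Theta ;
  theta_range : forall w, 0 <= Theta w < 2 * pi ;
  theta_law : forall B, measurable B ->
    P (Theta @^-1` B) =
    (\int[lebesgue_measure]_(x in B `&` `[0%R, (2 * pi)%R[)
      (complex.Re (theta_density n x))%:E)%E }.

Definition HP_process (alpha : R -> R -> T -> R) (Theta : T -> R) (w : T) :
    set R :=
  [set lambda | exists k : int, alpha lambda 0 w = Theta w + 2 * pi * k%:~R].

(* The number of points in B is only required to be a random variable up to a
   null event, since P need not be complete. *)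
Definition expected_points (X : T -> set R) (B : set R) (e : \bar R) : Prop :=
  exists N : T -> \bar R,
  [/\ measurable_fun setT N,
      {ae P, forall w, N w = counting (B `&` X w)} &
      (\int[P]_w N w)%E = e].

Record point_process_density (X : T -> set R) (rho : R -> R) : Prop := {
  density_measurable : measurable_fun setT rho ;
  density_ge0 : forall x, 0 <= rho x ;
  density_integral : forall B, measurable B ->
    expected_points X B (\int[lebesgue_measure]_(x in B) (rho x)%:E)%E }.

Definition q_vec (n : nat) (alpha : R -> R -> T -> R) (lambda : R) :
    'cV[R[i]]_n :=
  \col_k cexpectation (fun w => expi (k.+1%:R * alpha lambda 0 w)).

End Probability.

(* The row and column index k = 1, ..., n is i.+1 for i : 'I_n. *)
Section Matrices.
Variables (K : fieldType) (n : nat).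

Definition A_mx : 'M[K]_n := \matrix_(i, j)
  let k : K := i.+1%:R in
  if (j == i :> nat) then - k ^+ 2
  else if (j.+1 == i :> nat) then k * (k + n%:R) / 2
  else if (j == i.+1 :> nat) then k * (k - n%:R) / 2
  else 0.

Definition B_mx : 'M[K]_n := \matrix_(i, j) (i.+1%:R *+ (i == j)).

Definition e_vec : 'cV[K]_n := \col_i ((i == 0 :> nat)%N)%:R.

Definition v_vec : 'cV[K]_n :=
  \col_i ((- 1) ^+ i.+1 * ('C(2 * n, n + i.+1))%:R / ('C(2 * n, n))%:R).

End Matrices.

Fixpoint s_vec {R : realType} (beta : R) (n k : nat) : 'cV[R[i]]_n :=
  match k with
  | 0%N => - (n.+1%:R / 2) *: (invmx (A_mx R[i] n) *m e_vec R[i] n)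
  | k'.+1 => 'i *: (invmx (k%:R%:M - (4 / beta)%:C *: A_mx R[i] n)
                    *m B_mx R[i] n *m s_vec beta n k')
  end.

(* Main.v *)
(* By Ito's formula the moments q_k(u) = E exp(i k alpha(u)), k <= n, satisfy a closed
linear system: the coefficient k (k - n) / 2 of q_{k+1} vanishes at k = n. In the
variable y = lambda exp(beta u / 4) the vectors s_k are the coefficients of its formal
power series solution. A_n is negative definite for the weights binom(2n, n + k) / k, so
an energy estimate bounds the truncation error of the series by a multiple of
(n |y|)^m |y| / m!; this gives both the convergence and the identification of q.

Let F be the odd primitive of the density of Theta, a trigonometric polynomial plus a
linear term, with F(x + 2 pi) = F(x) + 1. It satisfies (1 - cos x) F'' = n sin x F', hence
only the lambda-term of the drift acts on E F(alpha_lambda(u)), and, E F'(alpha_lambda(0))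
being rho(lambda), E F(alpha_lambda(0)) is the integral of rho from 0 to lambda. The same
function applied to the negative part of alpha_lambda' - alpha_lambda is a Lyapunov
function which shows that lambda |-> alpha_lambda(0) is nondecreasing. Therefore, given
alpha, the probability that the level Theta + 2 pi k is crossed in ]a, b] is the increment
of F(alpha) - k clamped to [0, 1]; summing over k gives
E F(alpha_b(0)) - E F(alpha_a(0)).

Stochastic calculus enters only through Euler steps: moment bounds for the one-step
increments of alpha and a third-order Taylor expansion replace Ito's formula. *)

Require Import Defs.
From HB Require Import structures.
From mathcomp Require Import all_boot all_order all_algebra complex.
From mathcomp Require Import all_classical all_reals all_analysis measurable_realfun.
From mathcomp Require Import ring lra.
Import Order.TTheory GRing.Theory Num.Theory.
Import numFieldNormedType.Exports.
Set Implicit Arguments.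
Unset Strict Implicit.
Unset Printing Implicit Defensive.
Local Open Scope classical_set_scope.
Local Open Scope ring_scope.

(** * Calculus and integrability *)

(** The initial condition sits at [u = -oo]: there is no time from which to integrate, and neither a
    first moment of alpha nor a rate of decay is given. Both come out of the moment system. The
    moments are bounded by 1, and boundedness replaces an initial value: the energy of the
    truncation error, minus its claimed bound and times [expR u], is nonincreasing and tends to 0 at
    [-oo]. For [m = 0] the error bound says that the mean of [1 - cos alpha] is at most a multiple
    of [expR (beta / 4 * u)]. This rate gives a first moment of alpha that tends to 0, hence the
    limit of [E F(alpha)] at [-oo], and a finite mean for the random growth rate in the comparison
    argument.

    The error of an Euler step has order [h ^ (3 / 2)]: it disappears both in a derivative and in a
    sum over a grid. The step is a one-sided inequality with an adapted weight, because the Lyapunov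
    function need not have a third derivative at 0 and its growth is absorbed by a random
    integrating factor.

    The Gamma quotient in the density of Theta is never evaluated: total mass 1 determines it. *)

Section Calculus.
Context {R : realType}.
Implicit Types (f g : R -> R) (x l : R).
Local Notation leb := (@lebesgue_measure R).

(** Derivability and the value of the derivative in one relation. The rules below build the value
    syntactically, and [dv_eq] brings it to the desired form at the end. *)
Definition dv f x l := is_derive (x : R^o) (1 : R^o) (f : R^o -> R^o) (l : R^o).

Lemma dv_eq f x l l' : dv f x l -> l = l' -> dv f x l'.
Proof. by move=> h <-. Qed.

Lemma dv_ext f g x l : f =1 g -> dv f x l -> dv g x l.
Proof. by move=> /funext ->. Qed.

Lemma dv_cst (c : R) x : dv (fun=> c) x 0. Proof. exact: is_derive_cst. Qed.

Lemma dv_id x : dv id x 1. Proof. exact: is_derive_id. Qed.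

Lemma dvD f g x a b : dv f x a -> dv g x b -> dv (fun y => f y + g y) x (a + b).
Proof. by move=> h1 h2; exact: is_deriveD. Qed.

Lemma dvN f x a : dv f x a -> dv (fun y => - f y) x (- a).
Proof. by move=> h1; exact: is_deriveN. Qed.

Lemma dvB f g x a b : dv f x a -> dv g x b -> dv (fun y => f y - g y) x (a - b).
Proof. by move=> h1 h2; exact: is_deriveB. Qed.

Lemma dvM f g x a b : dv f x a -> dv g x b -> dv (fun y => f y * g y) x (a * g x + f x * b).
Proof.
by move=> h1 h2; apply: dv_eq (is_deriveM h1 h2) _; rewrite addrC; congr (_ + _); exact: mulrC.
Qed.

Lemma dvZ (c : R) f x a : dv f x a -> dv (fun y => c * f y) x (c * a).
Proof. by move=> h; apply: dv_eq (dvM (dv_cst c x) h) _; rewrite mul0r add0r. Qed.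

Lemma dv_comp f g x a b : dv f (g x) a -> dv g x b -> dv (fun y => f (g y)) x (a * b).
Proof. by move=> h1 h2; exact: is_derive1_comp. Qed.

Lemma dvX f x a n : dv f x a -> dv (fun y => f y ^+ n) x (n%:R * f x ^+ n.-1 * a).
Proof.
move=> h; elim: n => [|n IH].
  by rewrite !mul0r; apply: dv_ext (dv_cst 1 x) => y; rewrite expr0.
apply: (@dv_ext (fun y => f y * f y ^+ n)); first by move=> y; rewrite exprS.
apply: dv_eq (dvM h IH) _; case: n {IH} => [|n] /=; first by rewrite !expr0; ring.
by rewrite exprS -[n.+2%:R]natr1 -[n.+1%:R]natr1; ring.
Qed.

Lemma dv_sum n (F : nat -> R -> R) (l : nat -> R) x :
  (forall k, (k < n)%N -> dv (F k) x (l k)) ->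
  dv (fun y => \sum_(k < n) F k y) x (\sum_(k < n) l k).
Proof.
elim: n => [_|n IH h].
  by rewrite big_ord0; apply: dv_ext (dv_cst 0 x) => y; rewrite big_ord0.
rewrite big_ord_recr/=; apply: (@dv_ext (fun y => \sum_(k < n) F k y + F n y)).
  by move=> y; rewrite big_ord_recr.
by apply: dvD; [apply: IH => k kn; apply: h; exact: ltnW|exact: h].
Qed.

Lemma dv_sin (c x : R) : dv (fun y => sin (c * y)) x (c * cos (c * x)).
Proof.
apply: dv_eq (dv_comp (is_derive_sin (c * x)) (dvZ c (dv_id x))) _.
by rewrite mulr1 mulrC.
Qed.

Lemma dv_cos (c x : R) : dv (fun y => cos (c * y)) x (- c * sin (c * x)).
Proof.
apply: dv_eq (dv_comp (is_derive_cos (c * x)) (dvZ c (dv_id x))) _.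
by rewrite mulr1 mulrC mulrN mulNr.
Qed.

Lemma dv_exp (c x : R) : dv (fun y => expR (c * y)) x (c * expR (c * x)).
Proof.
apply: dv_eq (dv_comp (is_derive_expR (c * x)) (dvZ c (dv_id x))) _.
by rewrite mulr1 mulrC.
Qed.

Lemma dv_continuous f x l : dv f x l -> {for x, continuous f}.
Proof. by move=> [h _]; apply: differentiable_continuous; exact/derivable1_diffP. Qed.

Lemma dvE f x l : dv f x l -> f^`()%classic x = l.
Proof. by move=> [_ <-]; rewrite derive1E. Qed.

Lemma dv_mvt f f1 (a b : R) : (forall x, a <= x <= b -> dv f x (f1 x)) -> a < b ->
  exists2 c, a < c < b & f b - f a = f1 c * (b - a).
Proof.
move=> h ab; have [||c cab e] := @MVT R f f1 a b ab.
- by move=> x; rewrite in_itv/= => /andP[ax xb]; apply: h; rewrite !ltW.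
- apply: continuous_in_subspaceT => x; rewrite inE/= in_itv/= => xab.
  exact: dv_continuous (h x xab).
- by exists c => //; move: cab; rewrite in_itv.
Qed.

Lemma dv_lipschitz f f1 (K a b : R) : (forall x, a <= x <= b -> dv f x (f1 x)) ->
  (forall x, a <= x <= b -> `|f1 x| <= K) -> a <= b -> `|f b - f a| <= K * (b - a).
Proof.
move=> h hK; rewrite le_eqVlt => /predU1P[->|ab]; first by rewrite !subrr normr0 mulr0.
have [c /andP[ac cb] ->] := dv_mvt h ab.
rewrite normrM (gtr0_norm (_ : 0 < b - a)) ?subr_gt0// ler_wpM2r ?subr_ge0 ?(ltW ab)//.
by apply: hK; rewrite (ltW ac) (ltW cb).
Qed.

Lemma dv_global_lipschitz f f1 (K : R) : (forall x, dv f x (f1 x)) ->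
  (forall x, `|f1 x| <= K) -> forall x y, `|f y - f x| <= K * `|y - x|.
Proof.
move=> h hK x y; have [xy|yx] := leP x y.
  by rewrite (ger0_norm (_ : 0 <= y - x)) ?subr_ge0//; exact: dv_lipschitz.
rewrite distrC [`|y - x|]distrC (gtr0_norm (_ : 0 < x - y)) ?subr_gt0//.
by apply: dv_lipschitz (ltW yx).
Qed.

Lemma dv_nonincreasing f f1 (a b : R) : (forall x, a <= x <= b -> dv f x (f1 x)) ->
  (forall x, a <= x <= b -> f1 x <= 0) -> a <= b -> f b <= f a.
Proof.
move=> h hK; rewrite le_eqVlt => /predU1P[->//|ab].
have [c /andP[ac cb] e] := dv_mvt h ab; rewrite -subr_le0 e.
by rewrite mulr_le0_ge0 ?subr_ge0 ?(ltW ab)// hK// (ltW ac) (ltW cb).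
Qed.

Lemma dv_nondecreasing f f1 (a b : R) : (forall x, a <= x <= b -> dv f x (f1 x)) ->
  (forall x, a <= x <= b -> 0 <= f1 x) -> a <= b -> f a <= f b.
Proof.
move=> h hK ab; rewrite -lerN2.
apply: (@dv_nonincreasing (fun x => - f x) (fun x => - f1 x)) => // x xab.
  exact/dvN/h.
by rewrite oppr_le0 hK.
Qed.

Lemma dv_unique_constant f (a b : R) : (forall x, a <= x <= b -> dv f x 0) -> a <= b -> f b = f a.
Proof.
move=> h ab; apply/eqP; rewrite eq_le (dv_nonincreasing h)//=.
exact: (dv_nondecreasing h).
Qed.

(* The bound by d ^ 2 controls large d, for which f is merely Lipschitz. *)
Lemma taylor2_bound f f1 f2 f3 (K x d : R) : (forall x, dv f x (f1 x)) ->
  (forall x, dv f1 x (f2 x)) -> (forall x, dv f2 x (f3 x)) ->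
  (forall x, `|f2 x| <= K) -> (forall x, `|f3 x| <= K) ->
  `|f (x + d) - f x - f1 x * d - f2 x * d ^+ 2 / 2| <= 2 * K * d ^+ 2 /\
  `|f (x + d) - f x - f1 x * d - f2 x * d ^+ 2 / 2| <= K * `|d| ^+ 3.
Proof.
move=> h1 h2 h3 k2 k3.
have K0 : 0 <= K := le_trans (normr_ge0 _) (k2 0).
(* Mean value bound on the segment between 0 and [d], for either sign of [d]. *)
have bnd (g g1 : R -> R) (k : R) : g 0 = 0 -> (forall t, dv g t (g1 t)) ->
    (forall t, `|t| <= `|d| -> `|g1 t| <= k) -> `|g d| <= k * `|d|.
  move=> g0 hg hk; have k0 : 0 <= k := le_trans (normr_ge0 _) (hk d (lexx _)).
  have [d0|d0] := leP 0 d.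
    rewrite -{1}[g d]subr0 -g0 (ger0_norm d0) -{2}[d]subr0.
    apply: (dv_lipschitz (f1 := g1)) => // t /andP[t0 td].
    by apply: hk; rewrite !ger0_norm.
  rewrite -{1}[g d]subr0 -g0 distrC (ltr0_norm d0) -[- d]add0r.
  apply: (dv_lipschitz (f1 := g1)) (ltW d0) => // t /andP[t0 td].
  by apply: hk; rewrite (ler0_norm td) (ltr0_norm d0) lerN2.
have shift (g g1 : R -> R) : (forall y, dv g y (g1 y)) -> forall t, dv (fun t => g (x + t)) t (g1 (x + t)).
  move=> hg t; apply: dv_eq (dv_comp (hg (x + t)) (dvD (dv_cst x t) (dv_id t))) _.
  by rewrite add0r mulr1.
have e2 t : `|f1 (x + t) - f1 x| <= K * `|t|.
  by have := dv_global_lipschitz h2 k2 x (x + t); rewrite [x + t - x]addrC addKr.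
have e3 t : `|f2 (x + t) - f2 x| <= K * `|t|.
  by have := dv_global_lipschitz h3 k3 x (x + t); rewrite [x + t - x]addrC addKr.
have E t : dv (fun t => f (x + t) - f x - f1 x * t) t (f1 (x + t) - f1 x).
  apply: dv_eq (dvB (dvB (shift _ _ h1 t) (dv_cst (f x) t)) (dvZ (f1 x) (dv_id t))) _.
  by rewrite mulr1 subr0.
have b1 : `|f (x + d) - f x - f1 x * d| <= K * `|d| * `|d|.
  apply: (bnd (fun t => f (x + t) - f x - f1 x * t) (fun t => f1 (x + t) - f1 x)).
  - by rewrite addr0 mulr0; ring.
  - exact: E.
  - by move=> t td; apply: le_trans (e2 t) _; rewrite ler_wpM2l.
have E2 t : dv (fun t => f1 (x + t) - f1 x - f2 x * t) t (f2 (x + t) - f2 x).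
  apply: dv_eq (dvB (dvB (shift _ _ h2 t) (dv_cst (f1 x) t)) (dvZ (f2 x) (dv_id t))) _.
  by rewrite mulr1 subr0.
have dd : `|d| * `|d| = d ^+ 2 by rewrite -expr2 real_normK ?num_real.
split.
  apply: le_trans (ler_normB _ _) _.
  have -> : 2 * K * d ^+ 2 = K * `|d| * `|d| + K * d ^+ 2 by rewrite -[K * _ * _]mulrA dd; ring.
  apply: lerD => //; rewrite -mulrA normrM ler_pM//.
  rewrite ger0_norm ?divr_ge0 ?sqr_ge0//; have := sqr_ge0 d; lra.
(* This is the derivative of the third-order remainder; to integrate it once more it has to be
   bounded on the whole segment between 0 and [d], hence the free [s]. *)
have b2 (s : R) : `|s| <= `|d| -> `|f1 (x + s) - f1 x - f2 x * s| <= K * `|d| * `|d|.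
  move=> sd; have [s0|s0] := leP 0 s.
    have := @dv_lipschitz (fun t => f1 (x + t) - f1 x - f2 x * t) (fun t => f2 (x + t) - f2 x) (K * `|d|) 0 s.
    rewrite addr0 subrr mulr0 !subr0 => hh; apply: le_trans (hh _ _ s0) _.
    + by move=> t _; exact: E2.
    + move=> t /andP[t0 ts]; apply: le_trans (e3 t) _; rewrite ler_wpM2l//.
      by apply: le_trans sd; rewrite !ger0_norm.
    + by rewrite ler_wpM2l ?mulr_ge0//; move: sd; rewrite (ger0_norm s0).
  have := @dv_lipschitz (fun t => f1 (x + t) - f1 x - f2 x * t) (fun t => f2 (x + t) - f2 x) (K * `|d|) s 0.
  rewrite addr0 subrr mulr0 subr0 !sub0r normrN => hh; apply: le_trans (hh _ _ (ltW s0)) _.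
  + by move=> t _; exact: E2.
  + move=> t /andP[t0 ts]; apply: le_trans (e3 t) _; rewrite ler_wpM2l//.
    by apply: le_trans sd; rewrite (ler0_norm ts) (ltr0_norm s0) lerN2.
  + by rewrite ler_wpM2l ?mulr_ge0//; move: sd; rewrite (ltr0_norm s0).
have E3 t : dv (fun t => f (x + t) - f x - f1 x * t - f2 x * t ^+ 2 / 2) t (f1 (x + t) - f1 x - f2 x * t).
  apply: (@dv_ext (fun t => f (x + t) - f x - f1 x * t - f2 x / 2 * t ^+ 2)).
    by move=> s; field.
  apply: dv_eq (dvB (E t) (dvZ (f2 x / 2) (dvX 2 (dv_id t)))) _.
  by rewrite /= expr1 mulr1; field.
have -> : K * `|d| ^+ 3 = K * `|d| * `|d| * `|d| by rewrite !exprS expr0; ring.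
apply: (bnd (fun t => f (x + t) - f x - f1 x * t - f2 x * t ^+ 2 / 2)) E3 b2.
by rewrite addr0 mulr0 expr0n/= mulr0 mul0r; ring.
Qed.

(** The power 3/2 of [|v - u|] is the accuracy of an Euler step; divided by [v - u] it still leaves
    a factor [Num.sqrt |v - u|] that tends to 0. *)
Lemma dv_of_bound f (u l C e : R) : 0 < e ->
  (forall v, `|v - u| <= e -> `|f v - f u - (v - u) * l| <= C * (`|v - u| * Num.sqrt `|v - u|)) ->
  dv f u l.
Proof.
move=> e0 h.
have C1 : 0 < `|C| + 1 by have := normr_ge0 C; lra.
have lim : (fun t : R => t^-1 *: (f (t *: 1 + u) - f u)) t @[t --> 0^'] --> l.
  apply/cvgrPdist_le => eps eps0; near=> t.
  have t0 : t != 0 by near: t; exact: nbhs_dnbhs_neq.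
  have te : `|t| <= e by near: t; apply: dnbhs0_le.
  have tC : `|t| <= (eps / (`|C| + 1)) ^+ 2.
    near: t; apply: dnbhs0_le; by rewrite exprn_gt0// divr_gt0.
  have := h (t + u); rewrite addrK => /(_ te).
  rewrite /GRing.scale/= mulr1 => hh.
  have -> : l - t^-1 * (f (t + u) - f u) = - (t^-1 * (f (t + u) - f u - t * l)).
    by field.
  rewrite normrN normrM normfV ler_pdivrMl ?normr_gt0//.
  apply: le_trans hh _; rewrite mulrCA ler_wpM2l//.
  have st : Num.sqrt `|t| <= eps / (`|C| + 1).
    have q0 : 0 <= eps / (`|C| + 1) by rewrite divr_ge0// ltW.
    by rewrite -(@ler_pXn2r _ 2) ?nnegrE ?sqrtr_ge0// sqr_sqrtr.
  move: st; rewrite ler_pdivlMr// => st.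
  have := ler_norm C; have := sqrtr_ge0 `|t|; nra.
have d : derivable (f : R^o -> R^o) (u : R^o) (1 : R^o) by apply/cvg_ex; exists l.
by split=> //; apply: cvg_lim.
Unshelve. all: by end_near. Qed.

(** The derivative is asked for on [[a, b]] only, since the primitives of [continuous_primitive] are
    differentiable only to the right of their base point. *)
Lemma ftc_on f g (a b : R) : continuous g -> (forall x, a <= x <= b -> dv f x (g x)) -> a <= b ->
  (\int[leb]_(x in `[a, b]) (g x)%:E = (f b - f a)%:E)%E.
Proof.
move=> cg h; rewrite le_eqVlt => /predU1P[->|ab].
  by rewrite set_itv1 integral_set1 subrr.
rewrite (continuous_FTC2 (F := f) ab).
- by rewrite EFinB.
- exact: continuous_subspaceT.
- split.
  + by move=> x; rewrite in_itv/= => /andP[ax xb]; case: (h x); rewrite ?(ltW ax) ?(ltW xb).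
  + by apply: cvg_at_right_filter; apply: dv_continuous (h a _); rewrite lexx ltW.
  + by apply: cvg_at_left_filter; apply: dv_continuous (h b _); rewrite lexx ltW.
- by move=> x; rewrite in_itv/= => /andP[ax xb]; apply/dvE/h; rewrite !ltW.
Qed.

Lemma ftc f g (a b : R) : continuous g -> (forall x, dv f x (g x)) -> a <= b ->
  (\int[leb]_(x in `[a, b]) (g x)%:E = (f b - f a)%:E)%E.
Proof. by move=> cg h; apply: ftc_on => // x _; exact: h. Qed.

Lemma dv_all_continuous f g : (forall x, dv f x (g x)) -> continuous f.
Proof. by move=> h x; exact: dv_continuous (h x). Qed.

End Calculus.

(** * Expectation, integrability and square integrability *)

Section Expectation.
Context {R : realType} {d : measure_display} {T : measurableType d}.
Variable P : probability T R.
Implicit Types (X Y : T -> R) (A N : set T).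

(** Real-valued: [Rintegral] passes through [fine], which sends an infinite integral to 0. The
    algebraic rules therefore carry [L1] hypotheses. *)
Definition Ex X : R := \int[P]_w X w.
Definition L1 X := P.-integrable setT (EFin \o X).

Lemma L1_measurable X : L1 X -> measurable_fun setT X.
Proof. by move=> /measurable_int /measurable_EFinP. Qed.

Lemma Ex_EFin X : L1 X -> (\int[P]_w (X w)%:E)%E = (Ex X)%:E.
Proof. by move=> h; rewrite /Ex /Rintegral fineK//; exact: integrable_fin_num. Qed.

Lemma L1_le X Y : measurable_fun setT X -> (forall w, `|X w| <= Y w) -> L1 Y -> L1 X.
Proof.
move=> mX XY iY; apply: (le_integrable _ _ _ iY) => //.
  exact/measurable_EFinP.
move=> w _ /=; rewrite lee_fin (le_trans (XY w))// ler_norm//.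
Qed.

Lemma eq_L1 X Y : X =1 Y -> L1 X -> L1 Y.
Proof. by move=> /funext ->. Qed.

Lemma L1_cst (c : R) : L1 (fun=> c).
Proof. exact: finite_measure_integrable_cst. Qed.

Lemma L1_bounded (C : R) X : measurable_fun setT X -> (forall w, `|X w| <= C) -> L1 X.
Proof. by move=> mX XC; exact: (L1_le mX XC (L1_cst C)). Qed.

Lemma L1D X Y : L1 X -> L1 Y -> L1 (fun w => X w + Y w).
Proof. by move=> iX iY; have := @integrableD _ _ _ P setT measurableT _ _ iX iY. Qed.

Lemma L1Z (c : R) X : L1 X -> L1 (fun w => c * X w).
Proof. by move=> iX; have := @integrableZl _ _ _ P setT measurableT c _ iX. Qed.

Lemma L1N X : L1 X -> L1 (fun w => - X w).
Proof. by move=> /(L1Z (-1)); apply: eq_L1 => w; rewrite mulN1r. Qed.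

Lemma L1B X Y : L1 X -> L1 Y -> L1 (fun w => X w - Y w).
Proof. by move=> iX iY; apply: L1D => //; exact: L1N. Qed.

Lemma L1_norm X : L1 X -> L1 (fun w => `|X w|).
Proof. exact: integrable_norm. Qed.

Lemma L1_sum (I : Type) (s : seq I) (F : I -> T -> R) :
  (forall i, L1 (F i)) -> L1 (fun w => \sum_(i <- s) F i w).
Proof.
move=> iF; elim: s => [|i s IH].
  by apply: eq_L1 (L1_cst 0) => w; rewrite big_nil.
by apply: eq_L1 (L1D (iF i) IH) => w; rewrite big_cons.
Qed.

Lemma L1M_bounded (C : R) X Y : measurable_fun setT X -> (forall w, `|X w| <= C) ->
  L1 Y -> L1 (fun w => X w * Y w).
Proof.
move=> mX XC iY; apply: (@L1_le _ (fun w => C * `|Y w|)).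
- by apply: measurable_funM => //; exact: L1_measurable.
- by move=> w; rewrite normrM ler_wpM2r.
- exact/L1Z/L1_norm.
Qed.

Lemma eq_Ex X Y : X =1 Y -> Ex X = Ex Y.
Proof. by move=> /funext ->. Qed.

Lemma Ex_cst (c : R) : Ex (fun=> c) = c.
Proof. by rewrite /Ex Rintegral_cst//= probability_setT mulr1. Qed.

Lemma ExD X Y : L1 X -> L1 Y -> Ex (fun w => X w + Y w) = Ex X + Ex Y.
Proof. by move=> iX iY; rewrite /Ex RintegralD. Qed.

Lemma ExB X Y : L1 X -> L1 Y -> Ex (fun w => X w - Y w) = Ex X - Ex Y.
Proof. by move=> iX iY; rewrite /Ex RintegralB. Qed.

Lemma ExZ (c : R) X : L1 X -> Ex (fun w => c * X w) = c * Ex X.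
Proof. by move=> iX; rewrite /Ex RintegralZl. Qed.

Lemma ExN X : L1 X -> Ex (fun w => - X w) = - Ex X.
Proof.
by move=> iX; rewrite -mulN1r -ExZ//; apply: eq_Ex => w; rewrite mulN1r.
Qed.

Lemma Ex_sum (I : Type) (s : seq I) (F : I -> T -> R) :
  (forall i, L1 (F i)) ->
  Ex (fun w => \sum_(i <- s) F i w) = \sum_(i <- s) Ex (F i).
Proof.
move=> iF; elim: s => [|i s IH].
  by rewrite big_nil -[RHS](Ex_cst 0); apply: eq_Ex => w; rewrite big_nil.
rewrite big_cons -IH -ExD//; last exact: L1_sum.
by apply: eq_Ex => w; rewrite big_cons.
Qed.

Lemma Ex_ge0 X : (forall w, 0 <= X w) -> 0 <= Ex X.
Proof. by move=> X0; apply: Rintegral_ge0. Qed.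

Lemma Ex_le X Y : L1 X -> L1 Y -> (forall w, X w <= Y w) -> Ex X <= Ex Y.
Proof. by move=> iX iY XY; apply: le_Rintegral. Qed.

Lemma Ex_norm X : L1 X -> `|Ex X| <= Ex (fun w => `|X w|).
Proof. by move=> iX; apply: le_normr_Rintegral. Qed.

Lemma ae_null (Q : T -> Prop) : {ae P, forall w, Q w} ->
  exists N, [/\ measurable N, P N = 0%E & forall w, ~ N w -> Q w].
Proof.
move=> [N [mN N0 QN]]; exists N; split => // w Nw.
by apply: contrapT => nQ; apply: Nw; apply: QN.
Qed.

Lemma eq_Ex_ae X Y : measurable_fun setT X -> measurable_fun setT Y ->
  {ae P, forall w, X w = Y w} -> Ex X = Ex Y.
Proof.
move=> mX mY XY; congr fine; apply: ae_eq_integral => //;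
  [exact/measurable_EFinP|exact/measurable_EFinP|].
by move: XY; apply: filterS => w /= ->.
Qed.

Lemma L1_ae X Y : measurable_fun setT Y -> {ae P, forall w, X w = Y w} -> L1 X -> L1 Y.
Proof.
move=> mY XY iX; apply/integrableP; split; first exact/measurable_EFinP.
have mX := L1_measurable iX.
case/integrableP : iX => _; congr (_ < _)%E; apply: ge0_ae_eq_integral => //.
- by apply/measurable_EFinP; exact: measurableT_comp.
- by apply/measurable_EFinP; exact: measurableT_comp.
- by move: XY; apply: filterS => w /= ->.
Qed.

(** [Y] agrees almost everywhere with [Num.max (X w) (Y w)], which dominates [X] at every point. *)
Lemma Ex_le_ae X Y : L1 X -> L1 Y -> {ae P, forall w, X w <= Y w} -> Ex X <= Ex Y.
Proof.
move=> iX iY XY.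
have mX := L1_measurable iX; have mY := L1_measurable iY.
have mM : measurable_fun setT (fun w => Num.max (X w) (Y w)) by exact: measurable_maxr.
have XYM : {ae P, forall w, Y w = Num.max (X w) (Y w)}.
  by move: XY; apply: filterS => w XYw; rewrite max_r.
rewrite [leRHS](eq_Ex_ae mY mM XYM); apply: Ex_le => //.
  exact: (L1_ae mM XYM).
by move=> w; rewrite le_max lexx.
Qed.

Lemma Ex_eq0_ae X : L1 X -> (forall w, 0 <= X w) -> Ex X <= 0 -> {ae P, forall w, X w = 0}.
Proof.
move=> iX X0 EX.
have : (\int[P]_w `|(EFin \o X) w|)%E = 0%E.
  under eq_integral => w _ do rewrite /= ger0_norm//.
  by rewrite Ex_EFin//; congr EFin; apply/eqP; rewrite eq_le EX Ex_ge0.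
move/(ae_eq_integral_abs P measurableT (measurable_int _ iX)).1.
by apply: filterS => w /(_ Logic.I) /= [].
Qed.

Definition L2 X := measurable_fun setT X /\ L1 (fun w => X w ^+ 2).

Lemma L2_measurable X : L2 X -> measurable_fun setT X. Proof. by case. Qed.

Lemma eq_L2 X Y : X =1 Y -> L2 X -> L2 Y.
Proof. by move=> /funext ->. Qed.

Lemma L2_L1M X Y : L2 X -> L2 Y -> L1 (fun w => X w * Y w).
Proof.
move=> [mX iX] [mY iY]; apply: (@L1_le _ (fun w => X w ^+ 2 + Y w ^+ 2)).
- exact: measurable_funM.
- by move=> w; rewrite ler_norml; apply/andP; split; nra.
- exact: L1D.
Qed.

Lemma L2_bounded (C : R) X : measurable_fun setT X -> (forall w, `|X w| <= C) -> L2 X.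
Proof.
move=> mX XC; split => //; apply: (@L1_bounded (C ^+ 2)); first exact: measurable_funX.
by move=> w; rewrite normrX lerXn2r ?nnegrE// (le_trans _ (XC w)).
Qed.

Lemma L2_cst (c : R) : L2 (fun=> c).
Proof. by apply: (@L2_bounded `|c|). Qed.

Lemma L2_L1 X : L2 X -> L1 X.
Proof.
by move=> h; apply: eq_L1 (L2_L1M (L2_cst 1) h) => w; rewrite mul1r.
Qed.

Lemma L2D X Y : L2 X -> L2 Y -> L2 (fun w => X w + Y w).
Proof.
move=> h1 h2; have h := L2_L1M h1 h2; case: h1 h2 => [mX iX] [mY iY]; split.
  exact: measurable_funD.
apply: eq_L1 (L1D (L1D iX (L1Z 2 h)) iY) => w.
ring.
Qed.

Lemma L2Z (c : R) X : L2 X -> L2 (fun w => c * X w).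
Proof.
move=> [mX iX]; split; first exact: measurable_funM.
by apply: eq_L1 (L1Z (c ^+ 2) iX) => w; rewrite exprMn.
Qed.

Lemma L2N X : L2 X -> L2 (fun w => - X w).
Proof. by move=> /(L2Z (-1)); apply: eq_L2 => w; rewrite mulN1r. Qed.

Lemma L2B X Y : L2 X -> L2 Y -> L2 (fun w => X w - Y w).
Proof. by move=> iX iY; apply: L2D => //; exact: L2N. Qed.

(** Expand [(|x| - c) ^+ 2 >= 0] and take the mean. *)
Lemma Ex_norm_young (c : R) X : 0 < c -> L2 X ->
  Ex (fun w => `|X w|) <= c / 2 + Ex (fun w => X w ^+ 2) / (2 * c).
Proof.
move=> c0 LX; have [_ iX] := LX.
rewrite [_ / (2 * c)]mulrC -(Ex_cst (c / 2)) -ExZ// -ExD; [|exact: L1_cst|exact: L1Z].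
apply: Ex_le; [exact/L1_norm/L2_L1|apply: L1D; [exact: L1_cst|exact: L1Z]|].
move=> w; rewrite -(real_normK (num_real (X w))); set x := `|X w|.
have h := sqr_ge0 (x - c); rewrite -subr_ge0.
have -> : c / 2 + (2 * c)^-1 * x ^+ 2 - x = (x - c) ^+ 2 / (2 * c) by field; lra.
by rewrite divr_ge0//; lra.
Qed.

(** Cauchy-Schwarz against the constant 1, obtained from Young's inequality with the optimal
    [c = Num.sqrt v]; when [v = 0] every positive [c] is used instead. *)
Lemma Ex_norm_sqrt X : L2 X -> Ex (fun w => `|X w|) <= Num.sqrt (Ex (fun w => X w ^+ 2)).
Proof.
move=> LX; set v := Ex (fun w => X w ^+ 2).
have v0 : 0 <= v by apply: Ex_ge0 => w; exact: sqr_ge0.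
have [v1|v1] := eqVneq v 0.
  rewrite v1 sqrtr0; apply/ler_addgt0Pl => e e0; rewrite addr0.
  apply: (le_trans (Ex_norm_young e0 LX)); rewrite -/v v1; lra.
have s0 : 0 < Num.sqrt v by rewrite sqrtr_gt0 lt_def v1.
apply: (le_trans (Ex_norm_young s0 LX)); rewrite -/v -{2}(sqr_sqrtr v0).
have -> : Num.sqrt v / 2 + Num.sqrt v ^+ 2 / (2 * Num.sqrt v) = Num.sqrt v by field; lra.
exact: lexx.
Qed.

End Expectation.

(** * Independent variables and product laws *)

Section Independence.
Context {R : realType} {d : measure_display} {T : measurableType d}.
Variable P : probability T R.

Definition indep_rv (X Y : T -> R) := forall A B, measurable A -> measurable B ->
  P (X @^-1` A `&` Y @^-1` B) = (P (X @^-1` A) * P (Y @^-1` B))%E.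

Section Fubini.
Variables (X Y : T -> R).
Hypotheses (mX : measurable_fun setT X) (mY : measurable_fun setT Y).
Hypothesis XY : indep_rv X Y.

Let X' : {mfun T >-> R} := mfun_Sub (mem_set mX).
Let Y' : {mfun T >-> R} := mfun_Sub (mem_set mY).
Let PX : probability _ R := distribution P X'.
Let PY : probability _ R := distribution P Y'.

Let mXY : measurable_fun setT (fun w => (X w, Y w)).
Proof. exact: measurable_fun_pair. Qed.

Let XY' : {mfun T >-> (R * R)%type} := mfun_Sub (mem_set mXY).
Let PXY : probability _ R := distribution P XY'.

Let law_product D : measurable D -> (PX \x PY)%E D = PXY D.
Proof.
move=> mD; by apply: (product_measure_unique (m1 := PX) (m2 := PY)) => //.
Qed.

(** Freezing: independence says that the joint law agrees with the product of the marginals on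
    rectangles, hence everywhere, and Tonelli applies to the product. Values in [\bar R] allow
    indicators and moments alike. *)
Lemma indep_fubini_ge0 (f : R * R -> \bar R) :
  measurable_fun setT f -> (forall z, 0 <= f z)%E ->
  (\int[P]_w f (X w, Y w) = \int[P]_w \int[P]_w' f (X w, Y w'))%E.
Proof.
move=> mf f0.
transitivity (\int[PXY]_z f z)%E.
  by rewrite [RHS](ge0_integral_pushforward mXY).
rewrite (@eq_measure_integral _ _ _ _ (PX \x PY)%E); last first.
  by move=> A mA _; exact/esym/law_product.
rewrite fubini_tonelli1//= [LHS](ge0_integral_pushforward mX)//=; last 2 first.
  exact: measurable_fun_fubini_tonelli_F.
  by move=> x _; apply: integral_ge0.
apply: eq_integral => w _ /=; rewrite /fubini_F.
rewrite [LHS](ge0_integral_pushforward mY)//=.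
by apply: measurableT_comp => //; exact: measurable_pair1.
Qed.

End Fubini.

Lemma indep_rv_comp X Y (f g : R -> R) : measurable_fun setT f -> measurable_fun setT g ->
  indep_rv X Y -> indep_rv (f \o X) (g \o Y).
Proof.
move=> mf mg XY A B mA mB; apply: (XY (f @^-1` A) (g @^-1` B)).
  by rewrite -[X in measurable X]setTI; exact: mf.
by rewrite -[X in measurable X]setTI; exact: mg.
Qed.

Let indep_ExM_ge0 X Y : indep_rv X Y -> L1 P X -> L1 P Y ->
  (forall w, 0 <= X w) -> (forall w, 0 <= Y w) ->
  L1 P (fun w => X w * Y w) /\ Ex P (fun w => X w * Y w) = Ex P X * Ex P Y.
Proof.
move=> XY iX iY X0 Y0; have mX := L1_measurable iX; have mY := L1_measurable iY.
have mf : measurable_fun setT (fun z : R * R => `|z.1 * z.2|%:E).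
  by apply/measurable_EFinP/measurableT_comp => //;
    apply: measurable_funM; [exact: measurable_fst|exact: measurable_snd].
have e : (\int[P]_w `|X w * Y w|%:E = (Ex P X * Ex P Y)%:E)%E.
  rewrite (indep_fubini_ge0 mX mY XY mf)//= mulrC -ExZ// -Ex_EFin//; last exact: L1Z.
  apply: eq_integral => w _.
  rewrite mulrC -ExZ// -Ex_EFin; last exact: L1Z.
  by apply: eq_integral => w' _; rewrite ger0_norm// mulr_ge0.
split.
  apply/integrableP; split; last by rewrite /= e ltry.
  by apply/measurable_EFinP; exact: measurable_funM.
rewrite /Ex /Rintegral -[RHS]/(fine (Ex P X * Ex P Y)%:E) -e; congr fine.
by apply: eq_integral => w _; rewrite ger0_norm// mulr_ge0.
Qed.

(** Tonelli handles nonnegative factors. With [p] and [n] the positive and negative parts, the four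
    products are treated separately and recombined. *)
Lemma indep_ExM X Y : indep_rv X Y -> L1 P X -> L1 P Y ->
  L1 P (fun w => X w * Y w) /\ Ex P (fun w => X w * Y w) = Ex P X * Ex P Y.
Proof.
move=> XY iX iY; have mX := L1_measurable iX; have mY := L1_measurable iY.
pose p (x : R) := (`|x| + x) / 2; pose n (x : R) := (`|x| - x) / 2.
have mp : measurable_fun setT p.
  by apply: measurable_funM => //; apply: measurable_funD => //; exact: measurable_normr.
have mn : measurable_fun setT n.
  by apply: measurable_funM => //; apply: measurable_funB => //; exact: measurable_normr.
have p0 x : 0 <= p x by rewrite /p; have := ler_norm (- x); rewrite normrN; lra.
have n0 x : 0 <= n x by rewrite /n; have := ler_norm x; lra.
have pnE x : x = p x - n x by rewrite /p /n; field.
have ip Z : L1 P Z -> L1 P (p \o Z).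
  move=> iZ; apply: eq_L1 (L1Z 2^-1 (L1D (L1_norm iZ) iZ)) => w.
  by rewrite /p /= mulrC.
have iN Z : L1 P Z -> L1 P (n \o Z).
  move=> iZ; apply: eq_L1 (L1Z 2^-1 (L1B (L1_norm iZ) iZ)) => w.
  by rewrite /n /= mulrC.
have EpnE Z : L1 P Z -> Ex P Z = Ex P (p \o Z) - Ex P (n \o Z).
  move=> iZ; rewrite -ExB; [|exact: ip|exact: iN].
  by apply: eq_Ex => w; rewrite /= -pnE.
have [h1 e1] := indep_ExM_ge0 (indep_rv_comp mp mp XY) (ip _ iX) (ip _ iY)
  (fun w => p0 _) (fun w => p0 _).
have [h2 e2] := indep_ExM_ge0 (indep_rv_comp mp mn XY) (ip _ iX) (iN _ iY)
  (fun w => p0 _) (fun w => n0 _).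
have [h3 e3] := indep_ExM_ge0 (indep_rv_comp mn mp XY) (iN _ iX) (ip _ iY)
  (fun w => n0 _) (fun w => p0 _).
have [h4 e4] := indep_ExM_ge0 (indep_rv_comp mn mn XY) (iN _ iX) (iN _ iY)
  (fun w => n0 _) (fun w => n0 _).
have h := L1B (L1D h1 h4) (L1D h2 h3).
have E w : (p \o X) w * (p \o Y) w + (n \o X) w * (n \o Y) w
    - ((p \o X) w * (n \o Y) w + (n \o X) w * (p \o Y) w) = X w * Y w.
  by rewrite /= [in RHS](pnE (X w)) [in RHS](pnE (Y w)); ring.
split; first exact: eq_L1 E h.
rewrite -(eq_Ex P E) ExB ?ExD//; [|exact: L1D|exact: L1D].
rewrite e1 e2 e3 e4 (EpnE _ iX) (EpnE _ iY); ring.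
Qed.

End Independence.

(** * Moments of the normal law *)

Section GaussianMoments.
Context {R : realType}.
Local Notation leb := (@lebesgue_measure R).

(** The Radon-Nikodym derivative of [normal_prob] with respect to Lebesgue measure equals
    [normal_pdf] almost everywhere, because both have the same integral over every measurable
    set. *)
Lemma ge0_integral_normal_prob (m s : R) (f : R -> \bar R) :
  measurable_fun setT f -> (forall x, 0 <= f x)%E ->
  (\int[normal_prob m s]_x f x = \int[leb]_x (f x * (normal_pdf m s x)%:E))%E.
Proof.
move=> mf f0; have dom := normal_prob_dominates m s.
rewrite -(Radon_Nikodym_SigmaFinite.change_of_variables dom)//.
have mN : measurable_fun setT (EFin \o normal_pdf m s).
  by apply/measurable_EFinP; exact: measurable_normal_pdf.
have iRN := Radon_Nikodym_SigmaFinite.f_integrable dom.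
apply: ge0_ae_eq_integral => //.
- by apply: emeasurable_funM => //; exact: (measurable_int _ iRN).
- exact: emeasurable_funM.
- by move=> x _; rewrite mule_ge0// Radon_Nikodym_SigmaFinite.f_ge0.
- by move=> x _; rewrite mule_ge0// lee_fin normal_pdf_ge0.
apply: ae_eqe_mul2l => /=.
apply: integral_ae_eq => //= E _ mE.
by rewrite -Radon_Nikodym_SigmaFinite.f_integral.
Qed.

(** Completing the square: an exponential tilt shifts the mean. As the tilted density has mass 1 up
    to the constant, that constant is the Laplace transform. *)
Lemma normal_pdf_exp_tilt (s t x : R) : s != 0 ->
  expR (t * x) * normal_pdf 0 s x =
  expR (t ^+ 2 * s ^+ 2 / 2) * normal_pdf (t * s ^+ 2) s x.
Proof.
move=> s0; rewrite !normal_pdfE// mulrCA [RHS]mulrCA; congr (_ * _).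
by rewrite /normal_fun -!expRD; congr expR; field.
Qed.

(** A Gaussian tilt rescales the variance; [t * s ^+ 2 < 1] is the range where the exponent keeps
    its sign. *)
Lemma normal_pdf_sqr_tilt (s t x : R) : 0 < s -> t * s ^+ 2 < 1 ->
  expR (t * x ^+ 2 / 2) * normal_pdf 0 s x =
  (Num.sqrt (1 - t * s ^+ 2))^-1 * normal_pdf 0 (s / Num.sqrt (1 - t * s ^+ 2)) x.
Proof.
move=> s0 ts; set r := Num.sqrt _.
have r0 : 0 < r by rewrite sqrtr_gt0; lra.
have r2 : r ^+ 2 = 1 - t * s ^+ 2 by rewrite sqr_sqrtr//; lra.
have sr0 : 0 < s / r by rewrite divr_gt0.
have pk : normal_peak (s / r) = r * normal_peak s.
  rewrite /normal_peak (_ : (s / r) ^+ 2 * pi *+ 2 = (s ^+ 2 * pi *+ 2) * (r^-1) ^+ 2).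
    rewrite sqrtrM; last by rewrite mulrn_wge0// mulr_ge0 ?sqr_ge0// pi_ge0.
    by rewrite sqrtr_sqr ger0_norm ?invr_ge0 ?ltW// invfM invrK mulrC.
  by rewrite expr_div_n exprVn; ring.
rewrite !normal_pdfE ?gt_eqF// pk mulrCA [RHS]mulrA; congr (_ * _).
  by rewrite mulrA mulVf ?mul1r ?gt_eqF.
rewrite /normal_fun -expRD; congr expR; rewrite !subr0.
have -> : t = (1 - r ^+ 2) / s ^+ 2 by rewrite r2; field; lra.
by field; rewrite !gt_eqF.
Qed.

(** A linear function below a parabola on both sides of 0 has slope 0; test [t = c * m] with [c] so
    small that [C * c < 1]. Applied to exponential moments, it extracts mean and variance without
    differentiating under the integral. *)
Lemma eq0_of_lin_le_sqr (m C e : R) : 0 < e ->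
  (forall t, `|t| <= e -> t * m <= C * t ^+ 2) -> m = 0.
Proof.
move=> e0 h; apply: contrapT => /eqP m0.
have m2 : 0 < m ^+ 2 by rewrite exprn_even_gt0.
have nm : 0 < `|m| by rewrite normr_gt0.
pose c := Num.min (e / `|m|) (`|C| + 1)^-1.
have C0 : 0 < (`|C| + 1)^-1 by rewrite invr_gt0; have := normr_ge0 C; lra.
have c0 : 0 < c by rewrite lt_min C0 divr_gt0.
have := h (c * m); rewrite normrM (gtr0_norm c0) -ler_pdivlMr// ge_min lexx => /(_ isT).
rewrite exprMn -mulrA -expr2 => k.
have : 1 <= C * c.
  have : c * m ^+ 2 * 1 <= c * m ^+ 2 * (C * c) by rewrite mulr1 (le_trans k)// (_ : C * (_ * _) = c * m ^+ 2 * (C * c)) ?lexx//; ring.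
  by rewrite ler_pM2l// mulr_gt0.
have : c <= (`|C| + 1)^-1 by rewrite ge_min lexx orbT.
rewrite -[(_)^-1]mul1r ler_pdivlMr; last by have := normr_ge0 C; lra.
have := ler_norm C; nra.
Qed.

Context {d : measure_display} {T : measurableType d}.
Variable P : probability T R.

Section Moments.
Variables (X : T -> R) (s : R).
Hypotheses (s0 : 0 < s) (mX : measurable_fun setT X).
Hypothesis lawX : forall B, measurable B -> P (X @^-1` B) = normal_prob 0 s B.

Lemma ge0_integral_normal (f : R -> R) : measurable_fun setT f -> (forall x, 0 <= f x) ->
  (\int[P]_w (f (X w))%:E = \int[leb]_x (f x * normal_pdf 0 s x)%:E)%E.
Proof.
move=> mf f0; have mEf : measurable_fun setT (EFin \o f) by exact/measurable_EFinP.
have mX' : @measurable_fun _ _ T (measurableTypeR R) setT X by exact: mX.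
pose X' := @mfun_Sub _ _ T (measurableTypeR R) X (mem_set mX').
transitivity (\int[(distribution P X' : probability _ R)]_x (f x)%:E)%E.
  by rewrite [RHS](ge0_integral_pushforward mX')// => x _; rewrite lee_fin.
transitivity (\int[normal_prob 0 s]_x (f x)%:E)%E.
  by apply: eq_measure_integral => A mA _; exact: lawX.
by rewrite ge0_integral_normal_prob.
Qed.

Let integral_tilt (f g : R -> R) c m s' : measurable_fun setT f -> (forall x, 0 <= f x) ->
  0 <= c -> (forall x, f x * normal_pdf 0 s x = c * normal_pdf m s' x) ->
  L1 P (f \o X) /\ Ex P (f \o X) = c.
Proof.
move=> mf f0 c0 h.
have e : (\int[P]_w (f (X w))%:E = c%:E)%E.
  rewrite ge0_integral_normal//.
  under eq_integral => x _ do rewrite h EFinM.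
  rewrite ge0_integralZl//=.
  - by rewrite integral_normal_pdf mule1.
  - by apply/measurable_EFinP; exact: measurable_normal_pdf.
  - by move=> x _; rewrite lee_fin normal_pdf_ge0.
split; last by rewrite /Ex /Rintegral e.
apply/integrableP; split.
  by apply/measurable_EFinP; exact: (measurableT_comp mf mX).
by under eq_integral => w _ do rewrite /= ger0_norm//; rewrite e ltry.
Qed.

Let Ex_exp t : L1 P (fun w => expR (t * X w)) /\
  Ex P (fun w => expR (t * X w)) = expR (t ^+ 2 * s ^+ 2 / 2).
Proof.
apply: (@integral_tilt (fun x => expR (t * x)) id _ (t * s ^+ 2) s) => //.
- by apply: measurableT_comp => //; exact: measurable_funM.
- by move=> x; rewrite normal_pdf_exp_tilt// gt_eqF.
Qed.

Let Ex_exp_sqr t : t * s ^+ 2 < 1 -> L1 P (fun w => expR (t * X w ^+ 2 / 2)) /\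
  Ex P (fun w => expR (t * X w ^+ 2 / 2)) = (Num.sqrt (1 - t * s ^+ 2))^-1.
Proof.
move=> ts; apply: (@integral_tilt (fun x => expR (t * x ^+ 2 / 2)) id _ 0
   (s / Num.sqrt (1 - t * s ^+ 2))) => //.
- by apply: measurableT_comp => //; apply: measurable_funM => //;
    apply: measurable_funM => //; exact: measurable_funX.
- by move=> x; rewrite normal_pdf_sqr_tilt.
Qed.

(** Half of the critical exponent: [t0 * s ^+ 2 = 1 / 2], so [expR (t0 * X ^+ 2 / 2)] has a finite
    mean, the square root of 2. *)
Let t0 : R := (2 * s ^+ 2)^-1.
Let t0_gt0 : 0 < t0. Proof. by rewrite /t0 invr_gt0 mulr_gt0// exprn_gt0. Qed.
Let t0s : t0 * s ^+ 2 = 1 / 2. Proof. by rewrite /t0; field; rewrite gt_eqF. Qed.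

Let expR_ge_sqr (y : R) : 0 <= y -> y ^+ 2 / 4 <= expR y.
Proof.
move=> y0; have h : 1 + y / 2 <= expR (y / 2) by exact: expR_ge1Dx.
rewrite (_ : expR y = expR (y / 2) * expR (y / 2)); last by rewrite -expRD; congr expR; field.
 apply: (@le_trans _ _ ((1 + y / 2) * (1 + y / 2))); first by nra.
by apply: ler_pM => //; lra.
Qed.

(** This is [expR_ge_sqr] at [y = x ^+ 2 / (4 * s ^+ 2)], for which
    [y ^+ 2 / 4 = x ^+ 4 / (64 * s ^+ 4)]. *)
Let pow4_le (x : R) : x ^+ 4 <= 64 * s ^+ 4 * expR (t0 * x ^+ 2 / 2).
Proof.
have y0 : 0 <= t0 * x ^+ 2 / 2 by rewrite divr_ge0// mulr_ge0 ?sqr_ge0 ?ltW.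
have := expR_ge_sqr y0.
have s4 : 0 < 64 * s ^+ 4 by rewrite mulr_gt0// exprn_gt0.
move=> h; rewrite -(ler_pM2l s4) in h; apply: le_trans h.
rewrite /t0 le_eqVlt; apply/orP; left; apply/eqP; by field; rewrite gt_eqF.
Qed.

(** The constant is crude: 64 from [pow4_le], times the bound 2 for the exponential moment at [t0].
    Only the order [s ^+ 4] matters later. *)
Lemma normal_pow4 : L1 P (fun w => X w ^+ 4) /\ Ex P (fun w => X w ^+ 4) <= 128 * s ^+ 4.
Proof.
have [i1 e1] : L1 P (fun w => expR (t0 * X w ^+ 2 / 2)) /\
  Ex P (fun w => expR (t0 * X w ^+ 2 / 2)) = (Num.sqrt (1 - t0 * s ^+ 2))^-1.
  by apply: Ex_exp_sqr; rewrite t0s; lra.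
have i4 : L1 P (fun w => X w ^+ 4).
  apply: L1_le (L1Z (64 * s ^+ 4) i1); first exact: measurable_funX.
  by move=> w; rewrite ger0_norm ?pow4_le// exprn_even_ge0.
split=> //; apply: (@le_trans _ _ (Ex P (fun w => 64 * s ^+ 4 * expR (t0 * X w ^+ 2 / 2)))).
  by apply: Ex_le => //; exact: L1Z.
rewrite ExZ// e1 t0s.
have h : (Num.sqrt (1 - 1 / 2))^-1 <= 2 :> R.
  set r := Num.sqrt _; have r0 : 0 < r by rewrite sqrtr_gt0; lra.
  have r2 : r ^+ 2 = 1 - 1 / 2 by rewrite sqr_sqrtr//; lra.
  by rewrite -[_^-1]mul1r ler_pdivrMr//; nra.
have : 0 < s ^+ 4 by rewrite exprn_gt0.
nra.
Qed.

Lemma normal_L2 : L2 P X.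
Proof.
split=> //; have [i4 _] := normal_pow4.
apply: L1_le (L1D (L1_cst P 1) i4); first exact: measurable_funX.
move=> w; rewrite ger0_norm ?sqr_ge0//.
have := sqr_ge0 (X w ^+ 2 - 1); rewrite -[4%N]/(2 * 2)%N exprM; have := sqr_ge0 (X w); nra.
Qed.

(** Averaging [1 + t * X <= expR (t * X)] gives [t * E X <= expR y - 1] with
    [y = t ^+ 2 * s ^+ 2 / 2]. For [|t| <= s^-1] one has [y <= 1 / 2], where [expR y <= 1 + 2 * y],
    a quadratic bound in [t]. *)
Lemma normal_mean : Ex P X = 0.
Proof.
apply: (@eq0_of_lin_le_sqr _ (s ^+ 2) s^-1); first by rewrite invr_gt0.
move=> t ts; have [i1 e1] := Ex_exp t.
have iX := L2_L1 normal_L2.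
have : Ex P (fun w => 1 + t * X w) <= Ex P (fun w => expR (t * X w)).
  by apply: Ex_le => [||w]; [apply: L1D; [exact: L1_cst|exact: L1Z]|by []|exact: expR_ge1Dx].
rewrite ExD ?Ex_cst ?ExZ ?e1//; [|exact: L1_cst|exact: L1Z].
set y := t ^+ 2 * s ^+ 2 / 2.
have y0 : 0 <= y by rewrite /y divr_ge0// mulr_ge0 ?sqr_ge0.
have y1 : y <= 1 / 2.
  rewrite /y -exprMn -(real_normK (num_real (t * s))) normrM (gtr0_norm s0).
  have : `|t| * s <= 1 by rewrite -ler_pdivlMr// mul1r.
  have : 0 <= `|t| * s by rewrite mulr_ge0// ltW.
  by nra.
have : expR y * (1 - y) <= 1.
  have h : 1 - y <= expR (- y) by exact: expR_ge1Dx.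
  have : expR y * (1 - y) <= expR y * expR (- y) by rewrite ler_wpM2l ?expR_ge0.
  by rewrite -expRD subrr expR0.
have -> : s ^+ 2 * t ^+ 2 = 2 * y by rewrite /y; field.
nra.
Qed.

(** Same device with [1 + t * X ^+ 2 / 2 <= expR (t * X ^+ 2 / 2)]: the mean of the right side is
    [(1 - y) ^ (- 1 / 2)] with [y = t * s ^+ 2], which is at most [1 + y / 2 + y ^+ 2] for
    [|y| <= 1 / 2]. *)
Lemma normal_variance : Ex P (fun w => X w ^+ 2) = s ^+ 2.
Proof.
apply/eqP; rewrite -subr_eq0; apply/eqP.
apply: (@eq0_of_lin_le_sqr _ (2 * s ^+ 4) t0) => // t tt0.
have [_ iX] := normal_L2.
have ts : `|t * s ^+ 2| <= 1 / 2.
  by rewrite normrM (ger0_norm (sqr_ge0 s)) -t0s ler_wpM2r ?sqr_ge0.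
set y := t * s ^+ 2 in ts.
move: ts; rewrite ler_norml => /andP[y1 y2].
have [i1 e1] : L1 P (fun w => expR (t * X w ^+ 2 / 2)) /\
  Ex P (fun w => expR (t * X w ^+ 2 / 2)) = (Num.sqrt (1 - t * s ^+ 2))^-1.
  by apply: Ex_exp_sqr; rewrite -/y; lra.
have : Ex P (fun w => 1 + (t / 2) * X w ^+ 2) <= Ex P (fun w => expR (t * X w ^+ 2 / 2)).
  apply: Ex_le => [||w]; [by apply: L1D; [exact: L1_cst|exact: L1Z]|by []|].
  by rewrite mulrAC; exact: expR_ge1Dx.
rewrite ExD ?Ex_cst ?ExZ ?e1//; [|exact: L1_cst|exact: L1Z].
set V := Ex _ _; rewrite -/y; set r := Num.sqrt (1 - y).
have r0 : 0 < r by rewrite sqrtr_gt0; lra.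
have r2 : r ^+ 2 = 1 - y by rewrite sqr_sqrtr//; lra.
have z0 : 0 < 1 + y / 2 + y ^+ 2 by nra.
have : r^-1 <= 1 + y / 2 + y ^+ 2.
  rewrite -[_^-1]mul1r ler_pdivrMr//.
  rewrite mulrC; set q := r * _.
  have q0 : 0 < q by rewrite mulr_gt0.
  suff : 1 <= q ^+ 2 by nra.
  rewrite exprMn r2 mulrC.
  have -> : (1 + y / 2 + y ^+ 2) ^+ 2 * (1 - y) = 1 + y ^+ 2 * (5 / 4 - 5 / 4 * y - y * y ^+ 2) by field.
  have y3 : y ^+ 2 <= 1 / 4 by nra.
  have : 0 <= y ^+ 2 by exact: sqr_ge0.
  have : 0 <= 5 / 4 - 5 / 4 * y - y * y ^+ 2 by nra.
  nra.
have -> : 2 * s ^+ 4 * t ^+ 2 = 2 * y ^+ 2 by rewrite /y; ring.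
rewrite mulrBr -/y; lra.
Qed.

End Moments.
End GaussianMoments.

(** * Measurability with respect to generated sigma-algebras *)

Section SubSigmaAlgebra.
Context {R : realType} {d : measure_display} {T : measurableType d}.
Implicit Types (G : set_system T) (X Y : T -> R).

Lemma rv_measurableP G X :
  rv_measurable <<s G >> X <->
  @measurable_fun _ _ (g_sigma_algebraType G) R setT X.
Proof.
split=> h; first by move=> _ B mB; rewrite setTI; exact: h.
by move=> B mB; have := h measurableT B mB; rewrite setTI.
Qed.

Lemma sigma_sub_measurable G : G `<=` measurable -> <<s G >> `<=` measurable.
Proof.
move=> Gm; apply: smallest_sub => //; split; [exact: measurable0| |].
- by move=> A mA; rewrite setTD; exact: measurableC.
- by move=> F mF; exact: bigcupT_measurable.
Qed.

Lemma sigma_subset (G H : set_system T) : G `<=` <<s H >> -> <<s G >> `<=` <<s H >>.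
Proof. by move=> GH; apply: smallest_sub => //; exact: smallest_sigma_algebra. Qed.

Lemma sigmaI G A B : <<s G >> A -> <<s G >> B -> <<s G >> (A `&` B).
Proof. exact: (@measurableI _ (g_sigma_algebraType G)). Qed.

Lemma rv_measurable_sub (G H : set_system T) X : G `<=` H ->
  rv_measurable G X -> rv_measurable H X.
Proof. by move=> GH h B mB; apply/GH/h. Qed.

Lemma rv_measurable_fun G X : G `<=` measurable -> rv_measurable G X ->
  measurable_fun setT X.
Proof. by move=> Gm h _ B mB; rewrite setTI; apply/Gm/h. Qed.

Lemma rv_measurable_preimages (I : Type) (D : set I) (W : I -> T -> R) i : D i ->
  rv_measurable <<s preimages D W >> (W i).
Proof. by move=> Di B mB; apply: sub_sigma_algebra; exists i, B. Qed.

Lemma rvD G X Y : rv_measurable <<s G >> X -> rv_measurable <<s G >> Y ->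
  rv_measurable <<s G >> (fun w => X w + Y w).
Proof. by rewrite !rv_measurableP; exact: measurable_funD. Qed.

Lemma rvB G X Y : rv_measurable <<s G >> X -> rv_measurable <<s G >> Y ->
  rv_measurable <<s G >> (fun w => X w - Y w).
Proof. by rewrite !rv_measurableP; exact: measurable_funB. Qed.

Lemma rvM G X Y : rv_measurable <<s G >> X -> rv_measurable <<s G >> Y ->
  rv_measurable <<s G >> (fun w => X w * Y w).
Proof. by rewrite !rv_measurableP; exact: measurable_funM. Qed.

Lemma rv_comp G X (f : R -> R) : measurable_fun setT f -> rv_measurable <<s G >> X ->
  rv_measurable <<s G >> (f \o X).
Proof. by rewrite !rv_measurableP => mf; exact: measurableT_comp. Qed.

Lemma rv_cst G (c : R) : rv_measurable <<s G >> (fun=> c).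
Proof. by rewrite rv_measurableP; exact: measurable_cst. Qed.

Variable P : probability T R.

(** Dynkin's theorem: the events satisfying the product formula against a fixed [B] form a
    lambda-system. *)
Lemma indep_sigma (G : set_system T) (B : set T) : G `<=` measurable -> setI_closed G ->
  measurable B -> (forall A, G A -> P (A `&` B) = (P A * P B)%E) ->
  forall A, <<s G >> A -> P (A `&` B) = (P A * P B)%E.
Proof.
move=> Gm GI mB h.
suff : <<s G >> `<=` [set A | measurable A /\ P (A `&` B) = (P A * P B)%E].
  by move=> k A /k [].
apply: lambda_system_subset => //; last by move=> A GA; split; [exact: Gm|exact: h].
apply/dynkin_lambda_system; split.
- by split=> //; rewrite setTI probability_setT mul1e.
- move=> A [mA hA]; split; first exact: measurableC.
  rewrite setIC -setDE measureD//; last by rewrite (le_lt_trans (probability_le1 _ _)) ?ltry.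
  transitivity (P B - P A * P B)%E; first by congr (_ - _)%E; rewrite setIC.
  transitivity ((1 - P A) * P B)%E; last by rewrite probability_setC.
  have [fA fB] : P A \is a fin_num /\ P B \is a fin_num by split; exact: fin_num_measure.
  move: (P A) (P B) fA fB => [p||] [q||]// _ _.
  rewrite -EFinM -!EFinB -EFinM.
  by congr EFin; ring.
- move=> F tF hF; split; first by apply: bigcupT_measurable => k; exact: (hF k).1.
  have mF k : measurable (F k) := (hF k).1.
  rewrite setI_bigcupl measure_bigcup//; last 2 first.
  + by move=> k _; exact: measurableI.
  + exact: trivIset_setIr.
  have eB : P B = (fine (P B))%:E by rewrite fineK//; exact: fin_num_measure.
  rewrite measure_bigcup// muleC eB -nneseriesZl//.
  by apply: eq_eseriesr => k _; rewrite -eB muleC; exact: (hF k).2.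
Qed.

End SubSigmaAlgebra.
(** * Brownian increments and the Ito integral *)

Section BrownianIncrements.
Context {R : realType} {d : measure_display} {T : measurableType d}.
Variable P : probability T R.
Implicit Types (X Y : R -> T -> R).

(** The past of one component enlarged by the whole trajectory of the other and by the null events.
    It contains the filtration of [Z], yet the next increment of [X] remains independent of it. *)
Definition history X Y (r : R) : set_system T :=
  <<s preimages (before r) (increment X) `|` preimages setT Y
      `|` [set N | measurable N /\ P N = 0%E] >>.

Lemma increment_measurable X p : two_sided_BM P X -> measurable_fun setT (increment X p).
Proof. by move=> hX; apply: measurable_funB; exact: BM_measurable hX _. Qed.

Lemma preimages_sub_measurable (I : Type) (D : set I) (W : I -> T -> R) :
  (forall i, measurable_fun setT (W i)) -> preimages D W `<=` measurable.
Proof. by move=> mW A [i [B [_ mB ->]]]; rewrite -[X in measurable X]setTI; exact: mW. Qed.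

Lemma increment_sigma X (D : set (R * R)) :
  <<s preimages D (increment X) >> `<=` <<s preimages setT X >>.
Proof.
apply: sigma_subset => A [p [B [_ mB ->]]].
have : rv_measurable <<s preimages setT X >> (increment X p).
  by apply: rvB; exact: rv_measurable_preimages.
by apply.
Qed.

(** On rectangles the formula follows by splitting off the event of [Y], using the independence of
    the components, and then the event of the past of [X], using the independence of increments. *)
Lemma increment_history X Y r u : two_sided_BM P X -> two_sided_BM P Y ->
  independent P <<s preimages setT X >> <<s preimages setT Y >> -> r < u ->
  forall A B, history X Y r A -> measurable B ->
  P (A `&` increment X (r, u) @^-1` B) = (P A * P (increment X (r, u) @^-1` B))%E.
Proof.
move=> hX hY XY ru A B hA mB.
pose G1 := <<s preimages (before r) (increment X) >>.
pose G2 := <<s preimages setT Y >>.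
pose N0 := [set N : set T | measurable N /\ P N = 0%E].
(* Rectangles built from the past of [X] and from [Y], together with the null events: closed under
   intersection and generating the history. *)
pose G := [set A | exists A1 A2, [/\ G1 A1, G2 A2 & A = A1 `&` A2]] `|` N0.
have mG1 : G1 `<=` measurable.
  by apply/sigma_sub_measurable/preimages_sub_measurable => p; exact: increment_measurable.
have mG2 : G2 `<=` measurable.
  by apply/sigma_sub_measurable/preimages_sub_measurable => p; exact: BM_measurable hY _.
have mG : G `<=` measurable.
  move=> C [[A1 [A2 [h1 h2 ->]]]|[]//]; apply: measurableI; [exact: mG1|exact: mG2].
have mI : measurable (increment X (r, u) @^-1` B).
  by rewrite -[X in measurable X]setTI; exact: increment_measurable.
have N0I C D : measurable C -> N0 D -> N0 (C `&` D).
  move=> mC [mD D0]; split; first exact: measurableI.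
  apply/eqP; rewrite eq_le measure_ge0 andbT -D0 le_measure ?inE//; first exact: measurableI.
have : <<s G >> A.
  apply: (sigma_subset _ hA) => C [[C1|C2]|C3]; apply: sub_sigma_algebra.
  - left; exists C, setT; split; rewrite ?setIT//; first exact: sub_sigma_algebra.
    exact: (@measurableT _ (g_sigma_algebraType (preimages setT Y))).
  - left; exists setT, C; split; rewrite ?setTI//; last exact: sub_sigma_algebra.
    exact: (@measurableT _ (g_sigma_algebraType (preimages (before r) (increment X)))).
  - by right.
apply: indep_sigma => //.
- move=> C D [[A1 [A2 [h1 h2 ->]]]|hC] hD; last first.
    by right; rewrite setIC; apply: N0I => //; exact: mG.
  case: hD => [[B1 [B2 [k1 k2 ->]]]|hD].
    left; exists (A1 `&` B1), (A2 `&` B2); split; [exact: sigmaI|exact: sigmaI|].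
    by rewrite setIACA.
  by right; apply: N0I => //; apply: measurableI; [exact: mG1|exact: mG2].
- move=> C [[A1 [A2 [h1 h2 ->]]]|hC].
    have hI : <<s preimages [set (r, u)] (increment X) >> (increment X (r, u) @^-1` B).
      exact: rv_measurable_preimages.
    have hXA : <<s preimages setT X >> A1 by exact: increment_sigma h1.
    have hXI : <<s preimages setT X >> (increment X (r, u) @^-1` B).
      exact: increment_sigma hI.
    rewrite setIAC XY//; last exact: sigmaI.
    rewrite setIC (BM_independent hX ru)// XY//.
    by rewrite -muleA muleC muleAC.
- have [mIC e] : N0 (C `&` increment X (r, u) @^-1` B) by rewrite setIC; exact: N0I.
  by rewrite e hC.2 mul0e.
Qed.

Lemma history_measurable X Y r : two_sided_BM P X -> two_sided_BM P Y ->
  history X Y r `<=` measurable.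
Proof.
move=> hX hY; apply: sigma_sub_measurable => A [[|]|[]//].
- by apply: preimages_sub_measurable => p; exact: increment_measurable.
- by apply: preimages_sub_measurable => p; exact: BM_measurable hY _.
Qed.

(** With its imaginary counterpart below, this allows an increment of one component to be averaged
    against an adapted factor while the other component is held fixed. *)
Lemma filtration_history_re Z r :
  filtration P Z r `<=` history (re_part Z) (im_part Z) r.
Proof.
apply: sigma_subset => A [[hA|hA]|hA].
- by apply: sub_sigma_algebra; left; left.
- have : <<s preimages setT (im_part Z) >> A.
    by apply: increment_sigma; exact: sub_sigma_algebra hA.
  by apply: sigma_subset => C hC; apply: sub_sigma_algebra; left; right.
- by apply: sub_sigma_algebra; right.
Qed.

Lemma filtration_history_im Z r :
  filtration P Z r `<=` history (im_part Z) (re_part Z) r.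
Proof.
apply: sigma_subset => A [[hA|hA]|hA].
- have : <<s preimages setT (re_part Z) >> A.
    by apply: increment_sigma; exact: sub_sigma_algebra hA.
  by apply: sigma_subset => C hC; apply: sub_sigma_algebra; left; right.
- by apply: sub_sigma_algebra; left; left.
- by apply: sub_sigma_algebra; right.
Qed.

Lemma history_other X Y r p : rv_measurable (history X Y r) (increment Y p).
Proof.
have sub : <<s preimages setT Y >> `<=` history X Y r.
  by apply: sigma_subset => C hC; apply: sub_sigma_algebra; left; right.
apply: rv_measurable_sub sub _.
by apply: rvB; exact: rv_measurable_preimages.
Qed.

Lemma filtration_mono Z r u : r <= u -> filtration P Z r `<=` filtration P Z u.
Proof.
move=> ru; apply: sigma_subset => A; have sub W :
    preimages (before r) (increment W) A -> preimages (before u) (increment W) A.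
  by move=> [p [B [[p1 p2] mB ->]]]; exists p, B; split=> //; split=> //; exact: le_trans ru.
by move=> [[hA|hA]|hA]; apply: sub_sigma_algebra;
  [left; left; exact: sub|left; right; exact: sub|right].
Qed.

Lemma filtration_increment Z r u : r <= u ->
  rv_measurable (filtration P Z u) (increment (re_part Z) (r, u)) /\
  rv_measurable (filtration P Z u) (increment (im_part Z) (r, u)).
Proof.
move=> ru; split=> B mB; apply: sub_sigma_algebra.
- by left; left; exists (r, u), B; split=> //; split=> /=.
- by left; right; exists (r, u), B; split=> //; split=> /=.
Qed.

Lemma filtration_null Z u N : measurable N -> P N = 0%E -> filtration P Z u N.
Proof. by move=> mN N0; apply: sub_sigma_algebra; right. Qed.

Lemma independentC (F G : set_system T) : independent P F G -> independent P G F.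
Proof. by move=> h A B hA hB; rewrite setIC h// muleC. Qed.

Section Moments.
Variables (X Y : R -> T -> R) (r u : R).
Hypotheses (hX : two_sided_BM P X) (hY : two_sided_BM P Y).
Hypothesis XY : independent P <<s preimages setT X >> <<s preimages setT Y >>.
Hypothesis ru : r < u.
Local Notation dX := (increment X (r, u)).

Let s := Num.sqrt (u - r).
Let s0 : 0 < s. Proof. by rewrite sqrtr_gt0 subr_gt0. Qed.
Let s2 : s ^+ 2 = u - r. Proof. by rewrite sqr_sqrtr// subr_ge0 ltW. Qed.
Let mdX : measurable_fun setT dX. Proof. exact: increment_measurable. Qed.
Let law B : measurable B -> P (dX @^-1` B) = normal_prob 0 s B.
Proof. by move=> mB; exact: BM_normal. Qed.

Lemma increment_L2 : L2 P dX.
Proof. exact: (normal_L2 s0 mdX law). Qed.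

Lemma increment_mean : Ex P dX = 0.
Proof. exact: (normal_mean s0 mdX law). Qed.

Lemma increment_variance : Ex P (fun w => dX w ^+ 2) = u - r.
Proof. by rewrite (normal_variance s0 mdX law) s2. Qed.

Lemma increment_pow4 : L1 P (fun w => dX w ^+ 4) /\
  Ex P (fun w => dX w ^+ 4) <= 128 * (u - r) ^+ 2.
Proof. by have := normal_pow4 s0 mdX law; rewrite -s2 -exprM. Qed.

Lemma increment_indep (xi : T -> R) : rv_measurable (history X Y r) xi -> indep_rv P xi dX.
Proof. by move=> hxi A B mA mB; apply: (increment_history hX hY XY ru) => //; exact: hxi. Qed.

Lemma Ex_mul_increment xi : rv_measurable (history X Y r) xi -> L1 P xi ->
  L1 P (fun w => xi w * dX w) /\ Ex P (fun w => xi w * dX w) = 0.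
Proof.
move=> hxi ixi; have [h1 h2] := indep_ExM (increment_indep hxi) ixi (L2_L1 increment_L2).
by split=> //; rewrite h2 increment_mean mulr0.
Qed.

Lemma Ex_mul_increment_sqr xi : rv_measurable (history X Y r) xi -> L1 P xi ->
  L1 P (fun w => xi w * dX w ^+ 2) /\ Ex P (fun w => xi w * dX w ^+ 2) = (u - r) * Ex P xi.
Proof.
move=> hxi ixi; have [_ iX2] := increment_L2.
have m2 : measurable_fun setT (fun x : R => x ^+ 2) by exact: measurable_funX.
have [h1 h2] := indep_ExM (indep_rv_comp (f := id) (@measurable_id _ _ _) m2
   (increment_indep hxi)) ixi iX2.
by split=> //; rewrite h2 increment_variance mulrC.
Qed.

End Moments.

End BrownianIncrements.

(** * Elementary integrals and their isometry *)

Section ItoIntegral.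
Context {R : realType} {d : measure_display} {T : measurableType d}.
Variable P : probability T R.
Local Notation leb := (@lebesgue_measure R).

Lemma Re_add (x y : R[i]) : complex.Re (x + y) = complex.Re x + complex.Re y.
Proof. by case: x; case: y. Qed.

Lemma Re_sub (x y : R[i]) : complex.Re (x - y) = complex.Re x - complex.Re y.
Proof. by case: x; case: y. Qed.

Lemma Im_add (x y : R[i]) : complex.Im (x + y) = complex.Im x + complex.Im y.
Proof. by case: x; case: y. Qed.

Lemma Im_sub (x y : R[i]) : complex.Im (x - y) = complex.Im x - complex.Im y.
Proof. by case: x; case: y. Qed.

Lemma Re_mul (x y : R[i]) :
  complex.Re (x * y) = complex.Re x * complex.Re y - complex.Im x * complex.Im y.
Proof. by case: x; case: y. Qed.

Lemma Im_mul (x y : R[i]) :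
  complex.Im (x * y) = complex.Re x * complex.Im y + complex.Im x * complex.Re y.
Proof. by case: x; case: y. Qed.

Lemma Re_sum (I : Type) (s : seq I) (F : I -> R[i]) :
  complex.Re (\sum_(i <- s) F i) = \sum_(i <- s) complex.Re (F i).
Proof. by elim: s => [|i s IH]; rewrite ?big_nil// !big_cons Re_add IH. Qed.

Lemma Im_sum (I : Type) (s : seq I) (F : I -> R[i]) :
  complex.Im (\sum_(i <- s) F i) = \sum_(i <- s) complex.Im (F i).
Proof. by elim: s => [|i s IH]; rewrite ?big_nil// !big_cons Im_add IH. Qed.

Lemma cabs2_ge0 (z : R[i]) : 0 <= cabs2 z.
Proof. by rewrite addr_ge0 ?sqr_ge0. Qed.

Lemma cabs2_sub_le (x y z : R[i]) : cabs2 (x - y) <= 2 * (cabs2 (z - x) + cabs2 (z - y)).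
Proof.
rewrite /cabs2 !Re_sub !Im_sub.
set a := complex.Re x; set b := complex.Im x; set a' := complex.Re y.
set b' := complex.Im y; set p := complex.Re z; set q := complex.Im z.
have := sqr_ge0 ((p - a) + (p - a')); have := sqr_ge0 ((q - b) + (q - b')).
rewrite !expr2; lra.
Qed.

(** The integral of a nonnegative function is a supremum over the simple functions below it, so
    larger functions have larger integrals. The form for arbitrary functions matters: the inner
    integral in [is_ito_integral] is not known to be measurable in [w]. *)
Lemma ge0_integral_mono (f g : T -> \bar R) : (forall w, 0 <= f w)%E ->
  (forall w, f w <= g w)%E -> (\int[P]_w f w <= \int[P]_w g w)%E.
Proof.
move=> f0 fg; have g0 w : (0 <= g w)%E by exact: le_trans (f0 w) (fg w).
rewrite !ge0_integralTE//; apply: ereal_sup_le => _ [h hf <-].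
by exists h => // w; exact: le_trans (hf w) (fg w).
Qed.

(** The positive part of [f], cut off on [N], is measurable, has a mean at least that of [f], and
    lies below [g] everywhere. *)
Lemma Ex_le_ge0_integral (f : T -> R) (g : T -> \bar R) N : L1 P f -> measurable N ->
  P N = 0%E -> (forall w, 0 <= g w)%E -> (forall w, ~ N w -> ((f w)%:E <= g w)%E) ->
  ((Ex P f)%:E <= \int[P]_w g w)%E.
Proof.
move=> iF mN N0 g0 fg.
have mf := L1_measurable iF.
pose h w := Num.max (f w) 0 * (~~ (w \in N))%:R.
have mh : measurable_fun setT h.
  apply: measurable_funM; first exact: measurable_maxr.
  rewrite (_ : (fun _ => _) = \1_(~` N)); first by apply: measurable_indic; exact: measurableC.
  by apply/funext => w; rewrite indicE in_setC.
have h0 w : 0 <= h w by rewrite mulr_ge0// le_max lexx orbT.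
have ih : L1 P h.
  apply: L1_le (L1_norm iF) => // w; rewrite ger0_norm// /h.
  have := ler_norm (f w); have := normr_ge0 (f w).
  by case: (w \in N) => /=; rewrite ?mulr0 ?mulr1 ?ge_max => // -> ->.
apply: (@le_trans _ _ (\int[P]_w (h w)%:E)%E).
  rewrite Ex_EFin// lee_fin; apply: Ex_le_ae => //.
  exists N; split=> // w /= fhw; apply: contrapT => Nw; apply: fhw.
  by rewrite /h memNset//= mulr1 le_max lexx.
apply: ge0_integral_mono => w; first by rewrite lee_fin.
rewrite /h; case: (boolP (w \in N)) => wN /=; first by rewrite mulr0.
rewrite mulr1 EFin_max ge_max g0 andbT; apply: fg.
by move=> Nw; move: wN; rewrite mem_set.
Qed.

Variable Z : R -> T -> R[i].
Hypothesis hZ : two_sided_complex_BM P Z.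
Local Notation X := (re_part Z).
Local Notation Y := (im_part Z).
Local Notation F := (filtration P Z).

Lemma filtration_measurable u : F u `<=` measurable.
Proof.
apply: subset_trans (@filtration_history_re _ _ _ P Z u) _.
exact: (history_measurable (cBM_re hZ) (cBM_im hZ)).
Qed.

Lemma adapted_measurable u (W : T -> R) : rv_measurable (F u) W -> measurable_fun setT W.
Proof. exact/rv_measurable_fun/filtration_measurable. Qed.

Section OneStep.
Variables (r u : R).
Hypothesis ru : r < u.
Local Notation dX := (increment X (r, u)).
Local Notation dY := (increment Y (r, u)).

Lemma Ex_mul_dX xi : rv_measurable (F r) xi -> L1 P xi ->
  L1 P (fun w => xi w * dX w) /\ Ex P (fun w => xi w * dX w) = 0.
Proof.
move=> /(rv_measurable_sub (@filtration_history_re _ _ _ P Z r)).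
exact: (Ex_mul_increment (cBM_re hZ) (cBM_im hZ) (cBM_independent hZ)).
Qed.

Lemma Ex_mul_dY xi : rv_measurable (F r) xi -> L1 P xi ->
  L1 P (fun w => xi w * dY w) /\ Ex P (fun w => xi w * dY w) = 0.
Proof.
move=> /(rv_measurable_sub (@filtration_history_im _ _ _ P Z r)).
exact: (Ex_mul_increment (cBM_im hZ) (cBM_re hZ) (independentC (cBM_independent hZ))).
Qed.

Lemma Ex_mul_dX2 xi : rv_measurable (F r) xi -> L1 P xi ->
  L1 P (fun w => xi w * dX w ^+ 2) /\ Ex P (fun w => xi w * dX w ^+ 2) = (u - r) * Ex P xi.
Proof.
move=> /(rv_measurable_sub (@filtration_history_re _ _ _ P Z r)).
exact: (Ex_mul_increment_sqr (cBM_re hZ) (cBM_im hZ) (cBM_independent hZ)).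
Qed.

Lemma Ex_mul_dY2 xi : rv_measurable (F r) xi -> L1 P xi ->
  L1 P (fun w => xi w * dY w ^+ 2) /\ Ex P (fun w => xi w * dY w ^+ 2) = (u - r) * Ex P xi.
Proof.
move=> /(rv_measurable_sub (@filtration_history_im _ _ _ P Z r)).
exact: (Ex_mul_increment_sqr (cBM_im hZ) (cBM_re hZ) (independentC (cBM_independent hZ))).
Qed.

(** Relative to the history of [X], which contains all of [Y], the product [xi * dY] is known, so
    averaging [dX] alone gives 0. *)
Lemma Ex_mul_dXdY xi : rv_measurable (F r) xi -> L1 P xi ->
  L1 P (fun w => xi w * (dX w * dY w)) /\ Ex P (fun w => xi w * (dX w * dY w)) = 0.
Proof.
move=> hxi ixi; have [i1 _] := Ex_mul_dY hxi ixi.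
have h1 : rv_measurable (history P X Y r) (fun w => xi w * dY w).
  apply: rvM; last exact: history_other.
  exact: (rv_measurable_sub (@filtration_history_re _ _ _ P Z r)) hxi.
have [i2 e2] := Ex_mul_increment (cBM_re hZ) (cBM_im hZ) (cBM_independent hZ) ru h1 i1.
have E w : xi w * dY w * dX w = xi w * (dX w * dY w) by ring.
by split; [exact: eq_L1 E i2|rewrite -(eq_Ex P E)].
Qed.

Lemma dX_L2 : L2 P dX. Proof. exact: increment_L2 (cBM_re hZ) ru. Qed.
Lemma dY_L2 : L2 P dY. Proof. exact: increment_L2 (cBM_im hZ) ru. Qed.

(** Isometry over one step: the squares contribute [u - r] each and the cross term has mean 0. *)
Lemma one_step a b : rv_measurable (F r) a -> rv_measurable (F r) b ->
  L2 P a -> L2 P b ->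
  L2 P (fun w => a w * dX w - b w * dY w) /\
  Ex P (fun w => (a w * dX w - b w * dY w) ^+ 2) =
    (u - r) * Ex P (fun w => a w ^+ 2 + b w ^+ 2).
Proof.
move=> ha hb La Lb.
have ma := L2_measurable La; have mb := L2_measurable Lb.
have mX := L2_measurable dX_L2; have mY := L2_measurable dY_L2.
have [ia2 ea2] := Ex_mul_dX2 (rvM ha ha) (L2_L1M La La).
have [ib2 eb2] := Ex_mul_dY2 (rvM hb hb) (L2_L1M Lb Lb).
have [iab eab] := Ex_mul_dXdY (rvM ha hb) (L2_L1M La Lb).
have E w : a w * a w * dX w ^+ 2 + b w * b w * dY w ^+ 2 - 2 * (a w * b w * (dX w * dY w))
    = (a w * dX w - b w * dY w) ^+ 2 by ring.
have i := L1B (L1D ia2 ib2) (L1Z 2 iab).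
split; first by split; [by apply: measurable_funB; exact: measurable_funM|exact: eq_L1 E i].
rewrite -(eq_Ex P E) ExB; [|exact: L1D|exact: L1Z].
rewrite ExD// ExZ// ea2 eb2 eab mulr0 subr0 -mulrDr -ExD; [|exact: L2_L1M|exact: L2_L1M].
by congr (_ * _); apply: eq_Ex => w; rewrite !expr2.
Qed.

End OneStep.

Section MartingaleSum.
Variables (t : nat -> R) (N : nat) (a b : nat -> T -> R).
Hypothesis ht : forall j, (j < N)%N -> t j < t j.+1.
Hypothesis ha : forall j, (j < N)%N -> rv_measurable (F (t j)) (a j) /\ L2 P (a j).
Hypothesis hb : forall j, (j < N)%N -> rv_measurable (F (t j)) (b j) /\ L2 P (b j).

(** Real part of the elementary integral of the step process with complex values [a j + i * b j]. *)
Definition mart_sum (k : nat) (w : T) : R := \sum_(j < k)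
  (a j w * increment X (t j, t j.+1) w - b j w * increment Y (t j, t j.+1) w).

Let t_mono k : (k <= N)%N -> t 0%N <= t k.
Proof.
elim: k => [//|k IH] kN; apply: le_trans (IH (ltnW kN)) _; exact/ltW/ht.
Qed.

(** Induction on the number of steps: each new term is orthogonal to every square integrable
    variable known at its left endpoint, in particular to the previous sum and to [xi]. *)
Lemma mart_sumP k : (k <= N)%N ->
  [/\ rv_measurable (F (t k)) (mart_sum k), L2 P (mart_sum k),
   (forall xi (C : R), rv_measurable (F (t 0%N)) xi -> (forall w, `|xi w| <= C) ->
      Ex P (fun w => xi w * mart_sum k w) = 0) &
   Ex P (fun w => mart_sum k w ^+ 2) =
     \sum_(j < k) (t j.+1 - t j) * Ex P (fun w => a j w ^+ 2 + b j w ^+ 2)].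
Proof.
elim: k => [|k IH] kN.
  have E : mart_sum 0 = fun=> 0 by apply/funext => w; rewrite /mart_sum big_ord0.
  rewrite E; split; [exact: rv_cst|exact: L2_cst| |].
  - by move=> xi C _ _; rewrite -[RHS](Ex_cst P); apply: eq_Ex => w; rewrite mulr0.
  - by rewrite big_ord0 -[RHS](Ex_cst P); apply: eq_Ex => w; rewrite expr0n.
have [hS LS oS eS] := IH (ltnW kN).
pose D w := a k w * increment X (t k, t k.+1) w - b k w * increment Y (t k, t k.+1) w.
have E : mart_sum k.+1 = fun w => mart_sum k w + D w.
  by apply/funext => w; rewrite /mart_sum big_ord_recr.
have [hak Lak] := ha kN; have [hbk Lbk] := hb kN.
have tk := ht kN.
have [LD eD] := one_step tk hak hbk Lak Lbk.
have sub := @filtration_mono _ _ _ P Z _ _ (ltW tk).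
have orth xi : rv_measurable (F (t k)) xi -> L2 P xi ->
    L1 P (fun w => xi w * D w) /\ Ex P (fun w => xi w * D w) = 0.
  move=> hxi Lxi.
  have [i1 e1] := Ex_mul_dX tk (rvM hxi hak) (L2_L1M Lxi Lak).
  have [i2 e2] := Ex_mul_dY tk (rvM hxi hbk) (L2_L1M Lxi Lbk).
  have E' w : xi w * a k w * increment X (t k, t k.+1) w -
     xi w * b k w * increment Y (t k, t k.+1) w = xi w * D w by rewrite /D; ring.
  by split; [exact: eq_L1 E' (L1B i1 i2)|rewrite -(eq_Ex P E') ExB// e1 e2 subr0].
have [inX inY] := @filtration_increment _ _ _ P Z _ _ (ltW tk).
rewrite E; split.
- apply: rvD; first exact: rv_measurable_sub sub hS.
  by apply: rvB; apply: rvM => //; exact: rv_measurable_sub sub _.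
- exact: L2D.
- move=> xi C hxi bxi.
  have hxi' := rv_measurable_sub (@filtration_mono _ _ _ P Z _ _ (t_mono (ltnW kN))) hxi.
  have mxi := adapted_measurable hxi.
  have [i1 e1] := orth xi hxi' (L2_bounded P mxi bxi).
  have E' w : xi w * mart_sum k w + xi w * D w = xi w * (mart_sum k w + D w) by ring.
  rewrite -(eq_Ex P E') ExD//; first by rewrite e1 (oS _ C)// addr0.
  exact/(L1M_bounded mxi bxi)/L2_L1.
- have [i1 e1] := orth _ hS LS.
  have E' w : mart_sum k w ^+ 2 + D w ^+ 2 + 2 * (mart_sum k w * D w) =
     (mart_sum k w + D w) ^+ 2 by ring.
  have [_ iS] := LS; have [_ iD] := LD.
  rewrite -(eq_Ex P E') ExD; [|exact: L1D|exact: L1Z].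
  by rewrite ExD// ExZ// e1 mulr0 addr0 eS eD big_ord_recr.
Qed.

End MartingaleSum.
End ItoIntegral.

(** * Freezing the integrand of an Ito integral *)

Section ItoEstimate.
Context {R : realType} {d : measure_display} {T : measurableType d}.
Variable P : probability T R.
Local Notation leb := (@lebesgue_measure R).

Lemma cvg0_lt (f : nat -> \bar R) (e : R) : f m @[m --> \oo] --> 0%E -> 0 < e ->
  \forall m \near \oo, (f m < e%:E)%E.
Proof.
move=> h e0; have : nbhs 0%E [set x | (x < e%:E)%E] by apply: open_ereal_lt'; rewrite lte_fin.
by move/h.
Qed.

Lemma measurable_cabs2 (f : R -> R[i]) :
  measurable_fun setT (fun x => complex.Re (f x)) ->
  measurable_fun setT (fun x => complex.Im (f x)) ->
  measurable_fun setT (fun x => cabs2 (f x)).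
Proof. by move=> m1 m2; apply: measurable_funD; exact: measurable_funX. Qed.

Section Pathwise.
Variables (t : nat -> R) (N : nat) (v : nat -> R[i]) (c : R[i]) (h : R -> R[i]).
Hypothesis ht : forall j, (j < N)%N -> t j < t j.+1.
Hypothesis mRe : measurable_fun setT (fun x => complex.Re (h x)).
Hypothesis mIm : measurable_fun setT (fun x => complex.Im (h x)).

Let S (x : R) : R[i] := \sum_(j < N) (if t j <= x < t j.+1 then v j else 0).

Let t_le i j : (i <= j)%N -> (j <= N)%N -> t i <= t j.
Proof.
elim: j => [|j IH]; first by rewrite leqn0 => /eqP ->.
rewrite leq_eqVlt => /predU1P[->//|ij] jN.
apply: le_trans (IH ij (ltnW jN)) _; exact/ltW/ht.
Qed.

Let S_eq k x : (k < N)%N -> t k <= x < t k.+1 -> S x = v k.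
Proof.
move=> kN xk; rewrite /S (bigD1 (Ordinal kN))//= xk big1 ?addr0// => j jk.
case: ifP => // /andP[j1 j2]; exfalso; case/andP: xk => k1 k2.
have [jk'|jk'|jk'] := ltngtP j k.
- by have := t_le jk' (ltnW kN); lra.
- by have := t_le jk' (ltnW (ltn_ord j)); lra.
- by move/eqP: jk; apply; apply: val_inj.
Qed.

Let mS_part (f : R[i] -> R) : f 0 = 0 -> (forall s : seq 'I_N, forall F : 'I_N -> R[i],
    f (\sum_(i <- s) F i) = \sum_(i <- s) f (F i)) ->
  measurable_fun setT (fun x => f (S x)).
Proof.
move=> f0 fS; rewrite (_ : (fun _ => _) = fun x => \sum_(j < N)
    (if t j <= x < t j.+1 then f (v j) else 0)); last first.
  by apply/funext => x; rewrite /S fS; apply: eq_bigr => j _; case: ifP.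
apply: measurable_sum => j; apply: measurable_fun_ifT => //.
apply: (measurable_fun_bool true).
rewrite setTI (_ : _ @^-1` _ = `[t j, t j.+1[%classic); first exact: measurable_itv.
by apply/seteqP; split=> x; rewrite /= in_itv.
Qed.

Let G (x : R) := cabs2 (h x - S x) + cabs2 (h x - c).

Let mG1 : measurable_fun setT (fun x => cabs2 (h x - S x)).
Proof.
apply: measurable_cabs2.
- under eq_fun do rewrite Re_sub.
  by apply: measurable_funB => //; apply: (mS_part (f := @complex.Re R)) => // *; exact: Re_sum.
- under eq_fun do rewrite Im_sub.
  by apply: measurable_funB => //; apply: (mS_part (f := @complex.Im R)) => // *; exact: Im_sum.
Qed.

Let mG2 : measurable_fun setT (fun x => cabs2 (h x - c)).
Proof.
apply: measurable_cabs2.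
- by under eq_fun do rewrite Re_sub; exact: measurable_funB.
- by under eq_fun do rewrite Im_sub; exact: measurable_funB.
Qed.

(** The sum on the left is the time integral of the squared distance between the step function and
    the constant [c]. Interposing [h] through [cabs2_sub_le] gives the factor 2. *)
Lemma step_distance_le :
  ((\sum_(j < N) (t j.+1 - t j) * cabs2 (v j - c))%:E <=
   2%:E * (\int[leb]_(x in `[t 0%N, t N]) (cabs2 (h x - S x))%:E +
           \int[leb]_(x in `[t 0%N, t N]) (cabs2 (h x - c))%:E))%E.
Proof.
have mG : measurable_fun setT (fun x => (2 * G x)%:E).
  by apply/measurable_EFinP; apply: measurable_funM => //; exact: measurable_funD.
have G0 x : (0 <= (2 * G x)%:E)%E.
  by rewrite lee_fin mulr_ge0// addr_ge0// cabs2_ge0.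
have step k : (k <= N)%N -> ((\sum_(j < k) (t j.+1 - t j) * cabs2 (v j - c))%:E <=
    \int[leb]_(x in `[t 0%N, t k[) (2 * G x)%:E)%E.
  elim: k => [|k IH] kN.
    by rewrite big_ord0; apply: integral_ge0 => x _; exact: G0.
  rewrite big_ord_recr/= EFinD.
  have E : `[t 0%N, t k.+1[%classic = `[t 0%N, t k[ `|` `[t k, t k.+1[ :> set R.
    rewrite -itv_bndbnd_setU// bnd_simp; [exact: t_le (leq0n k) (ltnW kN)|exact/ltW/ht].
  rewrite E ge0_integral_setU//=; last 2 first.
  - by rewrite -E; apply: measurable_funS mG.
  - apply/disj_setPS => x [] /=; rewrite !in_itv/= => /andP[_ x1] /andP[x2 _].
    by move: x1; rewrite ltNge x2.
  apply: leeD; first exact: IH (ltnW kN).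
  apply: (@le_trans _ _ (\int[leb]_(x in `[t k, t k.+1[) (cabs2 (v k - c))%:E)%E).
    by rewrite integral_cst//= lebesgue_measure_itv/= lte_fin ht// -EFinB -EFinM mulrC.
  apply: ge0_le_integral => //.
  - by move=> x _; rewrite lee_fin cabs2_ge0.
  - exact: measurable_funS mG.
  - move=> x /=; rewrite in_itv/= => xk.
    by rewrite lee_fin -(S_eq kN xk) cabs2_sub_le.
apply: le_trans (step N (leqnn N)) _.
apply: (@le_trans _ _ (\int[leb]_(x in `[t 0%N, t N]) (2 * G x)%:E)%E).
  apply: ge0_subset_integral => //; first exact: measurable_funS mG.
  by apply: subset_itvl; rewrite bnd_simp.
under eq_integral do rewrite EFinM.
rewrite ge0_integralZl//=; last 2 first.
- by apply/measurable_EFinP; apply: (measurable_funS measurableT) => //; exact: measurable_funD.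
- by move=> x _; rewrite lee_fin addr_ge0// cabs2_ge0.
rewrite lee_pmul2l//.
under eq_integral do rewrite EFinD.
rewrite ge0_integralD//=.
- by move=> x _; rewrite lee_fin cabs2_ge0.
- by apply/measurable_EFinP; exact: (measurable_funS measurableT).
- by move=> x _; rewrite lee_fin cabs2_ge0.
- by apply/measurable_EFinP; exact: (measurable_funS measurableT).
Qed.

End Pathwise.

Variable Z : R -> T -> R[i].
Hypothesis hZ : two_sided_complex_BM P Z.
Local Notation X := (re_part Z).
Local Notation Y := (im_part Z).
Local Notation F := (filtration P Z).

Lemma L2_of_cabs2 (f : T -> R[i]) :
  measurable_fun setT (fun w => complex.Re (f w)) ->
  measurable_fun setT (fun w => complex.Im (f w)) ->
  (\int[P]_w (cabs2 (f w))%:E < +oo)%E ->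
  [/\ L1 P (fun w => cabs2 (f w)), L2 P (fun w => complex.Re (f w)) &
      L2 P (fun w => complex.Im (f w))].
Proof.
move=> m1 m2 fin.
have i : L1 P (fun w => cabs2 (f w)).
  apply/integrableP; split.
    by apply/measurable_EFinP; apply: measurable_funD; exact: measurable_funX.
  by under eq_integral => w _ do rewrite /= ger0_norm ?cabs2_ge0//.
split=> //; split=> //; apply: L1_le i => //.
- exact: measurable_funX.
- by move=> w; rewrite ger0_norm ?sqr_ge0// /cabs2 lerDl sqr_ge0.
- exact: measurable_funX.
- by move=> w; rewrite ger0_norm ?sqr_ge0// /cabs2 lerDr sqr_ge0.
Qed.

Section Limit.
Variables (H : R -> T -> R[i]) (r u : R) (J : T -> R[i]).
Hypothesis ru : r < u.
Hypothesis hJ : is_ito_integral P Z H r u J.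
Variables (c : T -> R[i]) (K : R) (kappa : T -> R) (N : set T).
Hypothesis hc : crv_measurable (F r) c.
Hypothesis cK : forall w, `|complex.Re (c w)| <= K /\ `|complex.Im (c w)| <= K.
Hypotheses (mN : measurable N) (N0 : P N = 0%E).
Hypothesis mH : forall w, ~ N w -> measurable_fun setT (fun x => complex.Re (H x w)) /\
  measurable_fun setT (fun x => complex.Im (H x w)).
Hypothesis ikappa : L1 P kappa.
Hypothesis hkappa : forall w, ~ N w ->
  (\int[leb]_(x in `[r, u]) (cabs2 (H x w - c w))%:E <= (kappa w)%:E)%E.

(** What remains of the real part of the Ito integral after its integrand has been frozen at the
    value [c] known at time [r]. *)
Let D (w : T) : R := complex.Re (J w) -
  (complex.Re (c w) * increment X (r, u) w - complex.Im (c w) * increment Y (r, u) w).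

(** [V] is the error of replacing [J] by an elementary integral, and [M] is the elementary integral
    of the step values minus [c]. The bound on [M] is the isometry combined with
    [step_distance_le]. *)
Let decomposition (e : R) : 0 < e -> exists V M : T -> R,
  [/\ D =1 (fun w => V w + M w), L2 P V /\ L2 P M, Ex P (fun w => V w ^+ 2) <= e,
    Ex P (fun w => M w ^+ 2) <= 2 * Ex P kappa + 2 * e &
    forall xi (C : R), rv_measurable (F r) xi -> (forall w, `|xi w| <= C) ->
      Ex P (fun w => xi w * M w) = 0].
Proof.
move=> e0; case: hJ => -[mJ1 mJ2] [phi [el A0 B0]].
have [m [Am Bm]] : exists m,
  (\int[P]_w \int[leb]_(x in `[r, u]) (cabs2 (H x w - step_eval (phi m) x w))%:E < e%:E)%E /\
  (\int[P]_w (cabs2 (J w - step_integral Z (phi m) w))%:E < e%:E)%E.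
  exact: (filter_ex (filterI (cvg0_lt A0 e0) (cvg0_lt B0 e0))).
have {el A0 B0} el := el m.
set f := phi m in Am Bm el.
pose t := step_time f; pose n := step_num f.
pose a j w := complex.Re (step_val f j w); pose b j w := complex.Im (step_val f j w).
pose c1 w := complex.Re (c w); pose c2 w := complex.Im (c w).
have tE0 : t 0%N = r := elem_start el.
have tEn : t n = u := elem_end el.
have ht : forall j, (j < n)%N -> t j < t j.+1 := @elem_incr _ _ _ _ _ _ _ _ el.
have t_le j : (j <= n)%N -> r <= t j.
  elim: j => [_|j IH jn]; first by rewrite tE0.
  exact: le_trans (IH (ltnW jn)) (ltW (ht _ jn)).
have mc1 := adapted_measurable hZ hc.1; have mc2 := adapted_measurable hZ hc.2.
have Lc1 : L2 P c1 by apply: (L2_bounded P mc1) => w; exact: (cK w).1.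
have Lc2 : L2 P c2 by apply: (L2_bounded P mc2) => w; exact: (cK w).2.
have hab j : (j < n)%N -> (rv_measurable (F (t j)) (a j) /\ L2 P (a j)) /\
    (rv_measurable (F (t j)) (b j) /\ L2 P (b j)).
  move=> jn; have [h1 h2] := elem_adapted el jn.
  have [_ l1 l2] := L2_of_cabs2 (adapted_measurable hZ h1) (adapted_measurable hZ h2)
     (elem_L2 el jn).
  by [].
pose a' j w := a j w - c1 w; pose b' j w := b j w - c2 w.
have sub j : (j <= n)%N -> F r `<=` F (t j) by move=> jn; apply: filtration_mono; exact: t_le.
have ha j : (j < n)%N -> rv_measurable (F (t j)) (a' j) /\ L2 P (a' j).
  move=> jn; have [[h1 h2] _] := hab _ jn; split; last exact: L2B.
  by apply: rvB => //; exact: rv_measurable_sub (sub _ (ltnW jn)) hc.1.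
have hb j : (j < n)%N -> rv_measurable (F (t j)) (b' j) /\ L2 P (b' j).
  move=> jn; have [_ [h1 h2]] := hab _ jn; split; last exact: L2B.
  by apply: rvB => //; exact: rv_measurable_sub (sub _ (ltnW jn)) hc.2.
have [hM LM oM eM] := mart_sumP hZ ht ha hb (leqnn n).
set M := mart_sum Z t a' b' n in hM LM oM eM.
have tele (W : R -> T -> R) w : \sum_(j < n) increment W (t j, t j.+1) w = increment W (r, u) w.
  by rewrite -(big_mkord xpredT (fun j => W (t j.+1) w - W (t j) w)) telescope_sumr// tE0 tEn.
have ME w : complex.Re (step_integral Z f w) =
   M w + (c1 w * increment X (r, u) w - c2 w * increment Y (r, u) w).
  rewrite /step_integral Re_sum -!tele !mulr_sumr /M /mart_sum -sumrB -big_split/=.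
  apply: eq_bigr => j _; rewrite Re_mul Re_sub Im_sub /a' /b' /a /b /increment /re_part /im_part /= -/t.
  ring.
have mI1 : measurable_fun setT (fun w => complex.Re (step_integral Z f w)).
  rewrite (_ : (fun _ => _) = fun w => M w + (c1 w * increment X (r, u) w - c2 w * increment Y (r, u) w)).
    apply: measurable_funD; first exact: L2_measurable LM.
    by apply: measurable_funB; apply: measurable_funM => //; apply: increment_measurable;
      [exact: cBM_re hZ|exact: cBM_im hZ].
  by apply/funext.
have mI2 : measurable_fun setT (fun w => complex.Im (step_integral Z f w)).
  rewrite (_ : (fun _ => _) = fun w => \sum_(j < n) (a j w * increment Y (t j, t j.+1) w
      + b j w * increment X (t j, t j.+1) w)).
    apply: measurable_sum => j; have [[_ l1] [_ l2]] := hab _ (ltn_ord j).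
    have iX := increment_measurable (t j, t j.+1) (cBM_re hZ).
    have iY := increment_measurable (t j, t j.+1) (cBM_im hZ).
    by apply: measurable_funD; apply: measurable_funM => //;
      [exact: L2_measurable l1|exact: L2_measurable l2].
  apply/funext => w; rewrite /step_integral Im_sum; apply: eq_bigr => j _.
  by rewrite Im_mul Re_sub Im_sub.
have mJ1' := rv_measurable_fun (@subset_refl _ _) mJ1.
have mJ2' := rv_measurable_fun (@subset_refl _ _) mJ2.
pose V w := complex.Re (J w - step_integral Z f w).
have [iV LV _] : [/\ L1 P (fun w => cabs2 (J w - step_integral Z f w)), L2 P V &
    L2 P (fun w => complex.Im (J w - step_integral Z f w))].
  apply: L2_of_cabs2; last by rewrite (lt_trans Bm) ?ltry.
    by under eq_fun do rewrite Re_sub; exact: measurable_funB.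
  by under eq_fun do rewrite Im_sub; exact: measurable_funB.
exists V, M; split=> //.
- by move=> w; rewrite /V /D Re_sub ME -/(c1 w) -/(c2 w); ring.
- apply: (@le_trans _ _ (Ex P (fun w => cabs2 (J w - step_integral Z f w)))).
    by apply: Ex_le => //; [exact: LV.2|move=> w; rewrite /cabs2 lerDl sqr_ge0].
  by rewrite -lee_fin -Ex_EFin// ltW.
- pose Q w := \sum_(j < n) (t j.+1 - t j) * (a' j w ^+ 2 + b' j w ^+ 2).
  have iQj (j : 'I_n) : L1 P (fun w => (t j.+1 - t j) * (a' j w ^+ 2 + b' j w ^+ 2)).
    by apply: L1Z; apply: L1D; [exact: (ha _ (ltn_ord j)).2.2|exact: (hb _ (ltn_ord j)).2.2].
  have iQ : L1 P Q by exact: L1_sum.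
  have EQ : Ex P (fun w => M w ^+ 2) = Ex P Q.
    rewrite eM Ex_sum//; apply: eq_bigr => j _; rewrite ExZ//.
    by apply: L1D; [exact: (ha _ (ltn_ord j)).2.2|exact: (hb _ (ltn_ord j)).2.2].
  (* Pathwise, half of [Q] is at most the approximation error plus [kappa]. The approximation error
     may fail to be measurable in [w], so the comparison of means goes through
     [Ex_le_ge0_integral]. *)
  have : ((Ex P (fun w => 2^-1 * Q w - kappa w))%:E <=
      \int[P]_w \int[leb]_(x in `[r, u]) (cabs2 (H x w - step_eval f x w))%:E)%E.
    apply: (Ex_le_ge0_integral _ mN N0) => //.
    - by apply: L1B => //; exact: L1Z.
    - by move=> w; apply: integral_ge0 => x _; rewrite lee_fin cabs2_ge0.
    move=> w Nw; have [m1 m2] := mH Nw.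
    have := step_distance_le (fun j => step_val f j w) (c w) ht m1 m2.
    have := hkappa Nw; rewrite tE0 tEn.
    rewrite (_ : \sum_(j < n) _ = Q w); last first.
      by apply: eq_bigr => j _; rewrite /cabs2 Re_sub Im_sub.
    rewrite -[X in (2%:E * (X + _))%E]/(\int[leb]_(x in `[r, u]) (cabs2 (H x w - step_eval f x w))%:E)%E.
    have := @integral_ge0 _ _ _ leb `[r, u]%classic _
      (fun x _ => lee_tofin (cabs2_ge0 (H x w - step_eval f x w))).
    have := @integral_ge0 _ _ _ leb `[r, u]%classic _
      (fun x _ => lee_tofin (cabs2_ge0 (H x w - c w))).
    case: (\int[leb]_(x in `[r, u]) (cabs2 (H x w - c w))%:E)%E => [p||]//.
    case: (\int[leb]_(x in `[r, u]) (cabs2 (H x w - step_eval f x w))%:E)%E => [q||]//.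
      rewrite -EFinD -EFinM !lee_fin; lra.
    by move=> *; rewrite leey.
  rewrite ExB//; last exact: L1Z.
  rewrite ExZ// => /le_lt_trans /(_ Am); rewrite lte_fin EQ; lra.
- by move=> xi C hxi; apply: oM; rewrite tE0.
Qed.

(** Let the approximation error in [decomposition] tend to 0. The constant is 4 rather than 1
    because the triangle inequality for squares is used twice. *)
Lemma ito_estimate :
  [/\ L2 P D, (forall xi (C : R), rv_measurable (F r) xi -> (forall w, `|xi w| <= C) ->
      Ex P (fun w => xi w * D w) = 0) &
    Ex P (fun w => D w ^+ 2) <= 4 * Ex P kappa].
Proof.
split.
- have [V [M [E [LV LM] _ _ _]]] := decomposition ltr01.
  by apply: eq_L2 (L2D LV LM) => w; rewrite E.
- move=> xi C hxi xiC; apply/eqP; rewrite -normr_le0.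
  apply/ler_addgt0Pl => e e0; rewrite addr0.
  have mxi := adapted_measurable hZ hxi.
  have C0 : 0 <= C.
    by apply: le_trans (xiC point); exact: normr_ge0.
  (* With the mean of [V ^+ 2] at most [g ^+ 2], Young's inequality bounds the mean of [|V|] by [g],
     and [C * g <= e]. *)
  pose g := e / (C + 1); have g0 : 0 < g by rewrite divr_gt0//; lra.
  have [V [M [E [LV LM] hV _ oM]]] := decomposition (exprn_gt0 2 g0).
  have iV := L2_L1 LV.
  have E' w : xi w * V w + xi w * M w = xi w * D w by rewrite E; ring.
  have ixV := L1M_bounded mxi xiC iV.
  rewrite -(eq_Ex P E') ExD//; last exact/(L1M_bounded mxi xiC)/L2_L1.
  rewrite (oM _ C)// addr0; apply: le_trans (Ex_norm ixV) _.
  apply: (@le_trans _ _ (C * Ex P (fun w => `|V w|))).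
    rewrite -ExZ; last exact: L1_norm.
    apply: Ex_le; [exact: L1_norm|exact/L1Z/L1_norm|].
    by move=> w; rewrite normrM ler_wpM2r.
  have := Ex_norm_young g0 LV.
  have : Ex P (fun w => V w ^+ 2) / (2 * g) <= g / 2.
    rewrite ler_pdivrMr; last by lra.
    by apply: le_trans hV _; rewrite le_eqVlt; apply/orP; left; apply/eqP; field.
  move=> h1 h2; apply: (@le_trans _ _ (C * g)); first by rewrite ler_wpM2l//; lra.
  by rewrite /g mulrA ler_pdivrMr; nra.
- apply/ler_addgt0Pl => e e0.
  (* Both squares are doubled, so an error [e'] enters as [2 * e' + 2 * (2 * e') = 6 * e']. *)
  have e6 : 0 < e / 6 by lra.
  have [V [M [E [LV LM] hV hM _]]] := decomposition e6.
  have : Ex P (fun w => D w ^+ 2) <= Ex P (fun w => 2 * V w ^+ 2 + 2 * M w ^+ 2).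
    apply: Ex_le; first by have := (L2D LV LM).2; apply: eq_L1 => w; rewrite E.
      by apply: L1D; apply: L1Z; [exact: LV.2|exact: LM.2].
    by move=> w; rewrite E; have := sqr_ge0 (V w - M w); rewrite !expr2; lra.
  rewrite ExD ?ExZ; [lra|exact: LM.2|exact: LV.2|apply: L1Z; exact: LV.2|apply: L1Z; exact: LM.2].
Qed.

End Limit.
End ItoEstimate.

(** * Tonelli for processes with continuous paths *)

Section PathIntegral.
Context {R : realType} {d : measure_display} {T : measurableType d}.
Variable P : probability T R.
Local Notation leb := (@lebesgue_measure R).
Local Notation RT := (measurableTypeR R * T)%type.

(** Rounds [x] down to the grid of mesh [m.+1%:R^-1] that starts at [r]. Points below [r] go to [r],
    as [Num.truncn] is 0 on negative numbers; this explains the [Num.max r x]. *)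
Let grid (r : R) (m : nat) (x : R) : R :=
  r + (Num.truncn ((x - r) * m.+1%:R))%:R / m.+1%:R.

Let gridP r m x : `|grid r m x - Num.max r x| <= m.+1%:R^-1.
Proof.
have m0 : 0 < m.+1%:R :> R by [].
rewrite /grid; case: (leP r x) => rx.
  have xr0 : 0 <= (x - r) * m.+1%:R by rewrite mulr_ge0 ?subr_ge0// ltW.
  have := truncn_itv xr0; set k := Num.truncn _ => /andP[k1 k2].
  have -> : r + k%:R / m.+1%:R - x = (k%:R - (x - r) * m.+1%:R) / m.+1%:R.
    by field; rewrite gt_eqF.
  rewrite normrM normfV (gtr0_norm m0) ler_piMl ?invr_ge0 ?(ltW m0)//.
  by rewrite ler_norml; move: k2; rewrite -natr1 => k2; apply/andP; split; lra.
have -> : Num.truncn ((x - r) * m.+1%:R) = 0%N.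
  apply/eqP; rewrite -leqn0 leqNgt truncn_gt_nat -ltNge (le_lt_trans _ ltr01)//.
  by rewrite mulr_le0_ge0 ?ltW// subr_lt0.
by rewrite mul0r addr0 subrr normr0 invr_ge0 ltW.
Qed.

(** Continuity in time makes the process a pointwise limit of processes constant on grid cells,
    which are jointly measurable because a cell index takes countably many values. *)
Lemma measurable_path (h : R -> T -> R) (r : R) :
  (forall w, continuous (h^~ w)) -> (forall x, measurable_fun setT (h x)) ->
  measurable_fun setT (fun z : RT => h (Num.max r z.1) z.2).
Proof.
move=> hc hm.
apply: (@measurable_fun_cvg _ _ _ _ (fun m (z : RT) => h (grid r m z.1) z.2)).
  move=> m _ B mB; rewrite setTI.
  pose A j := [set x : R | Num.truncn ((x - r) * m.+1%:R) = j].
  have mf : measurable_fun setT (fun x : measurableTypeR R => (x - r) * m.+1%:R).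
    by apply: measurable_funM => //; exact: measurable_funB.
  have mge k : measurable [set x : measurableTypeR R | k%:R <= (x - r) * m.+1%:R].
    rewrite (_ : [set _ | _] = setT `&` (fun x : measurableTypeR R => (x - r) * m.+1%:R) @^-1` `[k%:R, +oo[).
      by apply: mf => //; exact: measurable_itv.
    by rewrite setTI; apply/seteqP; split=> x /=; rewrite in_itv/= andbT.
  have mA j : measurable (A j : set (measurableTypeR R)).
    have E : A j = (if j is j'.+1 then [set x | j%:R <= (x - r) * m.+1%:R] else setT) `\`
        [set x | j.+1%:R <= (x - r) * m.+1%:R].
      apply/seteqP; split=> x; rewrite /A /=.
        move=> e; split; last by rewrite -truncn_gt_nat e ltnn.
        by case: j e => [//|j e] /=; rewrite -truncn_gt_nat e.
      rewrite -truncn_gt_nat => -[h1 /negP]; rewrite -leqNgt => h2.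
      apply/eqP; rewrite eqn_leq h2/=; case: j h1 {h2} => [//|j] /=.
      by rewrite -truncn_gt_nat.
    rewrite E; apply: measurableD => //; case: j {E} => [//|j]; exact: mge.
  rewrite (_ : _ @^-1` B = \bigcup_j (A j `*` (h (r + j%:R / m.+1%:R) @^-1` B))).
    apply: bigcupT_measurable => j; apply: measurableX => //.
    by rewrite -[X in measurable X]setTI; exact: hm.
  apply/seteqP; split=> [[x w] /= hB|[x w] [j _ [/= <-]]//].
  by exists (Num.truncn ((x - r) * m.+1%:R)).
move=> [x w] _ /=.
apply: (@continuous_cvg _ _ _ _ _ _ (h^~ w)); first exact: hc.
apply/cvgrPdist_le => e e0.
near=> m; rewrite distrC (le_trans (gridP _ _ _))//.
by near: m; apply: filterS (near_infty_natSinv_lt (PosNum e0)) => m /ltW.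
Unshelve. all: by end_near. Qed.

Lemma continuous_integrable_itv (f : R -> R) (r u : R) : continuous f ->
  leb.-integrable `[r, u] (EFin \o f).
Proof.
move=> cf; apply: continuous_compact_integrable; first exact: segment_compact.
exact: continuous_subspaceT.
Qed.

Section Fubini.
Variables (h : R -> T -> R) (r u : R).
Hypothesis hc : forall w, continuous (h^~ w).
Hypothesis hm : forall x, measurable_fun setT (h x).
Hypothesis h0 : forall x w, 0 <= h x w.

Let f (z : RT) : \bar R := (h (Num.max r z.1) z.2 * \1_(`[r, u]%classic) z.1)%:E.

Let mf : measurable_fun setT f.
Proof.
apply/measurable_EFinP; apply: measurable_funM; first exact: measurable_path.
by apply: (measurableT_comp _ measurable_fst); exact: measurable_indic.
Qed.

Let f0 z : (0 <= f z)%E. Proof. by rewrite lee_fin mulr_ge0// indicE. Qed.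

Let fE w : (\int[leb]_x f (x, w) = \int[leb]_(x in `[r, u]) (h x w)%:E)%E.
Proof.
rewrite [RHS]integral_mkcond; apply: eq_integral => x _.
rewrite /f /= patchE indicE; case: ifPn => [|_]; last by rewrite mulr0.
by rewrite inE/= in_itv/= => /andP[rx _]; rewrite mulr1 (max_idPr rx).
Qed.

(** [g] bounds the mean at each time and [G] its time integral, so that the same statement serves
    bounds constant in time and bounds decaying at [-oo]. *)
Lemma fubini_path (g : R -> R) (G : R) : measurable_fun setT g ->
  (forall x, r <= x <= u -> L1 P (h x) /\ Ex P (h x) <= g x) ->
  (\int[leb]_(x in `[r, u]) (g x)%:E <= G%:E)%E ->
  let kappa := fun w => \int[leb]_(x in `[r, u]) h x w in
  [/\ L1 P kappa, Ex P kappa <= G &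
      forall w, (\int[leb]_(x in `[r, u]) (h x w)%:E = (kappa w)%:E)%E].
Proof.
move=> mg hg gG kappa.
have kE w : (\int[leb]_(x in `[r, u]) (h x w)%:E = (kappa w)%:E)%E.
  by rewrite fineK//; apply: integrable_fin_num => //; exact: continuous_integrable_itv.
have k0 w : 0 <= kappa w by apply: Rintegral_ge0.
have mk : measurable_fun setT (EFin \o kappa).
  rewrite (_ : EFin \o kappa = fubini_G leb f).
    exact: measurable_fun_fubini_tonelli_G.
  by apply/funext => w; rewrite /fubini_G/= fE kE.
have le : (\int[P]_w (kappa w)%:E <= G%:E)%E.
  under eq_integral => w _ do rewrite -kE -fE.
  rewrite -(@fubini_tonelli _ _ _ _ _ leb P f mf f0).
  apply: le_trans gG; rewrite [leRHS]integral_mkcond; apply: ge0_le_integral => //.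
  - by move=> x _; apply: integral_ge0.
  - exact: (@measurable_fun_fubini_tonelli_F _ _ _ _ _ P f mf f0).
  - apply: (measurable_restrictT _ _).1 => //.
    by apply/measurable_EFinP; exact: measurable_funS mg.
  - move=> x _; rewrite patchE; case: ifPn => xru; last first.
      rewrite integral0_eq// => w _; rewrite /f/= indicE (negbTE xru) mulr0//.
    move: (xru); rewrite inE/= in_itv/= => /andP[rx xu].
    have [|ix ig] := hg x; first by rewrite rx.
    rewrite -[leRHS]/(g x)%:E (le_trans _ (_ : (Ex P (h x))%:E <= _)%E) ?lee_fin//.
    rewrite -Ex_EFin//; apply: ge0_le_integral => //.
    + by apply: (measurableT_comp mf); exact: measurable_pair1.
    + exact/measurable_EFinP/hm.
    + by move=> w _; rewrite /f/= indicE xru mulr1 (max_idPr rx).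
have ik : L1 P kappa.
  apply/integrableP; split=> //.
  under eq_integral => w _ do rewrite /= ger0_norm//.
  by apply: le_lt_trans le _; rewrite ltry.
by split=> //; rewrite -lee_fin -Ex_EFin.
Qed.

End Fubini.
End PathIntegral.

(** * The stochastic differential equation *)

Section SdePath.
Context {R : realType} {d : measure_display} {T : measurableType d}.
Variable P : probability T R.
Local Notation leb := (@lebesgue_measure R).

Lemma sigmaC (G : set_system T) A : <<s G >> A -> <<s G >> (~` A).
Proof. exact: (@measurableC _ (g_sigma_algebraType G)). Qed.

Lemma sin_lipschitz (x y : R) : `|sin y - sin x| <= `|y - x|.
Proof.
rewrite -[leRHS]mul1r; apply: (dv_global_lipschitz (f1 := cos)) => z; first exact: is_derive_sin.
by rewrite ler_norml cos_geN1 cos_le1.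
Qed.

Lemma cos_lipschitz (x y : R) : `|cos y - cos x| <= `|y - x|.
Proof.
rewrite -[leRHS]mul1r; apply: (dv_global_lipschitz (f1 := fun z => - sin z)) => z.
  exact: is_derive_cos.
by rewrite normrN ler_norml sin_geN1 sin_le1.
Qed.

Variable Z : R -> T -> R[i].
Hypothesis hZ : two_sided_complex_BM P Z.
Local Notation X := (re_part Z).
Local Notation Y := (im_part Z).
Local Notation F := (filtration P Z).

Variables (beta : R) (n : nat).
Hypothesis beta_gt0 : 0 < beta.

(** [lambda * (scale u - scale r)] is the [lambda]-part of the drift integrated over [[r, u]]. *)
Definition scale (u : R) : R := expR (beta / 4 * u).

(* A version of a strong solution that is continuous, adapted and tends to 0 at
   -oo for every w, not just almost every one. *)
Record sde_path (lambda : R) (b : R -> T -> R) : Prop := {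
  path_continuous : forall w, continuous (b^~ w) ;
  path_adapted : forall u, rv_measurable (F u) (b u) ;
  path_init : forall w, b u w @[u --> -oo] --> 0 ;
  path_step : forall r u, r < u -> exists J H N,
    [/\ is_ito_integral P Z H r u J, measurable N, P N = 0%E &
     forall w, ~ N w -> (forall x, H x w = expi (- b x w) - 1) /\
       b u w - b r w = lambda * (scale u - scale r) + complex.Re (J w)
         - n%:R * \int[leb]_(x in `[r, u]) sin (b x w)] }.

Lemma scale_dv x : dv scale x (beta / 4 * scale x).
Proof. exact: dv_exp. Qed.

Lemma scale_continuous : continuous scale.
Proof. exact: dv_all_continuous scale_dv. Qed.

Lemma scale_gt0 x : 0 < scale x. Proof. exact: expR_gt0. Qed.

Lemma scale_mono x y : x <= y -> scale x <= scale y.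
Proof. by move=> xy; rewrite ler_expR ler_wpM2l// divr_ge0// ltW. Qed.

Lemma Re_expi (x : R) : complex.Re (expi x) = cos x. Proof. by []. Qed.
Lemma Im_expi (x : R) : complex.Im (expi x) = sin x. Proof. by []. Qed.

(** Set the solution to 0 on the null event where continuity or the limit fails; it stays adapted
    since the filtration contains the null events. *)
Lemma strong_solution_path lambda a : strong_solution P Z beta n lambda a ->
  exists b N, [/\ sde_path lambda b, measurable N, P N = 0%E &
    forall w, ~ N w -> forall u, a u w = b u w].
Proof.
move=> [ad /ae_null[N1 [mN1 N10 cN1]] /ae_null[N2 [mN2 N20 iN2]] eqn].
pose N := N1 `|` N2; pose b u w := a u w * \1_(~` N) w.
have mN : measurable N by exact: measurableU.
have N0 : P N = 0%E by rewrite measureU0.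
have bN w : N w -> b^~ w = fun=> 0.
  by move=> Nw; apply/funext => x; rewrite /b indicE in_setC mem_set// mulr0.
have bNN w : ~ N w -> b^~ w = a^~ w.
  by move=> Nw; apply/funext => x; rewrite /b indicE in_setC memNset// mulr1.
exists b, N; split=> //; last by move=> w /bNN /(congr1 (@^~ _)) h u; rewrite -h.
split.
- move=> w; have [Nw|Nw] := pselect (N w); first by rewrite bN//; exact: cst_continuous.
  by rewrite bNN//; apply: cN1 => ?; apply: Nw; left.
- move=> u; apply: rvM; first exact: ad.
  have hN : F u (~` N) by apply: sigmaC; exact: filtration_null.
  apply/rv_measurableP; exact: measurable_indic.
- move=> w; have [Nw|Nw] := pselect (N w); first by rewrite bN//; exact: cvg_cst.
  by rewrite bNN//; apply: iN2 => ?; apply: Nw; right.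
- move=> r u ru; have [J [hJ /ae_null[N3 [mN3 N30 eJ]]]] := eqn _ _ (ltW ru).
  exists J, (fun x w => expi (- a x w) - 1), (N `|` N3); split=> //.
  + exact: measurableU.
  + by rewrite measureU0.
  move=> w Nw; have Nw1 : ~ N w by move=> ?; apply: Nw; left.
  have Nw3 : ~ N3 w by move=> ?; apply: Nw; right.
  have e x : b x w = a x w by exact: (congr1 (@^~ x) (bNN w Nw1)).
  split; first by move=> x; rewrite e.
  rewrite !e eJ//.
  have -> : \int[leb]_(x in `[r, u]) (lambda * (beta / 4) * expR (beta / 4 * x)) =
      lambda * (scale u - scale r).
    rewrite /Rintegral (@ftc _ (fun x => lambda * scale x)) ?ltW//.
    - by rewrite /= mulrBr.
    - move=> x; apply: cvgM; first exact: cvg_cst.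
      exact: scale_continuous.
    - by move=> x; apply: dv_eq (dvZ lambda (scale_dv x)) _; rewrite mulrA.
  congr (_ + _).
  (* The real part of [(e^(-ix) - 1) * (- i n)] is [- n sin x]. *)
  rewrite (_ : (fun x => _) = fun x => - n%:R * sin (b x w)); last first.
    apply/funext => x; rewrite Re_mul !Re_sub !Im_sub Re_expi Im_expi e cosN sinN.
    have -> : complex.Re (- ('i * n%:R) : R[i]) = 0.
      rewrite -mulNr Re_mul -(rmorph_nat (real_complex R)) /=; ring.
    have -> : complex.Im (- ('i * n%:R) : R[i]) = - n%:R.
      rewrite -mulNr Im_mul -(rmorph_nat (real_complex R)) /=; ring.
    by rewrite /=; ring.
  rewrite RintegralZl ?mulNr//.
  apply: continuous_integrable_itv => x; apply: continuous_comp; last exact: continuous_sin.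
  by rewrite bNN//; apply: cN1 => ?; apply: Nw1; left.
Qed.

End SdePath.

(** * Euler decomposition of a solution *)

Section EulerDecomposition.
Context {R : realType} {d : measure_display} {T : measurableType d}.
Variable P : probability T R.
Local Notation leb := (@lebesgue_measure R).
Variable Z : R -> T -> R[i].
Hypothesis hZ : two_sided_complex_BM P Z.
Local Notation X := (re_part Z).
Local Notation Y := (im_part Z).
Local Notation F := (filtration P Z).

Lemma integral_itv_cst (c r u : R) : r <= u ->
  (\int[leb]_(x in `[r, u]) c%:E = (c * (u - r))%:E)%E.
Proof.
rewrite le_eqVlt => /predU1P[->|ru].
  by rewrite set_itv1 integral_set1 subrr mulr0.
by rewrite integral_cst//= lebesgue_measure_itv/= lte_fin ru -EFinB -EFinM.
Qed.

Lemma Rintegral_itv_cst (c r u : R) : r <= u ->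
  \int[leb]_(x in `[r, u]) c = c * (u - r).
Proof. by move=> ru; rewrite /Rintegral integral_itv_cst. Qed.

(* M is the martingale part of the remainder, D its drift part. *)
Definition euler (C r u : R) (x y a c1 c2 : T -> R) : Prop := exists M D : T -> R,
  [/\ [/\ rv_measurable (F r) x, rv_measurable (F r) a, rv_measurable (F r) c1 &
        rv_measurable (F r) c2],
      (forall w, [/\ `|a w| <= C, `|c1 w| <= C & `|c2 w| <= C]),
      [/\ L2 P M, (forall xi (K : R), rv_measurable (F r) xi -> (forall w, `|xi w| <= K) ->
         Ex P (fun w => xi w * M w) = 0) & Ex P (fun w => M w ^+ 2) <= C * (u - r) ^+ 2],
      [/\ measurable_fun setT D, (forall w, `|D w| <= C * (u - r)) &
         Ex P (fun w => `|D w|) <= C * ((u - r) * Num.sqrt (u - r))] &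
      {ae P, forall w, y w = x w + ((u - r) * a w +
         (c1 w * increment X (r, u) w - c2 w * increment Y (r, u) w) + M w + D w)}].

Variables (beta : R) (n : nat).
Hypothesis beta_gt0 : 0 < beta.
Local Notation scale := (scale beta).

Variables (lambda : R) (b : R -> T -> R).
Hypothesis hb : sde_path P Z beta n lambda b.

Lemma path_measurable u : measurable_fun setT (b u).
Proof. exact: (adapted_measurable hZ (@path_adapted _ _ _ _ _ _ _ _ _ hb u)). Qed.

Lemma path_comp_continuous (f : R -> R) w : continuous f -> continuous (fun x => f (b x w)).
Proof.
by move=> cf x; apply: continuous_comp; [exact: (path_continuous hb)|exact: cf].
Qed.

Let measurable_continuous (f : R -> R) : continuous f -> measurable_fun setT f.
Proof. exact: continuous_measurable_fun. Qed.

Let S r u w := \int[leb]_(x in `[r, u]) sin (b x w).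

Let S_bound r u w : r <= u -> `|S r u w| <= u - r.
Proof.
move=> ru; have ci := path_comp_continuous (w := w) (@continuous_sin R).
apply: le_trans (le_normr_Rintegral _ _) _ => //; first exact: continuous_integrable_itv.
rewrite -[leRHS]mul1r -Rintegral_itv_cst//; apply: le_Rintegral => //.
- apply: continuous_integrable_itv => x.
  by apply: continuous_comp; [exact: ci|exact: norm_continuous].
- by apply: continuous_integrable_itv; exact: cst_continuous.
- by move=> x _; rewrite ler_norml sin_geN1 sin_le1.
Qed.

Let S_measurable r u : r <= u -> measurable_fun setT (S r u).
Proof.
move=> ru.
(* [sin] is shifted by 1 to make the integrand nonnegative, as [fubini_path] requires; the shift
   integrates to [u - r]. *)
have c1 w : continuous (fun x => sin (b x w) + 1).
  by move=> x; apply: cvgD; [exact: (path_comp_continuous (w := w) (@continuous_sin R))|exact: cvg_cst].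
have m1 x : measurable_fun setT (fun w => sin (b x w) + 1).
  apply: measurable_funD => //; apply: measurableT_comp; last exact: path_measurable.
  exact: measurable_continuous (@continuous_sin R).
have p1 x w : 0 <= sin (b x w) + 1 by have := sin_geN1 (b x w); lra.
have [||i _ _] := @fubini_path _ _ _ P _ r u c1 m1 p1 (fun=> 2) (2 * (u - r)) (measurable_cst _).
- move=> x _; have i : L1 P (fun w => sin (b x w) + 1).
    apply: (@L1_bounded _ _ _ P 2) => // w; rewrite ger0_norm//.
    by have := sin_le1 (b x w); lra.
  split=> //; rewrite -(Ex_cst P 2); apply: Ex_le => //; first exact: L1_cst.
  by move=> w; have := sin_le1 (b x w); lra.
- by rewrite integral_itv_cst.
have := L1_measurable i => m; have : measurable_fun setT (fun w =>
    (\int[leb]_(x in `[r, u]) (sin (b x w) + 1)) - (u - r)) by exact: measurable_funB.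
congr measurable_fun; apply/funext => w; rewrite RintegralD//.
- by rewrite Rintegral_itv_cst// mul1r addrK.
- by apply: continuous_integrable_itv; exact: path_comp_continuous (@continuous_sin R).
- by apply: continuous_integrable_itv; exact: cst_continuous.
Qed.

Lemma scale_lip r u : r <= u -> u <= 1 -> `|scale u - scale r| <= beta / 4 * scale 1 * (u - r).
Proof.
move=> ru u1; apply: (dv_lipschitz (f1 := fun x => beta / 4 * scale x)) => //.
  by move=> x _; exact: scale_dv.
move=> x /andP[_ xu]; have b0 : 0 < beta / 4 by rewrite divr_gt0.
rewrite gtr0_norm ?mulr_gt0 ?scale_gt0// ler_wpM2l ?(ltW b0)//.
by apply: scale_mono => //; exact: le_trans u1.
Qed.

Let cabs2_H (x : R) : cabs2 (expi (- x) - 1 : R[i]) = 2 - 2 * cos x.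
Proof.
rewrite /cabs2 Re_sub Im_sub Re_expi Im_expi cosN sinN /= subr0 sqrrN sqrrB.
have := cos2Dsin2 x; rewrite mulr1 -mulr_natr => h; lra.
Qed.

Let H_measurable r u J H N : 
  [/\ is_ito_integral P Z H r u J, measurable N, P N = 0%E &
     forall w, ~ N w -> (forall x, H x w = expi (- b x w) - 1) /\
       b u w - b r w = lambda * (scale u - scale r) + complex.Re (J w)
         - n%:R * S r u w] ->
  forall w, ~ N w -> measurable_fun setT (fun x => complex.Re (H x w)) /\
  measurable_fun setT (fun x => complex.Im (H x w)).
Proof.
move=> [_ _ _ h] w /h [e _]; split.
- rewrite (_ : (fun _ => _) = fun x => cos (b x w) - 1).
    apply: measurable_funB => //; apply: measurable_continuous.
    exact: path_comp_continuous (@continuous_cos R).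
  by apply/funext => x; rewrite e Re_sub Re_expi cosN.
- rewrite (_ : (fun _ => _) = fun x => - sin (b x w)).
    apply: measurableT_comp => //; apply: measurable_continuous.
    exact: path_comp_continuous (@continuous_sin R).
  by apply/funext => x; rewrite e Im_sub Im_expi sinN subr0.
Qed.

(** [ito_estimate] with the integrand frozen at 0, so that [D] is the entire stochastic integral. A
    constant [kappa] yields the crude increment bound below; a decaying one controls the path near
    [-oo]. *)
Lemma path_ito_bound r u (kappa : T -> R) : r < u -> L1 P kappa ->
  (forall w, (\int[leb]_(x in `[r, u]) (2 - 2 * cos (b x w))%:E <= (kappa w)%:E)%E) ->
  exists D : T -> R, [/\ L2 P D, Ex P (fun w => D w ^+ 2) <= 4 * Ex P kappa &
    {ae P, forall w, b u w - b r w = lambda * (scale u - scale r) + D w - n%:R * S r u w}].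
Proof.
move=> ru ik hk; have [J [H [N h]]] := path_step hb ru.
have mH := H_measurable h; have [hJ mN N0 eJ] := h.
pose c := fun _ : T => (0 : R[i]).
have hc : crv_measurable (F r) c by split; exact: rv_cst.
have cK w : `|complex.Re (c w)| <= (0 : R) /\ `|complex.Im (c w)| <= (0 : R).
  by rewrite /c/= normr0.
have [|LD _ eD] := ito_estimate hZ hJ hc cK mN N0 mH ik.
  move=> w Nw; apply: le_trans (hk w); rewrite le_eqVlt; apply/orP; left; apply/eqP.
  by apply: eq_integral => x _; rewrite subr0 (eJ w Nw).1 cabs2_H.
eexists; split; [exact: LD|exact: eD|].
exists N; split=> // w /= hw; apply: contrapT => Nw; apply: hw.
by rewrite (eJ w Nw).2 /c /= !mul0r subrr subr0.
Qed.

(** The restriction [u <= 1] bounds [scale], while leaving room on both sides of time 0, where the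
    solution is finally evaluated. *)
Lemma path_increment_bound : exists2 C : R, 0 <= C & forall r u, r < u -> u <= 1 -> u - r <= 1 ->
  L2 P (fun w => b u w - b r w) /\ Ex P (fun w => (b u w - b r w) ^+ 2) <= C * (u - r).
Proof.
pose A := `|lambda| * (beta / 4 * scale 1).
exists (3 * (A ^+ 2 + 16 + n%:R ^+ 2)).
  by rewrite mulr_ge0// !addr_ge0// sqr_ge0.
move=> r u ru u1 ur1.
have h0 : 0 < u - r by rewrite subr_gt0.
have [|D [LD eD hD]] := path_ito_bound ru (L1_cst P (4 * (u - r))).
  move=> w.
  rewrite -integral_itv_cst ?(ltW ru)//; apply: ge0_le_integral => //.
  - apply/measurable_EFinP/measurable_funB => //; apply: measurable_funM => //.
    apply: measurable_funTS; apply: measurable_continuous.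
    exact: path_comp_continuous (@continuous_cos R).
  - by move=> x _; rewrite lee_fin; have := cos_geN1 (b x w); lra.
rewrite Ex_cst in eD.
have LS : L2 P (fun w => n%:R * S r u w).
  apply/L2Z/(L2_bounded P (S_measurable (ltW ru))) => w; exact: (S_bound w (ltW ru)).
pose Q w := lambda * (scale u - scale r) + D w - n%:R * S r u w.
have LQ : L2 P Q by apply: L2B LS; apply: L2D => //; exact: L2_cst.
have mb : measurable_fun setT (fun w => b u w - b r w).
  by apply: measurable_funB; exact: path_measurable.
have mb2 : measurable_fun setT (fun w => (b u w - b r w) ^+ 2) by exact: measurable_funX.
have mQ2 : measurable_fun setT (fun w => Q w ^+ 2) by apply: measurable_funX; exact: L2_measurable LQ.
have e2 : {ae P, forall w, Q w ^+ 2 = (b u w - b r w) ^+ 2}.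
  by move: hD; apply: filterS => w ->.
split; first by split=> //; exact: L1_ae mb2 e2 LQ.2.
rewrite -(eq_Ex_ae mQ2 mb2 e2).
(* The square of a sum of three terms costs the factor 3. The 16 in the constant is 4 from
   [ito_estimate] times the bound 4 for [2 - 2 * cos]. *)
apply: (@le_trans _ _ (Ex P (fun w => 3 * (A * (u - r)) ^+ 2 + 3 * D w ^+ 2 + 3 * (n%:R * (u - r)) ^+ 2))).
  apply: Ex_le; first exact: LQ.2.
    by apply: L1D; [apply: L1D; [exact: L1_cst|apply: L1Z; exact: LD.2]|exact: L1_cst].
  move=> w; rewrite /Q; set p := lambda * _; set q := D w; set t := n%:R * S r u w.
  have hp : `|p| <= A * (u - r).
    by rewrite normrM /A -mulrA ler_wpM2l// scale_lip// ltW.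
  have ht : `|t| <= n%:R * (u - r).
    by rewrite normrM ger0_norm// ler_wpM2l// S_bound// ltW.
  have hp2 : p ^+ 2 <= (A * (u - r)) ^+ 2.
    by rewrite -(real_normK (num_real p)) lerXn2r// nnegrE (le_trans _ hp).
  have ht2 : t ^+ 2 <= (n%:R * (u - r)) ^+ 2.
    by rewrite -(real_normK (num_real t)) lerXn2r// nnegrE (le_trans _ ht).
  have := sqr_ge0 (p - q); have := sqr_ge0 (p + t); have := sqr_ge0 (q + t).
  rewrite !expr2 in hp2 ht2 *; lra.
rewrite ExD; [|by apply: L1D; [exact: L1_cst|apply: L1Z; exact: LD.2]|exact: L1_cst].
rewrite ExD; [|exact: L1_cst|apply: L1Z; exact: LD.2].
rewrite !Ex_cst ExZ; last exact: LD.2.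
have A0 := sqr_ge0 A; have n0 : 0 <= (n%:R : R) ^+ 2 by exact: sqr_ge0.
have -> : (A * (u - r)) ^+ 2 = A ^+ 2 * (u - r) ^+ 2 by rewrite exprMn.
have -> : (n%:R * (u - r)) ^+ 2 = n%:R ^+ 2 * (u - r) ^+ 2 by rewrite exprMn.
have hh : (u - r) ^+ 2 <= u - r by rewrite expr2 ler_piMl// ltW.
have k1 : A ^+ 2 * (u - r) ^+ 2 <= A ^+ 2 * (u - r) by rewrite ler_wpM2l.
have k2 : n%:R ^+ 2 * (u - r) ^+ 2 <= n%:R ^+ 2 * (u - r) by rewrite ler_wpM2l.
lra.
Qed.

Definition drift (u : R) : R := lambda * (beta / 4 * scale u).

(** Both the diffusion coefficient and the drift are frozen at time [r]. Since increments have size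
    [sqrt h] in mean square, the stochastic remainder has variance of order [h ^+ 2] and the drift
    remainder has mean of order [h ^ (3 / 2)]. *)
Lemma path_euler : exists2 C : R, 0 <= C & forall r u, r < u -> u <= 1 -> u - r <= 1 ->
  euler C r u (b r) (b u) (fun w => drift r - n%:R * sin (b r w))
    (fun w => cos (b r w) - 1) (fun w => - sin (b r w)).
Proof.
have [C0 C00 incr] := path_increment_bound.
have beta4 : 0 < beta / 4 by rewrite divr_gt0.
pose A := `|lambda| * (beta / 4 * scale 1).
pose A2 := `|lambda| * (beta / 4 * (beta / 4 * scale 1)).
have A_ge0 : 0 <= A by rewrite !mulr_ge0 ?(ltW (scale_gt0 _ _))// ltW.
have A2_ge0 : 0 <= A2 by rewrite !mulr_ge0 ?(ltW (scale_gt0 _ _))// ltW.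
have n_ge0 : 0 <= n%:R :> R by [].
pose C := A + A2 + 2 * n%:R + 8 * C0 + n%:R * Num.sqrt C0 + 2.
have s0 : 0 <= Num.sqrt C0 by exact: sqrtr_ge0.
have ns0 : 0 <= n%:R * Num.sqrt C0 by rewrite mulr_ge0.
have [C_ge0 hC1 hC2] : [/\ 0 <= C, A + n%:R <= C & 2 <= C] by rewrite /C; split; lra.
have [hC4 hC5 hC6] : [/\ 8 * C0 <= C, A2 + 2 * n%:R <= C & A2 + n%:R * Num.sqrt C0 <= C].
  by rewrite /C; split; lra.
clearbody C; exists C => // r u ru u1 ur1; set h := u - r.
have h0 : 0 < h by rewrite subr_gt0.
have hs : h * h <= h * Num.sqrt h.
  rewrite ler_wpM2l ?(ltW h0)//.
  rewrite -(@ler_pXn2r _ 2) ?nnegrE ?sqrtr_ge0 ?(ltW h0)// sqr_sqrtr ?(ltW h0)//.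
  by rewrite expr2 ler_piMl// ltW.
have incr' x : r <= x <= u -> L2 P (fun w => b x w - b r w) /\
    Ex P (fun w => (b x w - b r w) ^+ 2) <= C0 * h.
  move=> /andP[]; rewrite le_eqVlt => /predU1P[<- _|rx xu].
    have E w : 0 = b r w - b r w by rewrite subrr.
    split; first exact: eq_L2 E (L2_cst P 0).
    rewrite -[leRHS](Ex_cst P); apply/Ex_le; [|exact: L1_cst|].
      by apply: eq_L1 (L1_cst P 0) => w; rewrite subrr expr0n.
    by move=> w; rewrite subrr expr0n mulr_ge0// ltW.
  have [||L e] := incr r x rx; [exact: le_trans xu u1| |].
    by apply: le_trans ur1; rewrite lerD2r.
  by split=> //; apply: le_trans e _; rewrite ler_wpM2l// lerD2r.
have cdiff w : continuous (fun x => b x w - b r w).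
  by move=> x; apply: cvgB; [exact: (path_continuous hb)|exact: cvg_cst].
have mdiff x : measurable_fun setT (fun w => b x w - b r w).
  by apply: measurable_funB; exact: path_measurable.
have csq w : continuous (fun x => (b x w - b r w) ^+ 2).
  rewrite (_ : (fun _ => _) = fun x => (b x w - b r w) * (b x w - b r w)).
    by move=> x; apply: cvgM; exact: cdiff.
  by apply/funext => x; rewrite expr2.
have cnorm w : continuous (fun x => `|b x w - b r w|).
  by move=> x; apply: cvg_norm; exact: cdiff.
(* [2 * (b x - b r) ^+ 2] dominates the squared distance of the integrand from its frozen value,
   since [cos] and [sin] are both Lipschitz with constant 1. *)
have [|||||ik Ek kE] := @fubini_path _ _ _ P (fun x w => 2 * (b x w - b r w) ^+ 2) r u _ _ _
    (fun=> 2 * (C0 * h)) (2 * (C0 * h) * h) (measurable_cst _).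
- move=> w x; apply: cvgM; first exact: cvg_cst.
  exact: csq.
- by move=> x; apply: measurable_funM => //; apply: measurable_funX.
- by move=> x w; rewrite mulr_ge0// sqr_ge0.
- move=> x /incr'[L e]; split; first by apply: L1Z; exact: L.2.
  by rewrite ExZ ?ler_wpM2l//; exact: L.2.
- by rewrite integral_itv_cst// ltW.
set kappa := (fun w : T => _) in ik Ek kE.
have [J [H [N hJ]]] := path_step hb ru.
have mH := H_measurable hJ; have [iJ mN N0 eJ] := hJ.
pose c w : R[i] := ((cos (b r w) - 1) +i* (- sin (b r w)))%C.
have ad := @path_adapted _ _ _ _ _ _ _ _ _ hb r.
have mcos : measurable_fun setT (fun x : R => cos x - 1).
  by apply: measurable_funB => //; apply: measurable_continuous; exact: continuous_cos.
have msin : measurable_fun setT (fun x : R => - sin x).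
  by apply: measurableT_comp => //; apply: measurable_continuous; exact: continuous_sin.
have adc : rv_measurable (F r) (fun w => cos (b r w) - 1) by exact: rv_comp mcos ad.
have ads : rv_measurable (F r) (fun w => - sin (b r w)) by exact: rv_comp msin ad.
have hc : crv_measurable (F r) c by split.
have bcos x : `|cos x - 1| <= 2 :> R.
  by rewrite ler_norml; have := cos_le1 x; have := cos_geN1 x => ? ?; apply/andP; split; lra.
have bsin x : `|sin x| <= 1 :> R by rewrite ler_norml sin_geN1 sin_le1.
have cK w : `|complex.Re (c w)| <= 2 /\ `|complex.Im (c w)| <= 2.
  by split; [exact: bcos|rewrite /= normrN (le_trans (bsin _))// ler1n].
have hk w : ~ N w -> (\int[leb]_(x in `[r, u]) (cabs2 (H x w - c w))%:E <= (kappa w)%:E)%E.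
  move=> Nw; rewrite -kE; apply: ge0_le_integral => //.
  - by move=> x _; rewrite lee_fin cabs2_ge0.
  - apply: measurable_funTS; apply/measurable_EFinP; apply: measurable_cabs2.
      by under eq_fun do rewrite Re_sub; apply: measurable_funB => //; exact: (mH w Nw).1.
    by under eq_fun do rewrite Im_sub; apply: measurable_funB => //; exact: (mH w Nw).2.
  - apply: measurable_funTS; apply/measurable_EFinP; apply: measurable_funM => //.
    by apply: measurable_funX; apply: measurable_continuous; exact: cdiff.
  - move=> x _; rewrite lee_fin (eJ w Nw).1 /cabs2 !Re_sub !Im_sub Re_expi Im_expi /= cosN sinN.
    have h1 := cos_lipschitz (b r w) (b x w); have h2 := sin_lipschitz (b r w) (b x w).
    have sq (p q : R) : `|p| <= `|q| -> p ^+ 2 <= q ^+ 2.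
      by move=> pq; rewrite -(real_normK (num_real p)) -(real_normK (num_real q)) lerXn2r// nnegrE.
    have := sq _ _ h1; have := sq _ _ h2; rewrite subr0 opprK.
    have -> : cos (b x w) - 1 - (cos (b r w) - 1) = cos (b x w) - cos (b r w) by ring.
    have -> : (- sin (b x w) + sin (b r w)) ^+ 2 = (sin (b x w) - sin (b r w)) ^+ 2 by ring.
    by lra.
have [LM oM eM] := ito_estimate hZ iJ hc cK mN N0 mH ik hk.
set M := (fun w : T => _) in LM oM eM.
have [|||||iq Eq qE] := @fubini_path _ _ _ P (fun x w => `|b x w - b r w|) r u _ _ _
    (fun=> Num.sqrt (C0 * h)) (Num.sqrt (C0 * h) * h) (measurable_cst _).
- exact: cnorm.
- by move=> x; apply: measurableT_comp.
- by move=> x w.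
- move=> x /incr'[L e]; split; first exact/L1_norm/L2_L1.
  by apply: le_trans (Ex_norm_sqrt L) _; rewrite ler_wsqrtr.
- by rewrite integral_itv_cst// ltW.
set q := (fun w : T => _) in iq Eq qE.
(* [p] is the left-endpoint error of the smooth [lambda]-drift, of order [h ^+ 2]; the sine drift
   inherits only the [sqrt h] regularity of the path. *)
pose p := lambda * (scale u - scale r) - h * drift r.
pose D w := p - n%:R * (S r u w - h * sin (b r w)).
have hp : `|p| <= A2 * (h * h).
  rewrite /p /drift (_ : _ - _ = lambda * (scale u - scale r - h * (beta / 4 * scale r))); last by ring.
  rewrite normrM /A2 -[leRHS]mulrA ler_wpM2l//.
  have e x : dv (fun x => scale x - x * (beta / 4 * scale r)) x (beta / 4 * (scale x - scale r)).
    apply: (@dv_ext _ (fun x => scale x - (beta / 4 * scale r) * x)); first by move=> y; rewrite [y * _]mulrC.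
    apply: dv_eq (dvB (scale_dv beta x) (dvZ (beta / 4 * scale r) (dv_id x))) _.
    by rewrite mulr1 mulrBr.
  rewrite (_ : _ - _ = scale u - u * (beta / 4 * scale r) - (scale r - r * (beta / 4 * scale r))); last first.
    by rewrite /h; ring.
  rewrite (_ : _ * (h * h) = beta / 4 * (beta / 4 * scale 1 * h) * (u - r)); last by rewrite /h; ring.
  apply: (@dv_lipschitz _ _ _ (beta / 4 * (beta / 4 * scale 1 * h)) r u (fun x _ => e x) _ (ltW ru)).
  move=> x /andP[rx xu].
  rewrite normrM (gtr0_norm beta4) ler_wpM2l ?(ltW beta4)//.
  apply: le_trans (scale_lip rx (le_trans xu u1)) _.
  by rewrite ler_wpM2l ?lerD2r// mulr_ge0 ?(ltW (scale_gt0 _ _))// ltW.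
have hS w : `|S r u w - h * sin (b r w)| <= q w.
  have cs : continuous (fun x => sin (b x w)) by exact: path_comp_continuous (@continuous_sin R).
  have -> : S r u w - h * sin (b r w) = \int[leb]_(x in `[r, u]) (sin (b x w) - sin (b r w)).
    rewrite RintegralB//.
    - by rewrite Rintegral_itv_cst ?(ltW ru)// [h * _]mulrC.
    - exact: continuous_integrable_itv.
    - by apply: continuous_integrable_itv; exact: cst_continuous.
  have cs' : continuous (fun x => sin (b x w) - sin (b r w)).
    by move=> x; apply: cvgB; [exact: cs|exact: cvg_cst].
  apply: le_trans (le_normr_Rintegral _ _) _ => //; first exact: continuous_integrable_itv.
  apply: le_Rintegral => //.
  - by apply: continuous_integrable_itv => x; apply: cvg_norm; exact: cs'.
  - exact: continuous_integrable_itv (cnorm w).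
  - by move=> x _; exact: sin_lipschitz.
have mD : measurable_fun setT D.
  apply: measurable_funB => //; apply: measurable_funM => //; apply: measurable_funB.
    exact: S_measurable (ltW ru).
  apply: measurable_funM => //; apply: measurableT_comp; last exact: path_measurable.
  exact: measurable_continuous (@continuous_sin R).
exists M, D; split.
- split=> //; apply: rvB; first exact: rv_cst.
  apply: rvM; first exact: rv_cst.
  by apply: rv_comp ad; exact: measurable_continuous (@continuous_sin R).
- move=> w; split.
  + apply: le_trans (ler_normB _ _) _.
    apply: le_trans hC1; apply: lerD.
      rewrite /drift normrM ler_wpM2l// gtr0_norm ?mulr_gt0 ?scale_gt0//.
      by rewrite ler_wpM2l ?(ltW beta4)// scale_mono// (le_trans (ltW ru)).
    by rewrite normrM ger0_norm// ler_piMr.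
  + by apply: le_trans (bcos _) hC2.
  + by rewrite normrN; apply: le_trans (bsin _) (le_trans _ hC2); rewrite ler1n.
- split=> //; apply: le_trans eM _; apply: (@le_trans _ _ (4 * (2 * (C0 * h) * h))).
    by rewrite ler_wpM2l.
  have -> : 4 * (2 * (C0 * h) * h) = 8 * C0 * h ^+ 2 by ring.
  by rewrite ler_wpM2r ?sqr_ge0.
- have hDp w : `|D w| <= A2 * (h * h) + n%:R * q w.
    apply: le_trans (ler_normB _ _) _; apply: lerD => //.
    by rewrite normrM ger0_norm// ler_wpM2l.
  split=> //.
  + move=> w; apply: le_trans (ler_normB _ _) _.
    apply: (@le_trans _ _ (A2 * h + n%:R * (h + h))); last first.
      rewrite (_ : _ + _ = (A2 + 2 * n%:R) * h); first by rewrite ler_wpM2r// ltW.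
      by ring.
    apply: lerD.
      by apply: le_trans hp _; rewrite ler_wpM2l// ler_piMl// ltW.
    rewrite normrM ger0_norm// ler_wpM2l//; apply: le_trans (ler_normB _ _) _.
    by apply: lerD; [exact: S_bound (ltW ru)|rewrite normrM (gtr0_norm h0) ler_piMr// ltW].
  + apply: (@le_trans _ _ (Ex P (fun w => A2 * (h * h) + n%:R * q w))).
      have i2 : L1 P (fun w => A2 * (h * h) + n%:R * q w) by apply: L1D; [exact: L1_cst|exact: L1Z].
      apply: Ex_le => //; apply: L1_le i2; first exact: measurableT_comp.
      by move=> w; rewrite normr_id.
    rewrite ExD; [|exact: L1_cst|exact: L1Z].
    rewrite Ex_cst ExZ//.
    apply: (@le_trans _ _ ((A2 + n%:R * Num.sqrt C0) * (h * Num.sqrt h))); last first.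
      by rewrite ler_wpM2r// mulr_ge0 ?sqrtr_ge0// ltW.
    rewrite [leRHS]mulrDl; apply: lerD; first by rewrite ler_wpM2l.
    by rewrite -mulrA ler_wpM2l//; apply: le_trans Eq _; rewrite sqrtrM// -mulrA [_ * h]mulrC.
- exists N; split=> // w /= hw; apply: contrapT => Nw; apply: hw.
  have [_ e] := eJ w Nw; rewrite -/(S r u w) in e.
  rewrite -[b u w](subrK (b r w)) e /M /D /p /h /c /=; ring.
Qed.

End EulerDecomposition.

(** * A one-step Ito inequality *)

Section EulerStep.
Context {R : realType} {d : measure_display} {T : measurableType d}.
Variable P : probability T R.
Variable Z : R -> T -> R[i].
Hypothesis hZ : two_sided_complex_BM P Z.
Local Notation X := (re_part Z).
Local Notation Y := (im_part Z).
Local Notation F := (filtration P Z).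

(** Both variables are driven by the same increments of [Z], so the coefficients subtract. The
    factor 2 comes from squaring the difference of the martingale remainders. *)
Lemma euler_sub C C' r u x y a c1 c2 x' y' a' c1' c2' : r < u -> 0 <= C -> 0 <= C' ->
  euler P Z C r u x y a c1 c2 -> euler P Z C' r u x' y' a' c1' c2' ->
  euler P Z (2 * (C + C')) r u (fun w => x w - x' w) (fun w => y w - y' w)
    (fun w => a w - a' w) (fun w => c1 w - c1' w) (fun w => c2 w - c2' w).
Proof.
move=> ru C0 C0' [M [D [[hx ha h1 h2] bd [LM oM eM] [mD bD eD] E]]].
move=> [M' [D' [[hx' ha' h1' h2'] bd' [LM' oM' eM'] [mD' bD' eD'] E']]].
have h0 : 0 < u - r by rewrite subr_gt0.
have tri (p q : R) : `|p| <= C -> `|q| <= C' -> `|p - q| <= 2 * (C + C').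
  by move=> hp hq; apply: le_trans (ler_normB _ _) _; lra.
exists (fun w => M w - M' w), (fun w => D w - D' w); split.
- by split; exact: rvB.
- by move=> w; have [k1 k2 k3] := bd w; have [k1' k2' k3'] := bd' w; split; exact: tri.
- split; first exact: L2B.
    move=> xi K hxi xiK; have mxi := adapted_measurable hZ hxi.
    have e w : xi w * M w - xi w * M' w = xi w * (M w - M' w) by rewrite mulrBr.
    rewrite -(eq_Ex P e) ExB.
    + by rewrite (oM _ K)// (oM' _ K)// subrr.
    + exact/(L1M_bounded mxi xiK)/L2_L1.
    + exact/(L1M_bounded mxi xiK)/L2_L1.
  apply: (@le_trans _ _ (Ex P (fun w => 2 * M w ^+ 2 + 2 * M' w ^+ 2))).
    apply: Ex_le; first exact: (L2B LM LM').2.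
      by apply: L1D; apply: L1Z; [exact: LM.2|exact: LM'.2].
    by move=> w; have := sqr_ge0 (M w + M' w); rewrite !expr2; lra.
  by rewrite (ExD (L1Z 2 LM.2) (L1Z 2 LM'.2)) (ExZ 2 LM.2) (ExZ 2 LM'.2); lra.
- have i (V : T -> R) k : measurable_fun setT V -> (forall w, `|V w| <= k) -> L1 P V.
    exact: L1_bounded.
  split; first exact: measurable_funB.
    move=> w; apply: le_trans (ler_normB _ _) _; apply: le_trans (lerD (bD w) (bD' w)) _.
    by rewrite -mulrDl ler_wpM2r ?(ltW h0)//; lra.
  have iD := i _ _ mD bD; have iD' := i _ _ mD' bD'.
  apply: (@le_trans _ _ (Ex P (fun w => `|D w| + `|D' w|))).
    apply: Ex_le; [exact/L1_norm/L1B|by apply: L1D; exact: L1_norm|].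
    by move=> w; exact: ler_normB.
  rewrite ExD; [|exact: L1_norm|exact: L1_norm].
  apply: le_trans (lerD eD eD') _; rewrite -mulrDl ler_wpM2r//; last by lra.
  by rewrite mulr_ge0 ?sqrtr_ge0// ltW.
- by move: E E'; apply: filterS2 => w -> ->; ring.
Qed.

Definition adapted_bounded (r K : R) (xi : T -> R) :=
  rv_measurable (F r) xi /\ forall w, `|xi w| <= K.

Lemma adapted_boundedM r K K' xi xi' : adapted_bounded r K xi -> adapted_bounded r K' xi' ->
  adapted_bounded r (K * K') (fun w => xi w * xi' w).
Proof.
move=> [h1 b1] [h2 b2]; split; first exact: rvM.
by move=> w; rewrite normrM ler_pM.
Qed.

Lemma adapted_bounded_comp r K x (f : R -> R) : measurable_fun setT f -> (forall t, `|f t| <= K) ->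
  rv_measurable (F r) x -> adapted_bounded r K (f \o x).
Proof. by move=> mf fK hx; split; [exact: rv_comp|move=> w; exact: fK]. Qed.

Lemma adapted_bounded_L1 r K xi : adapted_bounded r K xi -> L1 P xi.
Proof. by move=> [h b]; exact: (L1_bounded P (adapted_measurable hZ h) b). Qed.

Lemma adapted_bounded_L2 r K xi : adapted_bounded r K xi -> L2 P xi.
Proof. by move=> [h b]; exact: (L2_bounded P (adapted_measurable hZ h) b). Qed.

Section Noise.
Variables (r u C : R) (c1 c2 : T -> R).
Hypothesis ru : r < u.
Hypothesis h1 : adapted_bounded r C c1.
Hypothesis h2 : adapted_bounded r C c2.
Local Notation dX := (increment X (r, u)).
Local Notation dY := (increment Y (r, u)).
Let g w := c1 w * dX w - c2 w * dY w.

Lemma noise_L2 : L2 P g.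
Proof.
have [] := one_step hZ ru h1.1 h2.1 (adapted_bounded_L2 h1) (adapted_bounded_L2 h2).
by [].
Qed.

Lemma noise_linear xi K : adapted_bounded r K xi -> Ex P (fun w => xi w * g w) = 0.
Proof.
move=> hxi; have k1 := adapted_boundedM hxi h1; have k2 := adapted_boundedM hxi h2.
have [i1 e1] := Ex_mul_dX hZ ru k1.1 (adapted_bounded_L1 k1).
have [i2 e2] := Ex_mul_dY hZ ru k2.1 (adapted_bounded_L1 k2).
have e w : xi w * c1 w * dX w - xi w * c2 w * dY w = xi w * g w by rewrite /g; ring.
by rewrite -(eq_Ex P e) ExB// e1 e2 subrr.
Qed.

Lemma noise_quadratic xi K : adapted_bounded r K xi ->
  Ex P (fun w => xi w * g w ^+ 2) = (u - r) * Ex P (fun w => xi w * (c1 w ^+ 2 + c2 w ^+ 2)).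
Proof.
move=> hxi; have k1 := adapted_boundedM (adapted_boundedM hxi h1) h1.
have k2 := adapted_boundedM (adapted_boundedM hxi h2) h2.
have k3 := adapted_boundedM (adapted_boundedM hxi h1) h2.
have [i1 e1] := Ex_mul_dX2 hZ ru k1.1 (adapted_bounded_L1 k1).
have [i2 e2] := Ex_mul_dY2 hZ ru k2.1 (adapted_bounded_L1 k2).
have [i3 e3] := Ex_mul_dXdY hZ ru k3.1 (adapted_bounded_L1 k3).
have e w : xi w * c1 w * c1 w * dX w ^+ 2 + xi w * c2 w * c2 w * dY w ^+ 2
    - 2 * (xi w * c1 w * c2 w * (dX w * dY w)) = xi w * g w ^+ 2 by rewrite /g; ring.
rewrite -(eq_Ex P e) ExB; [|exact: L1D|exact: L1Z].
rewrite ExD// ExZ// e1 e2 e3 mulr0 subr0 -mulrDr -ExD; [|exact: adapted_bounded_L1 k1|exact: adapted_bounded_L1 k2].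
by congr (_ * _); apply: eq_Ex => w; ring.
Qed.

Lemma noise_pow4 : L1 P (fun w => g w ^+ 4) /\
  Ex P (fun w => g w ^+ 4) <= 16 * C ^+ 4 * (128 * (u - r) ^+ 2).
Proof.
have [iX eX] := increment_pow4 (cBM_re hZ) ru.
have [iY eY] := increment_pow4 (cBM_im hZ) ru.
have C4 : 0 <= 8 * C ^+ 4 by rewrite mulr_ge0// exprn_even_ge0.
have pw (p q : R) : (p - q) ^+ 4 <= 8 * (p ^+ 4 + q ^+ 4).
  rewrite -subr_ge0.
  have -> : 8 * (p ^+ 4 + q ^+ 4) - (p - q) ^+ 4 =
     4 * (p ^+ 2 - q ^+ 2) ^+ 2 + (p + q) ^+ 2 * (2 * (p ^+ 2 + q ^+ 2) + (p - q) ^+ 2) by ring.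
  apply: addr_ge0; apply: mulr_ge0; rewrite ?sqr_ge0//.
  by apply: addr_ge0; rewrite ?sqr_ge0// mulr_ge0// addr_ge0// sqr_ge0.
have bnd c dz : `|c| <= C -> (c * dz) ^+ 4 <= C ^+ 4 * dz ^+ 4.
  move=> cC; rewrite exprMn ler_wpM2r ?exprn_even_ge0//.
  rewrite -[4%N]/(2 * 2)%N !exprM lerXn2r ?nnegrE ?sqr_ge0//.
  by rewrite -(real_normK (num_real c)) lerXn2r// nnegrE (le_trans _ cC).
have g4 w : g w ^+ 4 <= 8 * C ^+ 4 * (dX w ^+ 4 + dY w ^+ 4).
  apply: le_trans (pw _ _) _; rewrite -mulrA ler_wpM2l// [leRHS]mulrDr.
  by apply: lerD; apply: bnd; [exact: h1.2|exact: h2.2].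
have iXY := L1Z (8 * C ^+ 4) (L1D iX iY).
have mg : measurable_fun setT (fun w => g w ^+ 4).
  by apply: measurable_funX; exact: L2_measurable noise_L2.
have ig : L1 P (fun w => g w ^+ 4).
  by apply: L1_le iXY => // w; rewrite ger0_norm ?exprn_even_ge0.
split=> //; apply: le_trans (Ex_le ig iXY g4) _.
rewrite ExZ; last exact: L1D.
rewrite ExD//; move: (128 * (u - r) ^+ 2) eX eY => v eX eY.
have -> : 16 * C ^+ 4 * v = 8 * C ^+ 4 * (v + v) by ring.
by rewrite ler_wpM2l// lerD.
Qed.

End Noise.

(** Here [s] will be [sqrt h], the size of the noise [g]; the other parts of the increment have size
    [s ^+ 2]. Young's inequality with weight [s] balances every product, so that all error terms
    have mean of order [s ^+ 3]. *)
Let step_pointwise (K W f0 f1 f2 fd s ha g M D : R) : 0 < s -> s <= 1 -> 0 <= W -> W <= 1 -> 0 <= K ->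
  `|f1| <= K -> `|f2| <= K ->
  (forall e, e = ha + g + M + D -> fd <= f0 + f1 * e + f2 * e ^+ 2 / 2 + K * e ^+ 2 /\
     fd <= f0 + f1 * e + f2 * e ^+ 2 / 2 + K * `|e| ^+ 3) ->
  W * fd <= W * f0 + W * f1 * ha + W * f1 * g + W * f1 * M + W * f2 / 2 * g ^+ 2 +
    K * (`|D| + 15 / s * (ha ^+ 2 + M ^+ 2 + D ^+ 2) + 5 * s * g ^+ 2 + 4 / s * g ^+ 4).
Proof.
move=> s0 s1 W0 W1 K0 hf1 hf2 /(_ _ erefl); set e := ha + g + M + D => -[t2 t3].
pose q := ha + M + D.
have eE : e = g + q by rewrite /e /q; ring.
have q3 : q ^+ 2 <= 3 * (ha ^+ 2 + M ^+ 2 + D ^+ 2).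
  have := sqr_ge0 (ha - M); have := sqr_ge0 (ha - D); have := sqr_ge0 (M - D).
  by rewrite /q !expr2; lra.
have si0 : 0 < s^-1 by rewrite invr_gt0.
have si1 : 1 <= s^-1 by rewrite invf_ge1.
have qs : q ^+ 2 <= q ^+ 2 / s by rewrite ler_peMr// sqr_ge0.
have qs3 : q ^+ 2 / s <= 3 / s * (ha ^+ 2 + M ^+ 2 + D ^+ 2).
  by rewrite [leRHS]mulrAC ler_wpM2r// ltW.
have g20 := sqr_ge0 g; have q20 := sqr_ge0 q.
(* Young's inequality: 2 |g q| <= s g^2 + q^2 / s *)
have gq : `|g * q| <= (s * g ^+ 2 + q ^+ 2 / s) / 2.
  have k (z : R) : z * z = g ^+ 2 * q ^+ 2 -> z <= (s * g ^+ 2 + q ^+ 2 / s) / 2.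
    move=> zz; set p := _ / 2; have p0 : 0 <= p.
      by rewrite divr_ge0// addr_ge0// mulr_ge0// ltW.
    have p2 : g ^+ 2 * q ^+ 2 <= p ^+ 2.
      rewrite -subr_ge0.
      have -> : p ^+ 2 - g ^+ 2 * q ^+ 2 = (s * g ^+ 2 - q ^+ 2 / s) ^+ 2 / 4.
        by rewrite /p; field; rewrite gt_eqF.
      by rewrite divr_ge0// sqr_ge0.
    nra.
  by rewrite ler_norml lerNl; apply/andP; split; apply: k; ring.
have e2g : `|e ^+ 2 - g ^+ 2| <= 2 * q ^+ 2 / s + s * g ^+ 2.
  have -> : e ^+ 2 - g ^+ 2 = q ^+ 2 + 2 * (g * q) by rewrite eE; ring.
  apply: le_trans (ler_normD _ _) _; rewrite [`|2 * _|]normrM (ger0_norm q20) ger0_norm//.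
  by rewrite -mulrA; lra.
have g4 : `|g| ^+ 3 <= (s * g ^+ 2 + g ^+ 4 / s) / 2.
  rewrite -(real_normK (num_real g)) (_ : g ^+ 4 = `|g| ^+ 4); last first.
    by rewrite -[4%N]/(2 * 2)%N !exprM (real_normK (num_real g)).
  set a := `|g|; have a0 : 0 <= a by exact: normr_ge0.
  rewrite -subr_ge0; have -> : (s * a ^+ 2 + a ^+ 4 / s) / 2 - a ^+ 3 = a ^+ 2 * (a - s) ^+ 2 / (2 * s).
    by field; rewrite gt_eqF.
  by apply: divr_ge0; apply: mulr_ge0; rewrite ?sqr_ge0// ltW.
have g40 : 0 <= g ^+ 4 / s by rewrite divr_ge0 ?exprn_even_ge0// ltW.
have fin : fd <= f0 + f1 * e + f2 * e ^+ 2 / 2 + K * (4 * q ^+ 2 / s + 4 * (s * g ^+ 2 + g ^+ 4 / s)).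
  have sg0 : 0 <= s * g ^+ 2 by rewrite mulr_ge0// ltW.
  (* Where the remainder [q] dominates, the quadratic Taylor bound is used, as [M] is controlled
     only in mean square. Where the noise dominates, the cubic bound is used, and [g] has a fourth
     moment. *)
  have [gq'|gq'] := leP `|g| `|q|.
    apply: le_trans t2 _; rewrite lerD2l ler_wpM2l//.
    have : g ^+ 2 <= q ^+ 2.
      by rewrite -(real_normK (num_real g)) -(real_normK (num_real q)) lerXn2r ?nnegrE.
    have := sqr_ge0 (g - q); rewrite eE -mulrA; nra.
  apply: le_trans t3 _; rewrite lerD2l ler_wpM2l//.
  have ea : `|e| <= 2 * `|g| by rewrite eE; apply: le_trans (ler_normD _ _) _; lra.
  apply: (@le_trans _ _ ((2 * `|g|) ^+ 3)); first by rewrite lerXn2r ?nnegrE// mulr_ge0.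
  have q20' : 0 <= q ^+ 2 / s by rewrite divr_ge0// ltW.
  by rewrite exprMn -mulrA; lra.
have f1D : f1 * D <= K * `|D|.
  by apply: le_trans (ler_norm _) _; rewrite normrM ler_wpM2r.
have f2e : f2 * (e ^+ 2 - g ^+ 2) <= K * (2 * q ^+ 2 / s + s * g ^+ 2).
  by apply: le_trans (ler_norm _) _; rewrite normrM ler_pM.
pose A := `|D| + 15 / s * (ha ^+ 2 + M ^+ 2 + D ^+ 2) + 5 * s * g ^+ 2 + 4 / s * g ^+ 4.
have A1 : 0 <= A.
  rewrite /A !addr_ge0// mulr_ge0 ?addr_ge0 ?sqr_ge0 ?exprn_even_ge0//.
  - by rewrite divr_ge0// ltW.
  - by rewrite mulr_ge0// ltW.
  - by rewrite divr_ge0// ltW.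
have main : fd - (f0 + f1 * ha + f1 * g + f1 * M + f2 / 2 * g ^+ 2) <= K * A.
  have : K * (5 * (q ^+ 2 / s)) <= K * (15 / s * (ha ^+ 2 + M ^+ 2 + D ^+ 2)).
    by rewrite ler_wpM2l//; lra.
  have sg0 : 0 <= K * (s * g ^+ 2) by rewrite mulr_ge0// mulr_ge0// ltW.
  rewrite /A => k; move: fin f1D f2e k sg0; rewrite /e; nra.
have : W * (fd - (f0 + f1 * ha + f1 * g + f1 * M + f2 / 2 * g ^+ 2)) <= K * A.
  apply: le_trans (ler_wpM2l W0 main) _.
  by rewrite ler_piMl// mulr_ge0.
rewrite /A; lra.
Qed.

(** The hypothesis on [phi] is a one-sided Taylor bound, so that functions glued at a point qualify,
    and [W] leaves room for an integrating factor. [K'] depends on [C] and [K] only, hence is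
    uniform in the step and in [phi]. *)
Lemma euler_step (C K : R) : 0 <= C -> 0 <= K -> exists2 K' : R, 0 <= K' &
  forall r u x y a c1 c2 (W : T -> R) (phi phi1 phi2 : R -> R),
  r < u -> u - r <= 1 -> euler P Z C r u x y a c1 c2 ->
  rv_measurable (F r) W -> (forall w, 0 <= W w <= 1) ->
  [/\ measurable_fun setT phi, measurable_fun setT phi1 & measurable_fun setT phi2] ->
  (forall t, `|phi1 t| <= K /\ `|phi2 t| <= K) ->
  (forall t e, phi (t + e) <= phi t + phi1 t * e + phi2 t * e ^+ 2 / 2 + K * e ^+ 2 /\
     phi (t + e) <= phi t + phi1 t * e + phi2 t * e ^+ 2 / 2 + K * `|e| ^+ 3) ->
  L1 P (phi \o x) -> L1 P (phi \o y) ->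
  Ex P (fun w => W w * phi (y w)) <= Ex P (fun w => W w * phi (x w)) +
    (u - r) * Ex P (fun w => W w * (phi1 (x w) * a w + phi2 (x w) * (c1 w ^+ 2 + c2 w ^+ 2) / 2))
    + K' * ((u - r) * Num.sqrt (u - r)).
Proof.
move=> C0 K0.
have [B B0 hB] : exists2 B : R, 0 <= B & forall v, 16 * C ^+ 4 * (128 * v) = B * v.
  exists (16 * C ^+ 4 * 128); last by move=> v; rewrite mulrA.
  by rewrite mulr_ge0// mulr_ge0// exprn_ge0.
have C20 : 0 <= C ^+ 2 by rewrite sqr_ge0.
exists (K * (C + 15 * (C ^+ 2 + C + C ^+ 2) + 5 * (2 * C ^+ 2) + 4 * B)).
  by rewrite mulr_ge0//; lra.
move=> r u x y a c1 c2 W phi phi1 phi2 ru ur1.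
move=> [M [D [[hx ha h1 h2] bd [LM oM eM] [mD bD eD] E]]] hW W01 [mp mp1 mp2] bp taylor ix iy.
set h := u - r; have h0 : 0 < h by rewrite subr_gt0.
set s := Num.sqrt h; have s0 : 0 < s by rewrite sqrtr_gt0.
have s2 : s ^+ 2 = h by rewrite sqr_sqrtr// ltW.
have s1 : s <= 1.
  by rewrite -(@ler_pXn2r _ 2) ?nnegrE// ?(ltW s0)// s2 expr1n.
have aW : adapted_bounded r 1 W.
  by split=> // w; have /andP[k1 k2] := W01 w; rewrite ger0_norm.
have aa : adapted_bounded r C a by split=> // w; case: (bd w).
have a1 : adapted_bounded r C c1 by split=> // w; case: (bd w).
have a2 : adapted_bounded r C c2 by split=> // w; case: (bd w).
have ap1 : adapted_bounded r K (phi1 \o x).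
  by apply: adapted_bounded_comp => // t; case: (bp t).
have ap2 : adapted_bounded r K (phi2 \o x).
  by apply: adapted_bounded_comp => // t; case: (bp t).
pose g w := c1 w * increment X (r, u) w - c2 w * increment Y (r, u) w.
have Lg : L2 P g := noise_L2 ru a1 a2.
have aWp1 := adapted_boundedM aW ap1.
have aWp2 := adapted_boundedM aW ap2.
have ah : adapted_bounded r `|2^-1| (fun _ : T => 2^-1 : R) by split; [exact: rv_cst|].
have aWp2h := adapted_boundedM aWp2 ah.
have mW := adapted_measurable hZ hW.
have bW w : `|W w| <= 1 := aW.2 w.
have LD : L2 P D := L2_bounded P mD bD.
have [ig4] := noise_pow4 ru a1 a2; rewrite hB => eg4.
have iWy : L1 P (fun w => W w * phi (y w)) by exact: L1M_bounded mW bW iy.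
have iWx : L1 P (fun w => W w * phi (x w)) by exact: L1M_bounded mW bW ix.
pose A1 w := (W w * phi1 (x w)) * a w.
have iA1 : L1 P A1 := adapted_bounded_L1 (adapted_boundedM aWp1 aa).
have iA2 : L1 P (fun w => (W w * phi1 (x w)) * g w).
  exact: L2_L1M (adapted_bounded_L2 aWp1) Lg.
have iA3 : L1 P (fun w => (W w * phi1 (x w)) * M w).
  exact: L2_L1M (adapted_bounded_L2 aWp1) LM.
have iA4 : L1 P (fun w => (W w * phi2 (x w) * 2^-1) * g w ^+ 2).
  exact: (L1M_bounded (adapted_measurable hZ aWp2h.1) aWp2h.2 Lg.2).
(* Its mean is of order [s ^+ 3]: the fourth moment of [g] and the second moments of [h * a], [M]
   and [D] are of order [s ^+ 4], and the second moment of [g] is of order [s ^+ 2]. *)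
pose A5 w := `|D w| + 15 / s * ((h * a w) ^+ 2 + M w ^+ 2 + D w ^+ 2) +
   5 * s * g w ^+ 2 + 4 / s * g w ^+ 4.
have iha2 : L1 P (fun w => (h * a w) ^+ 2) by have [] := L2Z h (adapted_bounded_L2 aa).
have iA50 : L1 P (fun w => (h * a w) ^+ 2 + M w ^+ 2 + D w ^+ 2).
  by apply: L1D; [apply: L1D => //; exact: LM.2|exact: LD.2].
have iA51 : L1 P (fun w => `|D w| + 15 / s * ((h * a w) ^+ 2 + M w ^+ 2 + D w ^+ 2)).
  by apply: L1D; [exact/L1_norm/L2_L1|exact: L1Z].
have iA52 : L1 P (fun w => 5 * s * g w ^+ 2) by apply: L1Z; exact: Lg.2.
have iA53 : L1 P (fun w => 4 / s * g w ^+ 4) by exact: L1Z.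
have iA5 : L1 P A5 by apply: L1D => //; exact: L1D.
pose RHS w := W w * phi (x w) + h * A1 w + (W w * phi1 (x w)) * g w +
   (W w * phi1 (x w)) * M w + (W w * phi2 (x w) * 2^-1) * g w ^+ 2 + K * A5 w.
have j1 := L1D iWx (L1Z h iA1); have j2 := L1D j1 iA2; have j3 := L1D j2 iA3.
have j4 := L1D j3 iA4; have j5 := L1D j4 (L1Z K iA5).
have le : Ex P (fun w => W w * phi (y w)) <= Ex P RHS.
  apply: Ex_le_ae => //; move: E; apply: filterS => w yw.
  have /andP[W0 W1] := W01 w; have [b1 b2] := bp (x w).
  have := @step_pointwise K (W w) (phi (x w)) (phi1 (x w)) (phi2 (x w)) (phi (y w)) s
     (h * a w) (g w) (M w) (D w) s0 s1 W0 W1 K0 b1 b2.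
  have t e : e = h * a w + g w + M w + D w ->
      phi (y w) <= phi (x w) + phi1 (x w) * e + phi2 (x w) * e ^+ 2 / 2 + K * e ^+ 2 /\
      phi (y w) <= phi (x w) + phi1 (x w) * e + phi2 (x w) * e ^+ 2 / 2 + K * `|e| ^+ 3.
    by move=> ee; rewrite yw -ee; exact: taylor.
  move=> /(_ t); rewrite /RHS /A1 /A5.
  by rewrite [W w * phi1 (x w) * (h * a w)]mulrCA.
apply: le_trans le _.
rewrite /RHS (ExD j4 (L1Z K iA5)) (ExD j3 iA4) (ExD j2 iA3) (ExD j1 iA2) (ExD iWx (L1Z h iA1)).
rewrite (ExZ h iA1) (ExZ K iA5).
(* The terms linear in the noise and in [M] have mean 0; the quadratic one becomes the second-order
   part of the generator. *)
rewrite (noise_linear ru a1 a2 aWp1) (oM _ _ aWp1.1 aWp1.2) (noise_quadratic ru a1 a2 aWp2h) !addr0.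
have iq : L1 P (fun w => W w * phi2 (x w) * 2^-1 * (c1 w ^+ 2 + c2 w ^+ 2)).
  apply: eq_L1 (L1D (adapted_bounded_L1 (adapted_boundedM (adapted_boundedM aWp2h a1) a1))
    (adapted_bounded_L1 (adapted_boundedM (adapted_boundedM aWp2h a2) a2))) => w /=; ring.
have -> : Ex P (fun w => W w * (phi1 (x w) * a w + phi2 (x w) * (c1 w ^+ 2 + c2 w ^+ 2) / 2)) =
    Ex P A1 + Ex P (fun w => W w * phi2 (x w) * 2^-1 * (c1 w ^+ 2 + c2 w ^+ 2)).
  by rewrite -ExD//; apply: eq_Ex => w; rewrite /A1; field.
rewrite mulrDr !addrA lerD2l -mulrA ler_wpM2l//.
rewrite /A5 (ExD (L1D iA51 iA52) iA53) (ExD iA51 iA52) (ExD (L1_norm (L2_L1 LD)) (L1Z _ iA50)).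
rewrite (ExZ _ iA50) (ExZ _ Lg.2) (ExZ _ ig4) (ExD (L1D iha2 LM.2) LD.2) (ExD iha2 LM.2).
have hs : h * s = s ^+ 3 by rewrite -s2; ring.
have e1 : Ex P (fun w => (h * a w) ^+ 2) <= C ^+ 2 * s ^+ 4.
  rewrite -(Ex_cst P (C ^+ 2 * s ^+ 4)); apply: Ex_le => //; first exact: L1_cst.
  move=> w; rewrite exprMn -s2 -exprM mulrC ler_wpM2r ?exprn_ge0 ?(ltW s0)//.
  by rewrite -(real_normK (num_real (a w))) lerXn2r ?nnegrE// aa.2.
have e2 : Ex P (fun w => D w ^+ 2) <= C ^+ 2 * s ^+ 4.
  rewrite -(Ex_cst P (C ^+ 2 * s ^+ 4)); apply: Ex_le => //; [exact: LD.2|exact: L1_cst|].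
  move=> w; have := bD w; rewrite -/h -s2 => k.
  rewrite -(real_normK (num_real (D w))) (_ : C ^+ 2 * _ = (C * s ^+ 2) ^+ 2); last by ring.
  by rewrite lerXn2r ?nnegrE// mulr_ge0 ?exprn_ge0// ltW.
have e3 : Ex P (fun w => M w ^+ 2) <= C * s ^+ 4.
  by rewrite (_ : s ^+ 4 = h ^+ 2)// -s2; ring.
have e4 : Ex P (fun w => g w ^+ 2) <= 2 * C ^+ 2 * s ^+ 2.
  have hone : adapted_bounded r 1 (fun=> 1) by split; [exact: rv_cst|move=> w; rewrite normr1].
  have := noise_quadratic ru a1 a2 hone.
  rewrite (_ : Ex P (fun w => 1 * _) = Ex P (fun w => g w ^+ 2)); last by apply: eq_Ex => w; rewrite mul1r.
  move=> ->; rewrite -/h s2 mulrC ler_wpM2r ?(ltW h0)//.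
  rewrite -(Ex_cst P (2 * C ^+ 2)); apply: Ex_le.
  + by apply: eq_L1 (L1D (L2_L1M (adapted_bounded_L2 a1) (adapted_bounded_L2 a1))
      (L2_L1M (adapted_bounded_L2 a2) (adapted_bounded_L2 a2))) => w; ring.
  + exact: L1_cst.
  + move=> w; rewrite mul1r mulr_natl mulr2n; apply: lerD.
      by rewrite -(real_normK (num_real (c1 w))) lerXn2r ?nnegrE// a1.2.
    by rewrite -(real_normK (num_real (c2 w))) lerXn2r ?nnegrE// a2.2.
have e5 : Ex P (fun w => g w ^+ 4) <= B * s ^+ 4.
  by apply: le_trans eg4 _; rewrite -/h -s2 -exprM.
rewrite hs [leRHS]mulrDl [in leRHS]mulrDl [in leRHS]mulrDl; apply: lerD; last first.
  apply: (@le_trans _ _ (4 / s * (B * s ^+ 4))).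
    by rewrite ler_wpM2l// divr_ge0// ltW.
  by rewrite le_eqVlt; apply/orP; left; apply/eqP; field; rewrite gt_eqF.
apply: lerD; last first.
  apply: (@le_trans _ _ (5 * s * (2 * C ^+ 2 * s ^+ 2))).
    by rewrite ler_wpM2l// mulr_ge0// ltW.
  by rewrite le_eqVlt; apply/orP; left; apply/eqP; ring.
apply: lerD; first by rewrite -hs.
apply: (@le_trans _ _ (15 / s * (C ^+ 2 * s ^+ 4 + C * s ^+ 4 + C ^+ 2 * s ^+ 4))).
  by rewrite ler_wpM2l ?divr_ge0 ?(ltW s0)//; apply: lerD => //; exact: lerD.
by rewrite le_eqVlt; apply/orP; left; apply/eqP; field; rewrite gt_eqF.
Qed.

End EulerStep.

(** Half of the squared modulus of the diffusion coefficient [e^(-ix) - 1], which is the factor of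
    the second derivative in the generator. *)
Lemma half_sqr_dist {R : realType} (x : R) :
  ((cos x - 1) ^+ 2 + (- sin x) ^+ 2) / 2 = 1 - cos x.
Proof. by have := cos2Dsin2 x; rewrite !expr2 => h; nra. Qed.

Lemma ler_norm_of_sides {R : realType} (x y g c : R) :
  y <= x + g + c -> - y <= - x + - g + c -> `|y - x - g| <= c.
Proof. by move=> h1 h2; rewrite ler_norml; apply/andP; split; lra. Qed.

(** * Evolution of the means of smooth functions *)

Section Generator.
Context {R : realType} {d : measure_display} {T : measurableType d}.
Variable P : probability T R.
Variable Z : R -> T -> R[i].
Hypothesis hZ : two_sided_complex_BM P Z.
Local Notation F := (filtration P Z).
Variables (beta : R) (n : nat).
Hypothesis beta_gt0 : 0 < beta.
Local Notation scale := (scale beta).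
Variables (lambda : R) (b : R -> T -> R).
Hypothesis hb : sde_path P Z beta n lambda b.
Local Notation drift := (drift beta lambda).

Lemma measurable_continuous (f : R -> R) : continuous f -> measurable_fun setT f.
Proof. exact: continuous_measurable_fun. Qed.

Lemma dv_measurable (f g : R -> R) : (forall x, dv f x (g x)) -> measurable_fun setT f.
Proof. by move=> h; apply: measurable_continuous; exact: dv_all_continuous h. Qed.

Lemma cos_abs_le1 (x : R) : `|cos x| <= 1.
Proof. by rewrite ler_norml cos_geN1 cos_le1. Qed.

Lemma sin_abs_le1 (x : R) : `|sin x| <= 1.
Proof. by rewrite ler_norml sin_geN1 sin_le1. Qed.

Section Smooth.
Variables (phi phi1 phi2 phi3 : R -> R) (K : R).
Hypothesis d1 : forall x, dv phi x (phi1 x).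
Hypothesis d2 : forall x, dv phi1 x (phi2 x).
Hypothesis d3 : forall x, dv phi2 x (phi3 x).
Hypothesis k1 : forall x, `|phi1 x| <= K.
Hypothesis k2 : forall x, `|phi2 x| <= K.
Hypothesis k3 : forall x, `|phi3 x| <= K.
Hypothesis iphi : forall u, u <= 1 -> L1 P (fun w => phi (b u w)).

Let K0 : 0 <= K. Proof. exact: le_trans (k1 0). Qed.

Definition generator (u : R) : R := Ex P (fun w =>
  phi1 (b u w) * (drift u - n%:R * sin (b u w)) + phi2 (b u w) * (1 - cos (b u w))).

Let mphi : measurable_fun setT phi. Proof. exact: dv_measurable d1. Qed.
Let mphi1 : measurable_fun setT phi1. Proof. exact: dv_measurable d2. Qed.
Let mphi2 : measurable_fun setT phi2. Proof. exact: dv_measurable d3. Qed.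

Let taylor (t e : R) :
  [/\ phi (t + e) <= phi t + phi1 t * e + phi2 t * e ^+ 2 / 2 + 2 * K * e ^+ 2,
      phi (t + e) <= phi t + phi1 t * e + phi2 t * e ^+ 2 / 2 + 2 * K * `|e| ^+ 3,
      - phi (t + e) <= - phi t + - phi1 t * e + - phi2 t * e ^+ 2 / 2 + 2 * K * e ^+ 2 &
      - phi (t + e) <= - phi t + - phi1 t * e + - phi2 t * e ^+ 2 / 2 + 2 * K * `|e| ^+ 3].
Proof.
have [] := taylor2_bound t e d1 d2 d3 k2 k3.
have : K * `|e| ^+ 3 <= 2 * K * `|e| ^+ 3.
  by rewrite ler_wpM2r ?exprn_ge0// ler_peMl// ler1n.
by rewrite !ler_norml => q /andP[a1 a2] /andP[a3 a4]; split; lra.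
Qed.

(** [euler_step] is one-sided; it is applied to [phi] and to its opposite with weight 1. *)
Let step : exists2 C : R, 0 <= C & forall r u, r < u -> u <= 1 -> u - r <= 1 ->
  `|Ex P (fun w => phi (b u w)) - Ex P (fun w => phi (b r w)) - (u - r) * generator r| <=
  C * ((u - r) * Num.sqrt (u - r)).
Proof.
have [C C0 eu] := path_euler hZ beta_gt0 hb.
have K20 : 0 <= 2 * K by rewrite mulr_ge0.
have [C' C'0 st] := euler_step hZ C0 K20.
exists C' => // r u ru u1 ur1; have E := eu r u ru u1 ur1.
have r1 : r <= 1 by exact: le_trans (ltW ru) u1.
have h1 : rv_measurable (F r) (fun _ : T => 1 : R) by exact: rv_cst.
have W1 (w : T) : 0 <= (1 : R) <= 1 by rewrite ler01 lexx.
have KK (z : R) : z <= K -> z <= 2 * K by move=> zK; apply: le_trans zK _; rewrite ler_peMl// ler1n.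
have up := st r u _ _ _ _ _ _ phi phi1 phi2 ru ur1 E h1 W1.
have dn := st r u _ _ _ _ _ _ (fun t => - phi t) (fun t => - phi1 t) (fun t => - phi2 t) ru ur1 E h1 W1.
have {}up := up (And3 mphi mphi1 mphi2) (fun t => conj (KK _ (k1 t)) (KK _ (k2 t)))
  (fun t e => let: And4 p q _ _ := taylor t e in conj p q) (iphi r1) (iphi u1).
have mN (f : R -> R) : measurable_fun setT f -> measurable_fun setT (fun t => - f t).
  by move=> mf; exact: measurableT_comp.
have kN (f : R -> R) t : `|f t| <= K -> `|- f t| <= 2 * K by rewrite normrN; exact: KK.
have {}dn := dn (And3 (mN _ mphi) (mN _ mphi1) (mN _ mphi2)) (fun t => conj (kN _ _ (k1 t)) (kN _ _ (k2 t)))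
  (fun t e => let: And4 _ _ p q := taylor t e in conj p q) (L1N (iphi r1)) (L1N (iphi u1)).
have one (f : T -> R) : Ex P (fun w => 1 * f w) = Ex P f by apply: eq_Ex => w; rewrite mul1r.
rewrite !one in up dn.
have gE : Ex P (fun w => phi1 (b r w) * (drift r - n%:R * sin (b r w)) +
    phi2 (b r w) * ((cos (b r w) - 1) ^+ 2 + (- sin (b r w)) ^+ 2) / 2) = generator r.
  apply: eq_Ex => w; congr (_ + _); rewrite -mulrA; congr (_ * _).
  exact: half_sqr_dist.
have ig : L1 P (fun w => phi1 (b r w) * (drift r - n%:R * sin (b r w)) +
    phi2 (b r w) * ((cos (b r w) - 1) ^+ 2 + (- sin (b r w)) ^+ 2) / 2).
  have mb := path_measurable hZ hb r.
  have ms := measurable_continuous (@continuous_sin R).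
  have mc := measurable_continuous (@continuous_cos R).
  have msb : measurable_fun setT (fun w => sin (b r w)) by exact: measurableT_comp mb.
  have mcb : measurable_fun setT (fun w => cos (b r w)) by exact: measurableT_comp mb.
  apply: L1D.
    apply: (L1M_bounded (C := K)) => //; first exact: measurableT_comp.
    apply: L1B; first exact: L1_cst.
    by apply/L1Z/(L1_bounded P msb) => w; exact: sin_abs_le1.
  apply: (@eq_L1 _ _ _ _ (fun w => phi2 (b r w) * (((cos (b r w) - 1) ^+ 2 + (- sin (b r w)) ^+ 2) / 2))).
    by move=> w; rewrite mulrA.
  apply: (L1M_bounded (C := K)) => //; first exact: measurableT_comp.
  apply: (@eq_L1 _ _ _ _ (fun w => 1 - cos (b r w))).
    by move=> w; rewrite half_sqr_dist.
  apply: L1B; first exact: L1_cst.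
  by apply/(L1_bounded P mcb) => w; exact: cos_abs_le1.
rewrite gE in up.
have gN : Ex P (fun w => - phi1 (b r w) * (drift r - n%:R * sin (b r w)) +
    - phi2 (b r w) * ((cos (b r w) - 1) ^+ 2 + (- sin (b r w)) ^+ 2) / 2) = - generator r.
  by rewrite -gE -ExN//; apply: eq_Ex => w; ring.
rewrite gN (ExN (iphi r1)) (ExN (iphi u1)) in dn.
by rewrite mulrN in dn; exact: ler_norm_of_sides up dn.
Qed.

(** The Euler step evaluates the generator at the left endpoint. For the derivative from the left
    that endpoint moves, and this continuity moves the generator back to [u]. *)
Let generator_holder : exists2 C : R, 0 <= C & forall r u, r < u -> u <= 1 -> u - r <= 1 ->
  `|generator u - generator r| <= C * Num.sqrt (u - r).
Proof.
have [C0 C00 incr] := path_increment_bound hZ beta_gt0 hb.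
pose A := `|lambda| * (beta / 4 * scale 1).
have beta4 : 0 < beta / 4 by rewrite divr_gt0.
have A0 : 0 <= A by rewrite mulr_ge0// mulr_ge0 ?(ltW beta4)// ltW// scale_gt0.
have hA v : v <= 1 -> `|drift v| <= A.
  move=> v1; rewrite /drift normrM ler_wpM2l// gtr0_norm ?mulr_gt0 ?scale_gt0//.
  by rewrite ler_wpM2l ?(ltW beta4)// scale_mono.
have n0 : 0 <= n%:R :> R by [].
pose C1 := K * (A + n%:R) + K * n%:R + K * 2 + K.
pose C2 := K * (A * (beta / 4)).
have C20 : 0 <= C2 by rewrite mulr_ge0// mulr_ge0// ltW.
have C10 : 0 <= C1 by rewrite /C1 !addr_ge0// mulr_ge0// addr_ge0.
have lip (p q p' q' a a' c : R) : `|p| <= a -> `|q'| <= a' -> `|p - p'| * a' + a * `|q - q'| <= c ->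
    `|p * q - p' * q'| <= c.
  move=> hp hq; apply: le_trans.
  have -> : p * q - p' * q' = (p - p') * q' + p * (q - q') by ring.
  apply: le_trans (ler_normD _ _) _; rewrite !normrM; apply: lerD.
    by rewrite ler_wpM2l.
  by rewrite ler_wpM2r.
pose psi u w := phi1 (b u w) * (drift u - n%:R * sin (b u w)) + phi2 (b u w) * (1 - cos (b u w)).
have ipsi u : u <= 1 -> L1 P (psi u).
  move=> u1; have mb := path_measurable hZ hb u.
  have msb : measurable_fun setT (fun w => sin (b u w)).
    exact: measurableT_comp (measurable_continuous (@continuous_sin R)) mb.
  have mcb : measurable_fun setT (fun w => cos (b u w)).
    exact: measurableT_comp (measurable_continuous (@continuous_cos R)) mb.
  apply: L1D; apply: (L1M_bounded (C := K)) => //; try exact: measurableT_comp.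
    apply: L1B; first exact: L1_cst.
    by apply/L1Z/(L1_bounded P msb) => w; exact: sin_abs_le1.
  apply: L1B; first exact: L1_cst.
  by apply/(L1_bounded P mcb) => w; exact: cos_abs_le1.
exists (C1 * Num.sqrt C0 + C2); first by rewrite addr_ge0// mulr_ge0// sqrtr_ge0.
move=> r u ru u1 ur1; have r1 : r <= 1 by exact: le_trans (ltW ru) u1.
have h0 : 0 < u - r by rewrite subr_gt0.
have [L e] := incr r u ru u1 ur1.
have pw w : `|psi u w - psi r w| <= C1 * `|b u w - b r w| + C2 * (u - r).
  set x := b r w; set y := b u w.
  have l1 : `|phi1 y - phi1 x| <= K * `|y - x| by exact: dv_global_lipschitz.
  have l2 : `|phi2 y - phi2 x| <= K * `|y - x| by exact: dv_global_lipschitz.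
  have ls := sin_lipschitz x y; have lc := cos_lipschitz x y.
  have ld : `|drift u - drift r| <= A * (beta / 4) * (u - r).
    rewrite (_ : drift u - drift r = lambda * (beta / 4 * (scale u - scale r))); last by rewrite /drift !mulrBr.
    rewrite (_ : A * (beta / 4) * (u - r) = `|lambda| * (beta / 4 * (beta / 4 * scale 1 * (u - r)))); last by rewrite /A; ring.
    rewrite normrM ler_wpM2l// normrM (gtr0_norm beta4) ler_wpM2l ?(ltW beta4)//.
    have := scale_lip beta_gt0 (ltW ru) u1.
    by [].
  have -> : psi u w - psi r w = (phi1 y * (drift u - n%:R * sin y) - phi1 x * (drift r - n%:R * sin x))
     + (phi2 y * (1 - cos y) - phi2 x * (1 - cos x)) by rewrite /psi -/x -/y; ring.
  apply: le_trans (ler_normD _ _) _.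
  have t0 : 0 <= `|y - x| by [].
  apply: (@le_trans _ _ ((K * `|y - x| * (A + n%:R) + K * (A * (beta / 4) * (u - r) + n%:R * `|y - x|)) +
     (K * `|y - x| * 2 + K * `|y - x|))); last first.
    by rewrite le_eqVlt; apply/orP; left; apply/eqP; rewrite /C1 /C2; ring.
  apply: lerD.
    apply: (lip _ _ _ _ K (A + n%:R)) => //.
      apply: le_trans (ler_normB _ _) _; apply: lerD; first exact: hA.
      by rewrite normrM ger0_norm// ler_piMr// sin_abs_le1.
    apply: lerD; first by rewrite ler_wpM2r// addr_ge0.
    rewrite ler_wpM2l//.
    have -> : drift u - n%:R * sin y - (drift r - n%:R * sin x) = (drift u - drift r) - n%:R * (sin y - sin x) by ring.
    apply: le_trans (ler_normB _ _) _; apply: lerD => //.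
    by rewrite normrM ger0_norm// ler_wpM2l.
  apply: (lip _ _ _ _ K 2) => //.
    by apply: le_trans (ler_normB _ _) _; rewrite normr1; have := cos_abs_le1 x; lra.
  apply: lerD; first by rewrite ler_wpM2r.
  rewrite ler_wpM2l// (_ : 1 - cos y - (1 - cos x) = - (cos y - cos x)); last by ring.
  by rewrite normrN.
have i1 : L1 P (fun w => C1 * `|b u w - b r w|) by apply/L1Z/L1_norm/L2_L1.
rewrite /generator -ExB; [|exact: ipsi|exact: ipsi].
have ipd : L1 P (fun w => psi u w - psi r w) by apply: L1B; exact: ipsi.
apply: le_trans (Ex_norm ipd) _.
apply: (@le_trans _ _ (Ex P (fun w => C1 * `|b u w - b r w| + C2 * (u - r)))).
  by apply: Ex_le => //; [exact: L1_norm|apply: L1D => //; exact: L1_cst].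
rewrite ExD//; last exact: L1_cst.
rewrite Ex_cst ExZ; last exact/L1_norm/L2_L1.
rewrite [leRHS]mulrDl -[in leRHS]mulrA; apply: lerD.
  rewrite ler_wpM2l//; apply: le_trans (Ex_norm_sqrt L) _.
  by rewrite -sqrtrM// ler_wsqrtr.
rewrite ler_wpM2l// -(@ler_pXn2r _ 2) ?nnegrE ?sqrtr_ge0 ?(ltW h0)// sqr_sqrtr ?(ltW h0)//.
by rewrite expr2 ler_piMl// ltW.
Qed.

(** Dynkin's formula in differential form. To the right of [u] it is the Euler step itself; to the
    left the generator at [v] is replaced by the one at [u] at the cost of one more
    [h ^ (3 / 2)]. *)
Lemma path_generator u : u < 1 -> dv (fun u => Ex P (fun w => phi (b u w))) u (generator u).
Proof.
move=> u1; have [C C0 st] := step; have [C' C'0 ho] := generator_holder.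
pose e := Num.min 1 (1 - u).
have e0 : 0 < e by rewrite lt_min ltr01 subr_gt0.
apply: (dv_of_bound (C := C + C') e0) => v; rewrite le_min => /andP[v1 v2].
have s0 : 0 <= `|v - u| * Num.sqrt `|v - u| by rewrite mulr_ge0 ?sqrtr_ge0.
have [vu|vu|->] := ltgtP v u; last by rewrite !subrr mul0r subr0 normr0 mul0r mulr0.
- have uv0 : 0 < u - v by rewrite subr_gt0.
  have vE : `|v - u| = u - v by rewrite distrC gtr0_norm.
  rewrite vE in v1 v2 s0 *.
  have := st v u vu (ltW u1) v1; have := ho v u vu (ltW u1) v1.
  set m := Ex P _; set m' := Ex P _ => h1 h2.
  have -> : m' - m - (v - u) * generator u = - (m - m' - (u - v) * generator v) + (u - v) * (generator u - generator v).
    by ring.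
  apply: le_trans (ler_normD _ _) _; rewrite normrN [leRHS]mulrDl; apply: lerD => //.
  by rewrite normrM (gtr0_norm uv0) mulrCA ler_wpM2l// ltW.
- have uv0 : 0 < v - u by rewrite subr_gt0.
  rewrite (gtr0_norm uv0) in v1 v2 s0 *.
  have v1' : v <= 1 by lra.
  apply: le_trans (st u v vu v1' v1) _.
  by rewrite ler_wpM2r// lerDl.
Qed.

End Smooth.

Definition cos_mean (k : nat) (u : R) : R := Ex P (fun w => cos (k%:R * b u w)).
Definition sin_mean (k : nat) (u : R) : R := Ex P (fun w => sin (k%:R * b u w)).

Lemma L1_cosk k u : L1 P (fun w => cos (k%:R * b u w)).
Proof.
apply: (@L1_bounded _ _ _ P 1); last by move=> w; exact: cos_abs_le1.
apply: (measurableT_comp (measurable_continuous (@continuous_cos R))).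
by apply: measurable_funM => //; exact: (path_measurable hZ hb u).
Qed.

Lemma L1_sink k u : L1 P (fun w => sin (k%:R * b u w)).
Proof.
apply: (@L1_bounded _ _ _ P 1); last by move=> w; exact: sin_abs_le1.
apply: (measurableT_comp (measurable_continuous (@continuous_sin R))).
by apply: measurable_funM => //; exact: (path_measurable hZ hb u).
Qed.

Let coef_bound (k j : nat) (t : R) : (j <= 3)%N -> `|t| <= 1 -> `|k%:R ^+ j * t| <= k.+1%:R ^+ 3.
Proof.
move=> j3 t1; rewrite normrM normrX ger0_norm//.
apply: (@le_trans _ _ (k%:R ^+ j)); first by rewrite ler_piMr// exprn_ge0.
apply: (@le_trans _ _ (k.+1%:R ^+ j)); first by rewrite lerXn2r ?nnegrE// ler_nat.
by rewrite ler_weXn2l// ler1n.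
Qed.

Lemma cos_mean_dv k u : u < 1 -> dv (cos_mean k.+1) u
  (- (k.+1%:R * drift u) * sin_mean k.+1 u - k.+1%:R ^+ 2 * cos_mean k.+1 u
   + k.+1%:R * (k.+1%:R - n%:R) / 2 * cos_mean k.+2 u
   + k.+1%:R * (k.+1%:R + n%:R) / 2 * cos_mean k u).
Proof.
move=> u1; set c : R := k.+1%:R.
have D1 x : dv (fun x => cos (c * x)) x (- (c * sin (c * x))).
  by apply: dv_eq (dv_cos c x) _; rewrite mulNr.
have D2 x : dv (fun x => - (c * sin (c * x))) x (- (c ^+ 2 * cos (c * x))).
  by apply: dv_eq (dvN (dvZ c (dv_sin c x))) _; ring.
have D3 x : dv (fun x => - (c ^+ 2 * cos (c * x))) x (c ^+ 3 * sin (c * x)).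
  by apply: dv_eq (dvN (dvZ (c ^+ 2) (dv_cos c x))) _; ring.
have B1 x : `|- (c * sin (c * x))| <= k.+2%:R ^+ 3.
  by rewrite normrN -{1}[c]expr1; apply: coef_bound => //; exact: sin_abs_le1.
have B2 x : `|- (c ^+ 2 * cos (c * x))| <= k.+2%:R ^+ 3.
  by rewrite normrN; apply: coef_bound => //; exact: cos_abs_le1.
have B3 x : `|c ^+ 3 * sin (c * x)| <= k.+2%:R ^+ 3.
  by apply: coef_bound => //; exact: sin_abs_le1.
apply: dv_eq (path_generator D1 D2 D3 B1 B2 B3 (fun v _ => L1_cosk k.+1 v) u1) _.
have i0 := L1_cosk k u; have i1 := L1_cosk k.+1 u; have i2 := L1_cosk k.+2 u; have j1 := L1_sink k.+1 u.
rewrite /cos_mean /sin_mean -!ExZ// -ExB ?L1Z//; try exact: L1Z.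
rewrite -ExD; [|by apply: L1B; exact: L1Z|exact: L1Z].
rewrite -ExD; [|by apply: L1D; [apply: L1B; exact: L1Z|exact: L1Z]|exact: L1Z].
apply: eq_Ex => w; set x := b u w; rewrite -/c.
have -> : k.+2%:R * x = c * x + x by rewrite -[k.+2%:R]natr1 -/c; ring.
have -> : k%:R * x = c * x - x by rewrite /c -[k.+1%:R]natr1; ring.
by rewrite cosD cosB; field.
Qed.

Lemma sin_mean_dv k u : u < 1 -> dv (sin_mean k.+1) u
  ((k.+1%:R * drift u) * cos_mean k.+1 u - k.+1%:R ^+ 2 * sin_mean k.+1 u
   + k.+1%:R * (k.+1%:R - n%:R) / 2 * sin_mean k.+2 u
   + k.+1%:R * (k.+1%:R + n%:R) / 2 * sin_mean k u).
Proof.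
move=> u1; set c : R := k.+1%:R.
have D1 x : dv (fun x => sin (c * x)) x (c * cos (c * x)) by exact: dv_sin.
have D2 x : dv (fun x => c * cos (c * x)) x (- (c ^+ 2 * sin (c * x))).
  by apply: dv_eq (dvZ c (dv_cos c x)) _; ring.
have D3 x : dv (fun x => - (c ^+ 2 * sin (c * x))) x (- (c ^+ 3 * cos (c * x))).
  by apply: dv_eq (dvN (dvZ (c ^+ 2) (dv_sin c x))) _; ring.
have B1 x : `|c * cos (c * x)| <= k.+2%:R ^+ 3.
  by rewrite -{1}[c]expr1; apply: coef_bound => //; exact: cos_abs_le1.
have B2 x : `|- (c ^+ 2 * sin (c * x))| <= k.+2%:R ^+ 3.
  by rewrite normrN; apply: coef_bound => //; exact: sin_abs_le1.
have B3 x : `|- (c ^+ 3 * cos (c * x))| <= k.+2%:R ^+ 3.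
  by rewrite normrN; apply: coef_bound => //; exact: cos_abs_le1.
apply: dv_eq (path_generator D1 D2 D3 B1 B2 B3 (fun v _ => L1_sink k.+1 v) u1) _.
have i0 := L1_sink k u; have i1 := L1_sink k.+1 u; have i2 := L1_sink k.+2 u; have j1 := L1_cosk k.+1 u.
rewrite /cos_mean /sin_mean -!ExZ// -ExB ?L1Z//; try exact: L1Z.
rewrite -ExD; [|by apply: L1B; exact: L1Z|exact: L1Z].
rewrite -ExD; [|by apply: L1D; [apply: L1B; exact: L1Z|exact: L1Z]|exact: L1Z].
apply: eq_Ex => w; set x := b u w; rewrite -/c.
have -> : k.+2%:R * x = c * x + x by rewrite -[k.+2%:R]natr1 -/c; ring.
have -> : k%:R * x = c * x - x by rewrite /c -[k.+1%:R]natr1; ring.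
by rewrite sinD sinB; field.
Qed.

End Generator.

(** * The linear system for the moments *)

Section Energy.
Context {R : realType}.
Variable n : nat.

Definition weight (k : nat) : R := 'C(2 * n, n + k)%:R / k%:R.

(* Row k of A_n applied to (x_1, ..., x_n), with x_0 kept as a boundary value: the
   e_n source term of the equation for q is the term x_0 = 1. *)
Definition recurrence (x : nat -> R) (k : nat) : R :=
  - k%:R ^+ 2 * x k + k%:R * (k%:R + n%:R) / 2 * x k.-1 + k%:R * (k%:R - n%:R) / 2 * x k.+1.

Definition wdot (x y : nat -> R) : R := \sum_(i < n) weight i.+1 * (x i.+1 * y i.+1).

Lemma weight_gt0 (i : 'I_n) : 0 < weight i.+1.
Proof.
rewrite /weight divr_gt0 ?ltr0n// bin_gt0 mul2n -addnn leq_add2l.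
exact: ltn_ord.
Qed.

(** After cancelling the indices this is the ratio of consecutive binomial coefficients
    ['C(2 * n, n + k.+1)] and ['C(2 * n, n + k.+2)]; beyond [n] both vanish. *)
Lemma weight_skew k : weight k.+2 * (k.+2%:R * (k.+2%:R + n%:R)) = weight k.+1 * (k.+1%:R * (n%:R - k.+1%:R)).
Proof.
rewrite /weight !mulrA divfK ?pnatr_eq0// divfK ?pnatr_eq0//.
have [nk|kn] := ltnP n k.+1.
  by rewrite !bin_small ?mul0r// mul2n -addnn ltn_add2l// ltnW.
rewrite -(natrD R k.+2 n) -(natrB R kn) -!natrM; congr (_ %:R).
by have := mul_bin_left (2 * n) (n + k.+1); rewrite mul2n -addnn subnDl -addnS mulnC addnC => ->; rewrite mulnC.
Qed.

(* For these weights the tridiagonal part of A_n off the diagonal is antisymmetric. *)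
Lemma wdot_recurrence x : x 0%N = 0 ->
  wdot x (recurrence x) = - \sum_(i < n) weight i.+1 * (i.+1%:R * x i.+1) ^+ 2.
Proof.
(* The off-diagonal terms form a telescoping sum of [t]. It vanishes at the left end because
   [x 0 = 0] and at the right end because [weight n.+1 = 0]. *)
move=> x0; pose t k := weight k.+1 * (k.+1%:R * (k.+1%:R + n%:R)) * (x k * x k.+1) / 2.
have e i : weight i.+1 * (x i.+1 * recurrence x i.+1) =
    - (weight i.+1 * (i.+1%:R * x i.+1) ^+ 2) - (t i.+1 - t i).
  by rewrite /t weight_skew /recurrence /=; field.
rewrite /wdot (eq_bigr _ (fun (i : 'I_n) _ => e i)) big_split/= !sumrN -[RHS]addr0; congr (_ + _).
rewrite -(big_mkord xpredT (fun i => t i.+1 - t i)) telescope_sumr// /t x0.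
have -> : weight n.+1 = 0 by rewrite /weight bin_small ?mul0r// mul2n -addnn ltn_add2l.
by rewrite !mul0r !mulr0 mul0r subr0 oppr0.
Qed.

Lemma A_mxE x : x 0%N = 0 -> A_mx R n *m (\col_(i < n) x i.+1) = \col_(i < n) recurrence x i.+1.
Proof.
move=> x0; apply/matrixP => i j; rewrite [LHS]mxE [RHS]mxE.
set k : R := i.+1%:R.
pose c (j : nat) := (j == i)%:R * (- k ^+ 2 * x i.+1) + (j.+1 == i)%:R * (k * (k + n%:R) / 2 * x i)
  + (j == i.+1)%:R * (k * (k - n%:R) / 2 * x i.+2).
rewrite (eq_bigr (fun j : 'I_n => c j)); last first.
  move=> l _; rewrite !mxE /c -/k.
  have [->|li] := eqVneq (l : nat) i.
    have -> : (i.+1 == i) = false by rewrite gtn_eqF.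
    have -> : (i == i.+1 :> nat) = false by rewrite ltn_eqF.
    by rewrite !mul0r !addr0 mul1r.
  rewrite mul0r add0r.
  have [<-|li1] := eqVneq l.+1 (i : nat).
    have -> : (l == l.+2 :> nat) = false by rewrite ltn_eqF.
    by rewrite mul1r mul0r addr0.
  by rewrite mul0r add0r; case: eqP => [->|]; rewrite ?mul1r ?mul0r.
rewrite !big_split/= -!mulr_suml /recurrence -/k /=.
congr (_ + _ + _).
- rewrite (bigD1 i)//= eqxx big1 ?addr0 ?mul1r// => l li.
  by case: eqP => // e; move: li; rewrite -val_eqE/= e eqxx.
- case: (posnP i) => [i0|i0].
    by rewrite big1 ?mul0r ?i0 ?x0 ?mulr0// => l _; rewrite i0.
  have hi : (i.-1 < n)%N by exact: leq_ltn_trans (leq_pred _) (ltn_ord i).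
  rewrite (bigD1 (Ordinal hi))//= prednK// eqxx big1 ?addr0 ?mul1r// => l li.
  by case: eqP => // e; move: li; rewrite -val_eqE/= -e eqxx.
- have [hi|hi] := ltnP i.+1 n.
    rewrite (bigD1 (Ordinal hi))//= eqxx big1 ?addr0 ?mul1r// => l li.
    by case: eqP => // e; move: li; rewrite -val_eqE/= e eqxx.
  have -> : k - n%:R = 0.
    by apply/eqP; rewrite subr_eq0 eqr_nat eqn_leq hi andbT.
  by rewrite !(mulr0, mul0r).
Qed.

(** The index 1, ..., n of a vector becomes a natural number, with boundary value [a] at 0 and the
    value 0 beyond [n], so that [recurrence] applies without range conditions. *)
Definition extend (a : R) (v : 'cV[R]_n) (k : nat) : R :=
  if k is i.+1 then oapp (fun o : 'I_n => v o ord0) 0 (insub i) else a.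

Lemma extendE a v (i : 'I_n) : extend a v i.+1 = v i ord0.
Proof. by rewrite /extend valK. Qed.

Lemma extend_col a v : \col_(i < n) extend a v i.+1 = v.
Proof. by apply/matrixP => i j; rewrite mxE (ord1 j); exact: extendE. Qed.

(** Pairing a kernel vector with itself in [wdot] gives a sum of two nonnegative terms equal to 0,
    and the second controls every coordinate. The transpose appears since [inj_row_free] speaks of
    row vectors. *)
Lemma shift_A_unit (j c : R) : 0 <= j -> 0 < c -> (j%:M - c *: A_mx R n) \in unitmx.
Proof.
move=> j0 c0; rewrite -unitmx_tr -row_free_unit; apply: inj_row_free => v.
move=> /(congr1 trmx); rewrite trmx_mul trmxK trmx0.
set y := v^T => h; apply: trmx_inj; rewrite -/y trmx0.
pose x := extend 0 y.
have hx (i : 'I_n) : j * x i.+1 = c * recurrence x i.+1.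
  have := congr1 (fun M : 'cV[R]_n => M i ord0) h.
  rewrite -(extend_col 0 y) -/x mulmxBl -scalemxAl A_mxE// mul_scalar_mx !mxE => /eqP.
  by rewrite subr_eq0 => /eqP.
have e : j * wdot x x + c * \sum_(i < n) weight i.+1 * (i.+1%:R * x i.+1) ^+ 2 = 0.
  have := wdot_recurrence (erefl : x 0%N = 0) => /(congr1 (fun z => - (c * z))).
  rewrite mulrN opprK => <-; rewrite /wdot !mulr_sumr -sumrN -big_split/= big1// => i _.
  have := hx i => hi; rewrite mulrCA [j * _]mulrA hi mulrCA; ring.
have w0 (i : 'I_n) : 0 <= weight i.+1 * (i.+1%:R * x i.+1) ^+ 2.
  by rewrite mulr_ge0 ?sqr_ge0// ltW// weight_gt0.
have s0 : \sum_(i < n) weight i.+1 * (i.+1%:R * x i.+1) ^+ 2 = 0.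
  have p1 : 0 <= j * wdot x x.
    rewrite mulr_ge0// sumr_ge0// => i _; rewrite -expr2 mulr_ge0 ?sqr_ge0//.
    by rewrite ltW// weight_gt0.
  have p2 : 0 <= \sum_(i < n) weight i.+1 * (i.+1%:R * x i.+1) ^+ 2 by exact: sumr_ge0.
  have := mulr_ge0 (ltW c0) p2; move: e; set s := \sum_(i < n) _ => e p3.
  have : c * s = 0 by lra.
  by move/eqP; rewrite mulf_eq0 gt_eqF// => /eqP.
apply/matrixP => i o; rewrite [RHS]mxE (ord1 o) -(extendE 0 y i) -/x.
have /eqP := psumr_eq0P (fun (i : 'I_n) _ => w0 i) s0 (i := i) isT.
rewrite mulf_eq0 (gt_eqF (weight_gt0 i)) /= expf_eq0/= mulf_eq0 pnatr_eq0/=.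
by move/eqP.
Qed.

Lemma A_mx_unit : A_mx R n \in unitmx.
Proof.
have := shift_A_unit (lexx 0) ltr01.
by rewrite scale1r (_ : 0%:M = 0) ?raddf0// sub0r -scaleN1r unitmxZ// unitrN1.
Qed.

(** Hence [s_0] is the vector of ones, the value of [q] at [lambda = 0], where alpha is 0. Only the
    first row misses its left neighbour, which produces the right-hand side. *)
Lemma A_mx_ones : A_mx R n *m const_mx 1 = - (n.+1%:R / 2) *: e_vec R n.
Proof.
pose x (k : nat) : R := (0 < k)%:R.
have -> : const_mx 1 = \col_(i < n) x i.+1 by apply/matrixP => i j; rewrite !mxE.
rewrite A_mxE//; apply/matrixP => i j; rewrite !mxE /recurrence /x /= mulr1 mulr1.
case: (nat_of_ord i) => [|k] /=; first by rewrite -[n.+1%:R]natr1; field.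
by field.
Qed.

End Energy.

Section Coefficients.
Context {R : realType}.
Variables (beta : R) (n : nat).
Hypothesis beta_gt0 : 0 < beta.

(** The vectors [s_vec] without their powers of ['i] (see [s_vecE]); they are real, so that the
    energy estimate takes place over [R]. *)
Fixpoint series_vec (j : nat) : 'cV[R]_n :=
  if j is j'.+1 then invmx (j%:R%:M - (4 / beta) *: A_mx R n) *m B_mx R n *m series_vec j'
  else const_mx 1.

Let c0 : 0 < 4 / beta. Proof. by rewrite divr_gt0. Qed.

Lemma map_A_mx : map_mx (real_complex R) (A_mx R n) = A_mx R[i] n.
Proof.
apply/matrixP => i j; rewrite !mxE /=.
by case: (_ == _); [|case: (_ == _); [|case: (_ == _)]]; rewrite -/(real_complex R _) ?rmorph0// ?rmorphN ?rmorphXn !(rmorphM, rmorphD, rmorphN, fmorphV, rmorph_nat).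
Qed.

Lemma map_B_mx : map_mx (real_complex R) (B_mx R n) = B_mx R[i] n.
Proof. by apply/matrixP => i j; rewrite !mxE rmorphMn/= rmorph_nat. Qed.

Lemma map_e_vec : map_mx (real_complex R) (e_vec R n) = e_vec R[i] n.
Proof. by apply/matrixP => i j; rewrite !mxE rmorph_nat. Qed.

Lemma s_vecE j : s_vec beta n j = 'i ^+ j *: map_mx (real_complex R) (series_vec j).
Proof.
elim: j => [|j IH] /=.
  rewrite expr0 scale1r -map_e_vec -map_A_mx -map_invmx -map_mxM.
  have -> : - (n.+1%:R / 2) = real_complex R (- (n.+1%:R / 2)).
    by rewrite !(rmorphN, rmorphM, fmorphV, rmorph_nat).
  rewrite -map_mxZ; congr map_mx.
  by rewrite scalemxAr -A_mx_ones mulKmx// A_mx_unit.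
rewrite IH -map_A_mx -map_B_mx -map_mxZ.
have -> : (j.+1%:R%:M : 'M[R[i]]_n) = map_mx (real_complex R) j.+1%:R%:M.
  by rewrite map_scalar_mx rmorph_nat.
rewrite -map_mxB -map_invmx -map_mxM -scalemxAr scalerA -exprS -map_mxM.
by [].
Qed.

Lemma series_vec_rec j :
  j.+1%:R *: series_vec j.+1 - (4 / beta) *: (A_mx R n *m series_vec j.+1) = B_mx R n *m series_vec j.
Proof.
have e : series_vec j.+1 = invmx (j.+1%:R%:M - (4 / beta) *: A_mx R n) *m (B_mx R n *m series_vec j).
  by rewrite mulmxA.
have u := shift_A_unit n (ler0n R j.+1) c0.
by rewrite -[RHS](mulKVmx u) -e mulmxBl mul_scalar_mx -[in RHS]scalemxAl.
Qed.

Arguments extend : simpl never.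

(** The index [k = 0] stands for the constant moment 1: coefficient 1 in order 0 and coefficient 0
    in every higher order. *)
Definition series_coef (j k : nat) : R := extend (j == 0%N)%:R (series_vec j) k.

Arguments series_coef : simpl never.

Lemma series_coef0 k : (k <= n)%N -> series_coef 0 k = 1.
Proof.
case: k => [|k] // kn; rewrite /series_coef -[k]/(nat_of_ord (Ordinal kn)) extendE.
by rewrite mxE.
Qed.

Lemma series_coef_rec j (i : 'I_n) :
  j.+1%:R * series_coef j.+1 i.+1 =
  4 / beta * recurrence n (series_coef j.+1) i.+1 + i.+1%:R * series_coef j i.+1.
Proof.
rewrite /series_coef; move: (series_vec_rec j); rewrite -/(series_vec j.+1).
move: (series_vec j.+1) (series_vec j) => x y.
move=> /(congr1 (fun M : 'cV[R]_n => M i ord0)).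
rewrite -{2}(extend_col 0 x) A_mxE// !mxE (bigD1 i)//= big1 ?addr0; last first.
  by move=> k ki; rewrite !mxE eq_sym (negbTE ki) mulr0n mul0r.
rewrite !mxE eqxx mulr1n !extendE => <-.
by rewrite [RHS]addrC subrK.
Qed.

Lemma recurrence_series_coef0 (i : 'I_n) : recurrence n (series_coef 0) i.+1 = 0.
Proof.
have [hi|hi] := ltnP i.+1 n.
  by rewrite /recurrence !series_coef0 ?(ltnW (ltn_ord i))//; field.
(* In the last row the right neighbour is 0 instead of 1, but its factor [k - n] vanishes. *)
rewrite /recurrence (series_coef0 (ltn_ord i)) (series_coef0 (ltnW (ltn_ord i))).
have -> : i.+1 = n by apply/eqP; rewrite eqn_leq hi andbT.
by rewrite subrr mulr0 !mul0r addr0; field.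
Qed.

(** Pair the recursion with the new coefficient vector: the [A_n] term is nonpositive and is
    dropped, and Young's inequality with weight [j.+1] splits the [B_n] term, whose entries are at
    most [n]. *)
Lemma wdot_series_coef j : wdot n (series_coef j.+1) (series_coef j.+1) <=
  (n%:R / j.+1%:R) ^+ 2 * wdot n (series_coef j) (series_coef j).
Proof.
set x := series_coef j.+1; set y := series_coef j.
have J0 : 0 < j.+1%:R :> R by rewrite ltr0n.
have E : j.+1%:R * wdot n x x = 4 / beta * wdot n x (recurrence n x) +
    \sum_(i < n) weight n i.+1 * (i.+1%:R * x i.+1 * y i.+1).
  rewrite /wdot !mulr_sumr -big_split; apply: eq_bigr => i _; rewrite [RHS]/=.
  have := series_coef_rec j i; rewrite -/x -/y => h.
  by rewrite mulrCA [j.+1%:R * _]mulrA h; move: (recurrence _ _ _) (x _) (y _) (weight _ _) => *; ring.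
have e1 : 4 / beta * wdot n x (recurrence n x) <= 0.
  rewrite wdot_recurrence// mulrN oppr_le0 mulr_ge0 ?(ltW c0)// sumr_ge0// => i _.
  by rewrite mulr_ge0 ?sqr_ge0// ltW// weight_gt0.
have e2 : \sum_(i < n) weight n i.+1 * (i.+1%:R * x i.+1 * y i.+1) <=
   j.+1%:R / 2 * wdot n x x + n%:R ^+ 2 / (2 * j.+1%:R) * wdot n y y.
  rewrite /wdot !mulr_sumr -big_split; apply: ler_sum => i _ /=.
  have := @weight_gt0 R n i; move: (weight n i.+1) => w w0.
  have i0 : 0 <= i.+1%:R :> R by [].
  have ni : i.+1%:R ^+ 2 <= n%:R ^+ 2 :> R by rewrite lerXn2r ?nnegrE// ler_nat.
  rewrite [X in _ <= X + _]mulrCA [X in _ <= _ + X]mulrCA -mulrDr ler_wpM2l ?(ltW w0)//.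
  move: (x i.+1) (y i.+1) (i.+1%:R : R) (j.+1%:R : R) J0 i0 ni => a b k J J0 k0 kn.
  apply: (@le_trans _ _ (J / 2 * (a * a) + k ^+ 2 / (2 * J) * (b * b))).
    rewrite -subr_ge0 (_ : _ - _ = (J * a - k * b) ^+ 2 / (2 * J)); last first.
      by field; rewrite gt_eqF.
    by rewrite divr_ge0 ?sqr_ge0// mulr_ge0// ltW.
  rewrite lerD2l ler_wpM2r -?expr2 ?sqr_ge0// ler_wpM2r// invr_ge0.
  by rewrite mulr_ge0// ltW.
move: (wdot n x x) (wdot n y y) E e1 e2 => a b E e1 e2.
have h : j.+1%:R * a <= j.+1%:R / 2 * a + n%:R ^+ 2 / (2 * j.+1%:R) * b by rewrite E -[leRHS]add0r; exact: lerD.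
have h2 : j.+1%:R / 2 * a <= n%:R ^+ 2 / (2 * j.+1%:R) * b.
  by move: h; rewrite -lerBlDl (_ : _ - _ = j.+1%:R / 2 * a); last by field.
have k0 : 0 <= 2 / j.+1%:R :> R by rewrite divr_ge0// ltW.
have := ler_wpM2l k0 h2.
by congr (_ <= _); field; rewrite gt_eqF.
Qed.

Lemma series_coef_bound j : wdot n (series_coef j) (series_coef j) <=
  (n%:R ^+ j / j`!%:R) ^+ 2 * wdot n (series_coef 0) (series_coef 0).
Proof.
elim: j => [|j IH]; first by rewrite expr0 fact0 divr1 expr1n mul1r.
apply: le_trans (wdot_series_coef j) _.
apply: le_trans (ler_wpM2l (sqr_ge0 _) IH) _.
rewrite mulrA -exprMn le_eqVlt; apply/orP; left; apply/eqP; congr (_ ^+ 2 * _).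
by rewrite factS natrM exprS invfM; ring.
Qed.

End Coefficients.
Arguments series_coef : simpl never.

(** * Truncated series and the energy estimate *)

Section PowerSeries.
Context {R : realType}.
Variables (beta : R) (n : nat).
Hypothesis beta_gt0 : 0 < beta.
Local Notation scale := (scale beta).
Local Notation coef := (series_coef beta n).

Definition Re_i (j : nat) : R := complex.Re ('i%C ^+ j : R[i]).
Definition Im_i (j : nat) : R := complex.Im ('i%C ^+ j : R[i]).

Lemma Re_iS j : Re_i j.+1 = - Im_i j.
Proof. by rewrite /Re_i /Im_i exprS Re_mul /= mul0r mul1r sub0r. Qed.

Lemma Im_iS j : Im_i j.+1 = Re_i j.
Proof. by rewrite /Re_i /Im_i exprS Im_mul /= mul0r mul1r add0r. Qed.

Lemma Re_i_sqr j : Re_i j ^+ 2 + Im_i j ^+ 2 = 1.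
Proof.
elim: j => [|j IH]; first by rewrite /Re_i /Im_i expr0 /= expr1n expr0n addr0.
by rewrite Re_iS Im_iS sqrrN addrC.
Qed.

Definition partial_sum (c : nat -> R) (m k : nat) (y : R) : R :=
  \sum_(j < m.+1) c j * coef j k * y ^+ j.

Lemma partial_sum0 c m y : partial_sum c m 0 y = c 0%N.
Proof.
rewrite /partial_sum big_ord_recl /= expr0 !mulr1 big1 ?addr0// => j _.
by rewrite /series_coef /= mulr0 mul0r.
Qed.

Lemma recurrence_sum (N : nat) (x : nat -> nat -> R) k :
  recurrence n (fun k => \sum_(j < N) x j k) k = \sum_(j < N) recurrence n (x j) k.
Proof. by rewrite /recurrence !big_split/= -!mulr_sumr. Qed.

Lemma recurrenceZ a x k : recurrence n (fun k => a * x k) k = a * recurrence n x k :> R.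
Proof. by rewrite /recurrence; ring. Qed.

Lemma recurrenceB x y k : recurrence n (fun k => x k - y k) k = recurrence n x k - recurrence n y k :> R.
Proof. by rewrite /recurrence; ring. Qed.

(** The square root of the energy bound at order [m], read off in one coordinate (hence the division
    by its weight), with [series_coef_bound] inserted for the coefficients. *)
Definition truncation_error (i : 'I_n) (m : nat) (y : R) : R :=
  Num.sqrt ((beta / 4 * n%:R) ^+ 2 * wdot n (coef 0) (coef 0) / weight n i.+1) *
  ((n%:R * `|y|) ^+ m / m`!%:R * `|y|).

Lemma truncation_error_cvg i y : truncation_error i m y @[m --> \oo] --> (0 : R).
Proof.
rewrite -(mulr0 (Num.sqrt ((beta / 4 * n%:R) ^+ 2 * wdot n (coef 0) (coef 0) / weight n i.+1))).
apply: cvgM; first exact: cvg_cst.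
rewrite -(mul0r `|y|); apply: cvgM; last exact: cvg_cst.
exact: cvg_series_cvg_0 (is_cvg_series_exp_coeff (n%:R * `|y|)).
Qed.

Lemma truncation_error_mono i m x y : `|x| <= `|y| -> truncation_error i m x <= truncation_error i m y.
Proof.
move=> xy; rewrite ler_wpM2l ?sqrtr_ge0//; apply: ler_pM; [|by []| |by []].
  by rewrite divr_ge0// exprn_ge0// mulr_ge0.
rewrite ler_wpM2r ?invr_ge0// lerXn2r ?nnegrE ?mulr_ge0//.
  by rewrite ler_wpM2l.
Qed.

Lemma partial_sum_continuous c m k : continuous (partial_sum c m k).
Proof.
apply: dv_all_continuous => y.
exact: (dv_sum (n := m.+1) (fun j _ => dvZ (c j * coef j k) (dvX j (dv_id y)))).
Qed.

(** A locally uniform limit of polynomials: [truncation_error] is monotone in [|y|], so its value at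
    [|y| + 1] serves the whole unit ball around [y]. *)
Lemma limit_continuous (Q : R -> R) c (i : 'I_n) :
  (forall m y, `|Q y - partial_sum c m i.+1 y| <= truncation_error i m y) -> continuous Q.
Proof.
move=> h y; apply/cvgrPdist_lt => e e0.
have /cvgrPdist_lt/(_ (e / 3)) := truncation_error_cvg i (`|y| + 1).
rewrite divr_gt0// => /(_ isT) [m _ /(_ m (leqnn m))]; rewrite sub0r normrN => hm.
have E z : `|z| <= `|y| + 1 -> `|Q z - partial_sum c m i.+1 z| < e / 3.
  move=> hz; apply: le_lt_trans (h m z) (le_lt_trans _ (le_lt_trans (ler_norm _) hm)).
  by apply: truncation_error_mono; rewrite [leRHS]ger0_norm// addr_ge0.
have /cvgrPdist_lt/(_ (e / 3)) := @partial_sum_continuous c m i.+1 y.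
rewrite divr_gt0// => /(_ isT); have := nbhsx_ballx y (1 : R) ltr01.
apply: filterS2 => z /= hz1 hz2.
have e1 : `|Q y - partial_sum c m i.+1 y| < e / 3 by apply: E; rewrite lerDl.
have e2 : `|Q z - partial_sum c m i.+1 z| < e / 3.
  apply: E; rewrite -(subrK y z) addrC; apply: le_trans (ler_normD _ _) _.
  by rewrite lerD2l distrC ltW.
have -> : Q y - Q z = (Q y - partial_sum c m i.+1 y) - (Q z - partial_sum c m i.+1 z) +
   (partial_sum c m i.+1 y - partial_sum c m i.+1 z) by ring.
apply: le_lt_trans (ler_normD _ _) _; apply: le_lt_trans (lerD (ler_normB _ _) (lexx _)) _.
move: e1 e2 hz2; move: `|_| `|_| `|_| => p q t *; lra.
Qed.

Section Solution.
Variable lambda : R.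
Let y u := lambda * scale u.

Lemma scaled_pow_dv j u : dv (fun u => y u ^+ j) u (j%:R * (beta / 4) * y u ^+ j).
Proof.
apply: dv_eq (dvX j (dvZ lambda (scale_dv beta u))) _.
by case: j => [|j]; rewrite ?mul0r//= exprS /y; ring.
Qed.

(** The recursion of the coefficients matches the orders pairwise, so the truncated series solves
    the system up to one defect of order [m.+1] in [y], the image of its last term. *)
Lemma partial_sum_dv c m (i : 'I_n) u : dv (fun u => partial_sum c m i.+1 (y u)) u
  (recurrence n (fun k => partial_sum c m k (y u)) i.+1 +
   i.+1%:R * (beta / 4 * y u) * (partial_sum (fun j => c j.+1) m i.+1 (y u) - c m.+1 * coef m i.+1 * y u ^+ m)).
Proof.
have D := dv_sum (n := m.+1) (fun j _ => dvZ (c j * coef j i.+1) (scaled_pow_dv j u)).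
apply: dv_eq D _; rewrite /partial_sum (recurrence_sum m.+1 (fun j k => c j * coef j k * y u ^+ j)).
have -> : \sum_(j < m.+1) recurrence n (fun k => c j * coef j k * y u ^+ j) i.+1 =
   \sum_(j < m.+1) c j * y u ^+ j * recurrence n (coef j) i.+1.
  by apply: eq_bigr => j _; rewrite -recurrenceZ /recurrence; ring.
rewrite [X in _ * (X - _)]big_ord_recr/= addrK [LHS]big_ord_recl [X in _ = X + _]big_ord_recl/=.
rewrite recurrence_series_coef0 !mul0r !mulr0 !add0r mulr_sumr -big_split/=.
apply: eq_bigr => j _; rewrite /bump leq0n add1n.
have := series_coef_rec beta_gt0 j i; move: (recurrence _ _ _) (coef j.+1 _) (coef j _) => p q r h.
have -> : q = (4 / beta * p + i.+1%:R * r) / j.+1%:R by rewrite -h mulrC mulKf// pnatr_eq0.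
have J0 : j.+1%:R != 0 :> R by rewrite pnatr_eq0.
by move: (j.+1%:R : R) J0 => J J0; rewrite exprS; field; rewrite J0 gt_eqF.
Qed.

Variables c s : nat -> R -> R.
Hypothesis c0 : forall u, c 0 u = 1.
Hypothesis s0 : forall u, s 0 u = 0.
Hypothesis c1 : forall k u, `|c k u| <= 1.
Hypothesis s1 : forall k u, `|s k u| <= 1.
Hypothesis dc : forall k u, u < 1 -> dv (c k.+1) u
  (recurrence n (c^~ u) k.+1 - k.+1%:R * (beta / 4 * y u) * s k.+1 u).
Hypothesis ds : forall k u, u < 1 -> dv (s k.+1) u
  (recurrence n (s^~ u) k.+1 + k.+1%:R * (beta / 4 * y u) * c k.+1 u).

Section Error.
Variable m : nat.
(** [a] and [b] are the errors of the truncated cosine and sine series; [e] is the defect, up to the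
    factors [Re_i m.+1] and [Im_i m.+1]. *)
Let a k u := c k u - partial_sum Re_i m k (y u).
Let b k u := s k u - partial_sum Im_i m k (y u).
Let e k u := k%:R * (beta / 4 * y u) * (coef m k * y u ^+ m).

Let da (i : 'I_n) u : u < 1 -> dv (a i.+1) u
  (recurrence n (a^~ u) i.+1 - i.+1%:R * (beta / 4 * y u) * b i.+1 u + Re_i m.+1 * e i.+1 u).
Proof.
move=> u1; apply: dv_eq (dvB (dc i u1) (partial_sum_dv Re_i m i u)) _.
have -> : partial_sum (fun j => Re_i j.+1) m i.+1 (y u) = - partial_sum Im_i m i.+1 (y u).
  by rewrite /partial_sum -sumrN; apply: eq_bigr => j _; rewrite Re_iS; ring.
by rewrite /a recurrenceB /e /b; ring.
Qed.

Let db (i : 'I_n) u : u < 1 -> dv (b i.+1) u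
  (recurrence n (b^~ u) i.+1 + i.+1%:R * (beta / 4 * y u) * a i.+1 u + Im_i m.+1 * e i.+1 u).
Proof.
move=> u1; apply: dv_eq (dvB (ds i u1) (partial_sum_dv Im_i m i u)) _.
have -> : partial_sum (fun j => Im_i j.+1) m i.+1 (y u) = partial_sum Re_i m i.+1 (y u).
  by rewrite /partial_sum; apply: eq_bigr => j _; rewrite Im_iS.
by rewrite /b recurrenceB /e /a; ring.
Qed.

Let V u : R := \sum_(i < n) weight n i.+1 * (a i.+1 u ^+ 2 + b i.+1 u ^+ 2).
Let C : R := (beta / 4 * n%:R) ^+ 2 * wdot n (coef m) (coef m).

(** The coupling of [a] and [b] is antisymmetric and cancels. The recurrence contributes at most
    [- 2 * V] because [k >= 1], and Young's inequality spends [V] on the defect, the squares of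
    [Re_i] and [Im_i] adding up to 1. *)
Let dV u : u < 1 -> exists2 l, dv V u l & l <= - V u + C * y u ^+ m.+1 ^+ 2.
Proof.
move=> u1.
pose a' k := recurrence n (a^~ u) k.+1 - k.+1%:R * (beta / 4 * y u) * b k.+1 u + Re_i m.+1 * e k.+1 u.
pose b' k := recurrence n (b^~ u) k.+1 + k.+1%:R * (beta / 4 * y u) * a k.+1 u + Im_i m.+1 * e k.+1 u.
pose l k := weight n k.+1 * (2 * a k.+1 u * a' k + 2 * b k.+1 u * b' k).
have D : dv V u (\sum_(k < n) l k).
  apply: (dv_sum (F := fun k u => weight n k.+1 * (a k.+1 u ^+ 2 + b k.+1 u ^+ 2))) => k kn; rewrite /l.
  have A := da (Ordinal kn) u1; have B := db (Ordinal kn) u1.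
  apply: dv_eq (dvZ (weight n k.+1) (dvD (dvX 2 A) (dvX 2 B))) _.
  by rewrite /a' /b' /= !expr1.
exists (\sum_(k < n) l k) => //.
have a0 : a 0 u = 0 by rewrite /a c0 partial_sum0 /Re_i expr0 /= subrr.
have b0 : b 0 u = 0 by rewrite /b s0 partial_sum0 /Im_i expr0 /= subrr.
pose S (x : nat -> R) := \sum_(i < n) weight n i.+1 * (i.+1%:R * x i.+1) ^+ 2.
have wle (x : nat -> R) : \sum_(i < n) weight n i.+1 * x i.+1 ^+ 2 <= S x.
  apply: ler_sum => i _; rewrite ler_wpM2l ?(ltW (weight_gt0 i))//.
  by rewrite exprMn ler_peMl ?sqr_ge0// expr_ge1 ?ler1n// ler0n.
have h1 : \sum_(k < n) l k <= 2 * wdot n (a^~ u) (recurrence n (a^~ u)) + 2 * wdot n (b^~ u) (recurrence n (b^~ u))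
    + V u + \sum_(i < n) weight n i.+1 * e i.+1 u ^+ 2.
  rewrite /wdot /V !mulr_sumr -!big_split /=; apply: ler_sum => i _.
  rewrite /l /a' /b'; have := weight_gt0 (R := R) i; move: (weight n i.+1) => w w0.
  move: (recurrence _ _ _) (recurrence _ _ _) => ra rb.
  move: (a i.+1 u) (b i.+1 u) (e i.+1 u) (i.+1%:R * (beta / 4 * y u)) => A B E k.
  have := Re_i_sqr m.+1; move: (Re_i m.+1) (Im_i m.+1) => p q pq.
  rewrite -subr_ge0 (_ : _ - _ = w * ((A - p * E) ^+ 2 + (B - q * E) ^+ 2 + (1 - (p ^+ 2 + q ^+ 2)) * E ^+ 2)); last by ring.
  by rewrite pq subrr mul0r addr0 mulr_ge0 ?(ltW w0)// addr_ge0 ?sqr_ge0.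
have h2 : \sum_(i < n) weight n i.+1 * e i.+1 u ^+ 2 <= C * y u ^+ m.+1 ^+ 2.
  rewrite /C /wdot mulrAC mulr_sumr; apply: ler_sum => i _.
  have -> : weight n i.+1 * e i.+1 u ^+ 2 =
     ((beta / 4 * y u ^+ m.+1) ^+ 2 * (weight n i.+1 * (coef m i.+1 * coef m i.+1))) * i.+1%:R ^+ 2.
    by rewrite /e [y u ^+ m.+1]exprS; ring.
  have -> : (beta / 4 * n%:R) ^+ 2 * y u ^+ m.+1 ^+ 2 * (weight n i.+1 * (coef m i.+1 * coef m i.+1)) =
     ((beta / 4 * y u ^+ m.+1) ^+ 2 * (weight n i.+1 * (coef m i.+1 * coef m i.+1))) * n%:R ^+ 2 by ring.
  rewrite ler_wpM2l ?lerXn2r ?nnegrE// ?ler_nat//.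
  by rewrite mulr_ge0 ?sqr_ge0// -expr2 mulr_ge0 ?sqr_ge0// ltW// weight_gt0.
have h3 : V u <= S (a^~ u) + S (b^~ u).
  rewrite /V (eq_bigr (fun i : 'I_n => weight n i.+1 * a i.+1 u ^+ 2 + weight n i.+1 * b i.+1 u ^+ 2)); last first.
    by move=> i _; rewrite mulrDr.
  by rewrite big_split/=; apply: lerD; exact: wle.
have V0 : 0 <= V u.
  apply: sumr_ge0 => i _; rewrite mulr_ge0 ?addr_ge0 ?sqr_ge0//.
  by rewrite ltW// weight_gt0.
rewrite (wdot_recurrence n (x := a^~ u) a0) (wdot_recurrence n (x := b^~ u) b0) in h1.
move: h1; rewrite -/(S (a^~ u)) -/(S (b^~ u)).
move: (S _) (S _) (\sum_(i < n) _) (\sum_(i < n) _) h2 h3 V0 => A B E L.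
by move: (C * _) (V u) => Cy v h2 h3 v0 h1; lra.
Qed.

Let Vbound : exists M, forall u, u <= 0 -> V u <= M.
Proof.
pose B c k := \sum_(j < m.+1) `|c j * coef j k| * `|lambda| ^+ j.
have hB cc k u : u <= 0 -> `|partial_sum cc m k (y u)| <= B cc k.
  move=> u0; apply: le_trans (ler_norm_sum _ _ _) _; apply: ler_sum => j _.
  rewrite normrM ler_wpM2l// normrX lerXn2r ?nnegrE//.
  rewrite /y normrM ler_piMr// ger0_norm ?(ltW (scale_gt0 _ _))//.
  by apply: le_trans (scale_mono beta_gt0 u0) _; rewrite /scale mulr0 expR0.
exists (\sum_(i < n) weight n i.+1 * ((1 + B Re_i i.+1) ^+ 2 + (1 + B Im_i i.+1) ^+ 2)) => u u0.
apply: ler_sum => i _; rewrite ler_wpM2l ?(ltW (weight_gt0 i))//.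
have q (z t : R) : `|z| <= t -> z ^+ 2 <= t ^+ 2.
  by move=> h; rewrite -(real_normK (num_real z)) lerXn2r// nnegrE (le_trans _ h).
by apply: lerD; apply: q; apply: le_trans (ler_normB _ _) _; apply: lerD => //; exact: hB.
Qed.

(** Gronwall started at [-oo]: [g] is nonincreasing, since the subtracted term grows with [u], and
    [V] is bounded for [u <= 0], so [g r] is at most [expR r * M], which tends to 0. *)
Lemma energy_bound u : u < 1 -> V u <= C * (y u ^+ m.+1) ^+ 2.
Proof.
move=> u1; have [M hM] := Vbound.
pose g u := expR u * (V u - C * (y u ^+ m.+1) ^+ 2).
have C0 : 0 <= C.
  rewrite /C mulr_ge0 ?sqr_ge0// sumr_ge0// => i _; rewrite -expr2 mulr_ge0 ?sqr_ge0//.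
  by rewrite ltW// weight_gt0.
have gdec r : r <= u -> g u <= g r.
  move=> ru.
  have [l hl] : exists l : R -> R, forall x, x <= u -> dv V x (l x) /\ l x <= - V x + C * y x ^+ m.+1 ^+ 2.
    have /choice[l hl] : forall x, exists l, x <= u -> dv V x l /\ l <= - V x + C * y x ^+ m.+1 ^+ 2.
      move=> x; have [xu|xu] := leP x u; last by exists 0.
      by have [l d1 d2] := dV (le_lt_trans xu u1); exists l.
    by exists l.
  pose g1 x := expR x * (V x - C * (y x ^+ m.+1) ^+ 2) + expR x * (l x - C * (2 * (m.+1%:R * (beta / 4)) * (y x ^+ m.+1) ^+ 2)).
  apply: (dv_nonincreasing (f1 := g1)) ru.
    move=> x /andP[_ xu]; have [d1 _] := hl x xu.
    have := dvM (is_derive_expR x) (dvB d1 (dvZ C (dvX 2 (scaled_pow_dv m.+1 x)))).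
    by move=> d2; apply: dv_eq d2 _; rewrite /g1 /= expr1; ring.
  move=> x /andP[_ xu]; have [_ le] := hl x xu.
  rewrite /g1 -mulrDr pmulr_rle0 ?expR_gt0//.
  have p0 : 0 <= C * (2 * (m.+1%:R * (beta / 4)) * (y x ^+ m.+1) ^+ 2).
    by rewrite mulr_ge0// mulr_ge0 ?sqr_ge0// mulr_ge0// mulr_ge0// divr_ge0// ltW.
  by lra.
have gle r : r <= u -> r <= 0 -> g u <= expR r * M.
  move=> ru r0; apply: le_trans (gdec r ru) _; rewrite ler_wpM2l ?expR_ge0//.
  by apply: le_trans (hM r r0); rewrite gerBl mulr_ge0// sqr_ge0.
rewrite -subr_le0 -(pmulr_rle0 _ (expR_gt0 u)) -/(g u).
rewrite leNgt; apply/negP => g0.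
have M0 : 0 < M.
  have := gle (Num.min u 0); rewrite !ge_min !lexx orbT /= => /(_ isT isT) h.
  by move: (lt_le_trans g0 h); rewrite pmulr_rgt0// expR_gt0.
(* So far to the left that [expR r * M] is at most half of the supposedly positive [g u]. *)
pose r := Num.min (Num.min u 0) (ln (g u / (2 * M))).
have := gle r; rewrite !ge_min !lexx !orbT /= => /(_ isT isT) h.
have : expR r * M <= g u / 2.
  rewrite -ler_pdivlMr// (_ : g u / 2 / M = g u / (2 * M)); last by rewrite invfM mulrA.
  rewrite -[leRHS]lnK ?posrE ?divr_gt0// ?mulr_gt0// ler_expR.
  by rewrite ge_min lexx orbT.
by move=> /(le_trans h); lra.
Qed.

End Error.

Lemma partial_sum_error (i : 'I_n) m u : u < 1 ->
  `|c i.+1 u - partial_sum Re_i m i.+1 (y u)| <= truncation_error i m (y u) /\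
  `|s i.+1 u - partial_sum Im_i m i.+1 (y u)| <= truncation_error i m (y u).
Proof.
move=> u1.
pose N := wdot n (coef 0) (coef 0); have w0 := @weight_gt0 R n i.
have N0 : 0 <= N.
  rewrite /N sumr_ge0// => j _; rewrite -expr2 mulr_ge0 ?sqr_ge0//.
  by rewrite ltW// weight_gt0.
pose K2 := (beta / 4 * n%:R) ^+ 2 * N / weight n i.+1.
have K20 : 0 <= K2 by rewrite /K2 divr_ge0 ?(ltW w0)// mulr_ge0// sqr_ge0.
rewrite /truncation_error -/N -/K2; have := energy_bound m u1; set a := _ - _; set b := _ - _.
set E := (n%:R * `|y u|) ^+ m / m`!%:R * `|y u|.
have E0 : 0 <= E by rewrite mulr_ge0// divr_ge0// exprn_ge0// mulr_ge0.
move=> h.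
have hab : a ^+ 2 + b ^+ 2 <= K2 * E ^+ 2.
  rewrite /K2 mulrAC ler_pdivlMr// mulrC.
  apply: (@le_trans _ _ (\sum_(j < n) weight n j.+1 * ((c j.+1 u - partial_sum Re_i m j.+1 (y u)) ^+ 2 +
      (s j.+1 u - partial_sum Im_i m j.+1 (y u)) ^+ 2))).
    rewrite (bigD1 i)//= lerDl sumr_ge0// => j _; rewrite mulr_ge0 ?addr_ge0 ?sqr_ge0//.
    by rewrite ltW// weight_gt0.
  apply: le_trans h _; rewrite -[leLHS]mulrA -[leRHS]mulrA ler_wpM2l ?sqr_ge0//.
  apply: (@le_trans _ _ ((n%:R ^+ m / m`!%:R) ^+ 2 * N * (y u ^+ m.+1) ^+ 2)).
    by rewrite ler_wpM2r ?sqr_ge0// series_coef_bound.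
  rewrite mulrAC mulrC ler_wpM2l// -exprMn.
  rewrite -(real_normK (num_real (_ * y u ^+ _))) normrM normrX ger0_norm ?divr_ge0 ?exprn_ge0//.
  by rewrite (_ : _ * _ = E)// /E exprMn exprSr; ring.
have q (z : R) : z ^+ 2 <= K2 * E ^+ 2 -> `|z| <= Num.sqrt K2 * E.
  move=> hz; rewrite -(@ler_pXn2r _ 2) ?nnegrE ?mulr_ge0 ?sqrtr_ge0//.
  by rewrite (real_normK (num_real z)) exprMn sqr_sqrtr.
by split; apply: q; apply: le_trans hab; rewrite ?lerDl ?lerDr sqr_ge0.
Qed.

Lemma partial_sum_cvg (i : 'I_n) u : u < 1 ->
  (partial_sum Re_i m i.+1 (y u) @[m --> \oo] --> c i.+1 u) /\
  (partial_sum Im_i m i.+1 (y u) @[m --> \oo] --> s i.+1 u).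
Proof.
move=> u1.
have q (f : nat -> R) l : (forall m, `|l - f m| <= truncation_error i m (y u)) -> f m @[m --> \oo] --> l.
  move=> hf; apply/cvgrPdist_lt => e ep.
  have /cvgrPdist_lt/(_ e ep) := truncation_error_cvg i (y u); apply: filterS => m; rewrite sub0r normrN.
  by apply: le_lt_trans; apply: le_trans (hf m) (ler_norm _).
by split; apply: q => m; have [] := partial_sum_error i m u1.
Qed.

End Solution.
End PowerSeries.

(** * The primitive of the density of Theta *)

Section Profile.
Context {R : realType}.
Variable n : nat.

(** The real part of [e^(is) (1 - e^(iy))^N]. The recursion [hS] peels off one factor, and [h_even]
    is the identity [(1 - e^(iy))^2 = - (2 - 2 cos y) e^(iy)]. *)
Let h (N : nat) (y s : R) : R := \sum_(j < N.+1) (- 1) ^+ j * 'C(N, j)%:R * cos (j%:R * y + s).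

Let hS N y s : h N.+1 y s = h N y s - h N y (s + y).
Proof.
have -> : h N y s = cos s + \sum_(i < N.+1) (- 1) ^+ i.+1 * 'C(N, i.+1)%:R * cos (i.+1%:R * y + s).
  rewrite [X in _ = _ + X]big_ord_recr/= (@bin_small N N.+1)// mulr0 mul0r addr0 /h big_ord_recl.
  by rewrite bin0 expr0 !mul1r mul0r add0r.
rewrite /h big_ord_recl/= bin0 expr0 !mul1r mul0r add0r -addrA -sumrB; congr (_ + _).
apply: eq_bigr => i _; rewrite /bump /= add1n binS natrD exprS.
by rewrite -[i.+1%:R]natr1 mulrDl mul1r -addrA [y + s]addrC; ring.
Qed.

Let h_even m y s : h (2 * m) y s = (- 1) ^+ m * (2 - 2 * cos y) ^+ m * cos (s + m%:R * y).
Proof.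
elim: m s => [|m IH] s; first by rewrite /h big_ord1 bin0 !expr0 !mul0r add0r addr0.
rewrite mulnS add2n !hS !IH -[m.+1%:R]natr1 !exprS.
have -> : s + (m%:R + 1) * y = s + y + m%:R * y by ring.
have -> : s + m%:R * y = s + y + m%:R * y - y by ring.
have -> : s + y + y + m%:R * y = s + y + m%:R * y + y by ring.
by move: (s + y + m%:R * y) => z; rewrite cosB cosD; ring.
Qed.

Definition profile_coef (k : nat) : R := (- 1) ^+ k * 'C(2 * n, n + k)%:R / 'C(2 * n, n)%:R.

Definition trig_sum (g : R -> R) (p : nat -> R) (y : R) : R := \sum_(i < n) p i * g (i.+1%:R * y).

(* The primitive F of the density of Theta. Since (1 - cos y) F'' = n sin y F', Ito's
   correction cancels the n-dependent drift in E F(alpha). *)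
Definition profile (y : R) : R :=
  (2 * pi)^-1 * (y + 2 * trig_sum sin (fun i => profile_coef i.+1 / i.+1%:R) y).
Definition profile1 (y : R) : R := (2 * pi)^-1 * (1 + 2 * trig_sum cos (fun i => profile_coef i.+1) y).
Definition profile2 (y : R) : R :=
  (2 * pi)^-1 * (- (2 * trig_sum sin (fun i => profile_coef i.+1 * i.+1%:R) y)).
Definition profile3 (y : R) : R :=
  (2 * pi)^-1 * (- (2 * trig_sum cos (fun i => profile_coef i.+1 * i.+1%:R ^+ 2) y)).

Lemma trig_sum_sin p y : dv (trig_sum sin p) y (trig_sum cos (fun i => p i * i.+1%:R) y).
Proof.
apply: dv_eq (dv_sum (n := n) (fun i _ => dvZ (p i) (dv_sin i.+1%:R y))) _.
by apply: eq_bigr => i _; rewrite mulrA.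
Qed.

Lemma trig_sum_cos p y : dv (trig_sum cos p) y (- trig_sum sin (fun i => p i * i.+1%:R) y).
Proof.
apply: dv_eq (dv_sum (n := n) (fun i _ => dvZ (p i) (dv_cos i.+1%:R y))) _.
by rewrite /trig_sum -sumrN; apply: eq_bigr => i _; rewrite mulrA mulrN mulNr.
Qed.

Lemma profile_dv y : dv profile y (profile1 y).
Proof.
apply: dv_eq (dvZ _ (dvD (dv_id y) (dvZ 2 (trig_sum_sin _ y)))) _.
rewrite /profile1; congr (_ * (_ + _ * _)); apply: eq_bigr => i _.
by rewrite divfK// pnatr_eq0.
Qed.

Lemma profile1_dv y : dv profile1 y (profile2 y).
Proof.
by apply: dv_eq (dvZ _ (dvD (dv_cst 1 y) (dvZ 2 (trig_sum_cos _ y)))) _; rewrite add0r mulrN.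
Qed.

Lemma profile2_dv y : dv profile2 y (profile3 y).
Proof.
apply: dv_eq (dvZ _ (dvN (dvZ 2 (trig_sum_sin _ y)))) _; rewrite /profile3.
congr (_ * - (_ * _)); apply: eq_bigr => i _; ring.
Qed.

Lemma trig_sum_bound g p : (forall x, `|g x| <= 1) -> exists2 K, 0 <= K & forall y, `|trig_sum g p y| <= K.
Proof.
move=> g1; exists (\sum_(i < n) `|p i|); first exact: sumr_ge0.
move=> y; apply: le_trans (ler_norm_sum _ _ _) _; apply: ler_sum => i _.
by rewrite normrM ler_piMr.
Qed.

Lemma profile_bounds : exists2 K : R, 0 <= K & forall y,
  [/\ `|profile1 y| <= K, `|profile2 y| <= K & `|profile3 y| <= K].
Proof.
have [K1 K10 h1] := trig_sum_bound (fun i => profile_coef i.+1) (@cos_abs_le1 R).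
have [K2 K20 h2] := trig_sum_bound (fun i => profile_coef i.+1 * i.+1%:R) (@sin_abs_le1 R).
have [K3 K30 h3] := trig_sum_bound (fun i => profile_coef i.+1 * i.+1%:R ^+ 2) (@cos_abs_le1 R).
have p0 : 0 <= (2 * pi : R)^-1 by rewrite invr_ge0 mulr_ge0// pi_ge0.
exists ((2 * pi)^-1 * (1 + 2 * (K1 + K2 + K3))).
  by rewrite mulr_ge0// addr_ge0// mulr_ge0// !addr_ge0.
move=> y; move: (h1 y) (h2 y) (h3 y) => {}h1 {}h2 {}h3.
split; rewrite normrM (ger0_norm p0) ler_wpM2l//.
- apply: le_trans (ler_normD _ _) _; rewrite normr1 lerD2l normrM ger0_norm// ler_wpM2l//; lra.
- by rewrite normrN normrM ger0_norm//; lra.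
- by rewrite normrN normrM ger0_norm//; lra.
Qed.

(** Take the phase [s = - n * y] in [h_even]: the factor [cos] becomes 1 and the terms of index
    [n + k] and [n - k] coincide, which gives the 2. *)
Lemma binomial_cos y : (2 - 2 * cos y) ^+ n = 'C(2 * n, n)%:R * (1 + 2 * trig_sum cos (fun i => profile_coef i.+1) y).
Proof.
have C0 : 'C(2 * n, n)%:R != 0 :> R by rewrite pnatr_eq0 -lt0n bin_gt0 mul2n -addnn leq_addr.
have := h_even n y (- (n%:R * y)); rewrite addNr cos0 mulr1 => e.
have {}e : (2 - 2 * cos y) ^+ n = (- 1) ^+ n * h (2 * n) y (- (n%:R * y)).
  by rewrite e mulrA -expr2 sqrr_sign mul1r.
pose t (j : nat) : R := (- 1) ^+ j * 'C(2 * n, j)%:R * cos (j%:R * y - n%:R * y).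
have -> : 'C(2 * n, n)%:R * (1 + 2 * trig_sum cos (fun i => profile_coef i.+1) y) =
   'C(2 * n, n)%:R + 2 * \sum_(i < n) (- 1) ^+ i.+1 * 'C(2 * n, n + i.+1)%:R * cos (i.+1%:R * y).
  rewrite mulrDr mulr1; congr (_ + _); rewrite mulrCA; congr (_ * _); rewrite mulr_sumr.
  by apply: eq_bigr => i _; rewrite /profile_coef; field.
have s1 : \sum_(i < n) t (n.+1 + i)%N = (- 1) ^+ n * \sum_(i < n) (- 1) ^+ i.+1 * 'C(2 * n, n + i.+1)%:R * cos (i.+1%:R * y).
  rewrite mulr_sumr; apply: eq_bigr => i _; rewrite /t addSnnS exprD natrD !mulrA; congr (_ * cos _); ring.
have s2 : \sum_(i < n) t i = (- 1) ^+ n * \sum_(i < n) (- 1) ^+ i.+1 * 'C(2 * n, n + i.+1)%:R * cos (i.+1%:R * y).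
  rewrite (reindex_inj rev_ord_inj)/= mulr_sumr; apply: eq_bigr => i _; rewrite /t.
  have ni := ltn_ord i.
  have -> : 'C(2 * n, n - i.+1) = 'C(2 * n, n + i.+1).
    rewrite -[RHS]bin_sub; last by rewrite mul2n -addnn leq_add2l.
    by congr 'C(_, _); rewrite mul2n -addnn subnDl.
  have -> : (- 1) ^+ (n - i.+1) = (- 1) ^+ n * (- 1) ^+ i.+1 :> R.
    by rewrite -[X in _ = _ ^+ X * _](subnK ni) exprD -mulrA -expr2 sqrr_sign mulr1.
  have -> : (n - i.+1)%:R * y - n%:R * y = - (i.+1%:R * y) by rewrite natrB//; ring.
  by rewrite cosN; ring.
have n2 : (2 * n).+1 = (n + n.+1)%N by rewrite mul2n -addnn addnS.
have s3 : h (2 * n) y (- (n%:R * y)) = \sum_(i < n) t i + (t n + \sum_(i < n) t (n.+1 + i)%N).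
  rewrite /h n2 big_split_ord/= big_ord_recl/= addn0; congr (_ + (_ + _)).
  by apply: eq_bigr => i _; rewrite /t /bump /= addnA addn1.
rewrite e s3 s1 s2 /t subrr cos0 mulr1.
have ss : (- 1) ^+ n * (- 1) ^+ n = 1 :> R by rewrite -expr2 sqrr_sign.
move: (\sum_(i < n) _) ((- 1) ^+ n : R) ('C(_, _)%:R : R) ss => S a C ss.
transitivity (a * a * (C + 2 * S)); [ring|by rewrite ss mul1r].
Qed.

Definition profile_scale : R := (2 * pi * 'C(2 * n, n)%:R)^-1.

Lemma profile_scale_gt0 : 0 < profile_scale.
Proof.
rewrite invr_gt0 mulr_gt0// ?mulr_gt0// ?pi_gt0// ltr0n bin_gt0 mul2n -addnn.
exact: leq_addr.
Qed.

Lemma profile1E y : profile1 y = profile_scale * (2 - 2 * cos y) ^+ n.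
Proof.
rewrite binomial_cos /profile_scale /profile1.
have p0 : pi != 0 :> R by rewrite gt_eqF// pi_gt0.
have C0 : 'C(2 * n, n)%:R != 0 :> R by rewrite pnatr_eq0 -lt0n bin_gt0 mul2n -addnn leq_addr.
by move: (pi : R) ('C(_, _)%:R : R) p0 C0 => p C p0 C0; field; rewrite p0 C0.
Qed.

Lemma profile1_ge0 y : 0 <= profile1 y.
Proof.
rewrite profile1E mulr_ge0 ?(ltW profile_scale_gt0)// exprn_ge0// subr_ge0 ger_pMr// cos_le1.
Qed.

(** The derivative of [profile1] is computed a second time from the closed form [profile1E], and the
    two values are compared. *)
Lemma profile2E y : profile2 y * (1 - cos y) = n%:R * sin y * profile1 y.
Proof.
have d1 := profile1_dv y.
have d2 : dv profile1 y (profile_scale * (n%:R * (2 - 2 * cos y) ^+ n.-1 * (2 * sin y))).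
  apply: dv_ext (fun z => esym (profile1E z)) _.
  apply: dv_eq (dvZ profile_scale (dvX n (dvB (dv_cst 2 y) (dvZ 2 (is_derive_cos y))))) _.
  by congr (_ * (_ * _)); ring.
have -> : profile2 y = profile_scale * (n%:R * (2 - 2 * cos y) ^+ n.-1 * (2 * sin y)).
  by rewrite -(dvE d1) (dvE d2).
by rewrite profile1E; case: (n) => [|m]; rewrite ?mul0r ?mulr0 ?mul0r// exprS; ring.
Qed.

Lemma profile_nondecreasing : {homo profile : x y / x <= y}.
Proof.
by move=> x y xy; apply: (dv_nondecreasing (f1 := profile1)) xy => z _; [exact: profile_dv|exact: profile1_ge0].
Qed.

Lemma profile0 : profile 0 = 0.
Proof.
rewrite /profile add0r /trig_sum big1 ?mulr0// => i _.
by rewrite mulr0 sin0 mulr0.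
Qed.

Lemma profileN y : profile (- y) = - profile y.
Proof.
rewrite /profile -mulrN opprD -mulrN; congr (_ * (_ + _ * _)).
by rewrite /trig_sum -sumrN; apply: eq_bigr => i _; rewrite mulrN sinN mulrN.
Qed.

Let period_shift (p y : R) (k : nat) : k%:R * (y + 2 * p) = k%:R * y + p *+ 2 *+ k.
Proof. by rewrite mulrDr -[p *+ 2]mulr_natl -[(2 * p) *+ k]mulr_natl. Qed.

Lemma profile_2pi y : profile (y + 2 * pi) = profile y + 1.
Proof.
have p0 : 2 * pi != 0 :> R by rewrite mulf_neq0 ?pnatr_eq0// gt_eqF// pi_gt0.
have e : trig_sum sin (fun i => profile_coef i.+1 / i.+1%:R) (y + 2 * pi) = trig_sum sin (fun i => profile_coef i.+1 / i.+1%:R) y.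
  apply: eq_bigr => i _; congr (_ * _).
  have -> : i.+1%:R * (y + 2 * pi) = i.+1%:R * y + (pi *+ 2) *+ i.+1.
    exact: period_shift.
  exact: periodicn (@sinD2pi R) _ _.
by rewrite /profile e addrAC mulrDr mulVf.
Qed.

Lemma profile_measurable : measurable_fun setT profile.
Proof. exact: dv_measurable profile_dv. Qed.

End Profile.

Section Limits.
Context {R : realType} {d : measure_display} {T : measurableType d}.
Variable P : probability T R.

Lemma L1_le_ae (X Y : T -> R) : measurable_fun setT X -> L1 P Y ->
  {ae P, forall w, `|X w| <= Y w} -> L1 P X /\ Ex P (fun w => `|X w|) <= Ex P Y.
Proof.
move=> mX iY XY; have mY := L1_measurable iY.
pose X' w := Num.min `|X w| `|Y w|.
have mX' : measurable_fun setT X'.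
  by apply: measurable_minr; apply: measurableT_comp.
have iX' : L1 P X'.
  apply: (L1_le mX' _ (L1_norm iY)) => w.
  by rewrite ger0_norm /X' ?ge_min ?lexx ?orbT// le_min !normr_ge0.
have e : {ae P, forall w, X' w = `|X w|}.
  move: XY; apply: filterS => w h; apply/min_idPl; exact: le_trans h (ler_norm _).
have mN : measurable_fun setT (fun w => `|X w|) by exact: measurableT_comp.
have iN : L1 P (fun w => `|X w|) by exact: L1_ae mN e iX'.
split; last exact: Ex_le_ae.
by apply: (L1_le mX _ iN).
Qed.

(** Fatou: a uniform bound in [L1] passes to a pointwise limit. It transfers increments from
    [u - j.+1%:R] to [u] into a bound for the path at [u]. *)
Lemma fatou_bound (X : nat -> T -> R) (Y : T -> R) (B : R) :
  (forall j, L1 P (X j)) -> (forall j, Ex P (fun w => `|X j w|) <= B) ->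
  measurable_fun setT Y -> (forall w, X j w @[j --> \oo] --> Y w) ->
  L1 P Y /\ Ex P (fun w => `|Y w|) <= B.
Proof.
move=> iX hB mY XY.
have h : (\int[P]_w `|Y w|%:E <= B%:E)%E.
  apply: (@le_trans _ _ (\int[P]_w limn_einf (fun j => `|X j w|%:E))%E).
    rewrite le_eqVlt; apply/orP; left; apply/eqP; apply: eq_integral => w _.
    have [] := @cvg_limn_einf_sup R (fun j => `|X j w|%:E) `|Y w|%:E; last by move=> ->.
    by apply: cvg_EFin; [exact: nearW|apply: cvg_norm; exact: XY].
  apply: le_trans (@fatou _ _ _ P setT measurableT (fun j w => `|X j w|%:E) _ _) _.
  - move=> j; apply/measurable_EFinP; apply: measurableT_comp => //.
    exact: L1_measurable (iX j).
  - by move=> j w _; rewrite lee_fin.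
  - rewrite limn_einf_lim; apply: lime_le; first exact: is_cvg_einfs.
    apply: nearW => j; apply: (@le_trans _ _ (\int[P]_w `|X j w|%:E)%E).
      by apply: ereal_inf_lbound; exists j => /=.
    by rewrite Ex_EFin ?lee_fin//; exact: L1_norm (iX j).
have iY : L1 P Y.
  apply/integrableP; split; first exact/measurable_EFinP.
  by apply: le_lt_trans h (ltry _).
by split=> //; rewrite -lee_fin -Ex_EFin//; exact: L1_norm.
Qed.

End Limits.

Section Primitive.
Context {R : realType}.
Local Notation leb := (@lebesgue_measure R).

(** The primitive is the integral from [a], hence a derivative is claimed only to the right of
    [a]. *)
Lemma continuous_primitive (g : R -> R) (a : R) : continuous g ->
  exists G : R -> R, forall x, a < x -> dv G x (g x).
Proof.
move=> cg; exists (fun x => \int[leb]_(t in `[a, x]) g t) => x ax.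
have xx : x < x + 1 by rewrite ltrDl.
have [p q] := continuous_FTC1_closed xx (continuous_integrable_itv a (x + 1) cg) ax (cg x).
by split; [exact: p|rewrite -derive1E; exact: q].
Qed.

End Primitive.

(** * Decay at minus infinity and first moments *)

Section Mean.
Context {R : realType} {d : measure_display} {T : measurableType d}.
Variable P : probability T R.
Variable Z : R -> T -> R[i].
Hypothesis hZ : two_sided_complex_BM P Z.
Local Notation leb := (@lebesgue_measure R).
Variables (beta : R) (n : nat).
Hypothesis beta_gt0 : 0 < beta.
Hypothesis n_ge1 : (1 <= n)%N.
Local Notation scaleb := (scale beta).

(** Defined from the coefficients alone, which makes [hp_density] a function independent of the
    solution; the convergence behind [limn] is supplied by the existence of a solution. *)
Definition series_limit (k : nat) (y : R) : R := limn (fun m => partial_sum beta n Re_i m k y).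

Definition hp_density (y : R) : R :=
  (2 * pi)^-1 * (1 + 2 * \sum_(i < n) profile_coef n i.+1 * series_limit i.+1 y).

Section Path.
Variables (lambda : R) (b : R -> T -> R).
Hypothesis hb : sde_path P Z beta n lambda b.
Local Notation y u := (lambda * scaleb u).
Local Notation drift := (drift beta lambda).

Let c := cos_mean P b.
Let s := sin_mean P b.

Let c0 u : c 0 u = 1.
Proof.
rewrite /c /cos_mean (_ : (fun w => _) = fun=> 1) ?Ex_cst//.
by apply/funext => w; rewrite mul0r cos0.
Qed.

Let s0 u : s 0 u = 0.
Proof.
rewrite /s /sin_mean (_ : (fun w => _) = fun=> 0) ?Ex_cst//.
by apply/funext => w; rewrite mul0r sin0.
Qed.

Let bound1 (f : T -> R) : L1 P f -> (forall w, `|f w| <= 1) -> `|Ex P f| <= 1.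
Proof.
move=> i f1; apply: le_trans (Ex_norm i) _; rewrite -[leRHS](Ex_cst P).
by apply: Ex_le => //; [exact: L1_norm|exact: L1_cst].
Qed.

Let c1 k u : `|c k u| <= 1.
Proof. by apply: bound1 => [|w]; [exact: (L1_cosk hZ hb)|exact: cos_abs_le1]. Qed.

Let s1 k u : `|s k u| <= 1.
Proof. by apply: bound1 => [|w]; [exact: (L1_sink hZ hb)|exact: sin_abs_le1]. Qed.

Let dc k u : u < 1 -> dv (c k.+1) u
  (recurrence n (c^~ u) k.+1 - k.+1%:R * (beta / 4 * y u) * s k.+1 u).
Proof.
move=> u1; apply: dv_eq (cos_mean_dv hZ beta_gt0 hb k u1) _.
by rewrite /recurrence /drift /= -/c -/s; ring.
Qed.

Let ds k u : u < 1 -> dv (s k.+1) u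
  (recurrence n (s^~ u) k.+1 + k.+1%:R * (beta / 4 * y u) * c k.+1 u).
Proof.
move=> u1; apply: dv_eq (sin_mean_dv hZ beta_gt0 hb k u1) _.
by rewrite /recurrence /drift /= -/c -/s; ring.
Qed.

Lemma cos_mean_error (i : 'I_n) m u : u < 1 ->
  `|cos_mean P b i.+1 u - partial_sum beta n Re_i m i.+1 (y u)| <= truncation_error beta i m (y u).
Proof. by move=> u1; have [] := partial_sum_error beta_gt0 c0 s0 c1 s1 dc ds i m u1. Qed.

Lemma cos_mean_cvg (i : 'I_n) u : u < 1 ->
  partial_sum beta n Re_i m i.+1 (y u) @[m --> \oo] --> cos_mean P b i.+1 u.
Proof. by move=> u1; have [] := partial_sum_cvg beta_gt0 c0 s0 c1 s1 dc ds i u1. Qed.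

Lemma cos_meanE (i : 'I_n) u : u < 1 -> cos_mean P b i.+1 u = series_limit i.+1 (y u).
Proof. by move=> u1; apply/esym/cvg_lim => //; exact: cos_mean_cvg. Qed.

Definition decay_const : R :=
  2 * truncation_error beta (Ordinal n_ge1) 0 1 * `|lambda|.

(** At [m = 0] the partial sum is the constant 1 and the truncation error is linear in [|y|], so the
    first cosine moment tends to 1 at the rate of [scaleb]. *)
Lemma path_decay u : u < 1 -> Ex P (fun w => 2 - 2 * cos (b u w)) <= decay_const * scaleb u.
Proof.
move=> u1; have := cos_mean_error (Ordinal n_ge1) 0 u1.
have -> : partial_sum beta n Re_i 0 (Ordinal n_ge1).+1 (y u) = 1.
  by rewrite /partial_sum big_ord1 (series_coef0 beta) // /Re_i !expr0 /= !mulr1.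
have -> : cos_mean P b (Ordinal n_ge1).+1 u = Ex P (fun w => cos (b u w)).
  by apply: eq_Ex => w /=; rewrite mul1r.
have i : L1 P (fun w => cos (b u w)).
  by apply: eq_L1 (L1_cosk hZ hb 1 u) => w; rewrite mul1r.
have -> : Ex P (fun w => 2 - 2 * cos (b u w)) = - 2 * (Ex P (fun w => cos (b u w)) - 1).
  by rewrite ExB ?Ex_cst ?ExZ//; [ring|exact: L1_cst|exact: L1Z].
have -> : truncation_error beta (Ordinal n_ge1) 0 (y u) =
    truncation_error beta (Ordinal n_ge1) 0 1 * `|lambda| * scaleb u.
  by rewrite /truncation_error !expr0 normrM (gtr0_norm (scale_gt0 _ _)) normr1; ring.
rewrite /decay_const; move: (truncation_error _ _ _ _) (Ex P _) (scaleb u) => e m sc.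
rewrite ler_norml => /andP[h _]; rewrite mulNr lerNl.
have -> : - (2 * e * `|lambda| * sc) = 2 * (- (e * `|lambda| * sc)) by ring.
by rewrite ler_wpM2l.
Qed.

Lemma decay_const_ge0 : 0 <= decay_const.
Proof.
rewrite mulr_ge0// mulr_ge0// /truncation_error mulr_ge0 ?sqrtr_ge0// mulr_ge0//.
Qed.

Local Notation half := (scale (beta / 2)).

Let half_sqr u : half u ^+ 2 = scaleb u.
Proof. by rewrite /scale -expRM_natl; congr expR; field. Qed.

Lemma sqrt_scale u : Num.sqrt (scaleb u) = half u.
Proof. by rewrite -half_sqr sqrtr_sqr ger0_norm// ltW// scale_gt0. Qed.

Let beta2_gt0 : 0 < beta / 2. Proof. by rewrite divr_gt0. Qed.

Let int_scale bt r u (K : R) : 0 < bt -> r <= u -> 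
  (\int[leb]_(x in `[r, u]) (K * scale bt x)%:E = (K * (4 / bt) * (scale bt u - scale bt r))%:E)%E.
Proof.
move=> bt0 ru; rewrite (ftc (f := fun x => K * (4 / bt) * scale bt x)) ?mulrBr//.
  by apply: dv_all_continuous => x; exact: dvZ (scale_dv bt x).
by move=> x; apply: dv_eq (dvZ _ (scale_dv bt x)) _; field; rewrite gt_eqF.
Qed.

(** [sin ^+ 2 = (1 - cos) * (1 + cos)] is at most [2 - 2 * cos]; Cauchy-Schwarz halves the exponent
    of decay. *)
Lemma path_sin_decay u : u < 1 -> Ex P (fun w => `|sin (b u w)|) <= Num.sqrt decay_const * half u.
Proof.
move=> u1.
have mb := path_measurable hZ hb u.
have ms : measurable_fun setT (fun w => sin (b u w)).
  exact: measurableT_comp (measurable_continuous (@continuous_sin R)) mb.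
have mc : measurable_fun setT (fun w => cos (b u w)).
  exact: measurableT_comp (measurable_continuous (@continuous_cos R)) mb.
have Ls : L2 P (fun w => sin (b u w)) by apply: (L2_bounded P ms) => w; exact: sin_abs_le1.
apply: le_trans (Ex_norm_sqrt Ls) _.
rewrite -sqrt_scale -sqrtrM ?decay_const_ge0// ler_wsqrtr//.
apply: le_trans (path_decay u1); apply: Ex_le; first exact: Ls.2.
  apply: L1B; first exact: L1_cst.
  by apply/L1Z/(L1_bounded P mc) => w; exact: cos_abs_le1.
move=> w; rewrite sin2cos2 (_ : 1 - _ = (1 - cos (b u w)) * (1 + cos (b u w))); last by ring.
rewrite (_ : 2 - _ = (1 - cos (b u w)) * 2); last by ring.
rewrite ler_wpM2l ?subr_ge0 ?cos_le1//.
by rewrite [leRHS](_ : _ = 1 + 1)// lerD2l cos_le1.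
Qed.

(** Contributions of the [lambda]-drift, of the stochastic integral and of the sine drift. The
    factors [4 / beta] and [4 / (beta / 2)] come from integrating the two exponentials over the
    past. *)
Definition mean_const : R :=
  `|lambda| + Num.sqrt (4 * (decay_const * (4 / beta))) + n%:R * (Num.sqrt decay_const * (4 / (beta / 2))).

Let increment_mean r u : r < u -> u <= 0 ->
  L1 P (fun w => b u w - b r w) /\ Ex P (fun w => `|b u w - b r w|) <= mean_const * half u.
Proof.
move=> ru u0; have lt1 x : r <= x <= u -> x < 1.
  by move=> /andP[_ xu]; apply: le_lt_trans xu (le_lt_trans u0 ltr01).
have A0 := decay_const_ge0.
have mb x := path_measurable hZ hb x.
have ms x : measurable_fun setT (fun w => sin (b x w)).
  exact: measurableT_comp (measurable_continuous (@continuous_sin R)) (mb x).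
have mc x : measurable_fun setT (fun w => cos (b x w)).
  exact: measurableT_comp (measurable_continuous (@continuous_cos R)) (mb x).
have ic x : L1 P (fun w => 2 - 2 * cos (b x w)).
  apply: L1B; first exact: L1_cst.
  by apply/L1Z/(L1_bounded P (mc x)) => w; exact: cos_abs_le1.
have h0 : 0 <= half u by exact/ltW/scale_gt0.
have hc1 w : continuous (fun x => 2 - 2 * cos (b x w)).
  apply: (path_comp_continuous (f := fun z => 2 - 2 * cos z) hb).
  by apply: dv_all_continuous => z; exact: dvB (dv_cst 2 z) (dvZ 2 (is_derive_cos z)).
have hp1 x w : 0 <= 2 - 2 * cos (b x w) by rewrite subr_ge0 ger_pMr// cos_le1.
have mg1 : measurable_fun setT (fun x => decay_const * scaleb x).
  by apply: measurable_funM => //; apply: measurable_continuous; exact: scale_continuous.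
have [||ik Ek kE] := @fubini_path _ _ _ P (fun x w => 2 - 2 * cos (b x w)) r u hc1
    (fun x => L1_measurable (ic x)) hp1 _ (decay_const * (4 / beta) * half u ^+ 2) mg1.
- by move=> x xru; split=> //; apply: path_decay; exact: lt1.
- rewrite int_scale ?(ltW ru)// lee_fin half_sqr ler_wpM2l//.
    by rewrite mulr_ge0// divr_ge0// ltW.
  by rewrite gerBl ltW// scale_gt0.
set kappa := (fun w => _) in ik Ek kE.
have is' x : L1 P (fun w => `|sin (b x w)|).
  by apply/L1_norm/(L1_bounded P (ms x)) => w; exact: sin_abs_le1.
have hc2 w : continuous (fun x => `|sin (b x w)|).
  apply: (path_comp_continuous (f := fun z => `|sin z|) hb) => z.
  by apply: continuous_comp; [exact: continuous_sin|exact: norm_continuous].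
have hp2 x w : 0 <= `|sin (b x w)| by [].
have mg2 : measurable_fun setT (fun x => Num.sqrt decay_const * half x).
  by apply: measurable_funM => //; apply: measurable_continuous; exact: scale_continuous.
have [||ik2 Ek2 kE2] := @fubini_path _ _ _ P (fun x w => `|sin (b x w)|) r u hc2
    (fun x => L1_measurable (is' x)) hp2 _ (Num.sqrt decay_const * (4 / (beta / 2)) * half u) mg2.
- by move=> x xru; split=> //; apply: path_sin_decay; exact: lt1.
- rewrite int_scale ?(ltW ru)// lee_fin ler_wpM2l//.
    by rewrite mulr_ge0 ?sqrtr_ge0// divr_ge0// ltW.
  by rewrite gerBl ltW// scale_gt0.
set kappa2 := (fun w => _) in ik2 Ek2 kE2.
have [|D [LD eD hD]] := path_ito_bound hZ hb ru ik.
  by move=> w; rewrite kE.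
pose Y w := `|lambda| * half u + `|D w| + n%:R * kappa2 w.
have i1 : L1 P (fun w => `|lambda| * half u + `|D w|).
  by apply: L1D; [exact: L1_cst|exact/L1_norm/L2_L1].
have iY : L1 P Y by apply: L1D => //; exact: L1Z.
have half1 : half u <= 1.
  by apply: le_trans (scale_mono beta2_gt0 u0) _; rewrite /scale mulr0 expR0.
have scale_half : scaleb u <= half u by rewrite -half_sqr expr2 ler_piMl.
have [|||i e] := @L1_le_ae _ _ _ P (fun w => b u w - b r w) Y.
- exact: measurable_funB.
- exact: iY.
- move: hD; apply: filterS => w ->; rewrite /Y.
  apply: le_trans (ler_normB _ _) _; apply: lerD.
    apply: le_trans (ler_normD _ _) _; rewrite lerD2r normrM ler_wpM2l//.
    rewrite ger0_norm ?subr_ge0 ?scale_mono ?(ltW ru)//.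
    by apply: le_trans scale_half; rewrite gerBl ltW// scale_gt0.
  rewrite normrM ger0_norm// ler_wpM2l// /kappa2; apply: le_normr_Rintegral => //.
  apply: (@continuous_integrable_itv R (fun t => sin (b t w))).
  by apply: (path_comp_continuous hb); exact: continuous_sin.
split=> //; apply: le_trans e _.
rewrite /Y ExD ?ExZ//; last exact: L1Z.
rewrite ExD; [|exact: L1_cst|exact/L1_norm/L2_L1].
rewrite Ex_cst /mean_const 2!mulrDl; apply: lerD; last first.
  by rewrite -[leRHS]mulrA ler_wpM2l.
rewrite lerD2l; apply: le_trans (Ex_norm_sqrt LD) _.
rewrite -[X in _ <= _ * X](ger0_norm h0) -sqrtr_sqr -sqrtrM; last first.
  by rewrite mulr_ge0// mulr_ge0// divr_ge0// ltW.
rewrite ler_wsqrtr//; apply: le_trans eD _.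
by rewrite -mulrA ler_wpM2l.
Qed.

(** The increment bound does not depend on [r]; let [r] tend to [-oo], where the path tends to 0. *)
Lemma path_mean u : u <= 0 -> L1 P (b u) /\ Ex P (fun w => `|b u w|) <= mean_const * half u.
Proof.
move=> u0; apply: (@fatou_bound _ _ _ P (fun j w => b u w - b (u - j.+1%:R) w)).
- by move=> j; have [] := @increment_mean (u - j.+1%:R) u; rewrite ?ltrBlDr ?ltrDl.
- by move=> j; have [] := @increment_mean (u - j.+1%:R) u; rewrite ?ltrBlDr ?ltrDl.
- exact: (path_measurable hZ hb u).
move=> w; rewrite -[X in _ --> X]subr0; apply: cvgB; first exact: cvg_cst.
refine (cvg_comp (fun j : nat => u - j.+1%:R) (b^~ w) _ (path_init hb w)).
apply/cvgrNyPle => A; have := nbhs_infty_ger (u - A).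
by apply: filterS => j hj; rewrite lerBlDr -lerBlDl; apply: le_trans hj _; rewrite ler_nat.
Qed.

Lemma path_L1 u : u <= 1 -> L1 P (b u).
Proof.
move=> u1; have [u0|u0] := leP u 0; first exact: (path_mean u0).1.
have [C C0 h] := path_increment_bound hZ beta_gt0 hb.
have ur : u - 0 <= 1 by rewrite subr0.
have [L _] := h 0 u u0 u1 ur.
by apply: eq_L1 (L1D (L2_L1 L) (path_mean (lexx 0)).1) => w; rewrite subrK.
Qed.

Definition profile_mean (u : R) : R := Ex P (fun w => profile n (b u w)).

Let profile_le K : (forall z, `|profile1 n z| <= K) -> forall z : R, `|profile n z| <= K * `|z|.
Proof.
move=> hK z; have := dv_global_lipschitz (@profile_dv R n) hK 0 z.
by rewrite profile0 !subr0.
Qed.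

Lemma profile_L1 u : u <= 1 -> L1 P (fun w => profile n (b u w)).
Proof.
move=> u1; have [K K0 hK] := @profile_bounds R n.
apply: (@L1_le _ _ _ P _ (fun w => K * `|b u w|)).
- exact: measurableT_comp (profile_measurable n) (path_measurable hZ hb u).
- by move=> w; apply: profile_le => z; have [] := hK z.
- by apply/L1Z/L1_norm/path_L1.
Qed.

Lemma profile1_mean u : u < 1 -> Ex P (fun w => profile1 n (b u w)) = hp_density (y u).
Proof.
move=> u1.
have i (k : 'I_n) : L1 P (fun w => profile_coef n k.+1 * cos (k.+1%:R * b u w)).
  exact/L1Z/(L1_cosk hZ hb).
rewrite /profile1 /trig_sum ExZ; last first.
  by apply: L1D; [exact: L1_cst|apply: L1Z; exact: L1_sum].
rewrite ExD ?ExZ ?Ex_cst ?Ex_sum//; [|exact: L1_sum|exact: L1_cst|apply: L1Z; exact: L1_sum].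
congr (_ * (_ + _ * _)); apply: eq_bigr => k _.
by rewrite ExZ; [rewrite -(cos_meanE k u1)|exact: (L1_cosk hZ hb k.+1 u)].
Qed.

Lemma profile_mean_dv u : u < 1 -> dv profile_mean u (drift u * hp_density (y u)).
Proof.
move=> u1; have [K K0 hK] := @profile_bounds R n.
have D := path_generator hZ beta_gt0 hb (@profile_dv R n) (@profile1_dv R n) (@profile2_dv R n)
  (fun z => let: And3 p _ _ := hK z in p) (fun z => let: And3 _ p _ := hK z in p)
  (fun z => let: And3 _ _ p := hK z in p) profile_L1 u1.
apply: dv_eq D _; rewrite -(profile1_mean u1) -ExZ.
  apply: eq_Ex => w; rewrite profile2E; ring.
apply: (@L1_bounded _ _ _ P K); last by move=> w; have [] := hK (b u w).
exact: measurableT_comp (dv_measurable (@profile1_dv R n)) (path_measurable hZ hb u).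
Qed.

Lemma hp_density_ge0 u : u < 1 -> 0 <= hp_density (y u).
Proof. by move=> u1; rewrite -profile1_mean// Ex_ge0// => w; exact: profile1_ge0. Qed.

Lemma scale_cvg bt : 0 < bt -> scale bt (- j%:R) @[j --> \oo] --> (0 : R).
Proof.
move=> bt0; have e1 : expR (- (bt / 4)) < 1 by rewrite expR_lt1 oppr_lt0 divr_gt0.
rewrite (_ : (fun j : nat => _) = fun j => expR (- (bt / 4)) ^+ j).
  by apply: cvg_expr; rewrite ger0_norm ?expR_ge0.
by apply/funext => j; rewrite /scale -expRM_natl; congr expR; ring.
Qed.

(** Along the flow in [u] the mean of the profile and [G (lambda * scaleb u)] have the same
    derivative. At [-oo] the former tends to 0 by [path_mean] and the latter to [G 0]. *)
Lemma profile_meanE (G : R -> R) : (forall x, `|x| <= `|lambda| -> dv G x (hp_density x)) ->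
  profile_mean 0 = G lambda - G 0.
Proof.
move=> hG; have [K K0 hK] := @profile_bounds R n.
have K1 z : `|profile1 n z| <= K by have [] := hK z.
have yl u : u <= 0 -> `|y u| <= `|lambda|.
  move=> u0; rewrite normrM ler_piMr// gtr0_norm ?scale_gt0//.
  by apply: le_trans (scale_mono beta_gt0 u0) _; rewrite /scale mulr0 expR0.
have scale0 : scaleb 0 = 1 by rewrite /scale mulr0 expR0.
have const u : u <= 0 -> profile_mean 0 - G (y 0) = profile_mean u - G (y u).
  move=> u0; apply: (dv_unique_constant (f := fun u => profile_mean u - G (y u))) u0 => x /andP[_ x0].
  have x1 : x < 1 by exact: le_lt_trans x0 ltr01.
  have D1 := profile_mean_dv x1.
  have D2 : dv (fun u => G (y u)) x (hp_density (y x) * (lambda * (beta / 4 * scaleb x))).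
    exact: (dv_comp (g := fun u => y u) (hG _ (yl x x0)) (dvZ lambda (scale_dv beta x))).
  apply: dv_eq (dvB D1 D2) _.
  by rewrite /drift; ring.
rewrite scale0 mulr1 in const.
have cP : profile_mean (- j%:R) @[j --> \oo] --> (0 : R).
  apply: norm_cvg0.
  apply: (@squeeze_cvgr _ _ _ _ (fun=> 0) (fun j => K * mean_const * half (- j%:R))).
  - apply: nearW => j; rewrite normr_ge0/=.
    have j0 : - j%:R <= 0 :> R by rewrite oppr_le0.
    have i := profile_L1 (le_trans j0 ler01).
    apply: le_trans (Ex_norm i) _.
    rewrite -mulrA; apply: le_trans (ler_wpM2l K0 (path_mean j0).2).
    have ib := L1_norm (path_mean j0).1.
    rewrite -ExZ//; apply: Ex_le; [exact: L1_norm|exact: L1Z|].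
    by move=> w; exact: profile_le.
  - exact: cvg_cst.
  - by rewrite -(mulr0 (K * mean_const)); apply: cvgM; [exact: cvg_cst|exact: scale_cvg].
have cG : G (y (- j%:R)) @[j --> \oo] --> G 0.
  apply: (@continuous_cvg _ _ _ _ _ _ G).
    by apply: (dv_continuous (hG 0 _)); rewrite normr0.
  by rewrite -[X in _ --> X](mulr0 lambda); apply: cvgM; [exact: cvg_cst|exact: scale_cvg].
have cc : (fun _ : nat => profile_mean 0 - G lambda) @ \oo --> 0 - G 0.
  rewrite (_ : (fun _ => _) = fun j : nat => profile_mean (- j%:R) - G (y (- j%:R))).
    exact: cvgB.
  by apply/funext => j; apply: const; rewrite oppr_le0.
have e := cvg_unique (@Rhausdorff R) (cvg_cst (profile_mean 0 - G lambda)) cc.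
by rewrite -[profile_mean 0](subrK (G lambda)) e sub0r addrC.
Qed.

End Path.
End Mean.

(** * Monotonicity in lambda *)

Section NegativePart.
Context {R : realType}.
Variable n : nat.
Hypothesis n_ge1 : (1 <= n)%N.
Local Notation f := (@profile R n).
Local Notation f1 := (@profile1 R n).
Local Notation f2 := (@profile2 R n).

Lemma profile1_0 : f1 0 = 0.
Proof. by rewrite profile1E cos0 mulr1 subrr expr0n eqn0Ngt n_ge1 mulr0. Qed.

Lemma profile2_0 : f2 0 = 0.
Proof.
rewrite /profile2 /trig_sum big1 ?mulr0 ?oppr0 ?mulr0// => i _.
by rewrite mulr0 sin0 mulr0.
Qed.

Lemma profile_ge0 y : 0 <= y -> 0 <= f y.
Proof. by move=> y0; rewrite -(@profile0 R n); exact: profile_nondecreasing. Qed.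

(** [profile2E] in half angles with one factor [2 * sin (y / 2)] cancelled; where this factor is 0,
    [f1] vanishes too. *)
Lemma profile2_sin_half y : f2 y * sin (y / 2) = n%:R * cos (y / 2) * f1 y.
Proof.
have e : f2 y * (1 - cos y) = n%:R * sin y * f1 y := profile2E n y.
have y2 : y = y / 2 + y / 2 by field.
have c2 : 1 - cos y = 2 * sin (y / 2) ^+ 2.
  by rewrite [in LHS]y2 cosD; have := cos2Dsin2 (y / 2); rewrite !expr2; lra.
have s2 : sin y = 2 * (sin (y / 2) * cos (y / 2)) by rewrite [in LHS]y2 sinD; ring.
have [s0|s0] := eqVneq (sin (y / 2)) 0.
  rewrite s0 mulr0 profile1E (_ : 2 - 2 * cos y = 0); last first.
    by rewrite -[X in X - _]mulr1 -mulrBr c2 s0 expr0n/= !mulr0.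
  by rewrite expr0n eqn0Ngt n_ge1 !mulr0.
have s20 : 2 * sin (y / 2) != 0 by rewrite mulf_neq0// pnatr_eq0.
apply: (mulfI s20); rewrite c2 s2 in e.
transitivity (f2 y * (2 * sin (y / 2) ^+ 2)); [ring|by rewrite e; ring].
Qed.

(** The function [g] vanishes at 0 and has derivative [k * cos (z / 2) * f1 z], so both [k * f - g]
    and [k * f + g] are nondecreasing. Here [2^-1] comes from differentiating [sin (z / 2)]. *)
Lemma profile1_sin_half y : 0 <= y -> f1 y * `|sin (y / 2)| <= (n%:R + 2^-1) * f y.
Proof.
move=> y0; set k := n%:R + 2^-1; have k0 : 0 <= k by rewrite addr_ge0.
pose g z := f1 z * sin (z / 2).
have dg z : dv g z (k * cos (z / 2) * f1 z).
  have ds : dv (fun z => sin (z / 2)) z (2^-1 * cos (2^-1 * z)).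
    by apply: dv_ext (dv_sin 2^-1 z) => t; rewrite mulrC.
  apply: dv_eq (dvM (@profile1_dv R n z) ds) _.
  by rewrite profile2_sin_half [2^-1 * z]mulrC /k; ring.
have dk z : dv (fun z => k * f z) z (k * f1 z) by apply: dvZ; exact: profile_dv.
have g0 : g 0 = 0 by rewrite /g profile1_0 mul0r.
have f0 : k * f 0 = 0 by rewrite profile0 mulr0.
have h1 : 0 <= k * f y - g y.
  rewrite (_ : 0 = k * f 0 - g 0); last by rewrite g0 f0 subr0.
  apply: (dv_nondecreasing (fun z _ => dvB (dk z) (dg z))) => // z _.
  have := cos_le1 (z / 2); have := @profile1_ge0 R n z => p q.
  rewrite (_ : _ - _ = k * (f1 z * (1 - cos (z / 2)))); last by ring.
  by rewrite mulr_ge0// mulr_ge0// subr_ge0.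
have h2 : 0 <= k * f y + g y.
  rewrite (_ : 0 = k * f 0 + g 0); last by rewrite g0 f0 addr0.
  apply: (dv_nondecreasing (fun z _ => dvD (dk z) (dg z))) => // z _.
  have := cos_geN1 (z / 2); have := @profile1_ge0 R n z => p q.
  rewrite (_ : _ + _ = k * (f1 z * (1 + cos (z / 2)))); last by ring.
  by rewrite mulr_ge0// mulr_ge0// -lerBlDl sub0r.
have -> : f1 y * `|sin (y / 2)| = `|g y| by rewrite /g normrM (ger0_norm (profile1_ge0 n y)).
by rewrite ler_norml; apply/andP; split; lra.
Qed.

Lemma profile_eq0 y : 0 <= y -> f y = 0 -> y = 0.
Proof.
move=> y0 fy; apply/eqP; rewrite eq_le y0 andbT leNgt; apply/negP => yp.
(* Cutting at 1 keeps [z / 2] inside []0, pi[], where the sine is positive. *)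
pose z := Num.min y 1; have z0 : 0 < z by rewrite lt_min yp ltr01.
have fz : f z = 0.
  apply/eqP; rewrite eq_le profile_ge0 ?(ltW z0)// andbT -fy.
  by apply: profile_nondecreasing; rewrite ge_min lexx.
have h := profile1_sin_half (ltW z0); rewrite fz mulr0 in h.
have z1 : z <= 1 by rewrite ge_min lexx orbT.
have pi2 : 2 <= pi :> R by exact: pi_ge2.
have s0 : 0 < sin (z / 2).
  by apply: sin_gt0_pi; rewrite divr_gt0//=; lra.
have f1z : 0 < f1 z.
  rewrite profile1E mulr_gt0 ?profile_scale_gt0// exprn_gt0// subr_gt0.
  rewrite gtr_pMr// (_ : cos z = 1 - 2 * sin (z / 2) ^+ 2); last first.
    have z2 : z = z / 2 + z / 2 by field.
    by rewrite [in LHS]z2 cosD; have := cos2Dsin2 (z / 2); rewrite !expr2; lra.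
  by rewrite gtrBl mulr_gt0// exprn_gt0.
by move: h; apply/negP; rewrite -ltNge mulr_gt0// normr_gt0 gt_eqF.
Qed.

(* Lyapunov function of the comparison theorem. The difference z of two solutions has
   the quadratic variation 2 (1 - cos z) of a single solution, but its drift involves
   sin y - sin x instead of sin z; the resulting error is a multiple of |sin (x / 2)|,
   whose mean is integrable in time. *)
Definition negprofile (x : R) : R := - f (Num.min x 0).
Definition negprofile1 (x : R) : R := - f1 (Num.min x 0).
Definition negprofile2 (x : R) : R := - f2 (Num.min x 0).

Let mN (h h1 : R -> R) : (forall x, dv h x (h1 x)) -> measurable_fun setT (fun x : R => - h (Num.min x 0)).
Proof.
move=> dh; apply: measurableT_comp => //; apply: (measurableT_comp (dv_measurable dh)).
exact: measurable_minr.
Qed.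

Lemma negprofile_measurable :
  [/\ measurable_fun setT negprofile, measurable_fun setT negprofile1 & measurable_fun setT negprofile2].
Proof.
by split; [exact: mN (@profile_dv R n)|exact: mN (@profile1_dv R n)|exact: mN (@profile2_dv R n)].
Qed.

Lemma negprofile_ge0 x : 0 <= negprofile x.
Proof.
rewrite /negprofile oppr_ge0 -[leRHS](@profile0 R n); apply: profile_nondecreasing.
by rewrite ge_min lexx orbT.
Qed.

Lemma negprofile_eq0 x : negprofile x = 0 -> 0 <= x.
Proof.
rewrite /negprofile -profileN; have [x0|//] := ltP x 0.
move=> /profile_eq0; rewrite oppr_ge0 (ltW x0) => /(_ isT)/eqP.
by rewrite oppr_eq0 lt_eqF.
Qed.

(** The profile and its first two derivatives vanish at 0, so the gluing there is of class C2. When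
    [t] and [t + e] lie on different sides, [|t + e| <= |e|] and the profile at [t + e] is itself of
    third order. *)
Lemma negprofile_taylor : exists2 K : R, 0 <= K &
  [/\ forall t, `|negprofile1 t| <= K /\ `|negprofile2 t| <= K,
      forall t e, negprofile (t + e) <= negprofile t + negprofile1 t * e + negprofile2 t * e ^+ 2 / 2 + K * e ^+ 2 /\
        negprofile (t + e) <= negprofile t + negprofile1 t * e + negprofile2 t * e ^+ 2 / 2 + K * `|e| ^+ 3 &
      forall t, negprofile t <= K * `|t|].
Proof.
have [K K0 hK] := @profile_bounds R n.
have KK z : z <= K -> z <= 4 * K by move=> h; lra.
have T t e := taylor2_bound t e (@profile_dv R n) (@profile1_dv R n) (@profile2_dv R n)
  (fun y => let: And3 _ p _ := hK y in p) (fun y => let: And3 _ _ p := hK y in p).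
exists (4 * K); first by rewrite mulr_ge0.
split.
- by move=> t; rewrite /negprofile1 /negprofile2 !normrN; have [p q _] := hK (Num.min t 0); split; exact: KK.
- move=> t e.
  have cube0 z : `|f z| <= 2 * K * z ^+ 2 /\ `|f z| <= K * `|z| ^+ 3.
    have := T 0 z; rewrite add0r profile0 profile1_0 profile2_0 !mul0r !subr0.
    by [].
  have mon (z : R) : `|z| <= `|e| -> z ^+ 2 <= e ^+ 2 /\ `|z| ^+ 3 <= `|e| ^+ 3.
    move=> ze; split; last by rewrite lerXn2r ?nnegrE.
    by rewrite -(real_normK (num_real z)) -(real_normK (num_real e)) lerXn2r ?nnegrE.
  have e2 := sqr_ge0 e; have e3 : 0 <= `|e| ^+ 3 by rewrite exprn_ge0.
  have ke2 := mulr_ge0 K0 e2; have ke3 := mulr_ge0 K0 e3.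
  have [t0|t0] := ltP t 0; have [te0|te0] := ltP (t + e) 0.
  + rewrite /negprofile /negprofile1 /negprofile2 !min_l ?(ltW t0) ?(ltW te0)//.
    by have [] := T t e; rewrite !ler_norml => /andP[p1 p2] /andP[q1 q2]; split; lra.
  + rewrite /negprofile /negprofile1 /negprofile2 (min_r te0) (min_l (ltW t0)) profile0 oppr0.
    have [] := T t e; rewrite !ler_norml => /andP[p1 p2] /andP[q1 q2].
    have [c2 c3] := cube0 (t + e).
    have [|m2 m3] := mon (t + e).
      by rewrite ger0_norm//; apply: le_trans (ler_norm e); rewrite gerDr ltW.
    have := le_trans c2 (ler_wpM2l _ m2); have := le_trans c3 (ler_wpM2l K0 m3).
    rewrite (ger0_norm (profile_ge0 te0)) => r3 r2.
    have {}r2 := r2 (mulr_ge0 (ler0n R 2) K0).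
    by split; lra.
  + rewrite /negprofile /negprofile1 /negprofile2 (min_l (ltW te0)) (min_r t0) profile0 profile1_0 profile2_0.
    have [c2 c3] := cube0 (t + e).
    have [|m2 m3] := mon (t + e).
      rewrite ler0_norm ?(ltW te0)//; apply: (@le_trans _ _ (- e)); first by rewrite lerN2 lerDr.
      by rewrite -normrN ler_norm.
    have := le_trans c2 (ler_wpM2l (mulr_ge0 (ler0n R 2) K0) m2); have := le_trans c3 (ler_wpM2l K0 m3).
    by rewrite !ler_norml => /andP[p1 _] /andP[p2 _]; split; lra.
  + rewrite /negprofile /negprofile1 /negprofile2 !min_r// profile0 profile1_0 profile2_0.
    by split; lra.
- move=> t; rewrite -[negprofile t]ger0_norm ?negprofile_ge0// /negprofile normrN.
  have := dv_global_lipschitz (@profile_dv R n) (fun y => let: And3 p _ _ := hK y in p) 0 (Num.min t 0).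
  rewrite profile0 !subr0 => h; apply: le_trans h _.
  apply: (@le_trans _ _ (K * `|t|)); last by rewrite ler_wpM2r//; exact: KK.
  by rewrite ler_wpM2l//; case: (leP t 0) => // _; rewrite normr0.
Qed.

Let sin_product (x y : R) : sin (x + y) - sin x - sin y = - 4 * sin (x / 2) * sin (y / 2) * sin ((x + y) / 2).
Proof.
have -> : (x + y) / 2 = x / 2 + y / 2 by field.
have -> : x + y = (x / 2 + y / 2) + (x / 2 + y / 2) by field.
rewrite [in X in X - _ - _]sinD [sin (x / 2 + y / 2)]sinD [cos (x / 2 + y / 2)]cosD.
have -> : sin x = 2 * sin (x / 2) * cos (x / 2) by rewrite {1}(_ : x = x / 2 + x / 2) ?sinD; [ring|field].
have -> : sin y = 2 * sin (y / 2) * cos (y / 2) by rewrite {1}(_ : y = y / 2 + y / 2) ?sinD; [ring|field].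
have := cos2Dsin2 (x / 2); have := cos2Dsin2 (y / 2).
move: (sin (x / 2)) (cos (x / 2)) (sin (y / 2)) (cos (y / 2)) => s c s' c' h' h.
have {}h : c ^+ 2 = 1 - s ^+ 2 by rewrite -h addrK.
have {}h' : c' ^+ 2 = 1 - s' ^+ 2 by rewrite -h' addrK.
transitivity (2 * s * c * c' ^+ 2 + 2 * c ^+ 2 * s' * c' - 2 * s ^+ 2 * s' * c' - 2 * s * c * s' ^+ 2 - 2 * s * c - 2 * s' * c').
  ring.
by rewrite h h'; ring.
Qed.

(** By [profile2E] the second-order term cancels the part [sin z] of the drift difference. What
    remains is a product of three sines by [sin_product]; the factor [f1 z * sin (z / 2)] is
    absorbed by [profile1_sin_half], and [m >= 0] acts in the favourable direction. *)
Lemma negprofile_drift (x y m : R) : 0 <= m ->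
  negprofile1 (y - x) * (m - n%:R * (sin y - sin x)) +
    negprofile2 (y - x) * ((cos y - cos x) ^+ 2 + (- (sin y - sin x)) ^+ 2) / 2 <=
  4 * n%:R * (n%:R + 2^-1) * `|sin (x / 2)| * negprofile (y - x).
Proof.
move=> m0; set z := y - x.
have -> : (cos y - cos x) ^+ 2 + (- (sin y - sin x)) ^+ 2 = 2 * (1 - cos z).
  rewrite /z cosB; have := cos2Dsin2 x; have := cos2Dsin2 y; rewrite !expr2; lra.
have n0 : 0 <= n%:R :> R by [].
have k0 : 0 <= n%:R + 2^-1 :> R by rewrite addr_ge0.
have [z0|z0] := ltP z 0; last first.
  rewrite /negprofile1 /negprofile2 min_r// profile1_0 profile2_0 oppr0 !mul0r addr0.
  by rewrite mulr_ge0 ?negprofile_ge0// !mulr_ge0.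
rewrite /negprofile /negprofile1 /negprofile2 min_l ?(ltW z0)//.
have e := profile2E n z; have p := profile1_ge0 n z.
have -> : - f1 z * (m - n%:R * (sin y - sin x)) + - f2 z * (2 * (1 - cos z)) / 2 =
   - (f1 z * m) + n%:R * f1 z * (sin y - sin x) - f2 z * (1 - cos z) by field.
rewrite e -profileN.
have -> : - (f1 z * m) + n%:R * f1 z * (sin y - sin x) - n%:R * sin z * f1 z =
  - (f1 z * m) + n%:R * f1 z * (sin (x + z) - sin x - sin z).
  by rewrite (_ : x + z = y) /z; ring.
have fe : f1 (- z) = f1 z by rewrite !profile1E cosN.
have nz0 : 0 <= - z by rewrite oppr_ge0 ltW.
have h := profile1_sin_half nz0; rewrite fe mulNr sinN normrN in h.
rewrite sin_product.
have b1 : - 4 * sin (x / 2) * sin (z / 2) * sin ((x + z) / 2) <= 4 * `|sin (x / 2)| * `|sin (z / 2)|.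
  apply: le_trans (ler_norm _) _; rewrite !normrM normrN (@ger0_norm _ 4)//.
  by rewrite ler_piMr ?sin_abs_le1// !mulr_ge0.
have b2 : n%:R * f1 z * (- 4 * sin (x / 2) * sin (z / 2) * sin ((x + z) / 2)) <=
    n%:R * f1 z * (4 * `|sin (x / 2)| * `|sin (z / 2)|).
  by rewrite ler_wpM2l// mulr_ge0.
have b3 : n%:R * (4 * `|sin (x / 2)|) * (f1 z * `|sin (z / 2)|) <=
    n%:R * (4 * `|sin (x / 2)|) * ((n%:R + 2^-1) * f (- z)).
  by rewrite ler_wpM2l// !mulr_ge0.
have b4 : 0 <= f1 z * m by rewrite mulr_ge0.
rewrite [in leRHS](_ : _ * _ = n%:R * (4 * `|sin (x / 2)|) * ((n%:R + 2^-1) * f (- z))); last by ring.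
apply: le_trans b3; rewrite [leRHS](_ : _ = n%:R * f1 z * (4 * `|sin (x / 2)| * `|sin (z / 2)|)); last by ring.
by apply: le_trans b2; rewrite gerDr oppr_le0.
Qed.

End NegativePart.

Lemma sqr_sin_half {R : realType} (x : R) : sin (x / 2) ^+ 2 = (1 - cos x) / 2.
Proof.
have x2 : x = x / 2 + x / 2 by field.
by rewrite [in RHS]x2 cosD; have := cos2Dsin2 (x / 2); rewrite !expr2; lra.
Qed.

(** * Comparison of two solutions *)

Section Comparison.
Context {R : realType} {d : measure_display} {T : measurableType d}.
Variable P : probability T R.
Variable Z : R -> T -> R[i].
Hypothesis hZ : two_sided_complex_BM P Z.
Local Notation F := (filtration P Z).
Variables (beta : R) (n : nat).
Hypothesis beta_gt0 : 0 < beta.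
Hypothesis n_ge1 : (1 <= n)%N.
Variables (lambda lambda' : R) (b b' : R -> T -> R).
Hypothesis hb : sde_path P Z beta n lambda b.
Hypothesis hb' : sde_path P Z beta n lambda' b'.
Hypothesis lambda_le : lambda <= lambda'.
Local Notation psi := (@negprofile R n).
Local Notation half := (scale (beta / 2)).

Let k : R := 4 * n%:R * (n%:R + 2^-1).
Let sb (u : R) (w : T) : R := `|sin (b u w / 2)|.

Let k0 : 0 <= k. Proof. by rewrite mulr_ge0 ?mulr_ge0// addr_ge0. Qed.

Let sb01 u w : 0 <= sb u w <= 1.
Proof. by rewrite /sb normr_ge0 sin_abs_le1. Qed.

Let msin2 : measurable_fun setT (fun x : R => `|sin (x / 2)|).
Proof.
apply: measurableT_comp => //; apply: (measurableT_comp (measurable_continuous (@continuous_sin R))).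
exact: measurable_funM.
Qed.

Let sb_adapted u : rv_measurable (F u) (sb u).
Proof. exact: (rv_comp msin2 (@path_adapted _ _ _ _ _ _ _ _ _ hb u)). Qed.

Let msb u : measurable_fun setT (sb u).
Proof. exact: (adapted_measurable hZ (@sb_adapted u)). Qed.

Let diff_L1 u : u <= 1 -> L1 P (fun w => b' u w - b u w).
Proof. by move=> u1; apply: L1B; [exact: (path_L1 hZ beta_gt0 n_ge1 hb' u1)|exact: (path_L1 hZ beta_gt0 n_ge1 hb u1)]. Qed.

Let psi_L1 u : u <= 1 -> L1 P (fun w => psi (b' u w - b u w)).
Proof.
move=> u1; have [K K0 [_ _ hK]] := @negprofile_taylor R n n_ge1.
have [m _ _] := @negprofile_measurable R n.
apply: (@L1_le _ _ _ P _ (fun w => K * `|b' u w - b u w|)).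
- apply: (measurableT_comp m); exact: L1_measurable (diff_L1 u1).
- by move=> w; rewrite ger0_norm ?negprofile_ge0.
- by apply/L1Z/L1_norm/diff_L1.
Qed.

(** One step of a Gronwall argument with the random rate [k * sb r]: the exponential damps the
    weight by exactly the growth that [negprofile_drift] permits. *)
Let step_bound (K : R) : Prop := forall r u W, r < u -> u <= 1 -> u - r <= 1 ->
  rv_measurable (F r) W -> (forall w, 0 <= W w <= 1) ->
  Ex P (fun w => W w * expR (- (k * ((u - r) * sb r w))) * psi (b' u w - b u w)) <=
  Ex P (fun w => W w * psi (b' r w - b r w)) + K * ((u - r) * Num.sqrt (u - r)).

Let step : exists2 K : R, 0 <= K & step_bound K.
Proof.
have [C C0 e] := path_euler hZ beta_gt0 hb.
have [C' C'0 e'] := path_euler hZ beta_gt0 hb'.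
have [K K0 [hK tK _]] := @negprofile_taylor R n n_ge1.
have CC : 0 <= 2 * (C' + C) by rewrite mulr_ge0// addr_ge0.
have [K' K'0 st] := euler_step hZ CC K0.
exists K' => // r u W ru u1 ur1 hW W01.
have r1 : r <= 1 by exact: le_trans (ltW ru) u1.
have h0 : 0 <= u - r by rewrite subr_ge0 ltW.
have E := euler_sub hZ ru C'0 C0 (e' r u ru u1 ur1) (e r u ru u1 ur1).
pose W' w := W w * expR (- (k * ((u - r) * sb r w))).
have x0 w : 0 <= k * ((u - r) * sb r w).
  by rewrite !mulr_ge0//; case/andP: (sb01 r w).
have W'01 w : 0 <= W' w <= 1.
  have /andP[w0 w1] := W01 w; rewrite mulr_ge0 ?expR_ge0//=.
  by rewrite mulr_ile1 ?expR_ge0// -expR0 ler_expR oppr_le0.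
have hW' : rv_measurable (F r) W'.
  apply: rvM => //.
  have mm : measurable_fun setT (fun x : R => expR (- (k * ((u - r) * `|sin (x / 2)|)))).
    apply: measurableT_comp => //; apply: measurableT_comp => //.
    by apply: measurable_funM => //; exact: measurable_funM.
  exact: (rv_comp mm (@path_adapted _ _ _ _ _ _ _ _ _ hb r)).
have [m0 m1 m2] := @negprofile_measurable R n.
have := st r u _ _ _ _ _ W' psi (@negprofile1 R n) (@negprofile2 R n) ru ur1 E hW' W'01
  (And3 m0 m1 m2) hK tK (psi_L1 r1) (psi_L1 u1).
move/le_trans; apply; rewrite lerD2r.
set L := (fun w => W' w * (_ + _)).
have iW'psi : L1 P (fun w => W' w * psi (b' r w - b r w)).
  apply: (L1M_bounded (C := 1) (adapted_measurable hZ hW') _ (psi_L1 r1)) => w.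
  by have /andP[p q] := W'01 w; rewrite ger0_norm.
have iWpsi : L1 P (fun w => W w * psi (b' r w - b r w)).
  apply: (L1M_bounded (C := 1) (adapted_measurable hZ hW) _ (psi_L1 r1)) => w.
  by have /andP[p q] := W01 w; rewrite ger0_norm.
have bd w : L w <= k * (W' w * sb r w * psi (b' r w - b r w)).
  have /andP[p q] := W'01 w; rewrite /L.
  have mu0 : 0 <= drift beta lambda' r - drift beta lambda r.
    rewrite /drift -mulrBl mulr_ge0 ?subr_ge0// mulr_ge0 ?divr_ge0 ?(ltW beta_gt0)//.
    exact/ltW/scale_gt0.
  have := negprofile_drift n_ge1 (b r w) (b' r w) mu0.
  rewrite -/k -/(sb r w) => /(ler_wpM2l p).
  rewrite [W' w * (k * _ * _)](_ : _ = k * (W' w * sb r w * psi (b' r w - b r w))); last by ring.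
  apply: le_trans; rewrite ler_wpM2l// le_eqVlt; apply/orP; left; apply/eqP.
  by congr (_ * _ + _ * _ / 2); ring.
have isb : L1 P (fun w => W' w * sb r w * psi (b' r w - b r w)).
  apply: (L1M_bounded (C := 1) _ _ (psi_L1 r1)).
    by apply: measurable_funM; [exact: (adapted_measurable hZ hW')|exact: msb].
  move=> w; have /andP[p q] := W'01 w; have /andP[p' q'] := sb01 r w.
  by rewrite ger0_norm; [exact: mulr_ile1|exact: mulr_ge0].
have iL : L1 P L.
  have [M [D [[hx ha h1 h2] bde _ _ _]]] := E.
  have mx := adapted_measurable hZ hx; have ma := adapted_measurable hZ ha.
  have mc1 := adapted_measurable hZ h1; have mc2 := adapted_measurable hZ h2.
  apply: (L1M_bounded (C := 1) (adapted_measurable hZ hW')).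
    by move=> w; have /andP[p q] := W'01 w; rewrite ger0_norm.
  set A := 2 * (C' + C) in bde CC.
  apply: L1D.
    apply: (L1_bounded P (C := K * A)).
      by apply: measurable_funM => //; exact: measurableT_comp m1 mx.
    move=> w; rewrite normrM ler_pM//; first by case: (hK (b' r w - b r w)).
    by case: (bde w).
  apply: (L1_bounded P (C := K * (A ^+ 2 + A ^+ 2) * 2^-1)).
    apply: measurable_funM => //; apply: measurable_funM; first exact: measurableT_comp m2 mx.
    by apply: measurable_funD; exact: measurable_funX.
  move=> w; have [_ q1 q2] := bde w; have [_ p2] := hK (b' r w - b r w).
  rewrite normrM (@ger0_norm _ 2^-1)// ler_wpM2r// normrM ler_pM//.
  apply: le_trans (ler_normD _ _) _; rewrite !normrX.
  by apply: lerD; rewrite lerXn2r ?nnegrE.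
apply: (@le_trans _ _ (Ex P (fun w => W' w * psi (b' r w - b r w)) + (u - r) * Ex P (fun w => k * (W' w * sb r w * psi (b' r w - b r w))))).
  by rewrite lerD2l ler_wpM2l//; apply: Ex_le => //; exact: L1Z.
rewrite -ExZ; last exact: L1Z.
rewrite -ExD//; last by apply: L1Z; exact: L1Z.
apply: Ex_le => //; first by apply: L1D => //; apply: L1Z; exact: L1Z.
move=> w; have p := negprofile_ge0 n (b' r w - b r w); have /andP[w0 w1] := W01 w.
(* The growth factor [1 + x] is compensated by the damping [expR (- x)], with
   [x = k * ((u - r) * sb r w)]. *)
rewrite [leLHS](_ : _ = W w * psi (b' r w - b r w) * (expR (- (k * ((u - r) * sb r w))) * (1 + k * ((u - r) * sb r w)))); last first.
  by rewrite /W'; ring.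
rewrite ler_piMr ?mulr_ge0//.
rewrite expRN mulrC ler_pdivrMr ?expR_gt0// mul1r.
exact: expR_ge1Dx.
Qed.

Let decay_half u : u < 1 -> Ex P (sb u) <= Num.sqrt (decay_const beta n_ge1 lambda) * half u.
Proof.
move=> u1; have L : L2 P (sb u).
  by apply: (L2_bounded (C := 1) P (msb u)) => w; have /andP[p q] := sb01 u w; rewrite ger0_norm.
have -> : Ex P (sb u) = Ex P (fun w => `|sb u w|).
  by apply: eq_Ex => w; rewrite ger0_norm; last by case/andP: (sb01 u w).
apply: le_trans (Ex_norm_sqrt L) _.
rewrite -sqrt_scale -sqrtrM ?decay_const_ge0// ler_wsqrtr//.
apply: le_trans (path_decay hZ beta_gt0 n_ge1 hb u1).
have ic : L1 P (fun w => cos (b u w)).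
  by apply: eq_L1 (L1_cosk hZ hb 1 u) => w; rewrite mul1r.
apply: Ex_le; [exact: L.2|by apply: L1B; [exact: L1_cst|exact: L1Z]|].
move=> w; rewrite /sb real_normK ?num_real// sqr_sin_half.
by have := cos_le1 (b u w); lra.
Qed.

Section Grid.
Variables (M m : nat).
(** The mesh is a perfect square, so [sqrt h = m.+1%:R^-1] exactly. The [N] steps lead from [- M] to
    0, and their errors add up to a multiple of [M%:R / m.+1%:R]. *)
Let h : R := (m.+1%:R)^-1 ^+ 2.
Let t (j : nat) : R := - M%:R + j%:R * h.
Let S (j : nat) (w : T) : R := \sum_(i < j) h * sb (t i) w.
Let W (j : nat) (w : T) : R := expR (- (k * S j w)).
Let N := (M * m.+1 ^ 2)%N.

Let h0 : 0 < h. Proof. by rewrite exprn_gt0// invr_gt0. Qed.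
Let h1 : h <= 1. Proof. by rewrite exprn_ile1// ?invr_ge0// invf_le1// ler1n. Qed.
Let tS j : t j.+1 = t j + h. Proof. by rewrite /t -natr1; ring. Qed.
Let tN : t N = 0.
Proof.
rewrite /t /N /h natrM natrX exprVn -mulrA mulfV ?mulr1 ?addNr// expf_neq0//.
Qed.
Let t_mono i j : (i <= j)%N -> t i <= t j.
Proof. by move=> ij; rewrite /t lerD2l ler_wpM2r ?(ltW h0)// ler_nat. Qed.

Let S_ge0 j w : 0 <= S j w.
Proof.
by apply: sumr_ge0 => i _; rewrite mulr_ge0 ?(ltW h0)//; case/andP: (sb01 (t i) w).
Qed.

Let S_adapted j : rv_measurable (F (t j)) (S j).
Proof.
elim: j => [|j IH].
  rewrite (_ : S 0 = fun=> 0); first exact: rv_cst.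
  by apply/funext => w; rewrite /S big_ord0.
rewrite (_ : S j.+1 = fun w => S j w + h * sb (t j) w); last first.
  by apply/funext => w; rewrite /S big_ord_recr.
have sub := @filtration_mono _ _ _ P Z _ _ (t_mono (leqnSn j)).
apply: rvD; first exact: rv_measurable_sub sub IH.
apply: rv_measurable_sub sub _; apply: rvM; first exact: rv_cst.
exact: sb_adapted.
Qed.

Let W_adapted j : rv_measurable (F (t j)) (W j).
Proof.
have mm : measurable_fun setT (fun x : R => expR (- (k * x))).
  by apply: measurableT_comp => //; apply: measurableT_comp => //; exact: measurable_funM.
exact: (rv_comp mm (@S_adapted j)).
Qed.

Let W01 j w : 0 <= W j w <= 1.
Proof. by rewrite expR_ge0/= -expR0 ler_expR oppr_le0 mulr_ge0. Qed.

(** [8 / beta] is the factor that makes the induction close: it times the growth of [half] over one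
    step covers the new term, by [1 + x <= expR x]. *)
Let S_mean j : (j <= N)%N -> L1 P (S j) /\
  Ex P (S j) <= Num.sqrt (decay_const beta n_ge1 lambda) * (8 / beta) * half (t j).
Proof.
set A := Num.sqrt _; have A0 : 0 <= A by exact: sqrtr_ge0.
elim: j => [|j IH] jN.
  have -> : S 0 = fun=> 0 by apply/funext => w; rewrite /S big_ord0.
  split; first exact: L1_cst.
  by rewrite Ex_cst mulr_ge0 ?(ltW (scale_gt0 _ _))// mulr_ge0// divr_ge0// ltW.
have [i e] := IH (ltnW jN).
have tj1 : t j < 1.
  by apply: le_lt_trans (t_mono (ltnW jN)) _; rewrite tN.
have is' : L1 P (sb (t j)).
  by apply: (L1_bounded (C := 1) P (msb (t j))) => w; have /andP[p q] := sb01 (t j) w; rewrite ger0_norm.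
have -> : S j.+1 = fun w => S j w + h * sb (t j) w.
  by apply/funext => w; rewrite /S big_ord_recr.
split; first by apply: L1D => //; exact: L1Z.
rewrite ExD ?ExZ//; last exact: L1Z.
apply: (@le_trans _ _ (A * (8 / beta) * half (t j) + h * (A * half (t j)))).
  by apply: lerD => //; rewrite ler_wpM2l ?(ltW h0)//; exact: decay_half.
have -> : A * (8 / beta) * half (t j) + h * (A * half (t j)) =
    A * (8 / beta) * (half (t j) * (1 + beta / 2 / 4 * h)).
  by field; rewrite gt_eqF.
rewrite ler_wpM2l//; first by rewrite mulr_ge0// divr_ge0// ltW.
rewrite tS /scale [in leRHS]mulrDr expRD ler_wpM2l ?expR_ge0//.
exact: expR_ge1Dx.
Qed.

Let W_mean K j : step_bound K -> (j <= N)%N ->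
  Ex P (fun w => W j w * psi (b' (t j) w - b (t j) w)) <=
  Ex P (fun w => psi (b' (- M%:R) w - b (- M%:R) w)) + j%:R * (K * (h * Num.sqrt h)).
Proof.
move=> st; elim: j => [|j IH] jN.
  rewrite mul0r addr0 /t mul0r addr0 le_eqVlt; apply/orP; left; apply/eqP.
  by apply: eq_Ex => w; rewrite /W /S big_ord0 mulr0 oppr0 expR0 mul1r.
have tj1 : t j.+1 <= 1 by apply: le_trans (t_mono jN) _; rewrite tN.
have dt : t j.+1 - t j = h by rewrite tS addrC addKr.
have lt : t j < t j.+1 by rewrite tS ltrDl.
have := st (t j) (t j.+1) (W j) lt tj1; rewrite dt => /(_ h1 (@W_adapted j) (W01 j)) le.
have -> : Ex P (fun w => W j.+1 w * psi (b' (t j.+1) w - b (t j.+1) w)) =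
   Ex P (fun w => W j w * expR (- (k * (h * sb (t j) w))) * psi (b' (t j.+1) w - b (t j.+1) w)).
  apply: eq_Ex => w; congr (_ * _); rewrite /W -expRD -opprD -mulrDr.
  by rewrite /S big_ord_recr.
apply: le_trans le _; rewrite -natr1 mulrDl mul1r addrA lerD2r.
exact: IH (ltnW jN).
Qed.

(** The integrating factor may be small, so the event is split at [S = l]: below it [W] is at least
    [expR (- (k * l))], above it [S / l] exceeds 1 and dominates the truncated function. *)
Lemma negprofile_mean K l : step_bound K -> 0 < l ->
  Ex P (fun w => Num.min (psi (b' 0 w - b 0 w)) 1) <=
  expR (k * l) * (Ex P (fun w => psi (b' (- M%:R) w - b (- M%:R) w)) + M%:R * K * (m.+1%:R)^-1) +
  Num.sqrt (decay_const beta n_ge1 lambda) * (8 / beta) / l.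
Proof.
move=> st l0; have := W_mean st (leqnn N); rewrite tN.
have [iS eS] := S_mean (leqnn N).
have -> : N%:R * (K * (h * Num.sqrt h)) = M%:R * K * (m.+1%:R)^-1.
  rewrite /h sqrtr_sqr ger0_norm ?invr_ge0// /N natrM natrX; field.
  by rewrite nat1r pnatr_eq0.
rewrite tN /scale mulr0 expR0 mulr1 in eS => eW.
have i0 := psi_L1 ler01.
have iW : L1 P (fun w => W N w * psi (b' 0 w - b 0 w)).
  apply: (L1M_bounded (C := 1) _ _ i0).
    exact: (adapted_measurable hZ (@W_adapted N)).
  by move=> w; have /andP[p q] := W01 N w; rewrite ger0_norm.
have pw w : Num.min (psi (b' 0 w - b 0 w)) 1 <= expR (k * l) * (W N w * psi (b' 0 w - b 0 w)) + l^-1 * S N w.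
  have p0 := negprofile_ge0 n (b' 0 w - b 0 w); have s0 := S_ge0 N w.
  have /andP[w0 _] := W01 N w.
  have [Sl|Sl] := leP (S N w) l.
    apply: (@le_trans _ _ (psi (b' 0 w - b 0 w))); first by rewrite ge_min lexx.
    apply: (@le_trans _ _ (expR (k * l) * (W N w * psi (b' 0 w - b 0 w)))).
      rewrite mulrA ler_peMl// /W -expRD -expR0 ler_expR -mulrBr mulr_ge0// subr_ge0//.
    by rewrite lerDl mulr_ge0// invr_ge0 ltW.
  apply: (@le_trans _ _ 1); first by rewrite ge_min lexx orbT.
  apply: (@le_trans _ _ (l^-1 * S N w)); first by rewrite mulrC ler_pdivlMr// mul1r ltW.
  by rewrite lerDr mulr_ge0 ?expR_ge0// mulr_ge0.
apply: (@le_trans _ _ (Ex P (fun w => expR (k * l) * (W N w * psi (b' 0 w - b 0 w)) + l^-1 * S N w))).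
  apply: Ex_le => //; last by apply: L1D; exact: L1Z.
  apply: (L1_le _ _ (L1_norm i0)).
    by apply: measurable_minr => //; exact: L1_measurable i0.
  move=> w; rewrite [leRHS]ger0_norm ?negprofile_ge0// ger0_norm; first by rewrite ge_min lexx.
  by rewrite le_min negprofile_ge0 ler01.
rewrite ExD ?ExZ//; [|exact: L1Z|exact: L1Z].
apply: lerD; first by rewrite ler_wpM2l ?expR_ge0.
by rewrite mulrC ler_wpM2r// invr_ge0 ltW.
Qed.

End Grid.

Let lim_le (a c e : R) (u : nat -> R) : u j @[j --> \oo] --> (0 : R) ->
  (forall j, a <= c + e * u j) -> a <= c.
Proof.
move=> u0 h; have l : c + e * u j @[j --> \oo] --> c.
  rewrite -[X in _ --> X]addr0 -[X in _ --> c + X](mulr0 e).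
  by apply: cvgD; [exact: cvg_cst|apply: cvgM => //; exact: cvg_cst].
rewrite -(cvg_lim (@Rhausdorff R) l); apply: limr_ge; first by apply/cvg_ex; exists c.
exact: nearW.
Qed.

(** The limits are taken in this order: mesh to 0, starting time to [-oo], where both paths tend to
    0 in mean, and only then [l] to infinity, because [expR (k * l)] multiplies the first two
    errors. *)
Lemma path_comparison : {ae P, forall w, b 0 w <= b' 0 w}.
Proof.
have [K K0 st] := step.
set D := Num.sqrt (decay_const beta n_ge1 lambda) * (8 / beta).
set X := Ex P (fun w => Num.min (psi (b' 0 w - b 0 w)) 1).
have inv0 : (j.+1%:R : R)^-1 @[j --> \oo] --> (0 : R) := @cvg_harmonic R.
have b1 l M : 0 < l -> X <= expR (k * l) * Ex P (fun w => psi (b' (- M%:R) w - b (- M%:R) w)) + D / l.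
  move=> l0; apply: (lim_le (e := expR (k * l) * (M%:R * K)) inv0) => m.
  by apply: le_trans (negprofile_mean M m st l0) _; rewrite mulrDr -!addrA lerD2l addrC mulrA.
have [C C0 [_ _ hC]] := @negprofile_taylor R n n_ge1.
have half0 := scale_cvg (divr_gt0 beta_gt0 (ltr0n R 2)).
set E := mean_const beta n_ge1 lambda + mean_const beta n_ge1 lambda'.
have b2 l : 0 < l -> X <= D / l.
  move=> l0; apply: (lim_le (e := expR (k * l) * (C * E)) half0) => M.
  apply: le_trans (b1 l M l0) _; rewrite addrC lerD2l -mulrA ler_wpM2l ?expR_ge0//.
  have M0 : - M%:R <= 0 :> R by rewrite oppr_le0.
  have [i e] := path_mean hZ beta_gt0 n_ge1 hb M0.
  have [i' e'] := path_mean hZ beta_gt0 n_ge1 hb' M0.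
  have M1 := le_trans M0 ler01.
  apply: (@le_trans _ _ (Ex P (fun w => C * (`|b (- M%:R) w| + `|b' (- M%:R) w|)))).
    apply: Ex_le; [exact: psi_L1|by apply: L1Z; apply: L1D; exact: L1_norm|].
    move=> w; apply: le_trans (hC _) _; by rewrite ler_wpM2l// [leRHS]addrC ler_normB.
  rewrite ExZ ?ExD; [|exact: L1_norm|exact: L1_norm|by apply: L1D; exact: L1_norm].
  by rewrite -mulrA ler_wpM2l// /E mulrDl lerD.
have b3 : X <= 0.
  by apply: (lim_le (e := D) inv0) => j; rewrite add0r; exact: b2.
have mpsi := L1_measurable (psi_L1 ler01).
have p0 w : 0 <= Num.min (psi (b' 0 w - b 0 w)) 1 by rewrite le_min negprofile_ge0 ler01.
have iX : L1 P (fun w => Num.min (psi (b' 0 w - b 0 w)) 1).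
  apply: (@L1_bounded _ _ _ P 1) => [|w]; first exact: measurable_minr.
  by rewrite ger0_norm// ge_min lexx orbT.
have := Ex_eq0_ae iX p0 b3; apply: filterS => w.
rewrite minEle; case: ifP => [_ e|_ /eqP]; last by rewrite oner_eq0.
by rewrite -subr_ge0; exact: (negprofile_eq0 n_ge1 e).
Qed.

End Comparison.

(** * Counting level crossings *)

Section Level.
Context {R : realType} {d : measure_display} {T : measurableType d}.
Variable P : probability T R.
Variables (A : R -> T -> R) (L : T -> R).
Hypothesis mA : forall x, measurable_fun setT (A x).
Hypothesis cA : forall w, continuous (A^~ w).
Hypothesis A_mono : forall w, {homo A^~ w : x y / x <= y}.
Hypothesis mL : measurable_fun setT L.

Definition crossed : set T := [set w | (exists x, L w <= A x w) /\ (exists x, A x w < L w)].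

(** The parameter at which the level is reached; 0 is a placeholder when the level is not crossed,
    removed by intersecting with [crossed]. *)
Definition hitting (w : T) : R :=
  if `[< crossed w >] then inf [set x | L w <= A x w] else 0.

(** The infimum is attained by continuity and the set above it is upward closed by monotonicity. *)
Lemma hitting_le w x : crossed w -> (hitting w <= x) = (L w <= A x w).
Proof.
move=> cw; rewrite /hitting asboolT//.
have [[x0 hx0] [y0 hy0]] := cw; set S := [set x | _].
have lbS y : A y w < L w -> lbound S y.
  move=> hy z Sz; rewrite leNgt; apply/negP => zy.
  have := le_lt_trans (A_mono w (ltW zy)) hy; apply/negP; rewrite -leNgt; exact: Sz.
have hS : has_inf S by split; [exists x0|exists y0; exact: lbS].
apply/idP/idP => [|h]; last by apply: ge_inf => //; exists y0; exact: lbS.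
move=> ix; apply: (le_trans _ (A_mono w ix)); rewrite leNgt; apply/negP => lt.
have [e /= e0 he] : exists2 e : R, 0 < e & forall y, `|inf S - y| < e -> A y w < L w.
  have /cvgr_dist_lt/(_ (L w - A (inf S) w)) := @cA w (inf S).
  rewrite subr_gt0 => /(_ lt) [e e0 he]; exists e => // y hy.
  have := he y hy; rewrite /= distrC => /(le_lt_trans (ler_norm _)).
  by rewrite ltrD2r.
have : inf S + e / 2 <= inf S.
  apply: lb_le_inf; first by exists x0.
  apply: lbS; apply: he; rewrite opprD addNKr normrN gtr0_norm ?divr_gt0//.
  by rewrite ltr_pdivrMr// ltr_pMr// ltr1n.
by apply/negP; rewrite -ltNge ltrDl divr_gt0.
Qed.

Lemma hittingE w : crossed w -> A (hitting w) w = L w.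
Proof.
move=> cw; apply/eqP; rewrite eq_le -hitting_le// lexx andbT leNgt; apply/negP => lt.
have /cvgr_dist_lt/(_ (A (hitting w) w - L w)) := @cA w (hitting w).
rewrite subr_gt0 => /(_ lt) [e /= e0 he].
have := he (hitting w - e / 2); rewrite /= opprB addrC subrK gtr0_norm ?divr_gt0//.
have -> : e / 2 < e by rewrite ltr_pdivrMr// ltr_pMr// ltr1n.
move=> /(_ isT) /(le_lt_trans (ler_norm _)); rewrite ltrD2l ltrN2 => h.
have : hitting w <= hitting w - e / 2 by rewrite hitting_le// ltW.
by apply/negP; rewrite -ltNge gtrBl divr_gt0.
Qed.

Let m_le x : measurable [set w | L w <= A x w].
Proof. by rewrite -[X in measurable X]setTI; exact: measurable_fun_le. Qed.

Let m_lt x : measurable [set w | A x w < L w].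
Proof.
rewrite (_ : [set _ | _] = ~` [set w | L w <= A x w]); first exact: measurableC.
by apply/seteqP; split=> w /=; [move=> h; apply/negP; rewrite -ltNge|move/negP; rewrite -ltNge].
Qed.

Lemma crossed_measurable : measurable crossed.
Proof.
rewrite (_ : crossed = (\bigcup_j [set w | L w <= A j%:R w]) `&` (\bigcup_j [set w | A (- j%:R) w < L w])).
  by apply: measurableI; apply: bigcupT_measurable => j; [exact: m_le|exact: m_lt].
apply/seteqP; split=> w.
  move=> [[x hx] [y hy]]; split.
    exists (Num.bound `|x|) => //=; apply: le_trans hx (A_mono w _).
    by apply: le_trans (ler_norm _) _; exact/ltW/archi_boundP.
  exists (Num.bound `|y|) => //=; apply: le_lt_trans hy; apply: A_mono.
  rewrite lerNl; apply: le_trans (ler_norm _) _; rewrite normrN.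
  exact/ltW/archi_boundP.
by move=> [[i _ hi] [j _ hj]]; split; [exists i%:R|exists (- j%:R)].
Qed.

Lemma hitting_measurable : measurable_fun setT (hitting : T -> measurableTypeR R).
Proof.
apply: (measurability (@RGenCInfty.G R)); first exact: RGenCInfty.measurableE.
move=> _ [_ [x ->] <-]; rewrite setTI.
have -> : hitting @^-1` `[x, +oo[ = ~` (hitting @^-1` `]-oo, x[).
  by rewrite -setCitvl preimage_setC.
apply: measurableC.
(* Strict inequality for an infimum is witnessed at some [x - j.+1%:R^-1]; off [crossed] the
   placeholder 0 decides. *)
have -> : hitting @^-1` `]-oo, x[ = (crossed `&` \bigcup_j [set w | L w <= A (x - j.+1%:R^-1) w]) `|`
    (~` crossed `&` [set w | 0 < x]).
  apply/seteqP; split=> w /=; rewrite in_itv/=.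
    have [cw hx|cw] := pselect (crossed w).
      left; split=> //; have hx0 : 0 < x - hitting w by rewrite subr_gt0.
      have [j hj] := ltr_add_invr (hx0); exists j => //=.
      rewrite -hitting_le// lerBrDl -lerBrDr; apply: ltW; move: hj; rewrite add0r.
      by [].
    by rewrite /hitting asboolF// => x0; right.
  move=> [[cw [j _ /=]]|[cw x0]].
    by rewrite -hitting_le// => /le_lt_trans; apply; rewrite gtrBl invr_gt0.
  by rewrite /hitting asboolF.
apply: measurableU; apply: measurableI.
- exact: crossed_measurable.
- by apply: bigcupT_measurable => j; exact: m_le.
- exact/measurableC/crossed_measurable.
- have [x0|x0] := pselect (0 < x).
    by rewrite (_ : [set _ | _] = setT)//; apply/seteqP; split.
  by rewrite (_ : [set _ | _] = set0)//; apply/seteqP; split.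
Qed.

Lemma hitting_itv a b : a <= b ->
  hitting @^-1` `]a, b] `&` crossed = [set w | L w <= A b w] `\` [set w | L w <= A a w].
Proof.
move=> ab; apply/seteqP; split=> w /=; rewrite in_itv/=.
  by move=> [/andP[h1 h2] cw]; rewrite -!hitting_le//; split=> //; apply/negP; rewrite -ltNge.
move=> [h1 /negP]; rewrite -ltNge => h2.
have cw : crossed w by split; [exists b|exists a].
by split=> //; rewrite hitting_le// h1 andbT ltNge hitting_le// -ltNge.
Qed.

(** Two points at the same level would make the path flat between them, hence equal to the level at
    a rational parameter. *)
Lemma level_set w : (forall q : rat, A (ratr q) w <> L w) ->
  [set x | A x w = L w] = if `[< crossed w >] then [set hitting w] else set0.
Proof.
move=> hq.
have flat x y : x < y -> A x w = L w -> A y w = L w -> False.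
  move=> xy hx hy; have [q] := rat_in_itvoo xy; rewrite in_itv/= => /andP[xq qy].
  apply: (hq q); apply/eqP; rewrite eq_le; apply/andP; split.
    by rewrite -hy; exact/A_mono/ltW.
  by rewrite -hx; exact/A_mono/ltW.
case: ifPn => /asboolP cw; apply/seteqP; split=> x //=.
- move=> hx; have := hitting_le x cw; rewrite hx lexx => /idP.
  rewrite le_eqVlt => /predU1P[//|lt].
  by have := flat _ _ lt (hittingE cw) hx.
- by move=> ->; exact: hittingE.
- move=> hx; apply: cw; split; first by exists x; rewrite hx.
  (* If no value lies below the level, monotonicity forces the value at [x - 1] to equal the level
     as well. *)
  apply: contrapT => h; apply: (flat (x - 1) x) => //; first by rewrite gtrBl.
  apply/eqP; rewrite eq_le -{1}hx A_mono ?gerBl//= leNgt; apply/negP => lt.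
  by apply: h; exists (x - 1).
Qed.

(** Law of the hitting parameter restricted to the event that the level is crossed, so its mass may
    be less than 1. *)
Definition hit_measure : {measure set (measurableTypeR R) -> \bar R} :=
  measure_function_pushforward__canonical__measure_function_Measure
    (T2 := measurableTypeR R) (mrestr P crossed_measurable) hitting_measurable.

Lemma hit_measureE B : hit_measure B = P (hitting @^-1` B `&` crossed).
Proof. by []. Qed.

End Level.

Section Clamp.
Context {R : realType}.

Definition clamp01 (z : R) : R := Num.max 0 (Num.min z 1).

Lemma clamp01_mono : {homo clamp01 : x y / x <= y}.
Proof.
move=> x y xy; rewrite /clamp01 ge_max !le_max lexx/=; apply/orP; right.
by rewrite le_min !ge_min xy lexx orbT.
Qed.

Lemma clamp01_itv z : 0 <= clamp01 z <= 1.
Proof. by rewrite /clamp01 le_max lexx ge_max ler01 ge_min lexx orbT. Qed.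

Lemma sum_clamp_pos K z : \sum_(j < K) clamp01 (z - j%:R) = Num.max 0 (Num.min z K%:R).
Proof.
elim: K => [|K IH]; first by rewrite big_ord0 max_l// ge_min lexx orbT.
rewrite big_ord_recr/= IH /clamp01 -natr1.
have K0 : 0 <= K%:R :> R by [].
move: (K%:R : R) K0 => k k0; rewrite /Num.min /Num.max.
by case: (ltP z k) => ?; case: (ltP (z - k) 1) => ?; case: (ltP z (k + 1)) => ?; repeat (case: ltP => ?); lra.
Qed.

Lemma sum_clamp_neg K z : \sum_(j < K) clamp01 (z + j.+1%:R) = Num.max (Num.min z 0) (- K%:R) + K%:R.
Proof.
elim: K => [|K IH].
  by rewrite big_ord0 oppr0 addr0 max_r// ge_min lexx orbT.
rewrite big_ord_recr/= IH /clamp01 -natr1.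
have K0 : 0 <= K%:R :> R by [].
move: (K%:R : R) K0 => k k0; rewrite /Num.min /Num.max.
by case: (ltP z 0) => ?; case: (ltP (z + (k + 1)) 1) => ?; repeat (case: ltP => ?); lra.
Qed.

(* The integer k contributes the length of the part of [x, y] lying in [k, k + 1]. *)
Lemma series_clamp x y : x <= y ->
  (\sum_(0 <= j <oo) (clamp01 (y - j%:R) - clamp01 (x - j%:R))%:E +
   \sum_(0 <= j <oo) (clamp01 (y + j.+1%:R) - clamp01 (x + j.+1%:R))%:E = (y - x)%:E)%E.
Proof.
(* Once [K] exceeds [|x|] and [|y|] the partial sums no longer change, so each series equals one of
   its partial sums. *)
move=> xy; have far := nbhs_infty_ger (Num.max `|x| `|y|).
have -> : (\sum_(0 <= j <oo) (clamp01 (y - j%:R) - clamp01 (x - j%:R))%:E = (Num.max 0 y - Num.max 0 x)%:E)%E.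
  apply: lim_near_cst => //; move: far; apply: filterS => K.
  rewrite ge_max => /andP[xK yK]; rewrite big_mkord sumEFin sumrB !sum_clamp_pos.
  by rewrite !min_l// (le_trans (ler_norm _)).
have -> : (\sum_(0 <= j <oo) (clamp01 (y + j.+1%:R) - clamp01 (x + j.+1%:R))%:E = (Num.min y 0 - Num.min x 0)%:E)%E.
  apply: lim_near_cst => //; move: far; apply: filterS => K.
  rewrite ge_max => /andP[xK yK]; rewrite big_mkord sumEFin sumrB !sum_clamp_neg.
  rewrite !max_l; last 2 first.
  - by rewrite le_min oppr_le0 ler0n andbT lerNl; apply: le_trans xK; rewrite -normrN ler_norm.
  - by rewrite le_min oppr_le0 ler0n andbT lerNl; apply: le_trans yK; rewrite -normrN ler_norm.
  by congr EFin; ring.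
rewrite -EFinD; congr EFin; rewrite /Num.min /Num.max.
by repeat case: ltP => ?; lra.
Qed.

End Clamp.

Section DensityMeasure.
Context {R : realType}.
Local Notation leb := (@lebesgue_measure R).
Variable rho : R -> R.
Hypothesis mrho : measurable_fun setT rho.
Hypothesis rho0 : forall x, 0 <= rho x.

Definition density_measure (B : set (measurableTypeR R)) : \bar R := (\int[leb]_(x in B) (rho x)%:E)%E.

Let m0 : density_measure set0 = 0%E.
Proof. by rewrite /density_measure integral_set0. Qed.

Let m_ge0 B : (0 <= density_measure B)%E.
Proof. by apply: integral_ge0 => x _; rewrite lee_fin. Qed.

Let m_additive : semi_sigma_additive density_measure.
Proof.
move=> F mF tF mUF; rewrite /density_measure ge0_integral_bigcup//.
- by apply: is_cvg_ereal_nneg_natsum => k _; exact: m_ge0.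
- by apply/measurable_EFinP; exact: measurable_funTS.
- by move=> x _; rewrite lee_fin.
Qed.

HB.instance Definition _ := isMeasure.Build _ _ _ density_measure m0 m_ge0 m_additive.

Definition bundled_density_measure : {measure set (measurableTypeR R) -> \bar R} := density_measure.

End DensityMeasure.

Lemma ae_forall_countable {R : realType} {d : measure_display} {T : measurableType d}
    (P : probability T R) (I : countType) (Q : I -> T -> Prop) :
  (forall i, {ae P, forall w, Q i w}) -> {ae P, forall w i, Q i w}.
Proof.
move=> h; have : {ae P, forall w, forall j : nat, if unpickle j is Some i then Q i w else True}.
  by apply: ae_foralln => j; case: (unpickle j) => [i|]; [exact: h|exact: aeW].
by apply: filterS => w hw i; have := hw (pickle i); rewrite pickleK.
Qed.

(** * Expected number of crossings *)

Section Count.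
Context {R : realType} {d : measure_display} {T : measurableType d}.
Variable P : probability T R.
Local Notation leb := (@lebesgue_measure R).
Variables (A : R -> T -> R) (Theta : T -> R) (F : R -> R).
Hypothesis mA : forall x, measurable_fun setT (A x).
Hypothesis cA : forall w, continuous (A^~ w).
Hypothesis A_mono : forall w, {homo A^~ w : x y / x <= y}.
Hypothesis mTheta : measurable_fun setT Theta.
Hypothesis indep : forall x, indep_rv P (A x) Theta.
Hypothesis mF : measurable_fun setT F.
Hypothesis F_mono : {homo F : x y / x <= y}.
Hypothesis F_period : forall x, F (x + 2 * pi) = F x + 1.
Hypothesis Theta_cdf : forall s, P [set w | Theta w <= s] = (clamp01 (F s))%:E.
Hypothesis Theta_atomless : forall s, P [set w | Theta w = s] = 0%E.
Hypothesis FA_L1 : forall x, L1 P (fun w => F (A x w)).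

Definition level (k : int) (w : T) : R := Theta w + 2 * pi * k%:~R.

Let mlevel k : measurable_fun setT (level k).
Proof. by apply: measurable_funD => //; exact: measurable_cst. Qed.

Let F_shift (k : int) x : F (x - 2 * pi * k%:~R) = F x - k%:~R.
Proof.
have nat_shift (j : nat) y : F (y + 2 * pi * j%:R) = F y + j%:R.
  elim: j y => [|j IH] y; first by rewrite mulr0 !addr0.
  by rewrite -[j.+1%:R]natr1 mulrDr [_ * 1]mulr1 addrA F_period IH addrA.
case: k => j; first by rewrite -[in RHS](subrK (2 * pi * j%:~R) x) nat_shift addrK.
by rewrite NegzE mulrNz mulrN !opprK nat_shift.
Qed.

(** Conditioning on the path: by independence [Theta] can be averaged first with [A x] frozen. *)
Let prob_sub (x : R) (D : set (R * R)) : measurable D ->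
  P [set w | D (A x w, Theta w)] = (\int[P]_w P [set w' | D (A x w, Theta w')])%E.
Proof.
move=> mD.
have mf : measurable_fun setT (fun z : R * R => (\1_D z : R)%:E).
  by apply/measurable_EFinP; exact: measurable_indic.
have mR : measurable [set w | D (A x w, Theta w)].
  rewrite -[X in measurable X]setTI.
  have mp : measurable_fun setT (fun w => (A x w, Theta w)) by exact: measurable_fun_pair.
  exact: mp.
have m1 w : measurable [set w' | D (A x w, Theta w')].
  rewrite -[X in measurable X]setTI.
  have mp : measurable_fun setT (fun w' => (A x w, Theta w')) by exact: measurable_fun_pair.
  exact: mp.
have := indep_fubini_ge0 (mA x) mTheta (@indep x) mf (fun z => _).
move=> h.
transitivity (\int[P]_w (\1_D (A x w, Theta w))%:E)%E.
  by rewrite -[X in P X]setIT -integral_indic.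
rewrite h; last by move=> z; rewrite lee_fin.
by apply: eq_integral => w _; rewrite -[X in _ = P X]setIT -integral_indic.
Qed.

Let level_prob (k : int) (x : R) :
  P [set w | level k w <= A x w] = (Ex P (fun w => clamp01 (F (A x w) - k%:~R)))%:E.
Proof.
pose D : set (R * R) := [set z | z.2 + 2 * pi * k%:~R <= z.1].
have mD : measurable D.
  rewrite -[X in measurable X]setTI; apply: measurable_fun_le => //.
  by apply: measurable_funD => //; exact: measurable_cst.
rewrite (@prob_sub x D mD) -Ex_EFin; last first.
  apply: (@L1_bounded _ _ _ P 1) => [|w].
    apply: measurable_maxr => //; apply: measurable_minr => //.
    by apply: measurable_funB => //; exact: measurableT_comp.
  by have /andP[p q] := clamp01_itv (F (A x w) - k%:~R); rewrite ger0_norm.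
apply: eq_integral => w _; rewrite -F_shift -Theta_cdf; congr (P _).
by apply/seteqP; split=> w' /=; rewrite lerBrDr.
Qed.

(** For a fixed rational parameter and a fixed level the coincidence has probability 0, since
    [Theta] has no atoms and is independent of the path; there are countably many pairs. This
    supplies the hypothesis of [level_set]. *)
Let no_flat : {ae P, forall w (qk : rat * int), A (ratr qk.1) w <> level qk.2 w}.
Proof.
apply: ae_forall_countable => -[q k] /=.
pose D : set (R * R) := [set z | z.1 = z.2 + 2 * pi * k%:~R].
have mD : measurable D.
  rewrite (_ : D = [set z | z.2 + 2 * pi * k%:~R <= z.1] `&` [set z | z.1 <= z.2 + 2 * pi * k%:~R]).
    by apply: measurableI; rewrite -[X in measurable X]setTI; apply: measurable_fun_le => //;
      apply: measurable_funD => //; exact: measurable_cst.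
  apply/seteqP; split=> z /=; first by move=> ->; rewrite lexx.
  by move=> [h1 h2]; apply/eqP; rewrite eq_le h1 h2.
have mR : measurable [set w | A (ratr q) w = level k w].
  rewrite -[X in measurable X]setTI.
  have mp : measurable_fun setT (fun w => (A (ratr q) w, Theta w)) by exact: measurable_fun_pair.
  exact: (mp measurableT D mD).
exists [set w | A (ratr q) w = level k w]; split=> //; last by move=> w /= /contrapT.
rewrite (@prob_sub (ratr q) D mD) (eq_integral (cst 0%E)) ?integral0// => w _.
rewrite -(Theta_atomless (A (ratr q) w - 2 * pi * k%:~R)); congr (P _).
apply/seteqP; split=> w'; rewrite /D /=; first by move=> ->; rewrite addrK.
by move=> ->; rewrite subrK.
Qed.

Let hit k := hit_measure P mA cA A_mono (mlevel k).

Let hit_itv k a b : a <= b -> hit k `]a, b]%classic =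
  (\int[P]_w (clamp01 (F (A b w) - k%:~R) - clamp01 (F (A a w) - k%:~R))%:E)%E.
Proof.
move=> ab; have i x : L1 P (fun w => clamp01 (F (A x w) - k%:~R)).
  apply: (@L1_bounded _ _ _ P 1) => [|w].
    apply: measurable_maxr => //; apply: measurable_minr => //.
    by apply: measurable_funB => //; exact: measurableT_comp.
  by have /andP[p q] := clamp01_itv (F (A x w) - k%:~R); rewrite ger0_norm.
have m x : measurable [set w | level k w <= A x w].
  by rewrite -[X in measurable X]setTI; exact: measurable_fun_le.
rewrite /hit hit_measureE hitting_itv// measureD//; last first.
  by rewrite (le_lt_trans (probability_le1 _ _)) ?ltry.
rewrite setIidr; last by move=> w /= h; apply: le_trans h (A_mono w ab).
transitivity ((Ex P (fun w => clamp01 (F (A b w) - k%:~R)))%:E - (Ex P (fun w => clamp01 (F (A a w) - k%:~R)))%:E)%E.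
  by congr (_ - _)%E; exact: level_prob.
by rewrite -EFinB -ExB// Ex_EFin//; exact: L1B.
Qed.

(** The sum over all levels is a sum over the integers, split into two series indexed by the
    constructors [Posz] and [Negz]. *)
Let nu_pos : {measure set (measurableTypeR R) -> \bar R} := mseries (fun j : nat => hit (Posz j)) 0.
Let nu_neg : {measure set (measurableTypeR R) -> \bar R} := mseries (fun j : nat => hit (Negz j)) 0.
Let nu : {measure set (measurableTypeR R) -> \bar R} := measure_add nu_pos nu_neg.

Let nuE B : nu B = (\sum_(0 <= j <oo) hit (Posz j) B + \sum_(0 <= j <oo) hit (Negz j) B)%E.
Proof. exact: measure_addE. Qed.

Lemma nu_itv a b : a <= b -> nu `]a, b]%classic = (Ex P (fun w => F (A b w)) - Ex P (fun w => F (A a w)))%:E.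
Proof.
move=> ab; rewrite nuE.
have m (k : int) x : measurable_fun setT (fun w => clamp01 (F (A x w) - k%:~R)).
  apply: measurable_maxr => //; apply: measurable_minr => //.
  by apply: measurable_funB => //; exact: measurableT_comp.
pose u (k : int) w : \bar R := (clamp01 (F (A b w) - k%:~R) - clamp01 (F (A a w) - k%:~R))%:E.
have mu k : measurable_fun setT (u k) by apply/measurable_EFinP; exact: measurable_funB.
have u0 k w : (0 <= u k w)%E.
  by rewrite lee_fin subr_ge0; apply: clamp01_mono; rewrite lerD2r; exact/F_mono/A_mono.
rewrite (eq_eseriesr (fun j _ => hit_itv (Posz j) ab)) (eq_eseriesr (fun j _ => hit_itv (Negz j) ab)).
rewrite -(integral_nneseries P measurableT (f := fun j => u (Posz j)))//.
rewrite -(integral_nneseries P measurableT (f := fun j => u (Negz j)))//.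
have m_pos : measurable_fun setT (fun w => \sum_(0 <= j <oo) u (Posz j) w)%E.
  by apply: ge0_emeasurable_sum.
have m_neg : measurable_fun setT (fun w => \sum_(0 <= j <oo) u (Negz j) w)%E.
  by apply: ge0_emeasurable_sum.
rewrite -ge0_integralD//; [|by move=> w _; exact: nneseries_ge0|by move=> w _; exact: nneseries_ge0].
rewrite -ExB// -Ex_EFin; last exact: L1B.
apply: eq_integral => w _; rewrite -series_clamp; last exact/F_mono/A_mono.
congr (_ + _)%E; apply: eq_eseriesr => j _ //.
by rewrite /u NegzE mulrNz !opprK.
Qed.

Variable rho : R -> R.
Hypothesis mrho : measurable_fun setT rho.
Hypothesis rho0 : forall x, 0 <= rho x.
Hypothesis FA_rho : forall a b, a <= b ->
  (\int[leb]_(x in `[a, b]) (rho x)%:E = (Ex P (fun w => F (A b w)) - Ex P (fun w => F (A a w)))%:E)%E.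

(** Two measures that agree on half-open intervals, and are finite on those that exhaust the line,
    are equal. *)
Let nu_density B : measurable B -> nu B = (\int[leb]_(x in B) (rho x)%:E)%E.
Proof.
move=> mB; rewrite -[RHS]/(bundled_density_measure mrho rho0 B).
apply: (@measure_unique _ R (measurableTypeR R) (@ocitv R)
   (fun j : nat => `](- j%:R)%R, j%:R%R]%classic)) => //.
- exact: ocitvI.
- move=> j; exact: is_ocitv.
- apply/seteqP; split=> // x _; exists (Num.bound `|x|) => //=; rewrite in_itv/=.
  have h := archi_boundP (normr_ge0 x); apply/andP; split.
    by rewrite ltrNl; apply: le_lt_trans h; rewrite -normrN ler_norm.
  by apply: le_trans (ltW h); exact: ler_norm.
- move=> _ [[a b] _ <-] /=; have [ba|ab] := leP b a.
    by rewrite set_itv_ge ?measure0// bnd_simp -leNgt.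
  rewrite nu_itv ?(ltW ab)// -FA_rho ?(ltW ab)// /bundled_density_measure /= /density_measure.
  rewrite integral_itv_obnd_cbnd//; apply/measurable_EFinP; exact: measurable_funTS.
- by move=> j; rewrite nu_itv ?ltry//; apply: (@le_trans _ _ 0); rewrite ?oppr_le0.
Qed.

Theorem expected_points_density B : measurable B ->
  expected_points P (fun w => [set x | exists k : int, A x w = level k w]) B
    (\int[leb]_(x in B) (rho x)%:E)%E.
Proof.
move=> mB.
pose E k := hitting A (level k) @^-1` B `&` crossed A (level k).
have mE k : measurable (E k).
  apply: measurableI; last exact: crossed_measurable.
  rewrite -[X in measurable X]setTI; exact: (hitting_measurable mA cA A_mono (mlevel k)).
(* Each level carries at most one point almost surely, so counting points amounts to adding the
   indicators of a hit in [B]. *)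
exists (fun w => \sum_(0 <= j <oo) (\1_(E (Posz j)) w)%:E + \sum_(0 <= j <oo) (\1_(E (Negz j)) w)%:E)%E.
have m1 k : measurable_fun setT (fun w => (\1_(E k) w : R)%:E).
  by apply/measurable_EFinP; exact: measurable_indic.
have p1 k w : (0 <= (\1_(E k) w : R)%:E)%E by rewrite lee_fin.
have mp : measurable_fun setT (fun w => \sum_(0 <= j <oo) (\1_(E (Posz j)) w : R)%:E)%E.
  by apply: ge0_emeasurable_sum.
have mn : measurable_fun setT (fun w => \sum_(0 <= j <oo) (\1_(E (Negz j)) w : R)%:E)%E.
  by apply: ge0_emeasurable_sum.
split.
- exact: emeasurable_funD.
- move: no_flat; apply: filterS => w hw.
  have lev k : [set x | A x w = level k w] = if `[< crossed A (level k) w >] then [set hitting A (level k) w] else set0.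
    by apply: level_set => // q; exact: (hw (q, k)).
  pose S k := B `&` [set x | A x w = level k w].
  have cS k : counting (S k) = (\1_(E k) w : R)%:E.
    rewrite /S lev indicE; have [ck|ck] := asboolP (crossed A (level k) w); last first.
      rewrite setI0 measure0 (_ : w \in E k = false)//; apply/negbTE; rewrite notin_setE => -[] //.
    have [hB|hB] := pselect (B (hitting A (level k) w)).
      rewrite setIidr; last by move=> x /= ->.
      rewrite mem_set//=; rewrite /counting asboolT// fset_set1 finmap.cardfs1//.
    rewrite (_ : _ `&` _ = set0); last by apply/seteqP; split=> // x /= [xB] ex; apply: hB; rewrite -ex.
    by rewrite measure0 memNset//; move=> [].
  have inj k k' : level k w = level k' w -> k = k'.
    move=> /addrI /mulfI h; apply: (@intr_inj R); apply: h.
    by rewrite mulf_neq0 ?pnatr_eq0// gt_eqF// pi_gt0.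
  have disj k k' : k <> k' -> S k `&` S k' = set0.
    move=> kk'; apply/seteqP; split=> // x [[_ /= h] [_ /= h']]; apply: kk'; apply: inj.
    by rewrite -h -h'.
  have mS k : measurable (S k : set (measurableTypeR R)).
    by rewrite /S lev; apply: measurableI => //; case: ifP.
  have -> : B `&` [set x | exists k : int, A x w = level k w] =
     (\bigcup_j S (Posz j)) `|` (\bigcup_j S (Negz j)).
    apply/seteqP; split=> x.
      by move=> [xB [[j|j] h]]; [left|right]; exists j.
    by move=> [[j _ [xB h]]|[j _ [xB h]]]; split=> //; [exists (Posz j)|exists (Negz j)].
  have tP : trivIset setT (fun j => S (Posz j)).
    by apply/trivIsetP => i j _ _ ij; apply: disj => -[e]; rewrite e eqxx in ij.
  have tN : trivIset setT (fun j => S (Negz j)).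
    by apply/trivIsetP => i j _ _ ij; apply: disj => -[e]; rewrite e eqxx in ij.
  pose cm : {measure set (measurableTypeR R) -> \bar R} := counting.
  rewrite -[RHS]/(cm _) measureU; last 3 first.
  - exact: bigcupT_measurable.
  - exact: bigcupT_measurable.
  - by apply/seteqP; split=> // x [[i _ hi] [j _ hj]]; rewrite -(disj (Posz i) (Negz j)).
  have cU (g : nat -> int) : trivIset setT (fun j => S (g j)) ->
      cm (\bigcup_j S (g j)) = (\sum_(0 <= j <oo) (\1_(E (g j)) w : R)%:E)%E.
    move=> tg; rewrite (@measure_semi_bigcup _ _ _ cm (fun j => S (g j)))//; last exact: bigcupT_measurable.
    by apply: eq_eseriesr => j _; rewrite -cS.
  by congr (_ + _)%E; [exact: (esym (cU Posz tP))|exact: (esym (cU Negz tN))].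
- rewrite ge0_integralD//; [|by move=> w _; exact: nneseries_ge0|by move=> w _; exact: nneseries_ge0].
  rewrite !integral_nneseries// -nu_density// nuE; congr (_ + _)%E; apply: eq_eseriesr => j _.
    by rewrite integral_indic// setIT.
  by rewrite integral_indic// setIT.
Qed.

End Count.

Lemma cvg_sum_ord {R : realType} {T : Type} (F : set_system T) (n : nat) (f : 'I_n -> T -> R) (l : 'I_n -> R) :
  Filter F -> (forall i, f i x @[x --> F] --> l i) ->
  \sum_(i < n) f i x @[x --> F] --> \sum_(i < n) l i.
Proof. by move=> FF h; apply: cvg_big => [|i _]; [exact: add_continuous|exact: h]. Qed.

(** * The density of the point process *)

Section ThetaLaw.
Context {R : realType} {d : measure_display} {T : measurableType d}.
Variable P : probability T R.
Local Notation leb := (@lebesgue_measure R).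
Variables (n : nat) (Theta : T -> R).
Hypothesis hTheta : theta_variable P n Theta.

(** Both sides are multiples of [(2 - 2 * cos x) ^+ n], as
    [(1 - e^(-ix)) (1 - e^(ix)) = 2 - 2 cos x]. The constant stays abstract, with the Gamma values
    inside. *)
Lemma theta_density_profile : exists K : R, forall x : R,
  complex.Re (theta_density n x) = K * profile1 n x.
Proof.
exists ((2 * pi)^-1 * (Gamma (1 + n%:R) ^+ 2 / Gamma (1 + 2 * n%:R)) / profile_scale n) => x.
have e : (1 - expi (- x)) * (1 - expi x) = (2 - 2 * cos x)%:C%C :> R[i].
  apply/eqP; rewrite eq_complex Re_mul Im_mul /expi /= cosN sinN; apply/andP; split; apply/eqP.
    by have := cos2Dsin2 x; rewrite !expr2; lra.
  by rewrite /=; ring.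
rewrite /theta_density -mulrA -exprMn e -(rmorphXn (real_complex R)) -(rmorphM (real_complex R)) [LHS]/=.
rewrite profile1E mulrA divfK//.
by rewrite gt_eqF// profile_scale_gt0.
Qed.

Let norm_const : R := sval (cid theta_density_profile).

Let theta_densityE x : complex.Re (theta_density n x) = norm_const * profile1 n x.
Proof. by rewrite /norm_const; case: cid. Qed.

Let c1 : continuous (fun x : R => norm_const * @profile1 R n x).
Proof. by apply: dv_all_continuous => x; apply: dvZ; exact: profile1_dv. Qed.

Let prefix s : 0 <= s -> (\int[leb]_(x in `[0%R, s]) (complex.Re (theta_density n x))%:E =
  (norm_const * @profile R n s)%:E)%E.
Proof.
move=> s0; under eq_integral do rewrite theta_densityE.
move: norm_const c1 => K cK.
rewrite (ftc_on (f := fun x => K * @profile R n x) cK _ s0); first by rewrite profile0 mulr0 subr0.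
by move=> x _; apply: dvZ; exact: profile_dv.
Qed.

Let m1 : measurable_fun setT (EFin \o (fun x : R => complex.Re (theta_density n x))).
Proof.
apply/measurable_EFinP; rewrite (_ : (fun x => _) = fun x => norm_const * @profile1 R n x).
  exact: measurable_continuous c1.
by apply/funext => x; exact: theta_densityE.
Qed.

Let full : (\int[leb]_(x in `[0%R, (2 * pi)%R[) (complex.Re (theta_density n x))%:E = norm_const%:E)%E.
Proof.
rewrite integral_itv_bndo_bndc; last exact: measurable_funTS.
rewrite prefix; last by rewrite mulr_ge0// pi_ge0.
by have := @profile_2pi R n 0; rewrite add0r profile0 add0r => ->; rewrite mulr1.
Qed.

(** The law of [Theta] has mass 1 and the profile increases by 1 over a period, which forces the
    constant. *)
Let norm_const1 : norm_const = 1.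
Proof.
have := theta_law hTheta measurableT; rewrite preimage_setT probability_setT setTI full.
by move=> [].
Qed.

Lemma theta_cdf s : P [set w | Theta w <= s] = (clamp01 (@profile R n s))%:E.
Proof.
have p2 : 0 < 2 * pi :> R by rewrite mulr_gt0// pi_gt0.
have F2 : @profile R n (2 * pi) = 1 by have := @profile_2pi R n 0; rewrite add0r profile0 add0r.
have -> : [set w | Theta w <= s] = Theta @^-1` `]-oo, s].
  by apply/seteqP; split=> w /=; rewrite in_itv.
rewrite (theta_law hTheta)//; have [s0|s0] := ltP s 0.
  rewrite (_ : _ `&` _ = set0) ?integral_set0; last first.
    by apply/seteqP; split=> // x /=; rewrite !in_itv/= => -[xs /andP[x0 _]]; lra.
  congr EFin; rewrite /clamp01 max_l// ge_min -[X in X || _](_ : true = _)//.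
  by apply/esym; rewrite -[X in _ <= X](@profile0 R n); exact/profile_nondecreasing/ltW.
have F0 : 0 <= @profile R n s by rewrite -[leLHS](@profile0 R n); exact: profile_nondecreasing.
have [sp|sp] := ltP s (2 * pi).
  have -> : `]-oo, s] `&` `[0, (2 * pi)%R[ = `[0, s]%classic.
    apply/seteqP; split=> x /=; rewrite !in_itv/=.
      by move=> [-> /andP[-> _]].
    by move=> /andP[-> xs]; rewrite xs (le_lt_trans xs sp).
  rewrite prefix// norm_const1 mul1r; congr EFin.
  rewrite /clamp01 min_l ?max_r// -F2; exact/profile_nondecreasing/ltW.
have -> : `]-oo, s] `&` `[0, (2 * pi)%R[ = `[0, (2 * pi)%R[%classic.
  apply/seteqP; split=> x /=; rewrite !in_itv/=; first by case.
  by move=> h; split=> //; case/andP: h => _ /ltW h; exact: le_trans h sp.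
rewrite full norm_const1; congr EFin; rewrite /clamp01 min_r ?max_r//.
by rewrite -F2; exact: profile_nondecreasing.
Qed.

Lemma theta_atomless s : P [set w | Theta w = s] = 0%E.
Proof.
have -> : [set w | Theta w = s] = Theta @^-1` [set s] by [].
rewrite (theta_law hTheta)//.
have [h|h] := pselect ((`[0%R, (2 * pi)%R[%classic : set R) s).
  rewrite (_ : _ `&` _ = [set s]) ?integral_set1//.
  by apply/seteqP; split=> x /=; [case|move=> ->].
rewrite (_ : _ `&` _ = set0) ?integral_set0//.
by apply/seteqP; split=> // x [/= ->].
Qed.

End ThetaLaw.

(** * Independence of Theta and the solutions *)

Section Independence.
Context {R : realType} {d : measure_display} {T : measurableType d}.
Variable P : probability T R.
Variable Z : R -> T -> R[i].
Hypothesis hZ : two_sided_complex_BM P Z.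

Let off_null (A B N : set T) : measurable A -> measurable B -> measurable N -> P N = 0%E ->
  (forall w, ~ N w -> A w <-> B w) -> P A = P B.
Proof.
move=> mA mB mN N0 h.
have le C D : measurable C -> measurable D -> (forall w, ~ N w -> C w -> D w) -> (P C <= P D)%E.
  move=> mC mD CD; apply: (@le_trans _ _ (P (D `|` N))).
    rewrite le_measure ?inE//; first exact: measurableU.
    by move=> w Cw; have [Nw|Nw] := pselect (N w); [right|left; exact: CD].
  by rewrite measureU0.
by apply/eqP; rewrite eq_le !le// => w Nw; rewrite h.
Qed.

(** The filtration contains null events that need not belong to [sigma_of_process Z]. The family [G]
    consists of the events that agree with an event of that sigma-algebra off a null event, which
    changes no probability. *)
Lemma filtration_indep (Theta X : T -> R) u : measurable_fun setT Theta ->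
  independent P <<s preimages setT (fun _ : unit => Theta) >> (sigma_of_process Z) ->
  rv_measurable (filtration P Z u) X -> indep_rv P X Theta.
Proof.
move=> mTheta ind hX A B mA mB.
have mThB : measurable (Theta @^-1` B) by rewrite -[X in measurable X]setTI; exact: mTheta.
have mre v : measurable_fun setT (re_part Z v) := BM_measurable (cBM_re hZ) v.
have mim v : measurable_fun setT (im_part Z v) := BM_measurable (cBM_im hZ) v.
have mS : sigma_of_process Z `<=` measurable.
  apply: sigma_sub_measurable => C [|]; exact: preimages_sub_measurable.
pose G := [set S : set T | measurable S /\ exists S' N, [/\ sigma_of_process Z S', measurable N, P N = 0%E &
   forall w, ~ N w -> S w <-> S' w]].
have sub : filtration P Z u `<=` <<s G >>.
  have inc W : (forall v, measurable_fun setT (W v)) -> preimages setT W `<=` sigma_of_process Z ->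
      preimages (before u) (increment W) `<=` G.
    move=> mW WZ C [p [D [_ mD ->]]]; split.
      rewrite -[X in measurable X]setTI.
      have : measurable_fun setT (increment W p) by exact: measurable_funB.
      exact.
    exists (increment W p @^-1` D), set0; split=> //.
    have : rv_measurable (sigma_of_process Z) (increment W p).
      by apply: rvB => E mE; apply: WZ; [exists p.2, E|exists p.1, E].
    exact.
  apply: sigma_subset => C [[hC|hC]|[mC C0]]; apply: sub_sigma_algebra.
  - by apply: inc hC => // D hD; apply: sub_sigma_algebra; left.
  - by apply: inc hC => // D hD; apply: sub_sigma_algebra; right.
  - split=> //; exists set0, C; split=> //.
    exact: (@measurable0 _ (g_sigma_algebraType _)).
apply: (@indep_sigma _ _ _ P G) => //.
- by move=> S [].
- move=> S1 S2 [m1 [S1' [N1 [h1 mN1 N10 e1]]]] [m2 [S2' [N2 [h2 mN2 N20 e2]]]]; split; first exact: measurableI.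
  exists (S1' `&` S2'), (N1 `|` N2); split.
  + exact: sigmaI.
  + exact: measurableU.
  + by rewrite measureU0.
  + move=> w Nw; have [k1 k2] : S1 w <-> S1' w by apply: e1 => ?; apply: Nw; left.
    have [k3 k4] : S2 w <-> S2' w by apply: e2 => ?; apply: Nw; right.
    by split=> -[p q]; split; [exact: k1|exact: k3|exact: k2|exact: k4].
- move=> S [mS' [S' [N [hS' mN N0 e]]]].
  rewrite (@off_null S S' N)//; last exact: mS.
  rewrite (@off_null (S `&` _) (S' `&` Theta @^-1` B) N)//.
  + rewrite setIC ind// 1?muleC//; apply: sub_sigma_algebra; by exists tt, B.
  + exact: measurableI.
  + by apply: measurableI => //; exact: mS.
  + by move=> w /e [k1 k2]; split=> -[p q]; split=> //; [exact: k1|exact: k2].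
- by apply: sub; exact: hX.
Qed.

End Independence.

Lemma near_lt {R : realType} (a b p q : R) : `|a - p| < (a - b) / 2 -> `|b - q| < (a - b) / 2 -> q < p.
Proof. by rewrite !ltr_norml => /andP[? ?] /andP[? ?]; lra. Qed.

Section Assembly.
Context {R : realType} {d : measure_display} {T : measurableType d}.
Variable P : probability T R.
Variable Z : R -> T -> R[i].
Local Notation leb := (@lebesgue_measure R).
Variables (beta : R) (n : nat) (alpha : R -> R -> T -> R).
Hypothesis hZ : two_sided_complex_BM P Z.
Hypothesis beta_gt0 : 0 < beta.
Hypothesis n_ge1 : (1 <= n)%N.
Hypothesis halpha : forall lambda, strong_solution P Z beta n lambda (alpha lambda).

Let scale0 : scale beta 0 = 1. Proof. by rewrite /scale mulr0 expR0. Qed.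

Let path lambda := cid (strong_solution_path (halpha lambda)).
Let b lambda : R -> T -> R := sval (path lambda).

Let hb lambda : sde_path P Z beta n lambda (b lambda).
Proof. by rewrite /b; case: (path lambda) => /= ? [N []]. Qed.

Let alphaE lambda : {ae P, forall w, alpha lambda 0 w = b lambda 0 w}.
Proof.
rewrite /b; case: (path lambda) => /= c [N [_ mN N0 e]].
by exists N; split=> // w /= h; apply: contrapT => /e /(_ 0).
Qed.

Let malpha lambda : measurable_fun setT (alpha lambda 0).
Proof. exact: (adapted_measurable hZ (sol_adapted (halpha lambda) (u := 0))). Qed.

Let malphak k lambda : measurable_fun setT (fun w => cos (k%:R * alpha lambda 0 w)).
Proof.
apply: (measurableT_comp (measurable_continuous (@continuous_cos R))).
by apply: measurable_funM.
Qed.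

Lemma q_vecE lambda (i : 'I_n) :
  complex.Re (q_vec P n alpha lambda i ord0) = series_limit beta n i.+1 lambda.
Proof.
have e := cos_meanE hZ beta_gt0 (hb lambda) i ltr01.
rewrite scale0 mulr1 in e; rewrite -e mxE /cexpectation /=.
apply: eq_Ex_ae.
- exact: malphak.
- exact: L1_measurable (L1_cosk hZ (hb lambda) i.+1 0).
- by move: (alphaE lambda); apply: filterS => w ->.
Qed.

Lemma hp_densityE lambda : (2 * pi)^-1 * (1 + 2 * ((v_vec R n)^T *m
   map_mx (@complex.Re R) (q_vec P n alpha lambda)) ord0 ord0) = hp_density beta n lambda.
Proof.
congr (_ * (_ + _ * _)); rewrite mxE; apply: eq_bigr => i _.
rewrite [X in _ * X]mxE q_vecE; congr (_ * _).
by rewrite mxE mxE /profile_coef.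
Qed.

Lemma hp_density_continuous : continuous (hp_density beta n).
Proof.
have cq (i : 'I_n) : continuous (series_limit beta n i.+1).
  apply: (@limit_continuous R beta n _ Re_i i) => m y.
  have := cos_mean_error hZ beta_gt0 (hb y) i m ltr01.
  by rewrite (cos_meanE hZ beta_gt0 (hb y) i ltr01) scale0 mulr1.
move=> y; apply: cvgM; first exact: cvg_cst.
apply: cvgD; first exact: cvg_cst.
apply: cvgM; first exact: cvg_cst.
apply: cvg_sum_ord => i.
by apply: cvgM; [exact: cvg_cst|exact: cq].
Qed.

Lemma hp_density_nonneg y : 0 <= hp_density beta n y.
Proof.
by have := hp_density_ge0 hZ beta_gt0 (hb y) ltr01; rewrite scale0 mulr1.
Qed.

Let series_term (j : nat) (lambda : R) : R :=
  Re_i j * (\sum_(i < n) profile_coef n i.+1 * series_coef beta n j i.+1) * lambda ^+ j.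

(** Odd powers of ['i] are imaginary: this is why only even powers of [lambda] appear in the
    density. *)
Lemma Re_i_odd j : Re_i (R := R) (2 * j).+1 = 0.
Proof.
elim: j => [|j IH]; first by rewrite Re_iS /Im_i expr0 /= oppr0.
by rewrite mulnS !add2n Re_iS Im_iS IH oppr0.
Qed.

Let term_odd lambda j : series_term (2 * j).+1 lambda = 0.
Proof. by rewrite /series_term Re_i_odd !mul0r. Qed.

(** At order 0 all moments are 1, so the sum of the coefficients is the cosine sum at 0, where
    [profile1] vanishes. The density thus vanishes at [lambda = 0] and its series starts at
    [j = 1]. *)
Let term0 lambda : series_term 0 lambda = - 2^-1.
Proof.
rewrite /series_term expr0 mulr1 /Re_i expr0 /= mul1r.
have := @profile1_0 R n n_ge1; rewrite /profile1 /trig_sum.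
have p0 : (2 * pi)^-1 != 0 :> R by rewrite invr_eq0 mulf_neq0 ?pnatr_eq0// gt_eqF// pi_gt0.
move/eqP; rewrite mulf_eq0 (negbTE p0) /= => /eqP h.
have e : \sum_(i < n) profile_coef n i.+1 * series_coef beta n 0 i.+1 =
   \sum_(i < n) profile_coef n i.+1 * cos (i.+1%:R * 0) :> R.
  by apply: eq_bigr => i _; rewrite mulr0 cos0 (series_coef0 beta).
by rewrite e; move: (\sum_(i < n) _) h => S h; lra.
Qed.

Let terms_cvg lambda : \sum_(j < m.+1) series_term j lambda @[m --> \oo] -->
  \sum_(i < n) profile_coef n i.+1 * series_limit beta n i.+1 lambda.
Proof.
rewrite (_ : (fun m => _) = fun m => \sum_(i < n) profile_coef n i.+1 * partial_sum beta n Re_i m i.+1 lambda).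
  apply: cvg_sum_ord => i; apply: cvgM; first exact: cvg_cst.
  have := cos_mean_cvg hZ beta_gt0 (hb lambda) (i := i) ltr01.
  by rewrite (cos_meanE hZ beta_gt0 (hb lambda) i ltr01) scale0 mulr1.
apply/funext => m; rewrite /partial_sum.
rewrite [RHS](eq_bigr (fun i : 'I_n => \sum_(j < m.+1) Re_i j * (profile_coef n i.+1 * series_coef beta n j i.+1) * lambda ^+ j)).
  rewrite exchange_big/=; apply: eq_bigr => j _.
  by rewrite /series_term mulr_sumr mulr_suml.
by move=> i _; rewrite mulr_sumr; apply: eq_bigr => j _; ring.
Qed.

Lemma hp_density_cvg lambda :
  pi^-1 * \sum_(1 <= j < m) series_term (2 * j) lambda @[m --> \oo] --> hp_density beta n lambda.
Proof.
pose u m := \sum_(j < m) series_term j lambda.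
(* [u (2 * m.+1)] ends with the index [2 * m + 1], whose term is 0; the order 0 term [- 2^-1] later
   cancels the 1 in the density. *)
have uE m : u (2 * m.+1)%N = - 2^-1 + \sum_(1 <= j < m.+1) series_term (2 * j) lambda.
  elim: m => [|m IH].
    by rewrite big_geq// addr0 /u !big_ord_recr big_ord0/= add0r term0 (term_odd lambda 0) addr0.
  rewrite big_nat_recr//= addrA -IH /u mulnS add2n !big_ord_recr/=.
  by rewrite term_odd addr0.
rewrite -cvg_shiftS.
rewrite (_ : (fun m => _) = fun m => (2 * pi)^-1 * (1 + 2 * u (2 * m).+2)); last first.
  apply/funext => m; rewrite (_ : (2 * m).+2 = 2 * m.+1)%N ?uE; last by rewrite mulnS add2n.
  have p0 : pi != 0 :> R by rewrite gt_eqF// pi_gt0.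
  by move: (pi : R) p0 (\sum_(1 <= j < m.+1) _) => p p0 S; field.
apply: cvgM; first exact: cvg_cst.
apply: cvgD; first exact: cvg_cst.
apply: cvgM; first exact: cvg_cst.
have h : (2 * m).+1 @[m --> \oo] --> \oo.
  move=> S [N _ hN]; exists N => // m /= Nm; apply: hN => /=.
  by rewrite (leq_trans Nm)// leqW// leq_pmull.
exact: cvg_comp _ _ h (@terms_cvg lambda).
Qed.

Let cvg_complex (f : nat -> R) (l : R) : f m @[m --> \oo] --> l ->
  (real_complex R (f m) : R[i]^o) @[m --> \oo] --> (real_complex R l : R[i]^o).
Proof.
move=> /cvgrPdist_lt h; apply/cvgrPdist_lt => e e0.
have [e1 e2] : complex.Im e = 0 /\ 0 < complex.Re e.
  by move: e0; rewrite ltcE /= => /andP[/eqP -> ->].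
apply: filterS (h _ e2) => m hm.
rewrite -(rmorphB (real_complex R)) normc_def /= expr0n addr0 sqrtr_sqr ltcE /= hm.
by rewrite e1 eqxx.
Qed.

Lemma series_cvg lambda :
  (real_complex R pi^-1 * (\sum_(1 <= j < m)
       ((v_vec R[i] n)^T *m s_vec beta n (2 * j)) ord0 ord0
         * real_complex R lambda ^+ (2 * j)) : R[i]^o) @[m --> \oo] -->
  (real_complex R (hp_density beta n lambda) : R[i]^o).
Proof.
have E m : real_complex R pi^-1 * (\sum_(1 <= j < m) ((v_vec R[i] n)^T *m s_vec beta n (2 * j)) ord0 ord0
         * real_complex R lambda ^+ (2 * j)) =
   real_complex R (pi^-1 * \sum_(1 <= j < m) series_term (2 * j) lambda).
  rewrite (rmorphM (real_complex R)) (rmorph_sum (real_complex R)); congr (_ * _); apply: eq_bigr => j _.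
  rewrite /series_term !(rmorphM (real_complex R)) (rmorphXn (real_complex R)); congr (_ * _).
  have i2 : 'i%C ^+ (2 * j) = real_complex R (Re_i (2 * j)).
    apply/eqP; rewrite eq_complex /Re_i /= eqxx /=; apply/eqP.
    rewrite -[LHS]/(Im_i (R := R) (2 * j)) -[LHS]opprK -Re_iS Re_i_odd oppr0.
    by [].
  rewrite s_vecE mxE (rmorph_sum (real_complex R)) mulr_sumr; apply: eq_bigr => k _.
  rewrite !mxE i2 (rmorphM (real_complex R)) /series_coef extendE.
  rewrite mulrCA; congr (_ * (_ * _)).
  rewrite /profile_coef !(rmorphM (real_complex R)) (rmorphXn (real_complex R)) fmorphV.
  by rewrite !(rmorph_nat (real_complex R)) (rmorphN1 (real_complex R)).
rewrite (_ : (fun m => _) = fun m => real_complex R (pi^-1 * \sum_(1 <= j < m) series_term (2 * j) lambda)).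
  exact: cvg_complex (@hp_density_cvg lambda).
by apply/funext => m; exact: E.
Qed.

Hypothesis halpha_cont : {ae P, forall w, continuous (fun lambda => alpha lambda 0 w)}.

(** The comparison holds off a null event that depends on the pair of parameters, so it is used for
    rational pairs only and extended by continuity in [lambda]. *)
Let monotone_off_null : exists N, [/\ measurable N, P N = 0%E &
  forall w, ~ N w -> continuous (fun lambda => alpha lambda 0 w) /\
    {homo (fun lambda => alpha lambda 0 w) : x y / x <= y}].
Proof.
have [N1 [mN1 N10 h1]] := ae_null halpha_cont.
have mono_rat : {ae P, forall w (q : rat * rat), ratr q.1 <= ratr q.2 :> R ->
    alpha (ratr q.1) 0 w <= alpha (ratr q.2) 0 w}.
  apply: ae_forall_countable => -[q q'] /=.
  have [qq'|_] := boolP (ratr q <= ratr q' :> R); last exact: aeW.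
  have := path_comparison hZ beta_gt0 n_ge1 (hb (ratr q)) (hb (ratr q')) qq'.
  by apply: filterS3 (alphaE (ratr q)) (alphaE (ratr q')) => w -> ->.
have [N2 [mN2 N20 h2]] := ae_null mono_rat.
exists (N1 `|` N2); split; [exact: measurableU|by rewrite measureU0|].
move=> w Nw; have c : continuous (fun lambda => alpha lambda 0 w) by apply: h1 => ?; apply: Nw; left.
split=> // x y; rewrite le_eqVlt => /predU1P[->//|xy].
have {}h2 q q' : ratr q <= ratr q' :> R -> alpha (ratr q) 0 w <= alpha (ratr q') 0 w.
  by apply: (h2 w _ (q, q')) => ?; apply: Nw; right.
rewrite leNgt; apply/negP => lt.
(* Half of the supposed decrease: rationals [q < q'] close enough to [x] and [y] would still show a
   decrease. *)
pose e := (alpha x 0 w - alpha y 0 w) / 2.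
have e0 : 0 < e by rewrite divr_gt0// subr_gt0.
have near (z : R) : exists2 dl : R, 0 < dl & forall t, `|z - t| < dl -> `|alpha z 0 w - alpha t 0 w| < e.
  by have /cvgr_dist_lt/(_ e e0) [dl dl0 hd] := c z; exists dl.
have [d1 d10 k1] := near x; have [d2 d20 k2] := near y.
have lt1 : x < Num.min (x + d1) y by rewrite lt_min ltrDl d10.
have [q] := rat_in_itvoo lt1.
rewrite in_itv/= lt_min => /andP[xq /andP[q1 q2]].
have lt2 : Num.max (y - d2) (ratr q) < y by rewrite gt_max gtrBl d20.
have [q'] := rat_in_itvoo lt2.
rewrite in_itv/= gt_max => /andP[/andP[q3 q4] q5].
have := h2 q q' (ltW q4).
have b1 : `|x - ratr q| < d1 by rewrite ltr0_norm ?subr_lt0// opprB ltrBlDl.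
have b2 : `|y - ratr q'| < d2 by rewrite gtr0_norm ?subr_gt0// ltrBlDl -ltrBlDr.
by rewrite leNgt (near_lt (k1 _ b1) (k2 _ b2)).
Qed.

Variable Theta : T -> R.
Hypothesis hTheta : theta_variable P n Theta.
Hypothesis hTheta_indep : independent P <<s preimages setT (fun _ : unit => Theta) >>
  (sigma_of_process Z).

Lemma hp_expected_points B : measurable B ->
  expected_points P (HP_process alpha Theta) B (\int[leb]_(x in B) (hp_density beta n x)%:E)%E.
Proof.
move=> mB; have [N [mN N0 hN]] := monotone_off_null.
(* Vanishing on the null event makes every path continuous and nondecreasing, and preserves
   adaptedness because the filtration contains the null events. *)
pose A lambda w := alpha lambda 0 w * \1_(~` N) w.
have AN w : N w -> A^~ w = fun=> 0.
  by move=> Nw; apply/funext => x; rewrite /A indicE in_setC mem_set// mulr0.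
have ANN w : ~ N w -> A^~ w = (fun x => alpha x 0 w).
  by move=> Nw; apply/funext => x; rewrite /A indicE in_setC memNset// mulr1.
have hA x : rv_measurable (filtration P Z 0) (A x).
  apply: rvM; first exact: (sol_adapted (halpha x)).
  have hN' : filtration P Z 0 (~` N) by apply: sigmaC; exact: filtration_null.
  apply/rv_measurableP; exact: measurable_indic.
have mA x : measurable_fun setT (A x) := adapted_measurable hZ (hA x).
have cA w : continuous (A^~ w).
  have [Nw|Nw] := pselect (N w); first by rewrite AN//; exact: cst_continuous.
  by rewrite ANN//; exact: (hN w Nw).1.
have A_mono w : {homo A^~ w : x y / x <= y}.
  have [Nw|Nw] := pselect (N w); first by rewrite AN.
  by rewrite ANN//; exact: (hN w Nw).2.
have AE x : {ae P, forall w, profile n (b x 0 w) = profile n (A x w)}.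
  have nN : {ae P, forall w, ~ N w}.
    by exists N; split=> // w /= h; apply: contrapT => ?; apply: h.
  apply: filterS2 nN (alphaE x) => w Nw e.
  by rewrite -e (congr1 (@^~ x) (ANN w Nw)).
have mPA x : measurable_fun setT (fun w => profile n (A x w)).
  exact: measurableT_comp (profile_measurable n) (mA x).
have iPb x : L1 P (fun w => profile n (b x 0 w)) := profile_L1 hZ beta_gt0 n_ge1 (hb x) ler01.
have iPA x : L1 P (fun w => profile n (A x w)) by exact: L1_ae (mPA x) (AE x) (iPb x).
have chp := hp_density_continuous.
have increments a c : a <= c -> (\int[leb]_(x in `[a, c]) (hp_density beta n x)%:E =
    (Ex P (fun w => profile n (A c w)) - Ex P (fun w => profile n (A a w)))%:E)%E.
  (* A base point to the left of [a], [c], 0 and everything between them, so that one primitive [G]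
     serves both endpoints and the integral. *)
  move=> ac; pose M := `|a| + `|c| + 1.
  have [G hG] := continuous_primitive (- M) chp.
  have EA x : `|x| <= `|a| + `|c| -> Ex P (fun w => profile n (A x w)) = G x - G 0.
    move=> xM; rewrite -(eq_Ex_ae (L1_measurable (iPb x)) (mPA x) (AE x)).
    apply: (profile_meanE hZ beta_gt0 n_ge1 (hb x)) => y yx; apply: hG.
    rewrite ltrNl; apply: le_lt_trans (ler_norm _) _; rewrite normrN.
    by apply: le_lt_trans yx (le_lt_trans xM _); rewrite ltrDl.
  rewrite (ftc_on (f := G) chp _ ac); last first.
    move=> x /andP[ax _]; apply: hG; apply: lt_le_trans ax.
    rewrite ltrNl; apply: le_lt_trans (ler_norm _) _; rewrite normrN /M -addrA ltrDl.
    by rewrite ltr_wpDl.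
  by rewrite !EA ?lerDl ?lerDr//; congr EFin; ring.
have [X [mX aeX EX]] := expected_points_density mA cA A_mono (theta_measurable hTheta)
  (fun x => filtration_indep hZ (theta_measurable hTheta) hTheta_indep (hA x))
  (profile_measurable n) (@profile_nondecreasing R n) (@profile_2pi R n) (theta_cdf hTheta)
  (theta_atomless hTheta) iPA (measurable_continuous chp) hp_density_nonneg increments mB.
exists X; split=> //.
have nN : {ae P, forall w, ~ N w}.
  by exists N; split=> // w /= h; apply: contrapT => ?; apply: h.
apply: filterS2 nN aeX => w Nw ->; congr (counting (_ `&` _)).
by apply/seteqP; split=> x [k hk]; exists k; move: hk; rewrite (congr1 (@^~ x) (ANN w Nw)).
Qed.

End Assembly.

Unset Implicit Arguments.
Local Open Scope complex_scope.

Theorem corollary15 (R : realType) (d : measure_display) (T : measurableType d)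
  (P : probability T R) (Z : R -> T -> R[i]) (beta : R) (n : nat)
  (alpha : R -> R -> T -> R) (Theta : T -> R)
  (beta_gt0 : 0 < beta) (n_ge1 : (1 <= n)%N)
  (hZ : two_sided_complex_BM P Z)
  (halpha : forall lambda, strong_solution P Z beta n lambda (alpha lambda))
  (halpha_cont : {ae P, forall w, continuous (fun lambda => alpha lambda 0 w)})
  (hTheta : theta_variable P n Theta)
  (hTheta_indep : independent P <<s preimages setT (fun _ : unit => Theta) >>
                                (sigma_of_process Z)) :
  let rho : R -> R := fun lambda =>
    (2 * pi)^-1 *
    (1 + 2 * ((v_vec R n)^T *m
              map_mx (@complex.Re R) (q_vec P n alpha lambda)) ord0 ord0) in
  point_process_density P (HP_process alpha Theta) rho /\
  forall lambda : R,
    (pi^-1)%:C * (\sum_(1 <= j < m)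
       ((v_vec R[i] n)^T *m s_vec beta n (2 * j)) ord0 ord0
         * lambda%:C ^+ (2 * j)) @[m --> \oo] --> ((rho lambda)%:C : R[i]^o).
Proof.
have rhoE : (fun lambda => (2 * pi)^-1 * (1 + 2 * ((v_vec R n)^T *m
    map_mx (@complex.Re R) (q_vec P n alpha lambda)) ord0 ord0)) = hp_density beta n.
  by apply/funext => lambda; exact: (hp_densityE hZ beta_gt0 halpha).
move=> rho; have -> : rho = hp_density beta n := rhoE; split; last first.
  move=> lambda.
  exact: (series_cvg hZ beta_gt0 n_ge1 halpha).
split.
- exact: measurable_continuous (hp_density_continuous hZ beta_gt0 halpha).
- exact: (hp_density_nonneg hZ beta_gt0 halpha).
- exact: (hp_expected_points hZ beta_gt0 n_ge1 halpha halpha_cont hTheta hTheta_indep).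
Qed.
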